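(* Assume $\frac56\le s<1$ and let $u$ be a weak solution of the stationary fractional Navier--Stokes equations $$(-\Delta)^su+u\cdot\nabla u+\nabla P=0,\qquad\nabla\cdot u=0\qquad\text{in }\mathbb{R}^3,$$ with $\int_{\mathbb{R}^3}|(-\Delta)^{\frac s2}u|^2dx<\infty$. If $$\liminf_{k\to-\infty}2^{k(1-2s)}\|\dot S_ku\|_{L^\infty(\mathbb{R}^3)}<\infty,$$ then $u\equiv0$. In particular, if $u$ satisfies $$\liminf_{k\to-\infty}\|\dot S_ku\|_{\dot B^{1-2s}_{\infty,\infty}}<\infty,$$ or $$\liminf_{k\to-\infty}\|\hat u\|_{L^r(B_{2^k})}<\infty\quad\text{for some } r\ge\tfrac{3}{4-2s},$$ then $u\equiv0$. Here $k$ ranges over the integers.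
   Context: Fourier transform on $\mathcal{S}'(\mathbb{R}^3)$: $\hat f(\xi)=(2\pi)^{-3/2}\int_{\mathbb{R}^3} e^{-ix\cdot\xi}f(x)\,dx$, with inverse $\mathcal{F}^{-1}$; $(-\Delta)^{\sigma}f=\mathcal{F}^{-1}(|\xi|^{2\sigma}\hat f)$; $\|f\|_{\dot H^\sigma}=(\int_{\mathbb{R}^3}|\xi|^{2\sigma}|\hat f(\xi)|^2d\xi)^{1/2}$. Weak solution: a vector field $u\in\dot H^s(\mathbb{R}^3)$ is a weak solution of the stationary fractional Navier--Stokes equations $(-\Delta)^su+u\cdot\nabla u+\nabla P=0$, $\nabla\cdot u=0$ in $\mathbb{R}^3$ if $u$ is weakly divergence free and, for some $P\in\mathcal{S}'(\mathbb{R}^3)$ and all $\phi\in(C_0^\infty(\mathbb{R}^3))^3$, $$\int_{\mathbb{R}^3}(-\Delta)^{\frac s2}u\cdot(-\Delta)^{\frac s2}\phi\,dx=\int_{\mathbb{R}^3}(u\otimes u):\nabla\phi\,dx+\int_{\mathbb{R}^3}P\,\nabla\cdot\phi\,dx,$$ where $(\nabla\phi)_{i,j}=\partial_j\phi_i$ and the last integral is a duality pairing. Littlewood--Paley notation: $B_r=\{x\in\mathbb{R}^3:|x|\le r\}$. Fix a non-negative $\psi\in C_0^\infty(B_1)$ with $\psi(\xi)=1$ for $|\xi|\le\frac12$, and set $\varphi(\xi)=\psi(2^{-1}\xi)-\psi(\xi)$. For $k\in\mathbb{Z}$ put $\dot\Delta_ku=\mathcal{F}^{-1}(\varphi(2^{-k}\cdot)\hat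 u)$ and $\dot S_ku=\mathcal{F}^{-1}(\psi(2^{-k}\cdot)\hat u)$ (componentwise on vector fields). $\mathcal{S}_h'(\mathbb{R}^3)=\{f\in\mathcal{S}'(\mathbb{R}^3):\lim_{k\to-\infty}\dot S_kf=0\}$. The homogeneous Besov space $\dot B^{\sigma}_{\infty,\infty}$ is the set of $f\in\mathcal{S}_h'(\mathbb{R}^3)$ with $\|f\|_{\dot B^\sigma_{\infty,\infty}}=\sup_{j\in\mathbb{Z}}2^{j\sigma}\|\dot\Delta_jf\|_{L^\infty}<\infty$. *)

(* Defs.v *)
From HB Require Import structures.
From mathcomp Require Import all_boot all_order all_algebra.
From mathcomp Require Import all_classical all_reals all_analysis.
From mathcomp.real_closed Require Import complex.

Set Implicit Arguments.
Unset Strict Implicit.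
Unset Printing Implicit Defensive.

Import Order.TTheory GRing.Theory Num.Theory numFieldNormedType.Exports.

Local Open Scope classical_set_scope.
Local Open Scope complex_scope.
Local Open Scope ring_scope.

Section Definitions.
Variable R : realType.

(* Points of R^3 are triples because the library has product measures on pairs
   but no measure on row vectors.  The library's norm on triples is the sup norm;
   the Euclidean norm is [enorm]. *)
Local Notation R3 := (R * R * R)%type.
Local Notation C := R[i].

Definition mu3 : {measure set _ -> \bar R} :=
  ((@lebesgue_measure R \x @lebesgue_measure R) \x @lebesgue_measure R)%E.

Definition coord3 (i : 'I_3) (x : R3) : R :=
  match val i with 0%N => x.1.1 | 1%N => x.1.2 | _ => x.2 end.

Definition basis3 (i : 'I_3) : R3 :=
  ((val i == 0%N)%:R, (val i == 1%N)%:R, (val i == 2%N)%:R).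

Definition dot (x y : R3) : R := \sum_(i < 3) coord3 i x * coord3 i y.

Definition enorm (x : R3) : R := Num.sqrt (dot x x).

Definition vnorm (g : 'I_3 -> R3 -> C) (x : R3) : R :=
  Num.sqrt (\sum_(j < 3) Normc.normc (g j x) ^+ 2).

Definition cfun (f : R3 -> R) : R3 -> C := fun x => (f x)%:C.

Definition cmeasurable (f : R3 -> C) : Prop :=
  measurable_fun [set: R3] (fun x => complex.Re (f x)) /\
  measurable_fun [set: R3] (fun x => complex.Im (f x)).

Definition cintegrable (f : R3 -> C) : Prop :=
  mu3.-integrable [set: R3] (fun x => (complex.Re (f x))%:E) /\
  mu3.-integrable [set: R3] (fun x => (complex.Im (f x))%:E).

Definition cintegral (f : R3 -> C) : C :=
  (\int[mu3]_x complex.Re (f x)) +i* (\int[mu3]_x complex.Im (f x)).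

Definition partial (i : 'I_3) (f : R3 -> R) : R3 -> R :=
  fun x => 'D_(basis3 i) f x.

(* Multi-indices are written as lists of coordinate directions. *)
Definition partials (b : seq 'I_3) (f : R3 -> R) : R3 -> R := foldr partial f b.

Definition cpartials (b : seq 'I_3) (f : R3 -> C) : R3 -> C := fun x =>
  partials b (fun y => complex.Re (f y)) x +i*
  partials b (fun y => complex.Im (f y)) x.

Definition monomial (a : seq 'I_3) (x : R3) : R := \prod_(i <- a) coord3 i x.

Definition smooth (f : R3 -> R) : Prop :=
  forall b : seq 'I_3, continuous (partials b f) /\
    forall (i : 'I_3) (x : R3), derivable (partials b f) x (basis3 i).

Definition test_function (f : R3 -> R) : Prop :=
  smooth f /\ exists r : R, forall x, r < enorm x -> f x = 0.

Definition schwartz_seminorm (N : nat) (f : R3 -> C) : \bar R :=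
  ereal_sup [set y | exists (a b : seq 'I_3) (x : R3),
    [/\ (size a <= N)%N, (size b <= N)%N &
        y = (Normc.normc ((monomial a x)%:C * cpartials b f x))%:E]].

Definition schwartz (f : R3 -> C) : Prop :=
  [/\ smooth (fun x => complex.Re (f x)), smooth (fun x => complex.Im (f x)) &
      forall N, (schwartz_seminorm N f < +oo)%E].

(* Distributions are functionals on all functions R^3 -> C, of which only the
   values on Schwartz functions are meaningful: this makes the operations below
   total.  Two distributions are equal when they agree on Schwartz functions. *)
Definition tdistribution : Type := (R3 -> C) -> C.

Definition tempered (T : tdistribution) : Prop :=
  (forall (c : C) (f g : R3 -> C), schwartz f -> schwartz g ->
     T (fun x => c * f x + g x) = c * T f + T g) /\
  exists (K : R) (N : nat), forall f, schwartz f ->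
    ((Normc.normc (T f))%:E <= K%:E * schwartz_seminorm N f)%E.

Definition dist_of (g : R3 -> C) : tdistribution :=
  fun f => cintegral (fun x => g x * f x).

(* Such a g is locally integrable and dist_of g is tempered. *)
Definition regular (g : R3 -> C) : Prop :=
  cmeasurable g /\
  forall f, schwartz f -> cintegrable (fun x => g x * f x).

Definition represents (T : tdistribution) (g : R3 -> C) : Prop :=
  regular g /\ forall f, schwartz f -> T f = dist_of g f.

(* The function identified with T (unique a.e.), zero if there is none. *)
Definition density (T : tdistribution) : R3 -> C :=
  xget (fun=> 0) [set g | represents T g].

Definition fourier_fun (f : R3 -> C) : R3 -> C := fun xi =>
  (((2 * pi) `^ (- (3 / 2)))%:C) *
  cintegral (fun x => (cos (dot x xi) -i* sin (dot x xi)) * f x).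

Definition inv_fourier_fun (f : R3 -> C) : R3 -> C := fun x =>
  (((2 * pi) `^ (- (3 / 2)))%:C) *
  cintegral (fun xi => (cos (dot x xi) +i* sin (dot x xi)) * f xi).

Definition fourier (T : tdistribution) : tdistribution :=
  fun f => T (fourier_fun f).

Definition inv_fourier (T : tdistribution) : tdistribution :=
  fun f => T (inv_fourier_fun f).

Definition dist_mul (m : R3 -> R) (T : tdistribution) : tdistribution :=
  fun f => T (fun x => (m x)%:C * f x).

(* Since |xi|^(2 sigma) need not be smooth at 0, its product with the Fourier
   transform of T is taken as a product of functions. *)
Definition frac_laplacian (sigma : R) (T : tdistribution) : tdistribution :=
  inv_fourier (dist_of (fun xi =>
    (enorm xi `^ (2 * sigma))%:C * density (fourier T) xi)).

Definition in_Hdot (sigma : R) (T : 'I_3 -> tdistribution) : Prop :=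
  exists U : 'I_3 -> R3 -> C,
    (forall j, represents (fourier (T j)) (U j)) /\
    (\int[mu3]_xi ((enorm xi `^ (2 * sigma) * vnorm U xi ^+ 2)%:E) < +oo)%E.

Definition dist_field (u : 'I_3 -> R3 -> R) : 'I_3 -> tdistribution :=
  fun j => dist_of (cfun (u j)).

Definition weakly_div_free (u : 'I_3 -> R3 -> R) : Prop :=
  forall eta, test_function eta ->
    \int[mu3]_x (\sum_(j < 3) u j x * partial j eta x) = 0.

Definition frac_laplacian_field (sigma : R) (u : 'I_3 -> R3 -> R) :
    'I_3 -> R3 -> C :=
  fun j => density (frac_laplacian sigma (dist_field u j)).

Definition divergence (phi : 'I_3 -> R3 -> R) : R3 -> R :=
  fun x => \sum_(j < 3) partial j (phi j) x.

Definition weak_solution (s : R) (u : 'I_3 -> R3 -> R) : Prop :=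
  [/\ forall j, regular (cfun (u j)),
      in_Hdot s (dist_field u),
      weakly_div_free u &
      exists2 P : tdistribution, tempered P &
      forall phi : 'I_3 -> R3 -> R, (forall j, test_function (phi j)) ->
        cintegral (fun x => \sum_(j < 3)
          frac_laplacian_field (s / 2) u j x *
          frac_laplacian_field (s / 2) phi j x) =
        (\int[mu3]_x (\sum_(i < 3) \sum_(j < 3)
          u i x * u j x * partial j (phi i) x))%:C
        + P (cfun (divergence phi))].

(* The L^p(A) norm of a field of distributions, +oo when the field is not
   given by functions. *)
Definition dist_Lnorm (p : \bar R) (A : set R3) (T : 'I_3 -> tdistribution) :
    \bar R :=
  ereal_inf [set Lnorm mu3 p ((fun x => (vnorm g x)%:E) \_ A) | g in
    [set g : 'I_3 -> R3 -> C | forall j, represents (T j) (g j)]].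

Definition dyadic_ball (k : int) : set R3 := [set x | enorm x <= 2 ^ k].

Definition cutoff (psi : R3 -> R) : Prop :=
  [/\ smooth psi,
      forall xi, 0 <= psi xi,
      forall xi, 1 < enorm xi -> psi xi = 0 &
      forall xi, enorm xi <= 1 / 2 -> psi xi = 1].

Definition annulus_cutoff (psi : R3 -> R) : R3 -> R :=
  fun xi => psi ((2 ^ (-1)) *: xi) - psi xi.

Definition dyadic_multiplier (m : R3 -> R) (k : int) (T : tdistribution) :
    tdistribution :=
  inv_fourier (dist_mul (fun xi => m ((2 ^ (- k)) *: xi)) (fourier T)).

Definition dotS (psi : R3 -> R) (k : int) : tdistribution -> tdistribution :=
  dyadic_multiplier psi k.

Definition dotDelta (psi : R3 -> R) (k : int) : tdistribution -> tdistribution :=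
  dyadic_multiplier (annulus_cutoff psi) k.

Definition in_S'h (psi : R3 -> R) (T : tdistribution) : Prop :=
  tempered T /\ forall f, schwartz f ->
    (fun n : nat => Normc.normc (dotS psi (- n%:Z) T f)) @ \oo --> (0 : R).

Definition besov_norm (psi : R3 -> R) (sigma : R) (T : 'I_3 -> tdistribution) :
    \bar R :=
  if `[< forall i, in_S'h psi (T i) >] then
    ereal_sup [set ((2 `^ (j%:~R * sigma))%:E *
      dist_Lnorm +oo [set: R3] (fun i => dotDelta psi j (T i)))%E | j in [set: int]]
  else +oo%E.

Definition liminf_minfty (a : int -> \bar R) : \bar R :=
  limn_einf (fun n : nat => a (- n%:Z)).

End Definitions.

(* Main.v *)
Require Import Defs.
From HB Require Import structures.
From mathcomp Require Import all_boot all_order all_algebra.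
From mathcomp Require Import all_classical all_reals all_analysis.
From mathcomp.real_closed Require Import complex.
From mathcomp Require Import measurable_realfun ess_sup_inf ring lra.
Set Implicit Arguments.
Unset Strict Implicit.
Unset Printing Implicit Defensive.
Import Order.TTheory GRing.Theory Num.Theory numFieldNormedType.Exports.
Local Open Scope classical_set_scope.
Local Open Scope complex_scope.
Local Open Scope ring_scope.
(* Imported again: the libraries hide some of its names. *)
Require Import Defs.

(* Let U be the Fourier transform of u.  Testing the equation with divergence-free
   fields removes the pressure, and since z.U(z) = 0 this gives, for a.e. z and
   a constant k <> 0,
     k |z|^(2s) |U(z)|^2 = \int (U(x).z) (U(y).U(z)) dx,   x + y + z = 0.
   Split U = W + V at frequency 2^-n with W = psi(2^n .) U, replace the last factor U(z)
   by V(z) and integrate over z.  The part (U(x).z) (V(y).V(z)) is antisymmetric under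
   y <-> z, since U(x).x = 0, so it integrates to zero; the antisymmetrised
   integrand is dominated by min(|x|,|y|,|z|) |U(x)| |V(y)| |V(z)|, which is integrable
   because s >= 5/6.  In the remaining part, which contains W(y), U(x).z = - U(x).y,
   and Plancherel together with Bernstein's inequality bounds it by
     |F^-1 W|_oo 2^(n(2s-1)) (|E|^(1/2) |2^(-ns) V|_2 + |2^(-ns) V|_2^2)
   up to a constant, where E = \int |z|^(2s) |U|^2.  By hypothesis the first two factors
   stay bounded along a sequence n -> oo while |2^(-ns) V|_2 -> 0, whence E = 0.
   The Besov condition and the L^r condition on U both imply a bound
   |F^-1 W|_oo = O(2^(-n(2s-1))): the first by summing the dyadic blocks below 2^-n, the
   second by the convergence of the Fourier integral. *)

(** The obstacle is absolute convergence. Finite energy only puts $U$ in $L^2(|\xi|^{2s}d\xi)$, and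
    the part with two high-frequency factors $V(y)$, $V(z)$ need not converge absolutely as a double
    integral because of the factor $z$. Exchanging $y$ and $z$ is therefore not legitimate at once:
    a cutoff in $|z|$, flattening out in the limit, makes each part integrable, and the
    antisymmetrised integrand keeps a majorant independent of the cutoff. The threshold $5/6$ comes
    from the largest modulus $g$ of the three frequencies: after the arithmetic-geometric mean
    inequality there remains $g^{2-4s}$, to be bounded by a constant times $g^{2s}g^{-3}$ for $g$
    away from 0, that is $5-6s\le0$; the factor $g^{-3}$ pays for integrating over a ball of radius
    $g$. Fourier analysis is built on the cutoff [psi] in place of Gaussians, so inversion and
    Parseval carry a constant [kap], known only to be positive. Equations in frequency space are
    identities between functions integrable against a power of the weight [om], recovered almost
    everywhere from pairings with transforms of test functions. *)

Local Notation normc := Normc.normc.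

(** * Lebesgue measure on R^3 and complex integrals *)

Section Affine1.
Variable R : realType.
Local Notation lam := (@lebesgue_measure R).

Lemma measurable_affine (a h : R) :
  measurable_fun setT (fun x : measurableTypeR R => a * x + h : measurableTypeR R).
Proof. by apply: measurable_funD => //; apply: measurable_funM. Qed.

(** [a] times the image of Lebesgue measure under $x\mapsto ax+h$ gives every half-open interval its
    length, hence is Lebesgue measure. *)
Lemma integral_affine (a h : R) (f : R -> \bar R) : 0 < a ->
  measurable_fun setT f -> (forall x, 0 <= f x)%E ->
  (\int[lam]_x f (a * x + h)%R = (a^-1)%:E * \int[lam]_x f x)%E.
Proof.
move=> a0 mf f0.
have a0' : 0 <= a by exact: ltW.
have mphi := measurable_affine a h.
have pushE (A : set (measurableTypeR R)) : measurable A ->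
    lebesgue_measure A = mscale (NngNum a0')
      (pushforward lam (fun x : measurableTypeR R => a * x + h : measurableTypeR R)) A.
  move=> mA.
  pose phi : {mfun measurableTypeR R >-> measurableTypeR R} :=
    HB.pack (fun x : measurableTypeR R => a * x + h : measurableTypeR R)
      (isMeasurableFun.Build _ _ _ _ _ mphi).
  apply: (@lebesgue_measure_unique _
    (mscale (NngNum a0') (pushforward lam phi))) => //= _ [[c d]] _ <-.
  rewrite /mscale/= /pushforward.
  have -> : (fun x : R => a * x + h) @^-1` (`]c, d]%classic) =
      `](c - h) / a, (d - h) / a]%classic.
    apply/seteqP; split => x /=; rewrite !in_itv/= ltr_pdivrMr// ler_pdivlMr//;
      by rewrite [x * a]mulrC ltrBlDr lerBrDr.
  rewrite /= !lebesgue_measure_itv /= !lte_fin ltr_pM2r ?invr_gt0// ltrD2r.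
  case: ifPn => _; last by rewrite mule0.
  rewrite -!EFinB -EFinM; congr (_ %:E).
  have an0 : a != 0 by rewrite gt_eqF.
  by field.
have ia0 : 0 <= a^-1 by rewrite invr_ge0.
pose phi : {mfun measurableTypeR R >-> measurableTypeR R} :=
    HB.pack (fun x : measurableTypeR R => a * x + h : measurableTypeR R)
      (isMeasurableFun.Build _ _ _ _ _ mphi).
have -> : (\int[lam]_x f (a * x + h)%R = \int[pushforward lam phi]_x f x)%E.
  rewrite ge0_integral_pushforward//.
transitivity (a^-1%:E * (a%:E * \int[pushforward lam phi]_x f x))%E.
  by rewrite muleA -EFinM mulVf ?mul1e// gt_eqF.
congr (_ * _)%E.
rewrite -(@ge0_integral_mscale _ _ _ _ _ _ (NngNum a0'))//.
by apply: eq_measure_integral => A mA _; rewrite [RHS]pushE.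
Qed.

Lemma integral_opp1 (f : R -> \bar R) :
  measurable_fun setT f -> (forall x, 0 <= f x)%E ->
  (\int[lam]_x f (- x)%R = \int[lam]_x f x)%E.
Proof.
move=> mf f0.
transitivity (\int[pushforward lam (-%R : measurableTypeR R -> measurableTypeR R)]_x f x)%E.
  by rewrite ge0_integral_pushforward.
by apply: eq_measure_integral => A mA _; exact: lebesgue_measureN.
Qed.
End Affine1.

(** Products of two exhausting sequences exhaust the product. This makes Fubini's theorem applicable
    to [mu3], itself an iterated product, and to the product of [mu3] with itself. *)
Lemma product_measure_sigma_finite d1 d2 (T1 : measurableType d1)
    (T2 : measurableType d2) (R : realType)
    (m1 : {sigma_finite_measure set T1 -> \bar R})
    (m2 : {sigma_finite_measure set T2 -> \bar R}) :
  sigma_finite setT (m1 \x m2)%E.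
Proof.
have /sigma_finiteP[F [TF ndF Foo]] := sigma_finiteT m1.
have /sigma_finiteP[G [TG ndG Goo]] := sigma_finiteT m2.
exists (fun n => F n `*` G n) => [|n].
  rewrite -setXTT TF TG predeqE => -[x y]; split; last first.
    by move=> [n _ []/= ? ?]; split; exists n.
  move=> [/= [n _ Fnx] [k _ Gky]]; exists (maxn n k) => //; split.
  - by move: x Fnx; exact/subsetPset/ndF/leq_maxl.
  - by move: y Gky; exact/subsetPset/ndG/leq_maxr.
have [? ?] := Foo n; have [? ?] := Goo n.
split; first exact: measurableX.
by rewrite product_measure1E// lte_mul_pinfty// ge0_fin_numE.
Qed.

Definition mu2 (R : realType) : {measure set _ -> \bar R} :=
  (@lebesgue_measure R \x @lebesgue_measure R)%E.

Definition sfmu2 (R : realType) : {sigma_finite_measure set _ -> \bar R} :=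
  HB.pack (Measure.sort (mu2 R)) (Measure_isSigmaFinite.Build _ _ _ (Measure.sort (mu2 R))
    (product_measure_sigma_finite (@lebesgue_measure R) (@lebesgue_measure R))).

Definition sfmu3 (R : realType) : {sigma_finite_measure set _ -> \bar R} :=
  HB.pack (Measure.sort (mu3 R)) (Measure_isSigmaFinite.Build _ _ _ (Measure.sort (mu3 R))
    (product_measure_sigma_finite (sfmu2 R) (@lebesgue_measure R))).

Section Mu3.
Variable R : realType.
Local Notation R3 := (R * R * R)%type.
Local Notation C := R[i].
Local Notation lam := (@lebesgue_measure R).
Local Notation mu := (mu3 R).

Lemma mu3_fubini (f : R3 -> \bar R) : measurable_fun setT f ->
  (forall x, 0 <= f x)%E ->
  (\int[mu]_x f x = \int[lam]_x \int[lam]_y \int[lam]_z f (x, y, z))%E.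
Proof.
move=> mf f0.
rewrite [LHS](@fubini_tonelli1 _ _ _ _ _ (sfmu2 R) lam)//.
rewrite [LHS](@fubini_tonelli1 _ _ _ _ _ lam lam)//.
  exact: (@measurable_fun_fubini_tonelli_F _ _ _ _ _ lam).
by move=> x; exact: integral_ge0.
Qed.

Lemma measurable_scale3 (a : R) (h : R3) :
  measurable_fun setT (fun x : R3 => a *: x + h).
Proof.
have m1 : measurable_fun setT (fun x : R3 => x.1.1).
  by apply: measurableT_comp => //; exact: measurable_fst.
have m2 : measurable_fun setT (fun x : R3 => x.1.2).
  by apply: measurableT_comp => //; exact: measurable_fst.
have m3 : measurable_fun setT (fun x : R3 => x.2) by exact: measurable_snd.
apply: measurable_fun_pair; first apply: measurable_fun_pair;
  by apply: measurable_funD => //; apply: measurable_funM.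
Qed.

(** One-dimensional substitutions with a common Jacobian [c] combine to [c ^+ 3] by Tonelli.
    Dilations with translation and the reflection $x\mapsto-x$ are the two instances. *)
Lemma integral3_map (T1 T2 T3 : R -> R) (c : R) : 0 <= c ->
  (forall T, T = T1 \/ T = T2 \/ T = T3 -> measurable_fun setT T /\
     forall g : R -> \bar R, measurable_fun setT g -> (forall x, 0 <= g x)%E ->
       (\int[lam]_x g (T x) = c%:E * \int[lam]_x g x)%E) ->
  forall f : R3 -> \bar R, measurable_fun setT f -> (forall x, 0 <= f x)%E ->
  (\int[mu]_x f (T1 x.1.1, T2 x.1.2, T3 x.2) = (c ^+ 3)%:E * \int[mu]_x f x)%E.
Proof.
move=> c0 HT f mf f0.
have [mT1 H1] := HT T1 (or_introl erefl).
have [mT2 H2] := HT T2 (or_intror (or_introl erefl)).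
have [mT3 H3] := HT T3 (or_intror (or_intror erefl)).
have m1 : measurable_fun setT (fun x : R3 => T1 x.1.1).
  by apply: measurableT_comp => //; apply: measurableT_comp => //; exact: measurable_fst.
have m2 : measurable_fun setT (fun x : R3 => T2 x.1.2).
  by apply: measurableT_comp => //; apply: measurableT_comp => //; exact: measurable_fst.
have m3 : measurable_fun setT (fun x : R3 => T3 x.2).
  by apply: measurableT_comp => //; exact: measurable_snd.
have mT : measurable_fun setT (fun x : R3 => f (T1 x.1.1, T2 x.1.2, T3 x.2)).
  by apply: measurableT_comp => //; apply: measurable_fun_pair => //; apply: measurable_fun_pair.
rewrite !mu3_fubini//.
pose g (p : R * R) := (\int[lam]_z f (p, z))%E.
have mg : measurable_fun setT g.
  exact: (@measurable_fun_fubini_tonelli_F _ _ _ _ _ lam).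
have g0 p : (0 <= g p)%E by exact: integral_ge0.
pose k x := (\int[lam]_y g (x, y))%E.
have mk : measurable_fun setT k.
  exact: (@measurable_fun_fubini_tonelli_F _ _ _ _ _ lam).
have k0 p : (0 <= k p)%E by exact: integral_ge0.
transitivity (\int[lam]_x (c%:E * (c%:E * k (T1 x))))%E.
  apply: eq_integral => x _.
  transitivity (\int[lam]_y (c%:E * g (T1 x, T2 y)))%E.
    apply: eq_integral => y _ /=.
    rewrite (H3 (fun z => f (T1 x, T2 y, z)))//.
    by apply: measurableT_comp => //; exact: pair1_measurable.
  rewrite ge0_integralZl_EFin//.
    rewrite (H2 (fun y => g (T1 x, y)))//.
    by apply: measurableT_comp => //; exact: pair1_measurable.
  apply: measurableT_comp => //.
  by apply: measurable_fun_pair => //.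
rewrite ge0_integralZl_EFin//; last 2 first.
- by move=> x _; rewrite mule_ge0// lee_fin.
- by apply: measurable_funeM; exact: measurableT_comp.
rewrite ge0_integralZl_EFin//; last exact: measurableT_comp.
by rewrite (H1 k)// !muleA -!EFinM; congr (_%:E * _)%E; rewrite !exprS expr0 mulr1 mulrA.
Qed.

Lemma integral3_affine (a : R) (h : R3) (f : R3 -> \bar R) : 0 < a ->
  measurable_fun setT f -> (forall x, 0 <= f x)%E ->
  (\int[mu]_x f (a *: x + h)%R = (a ^- 3)%:E * \int[mu]_x f x)%E.
Proof.
move=> a0 mf f0; case: h => -[h1 h2] h3; rewrite -exprVn.
apply: (@integral3_map (fun x => a * x + h1) (fun x => a * x + h2) (fun x => a * x + h3)) => //.
  by rewrite invr_ge0 ltW.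
move=> T HT; have [h ->] : exists h, T = (fun x => a * x + h).
  by case: HT => [|[|]] ->; eexists.
split; first exact: measurable_affine.
by move=> g mg g0; rewrite integral_affine.
Qed.

Lemma integral3_opp (f : R3 -> \bar R) :
  measurable_fun setT f -> (forall x, 0 <= f x)%E ->
  (\int[mu]_x f (- x)%R = \int[mu]_x f x)%E.
Proof.
move=> mf f0; transitivity ((1 ^+ 3)%:E * \int[mu]_x f x)%E; last first.
  by rewrite expr1n mul1e.
apply: (@integral3_map (fun x : R => - x) (fun x : R => - x) (fun x : R => - x)) => //.
move=> T HT; have -> : T = (fun x => - x) by case: HT => [|[|]].
split; first exact: oppr_measurable.
by move=> g mg g0; rewrite integral_opp1 ?mul1e.
Qed.

Lemma integral3_trans (h : R3) (f : R3 -> \bar R) :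
  measurable_fun setT f -> (forall x, 0 <= f x)%E ->
  (\int[mu]_x f (x + h)%R = \int[mu]_x f x)%E.
Proof.
move=> mf f0; have := integral3_affine h ltr01 mf f0.
by under eq_integral do rewrite scale1r; rewrite expr1n invr1 mul1e.
Qed.

Lemma integral3_reflect (h : R3) (f : R3 -> \bar R) :
  measurable_fun setT f -> (forall x, 0 <= f x)%E ->
  (\int[mu]_x f (h - x)%R = \int[mu]_x f x)%E.
Proof.
move=> mf f0; rewrite -[RHS](integral3_trans h mf f0).
rewrite -[RHS](@integral3_opp (fun x => f (x + h)))//.
  by apply: eq_integral => x _; rewrite addrC.
apply: measurableT_comp => //.
have := measurable_scale3 1 h.
by apply: eq_measurable_fun => x _; rewrite scale1r.
Qed.
End Mu3.

(** * Moduli and sequential limits of complex numbers *)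

Section Normc.
Variable R : realType.
Implicit Types z w : R[i].

Lemma normc_ge0 z : 0 <= normc z.
Proof. by case: z => a b; exact: sqrtr_ge0. Qed.

Lemma sqr_normcE z : normc z ^+ 2 = complex.Re z ^+ 2 + complex.Im z ^+ 2.
Proof. by case: z => a b /=; rewrite sqr_sqrtr// addr_ge0 ?sqr_ge0. Qed.

Lemma Re_le_normc z : `|complex.Re z| <= normc z.
Proof. by case: z => a b /=; rewrite -sqrtr_sqr ler_sqrt ?addr_ge0 ?sqr_ge0// lerDl sqr_ge0. Qed.

Lemma Im_le_normc z : `|complex.Im z| <= normc z.
Proof. by case: z => a b /=; rewrite -sqrtr_sqr ler_sqrt ?addr_ge0 ?sqr_ge0// lerDr sqr_ge0. Qed.

Lemma normc_real (x : R) : normc x%:C = `|x|.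
Proof. by rewrite /= expr0n/= addr0 sqrtr_sqr. Qed.

Definition ci : R[i] := 0 +i* 1.

Lemma normc_le z : normc z <= `|complex.Re z| + `|complex.Im z|.
Proof.
rewrite -(ler_pXn2r (_ : 0 < 2)%N)// ?nnegrE ?normc_ge0 ?addr_ge0//.
rewrite sqr_normcE sqrrD !real_normK ?num_real//.
have h : 0 <= `|complex.Re z| * `|complex.Im z| by rewrite mulr_ge0.
by move: h; set a := `|_| * `|_| => h; nra.
Qed.

Lemma normc_conj z : normc z^* = normc z.
Proof. by case: z => a b /=; rewrite sqrrN. Qed.

Lemma mulcJ z : z * z^* = (normc z ^+ 2)%:C.
Proof.
rewrite sqr_normcE; case: z => a b; apply/eqP; rewrite eq_complex/=; apply/andP.
by split; apply/eqP; ring.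
Qed.

Lemma normc_sum I (s : seq I) (P : pred I) (F : I -> R[i]) :
  normc (\sum_(i <- s | P i) F i) <= \sum_(i <- s | P i) normc (F i).
Proof.
elim/big_ind2: _ => [|x a y b ha hb|i _//]; first by rewrite Normc.normc0.
by rewrite (le_trans (le_normcD _ _))// lerD.
Qed.

Lemma normcB_sym z w : normc (z - w) = normc (w - z).
Proof. by rewrite -opprB normcN. Qed.

Lemma ReM z w : complex.Re (z * w) =
  complex.Re z * complex.Re w - complex.Im z * complex.Im w.
Proof. by case: z w => a b [c d]. Qed.
Lemma ImM z w : complex.Im (z * w) =
  complex.Re z * complex.Im w + complex.Im z * complex.Re w.
Proof. by case: z w => a b [c d]. Qed.
Lemma ReD z w : complex.Re (z + w) = complex.Re z + complex.Re w.
Proof. by case: z w => a b [c d]. Qed.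
Lemma ImD z w : complex.Im (z + w) = complex.Im z + complex.Im w.
Proof. by case: z w => a b [c d]. Qed.
Lemma ReN z : complex.Re (- z) = - complex.Re z.
Proof. by case: z => a b. Qed.
Lemma ImN z : complex.Im (- z) = - complex.Im z.
Proof. by case: z => a b. Qed.
Lemma ReJ z : complex.Re (z^*) = complex.Re z.
Proof. by case: z => a b. Qed.
Lemma ImJ z : complex.Im (z^*) = - complex.Im z.
Proof. by case: z => a b. Qed.

Lemma ReZ (a : R) z : complex.Re (a%:C * z) = a * complex.Re z.
Proof. by case: z => b c /=; rewrite mul0r subr0. Qed.
Lemma ImZ (a : R) z : complex.Im (a%:C * z) = a * complex.Im z.
Proof. by case: z => b c /=; rewrite mul0r addr0. Qed.
Lemma conjM z w : (z * w)^* = z^* * w^*.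
Proof. by case: z w => a b [c d]; apply/eqP; rewrite eq_complex/=; apply/andP; split; apply/eqP; ring. Qed.
Lemma conjD z w : (z + w)^* = z^* + w^*.
Proof. by case: z w => a b [c d]; apply/eqP; rewrite eq_complex/=; apply/andP; split; apply/eqP; ring. Qed.

Lemma complexP z w : complex.Re z = complex.Re w -> complex.Im z = complex.Im w -> z = w.
Proof. by case: z w => a b [c d] /= -> ->. Qed.

Lemma conjK z : (z^*)^* = z.
Proof. by apply: complexP; rewrite ?ReJ ?ImJ ?opprK. Qed.

Definition ccvg (z_ : nat -> R[i]) (z : R[i]) : Prop :=
  (fun n => normc (z_ n - z)) @ \oo --> (0 : R).

Lemma ccvg_ReIm (z_ : nat -> R[i]) z : ccvg z_ z <->
  (fun n => complex.Re (z_ n)) @ \oo --> complex.Re z /\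
  (fun n => complex.Im (z_ n)) @ \oo --> complex.Im z.
Proof.
split=> [h|[hr hi]].
  split; apply/cvgrPdist_le => e e0; move/cvgrPdist_le : h => /(_ _ e0) [N _ hN];
    exists N => // n Nn; have := hN n Nn; rewrite /= sub0r normrN ger0_norm ?normc_ge0//;
    apply: le_trans; rewrite normcB_sym.
    by rewrite -ReN -ReD Re_le_normc.
  by rewrite -ImN -ImD Im_le_normc.
apply: (@squeeze_cvgr _ _ _ _ (cst 0)
  (fun n => `|complex.Re (z_ n) - complex.Re z| + `|complex.Im (z_ n) - complex.Im z|)).
- near=> n; rewrite normc_ge0 /= (le_trans (normc_le _))//.
  by rewrite ReD ImD ReN ImN.
- exact: cvg_cst.
- rewrite -[X in _ --> X](addr0 0); apply: cvgD; apply/norm_cvg0P.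
    by apply/subr_cvg0.
  by apply/subr_cvg0.
Unshelve. all: end_near. Qed.

Lemma ccvg_unique (z_ : nat -> R[i]) z w : ccvg z_ z -> ccvg z_ w -> z = w.
Proof.
move=> /ccvg_ReIm[h1 h2] /ccvg_ReIm[h3 h4].
by apply: complexP; [exact: (cvg_unique _ h1 h3)|exact: (cvg_unique _ h2 h4)].
Qed.

Lemma ccvg_cst z : ccvg (fun=> z) z.
Proof. by apply/ccvg_ReIm; split; exact: cvg_cst. Qed.

Lemma ccvgD (z_ w_ : nat -> R[i]) z w : ccvg z_ z -> ccvg w_ w -> ccvg (fun n => z_ n + w_ n) (z + w).
Proof.
move=> /ccvg_ReIm[h1 h2] /ccvg_ReIm[h3 h4]; apply/ccvg_ReIm; split.
  by rewrite ReD; under eq_fun do rewrite ReD; exact: cvgD.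
by rewrite ImD; under eq_fun do rewrite ImD; exact: cvgD.
Qed.

Lemma ccvgM (z_ w_ : nat -> R[i]) z w : ccvg z_ z -> ccvg w_ w -> ccvg (fun n => z_ n * w_ n) (z * w).
Proof.
move=> /ccvg_ReIm[h1 h2] /ccvg_ReIm[h3 h4]; apply/ccvg_ReIm; split.
  by rewrite ReM; under eq_fun do rewrite ReM; apply: cvgB; exact: cvgM.
by rewrite ImM; under eq_fun do rewrite ImM; apply: cvgD; exact: cvgM.
Qed.

Lemma ccvg_le (z_ : nat -> R[i]) z (e : R) : ccvg z_ z -> (forall n, normc (z_ n) <= e) -> normc z <= e.
Proof.
move=> zz he; apply/ler_addgt0Pl => d d0.
move/cvgrPdist_le : zz => /(_ _ d0) [N _ /(_ N (leqnn N))] /=.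
rewrite sub0r normrN ger0_norm ?normc_ge0// normcB_sym => h.
by rewrite -[z](subrK (z_ N)) (le_trans (le_normcD _ _))// lerD.
Qed.
Lemma ci2 z : ci * (ci * z) = - z.
Proof. by apply: complexP; rewrite /ci !(ReM, ImM, ReN, ImN) /=; ring. Qed.
End Normc.

(** * Integrable complex functions on a measure space *)

Section Gen.
Context d (T : measurableType d) (R : realType) (m : {measure set T -> \bar R}).
Local Notation C := R[i].
Implicit Types (f g : T -> R) (F G : T -> C).

Definition rint f : Prop := m.-integrable setT (fun x => (f x)%:E).

Definition cmeas F : Prop :=
  measurable_fun setT (fun x => complex.Re (F x)) /\
  measurable_fun setT (fun x => complex.Im (F x)).

Definition L1 F : Prop :=
  rint (fun x => complex.Re (F x)) /\ rint (fun x => complex.Im (F x)).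

Definition cint F : C :=
  (\int[m]_x complex.Re (F x)) +i* (\int[m]_x complex.Im (F x)).

Lemma rint_meas f : rint f -> measurable_fun setT f.
Proof. by move=> /measurable_int /measurable_EFinP. Qed.

Lemma rint_le g f : measurable_fun setT f -> (forall x, `|f x| <= g x) ->
  rint g -> rint f.
Proof.
move=> mf fg; apply: le_integrable => //; first exact/measurable_EFinP.
by move=> x _; rewrite lee_fin (le_trans (fg x))// ler_norm.
Qed.

Lemma rintN f : rint f -> rint (fun x => - f x).
Proof. by move=> h; have := integrableN h; apply: eq_integrable => // x _ /=; rewrite EFinN. Qed.

Lemma rintD f g : rint f -> rint g -> rint (fun x => f x + g x).
Proof. by move=> h1 h2; have := integrableD measurableT h1 h2; apply: eq_integrable. Qed.

Lemma rintB f g : rint f -> rint g -> rint (fun x => f x - g x).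
Proof. by move=> h1 h2; apply: rintD => //; exact: rintN. Qed.

Lemma rintZ (k : R) f : rint f -> rint (fun x => k * f x).
Proof. by move=> h; have := integrableZl measurableT k h; apply: eq_integrable. Qed.

Lemma rint_norm f : rint f -> rint (fun x => `|f x|).
Proof. exact: integrable_norm. Qed.

Lemma rint0 : rint (fun=> 0).
Proof. exact: integrable0. Qed.

Lemma rint_sum I (s : seq I) (h : I -> T -> R) :
  (forall i, rint (h i)) -> rint (fun x => \sum_(i <- s) h i x).
Proof.
move=> hh; elim: s => [|i s IH].
  by under eq_fun do rewrite big_nil; exact: rint0.
by under eq_fun do rewrite big_cons; exact: rintD.
Qed.

Lemma rint_lty f : measurable_fun setT f -> (forall x, 0 <= f x) ->
  (\int[m]_x (f x)%:E < +oo)%E -> rint f.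
Proof.
move=> mf f0 h; apply/integrableP; split; first exact/measurable_EFinP.
by under eq_integral do rewrite abse_EFin ger0_norm//.
Qed.

Lemma lty_rint f : (forall x, 0 <= f x) -> rint f -> (\int[m]_x (f x)%:E < +oo)%E.
Proof.
move=> f0 /integrableP[_]; by under eq_integral do rewrite abse_EFin ger0_norm//.
Qed.

Lemma EFin_Rint f : rint f -> (\int[m]_x f x)%:E = (\int[m]_x (f x)%:E)%E.
Proof. by move=> h; rewrite fineK//; exact: integrable_fin_num. Qed.

Lemma Rint_ge0 f : (forall x, 0 <= f x) -> 0 <= \int[m]_x f x.
Proof. by move=> f0; apply: Rintegral_ge0. Qed.

Lemma Rint_le f g : rint f -> rint g -> (forall x, f x <= g x) ->
  \int[m]_x f x <= \int[m]_x g x.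
Proof. by move=> h1 h2 fg; apply: le_Rintegral => // x _; exact: fg. Qed.

Lemma Rint_norm_le f : rint f -> `|\int[m]_x f x| <= \int[m]_x `|f x|.
Proof. by move=> h; exact: le_normr_Rintegral. Qed.

Lemma RintD f g : rint f -> rint g ->
  \int[m]_x (f x + g x) = \int[m]_x f x + \int[m]_x g x.
Proof. by move=> h1 h2; exact: RintegralD. Qed.

Lemma RintZ k f : rint f -> \int[m]_x (k * f x) = k * \int[m]_x f x.
Proof. by move=> h; exact: RintegralZl. Qed.

Lemma RintN f : rint f -> \int[m]_x (- f x) = - \int[m]_x f x.
Proof.
by move=> h; under eq_Rintegral do rewrite -mulN1r; rewrite RintZ// mulN1r.
Qed.

Lemma RintB f g : rint f -> rint g ->
  \int[m]_x (f x - g x) = \int[m]_x f x - \int[m]_x g x.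
Proof. by move=> h1 h2; rewrite RintD ?RintN//; exact: rintN. Qed.

Lemma Rint_ae_eq f g : measurable_fun setT f -> measurable_fun setT g ->
  {ae m, forall x, f x = g x} -> \int[m]_x f x = \int[m]_x g x.
Proof.
move=> mf mg fg; congr fine; apply: ae_eq_integral => //; try exact/measurable_EFinP.
by apply: filterS fg => x + _ => ->.
Qed.

Lemma rint_ae f g : measurable_fun setT f -> {ae m, forall x, `|f x| <= g x} ->
  rint g -> rint f.
Proof.
move=> mf fg ig; apply/integrableP; split; first exact/measurable_EFinP.
have mg := rint_meas ig.
apply: (@le_lt_trans _ _ (\int[m]_x `|(g x)%:E|)%E); last by case/integrableP: ig.
apply: ae_ge0_le_integral => //.
- by apply: measurableT_comp => //; exact/measurable_EFinP.
- by apply: measurableT_comp => //; exact/measurable_EFinP.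
- by apply: filterS fg => x h _; rewrite lee_fin (le_trans h)// ler_norm.
Qed.

Lemma cmeas_normc F : cmeas F -> measurable_fun setT (fun x => normc (F x)).
Proof.
move=> [h1 h2].
have -> : (fun x => normc (F x)) =
  (fun x => Num.sqrt (complex.Re (F x) ^+ 2 + complex.Im (F x) ^+ 2)).
  by apply/funext => x; case: (F x).
apply: (measurableT_comp (continuous_measurable_fun (@sqrt_continuous R))).
by apply: measurable_funD; exact: measurable_funX.
Qed.

Lemma cmeasD F G : cmeas F -> cmeas G -> cmeas (fun x => F x + G x).
Proof.
move=> [h1 h2] [h3 h4]; split.
  by under eq_fun do rewrite ReD; exact: measurable_funD.
by under eq_fun do rewrite ImD; exact: measurable_funD.
Qed.

Lemma cmeasN F : cmeas F -> cmeas (fun x => - F x).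
Proof.
move=> [h1 h2]; split.
  by under eq_fun do rewrite ReN; exact: measurable_funN.
by under eq_fun do rewrite ImN; exact: measurable_funN.
Qed.

Lemma cmeasB F G : cmeas F -> cmeas G -> cmeas (fun x => F x - G x).
Proof. by move=> h1 h2; apply: cmeasD => //; exact: cmeasN. Qed.

Lemma cmeasM F G : cmeas F -> cmeas G -> cmeas (fun x => F x * G x).
Proof.
move=> [h1 h2] [h3 h4]; split.
  by under eq_fun do rewrite ReM; apply: measurable_funB; exact: measurable_funM.
by under eq_fun do rewrite ImM; apply: measurable_funD; exact: measurable_funM.
Qed.

Lemma cmeasJ F : cmeas F -> cmeas (fun x => (F x)^*).
Proof.
move=> [h1 h2]; split.
  by under eq_fun do rewrite ReJ.
by under eq_fun do rewrite ImJ; exact: measurable_funN.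
Qed.

Lemma cmeas_cst (c : C) : cmeas (fun=> c).
Proof. by split; exact: measurable_cst. Qed.

Lemma cmeas_real f : measurable_fun setT f -> cmeas (fun x => (f x)%:C).
Proof. by move=> h; split=> //=; exact: measurable_cst. Qed.

Lemma cmeas_sum I (s : seq I) (h : I -> T -> C) :
  (forall i, cmeas (h i)) -> cmeas (fun x => \sum_(i <- s) h i x).
Proof.
move=> hh; elim: s => [|i s IH].
  by under eq_fun do rewrite big_nil; exact: cmeas_cst.
by under eq_fun do rewrite big_cons; exact: cmeasD.
Qed.

Lemma L1_cmeas F : L1 F -> cmeas F.
Proof. by move=> [h1 h2]; split; exact: rint_meas. Qed.

Lemma L1_normc F : L1 F -> rint (fun x => normc (F x)).
Proof.
move=> [h1 h2]; apply: (@rint_le (fun x => `|complex.Re (F x)| + `|complex.Im (F x)|)).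
- by apply: cmeas_normc; split; exact: rint_meas.
- by move=> x; rewrite ger0_norm ?normc_ge0// normc_le.
- by apply: rintD; exact: rint_norm.
Qed.

Lemma L1_le g F : cmeas F -> (forall x, normc (F x) <= g x) -> rint g -> L1 F.
Proof.
move=> [m1 m2] Fg ig; split; apply: (rint_le _ _ ig) => // x.
  exact: le_trans (Re_le_normc _) (Fg x).
exact: le_trans (Im_le_normc _) (Fg x).
Qed.

Lemma L1D F G : L1 F -> L1 G -> L1 (fun x => F x + G x).
Proof.
move=> [h1 h2] [h3 h4]; split.
  by under eq_fun do rewrite ReD; exact: rintD.
by under eq_fun do rewrite ImD; exact: rintD.
Qed.

Lemma L1N F : L1 F -> L1 (fun x => - F x).
Proof.
move=> [h1 h2]; split.
  by under eq_fun do rewrite ReN; exact: rintN.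
by under eq_fun do rewrite ImN; exact: rintN.
Qed.

Lemma L1B F G : L1 F -> L1 G -> L1 (fun x => F x - G x).
Proof. by move=> h1 h2; apply: L1D => //; exact: L1N. Qed.

Lemma L1Z (c : C) F : L1 F -> L1 (fun x => c * F x).
Proof.
move=> [h1 h2]; split.
  by under eq_fun do rewrite ReM; apply: rintB; exact: rintZ.
by under eq_fun do rewrite ImM; apply: rintD; exact: rintZ.
Qed.

Lemma L1J F : L1 F -> L1 (fun x => (F x)^*).
Proof.
move=> [h1 h2]; split.
  by under eq_fun do rewrite ReJ.
by under eq_fun do rewrite ImJ; exact: rintN.
Qed.

Lemma L1_0 : L1 (fun=> 0).
Proof. by split; exact: rint0. Qed.

Lemma L1_sum I (s : seq I) (h : I -> T -> C) :
  (forall i, L1 (h i)) -> L1 (fun x => \sum_(i <- s) h i x).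
Proof.
move=> hh; elim: s => [|i s IH].
  by under eq_fun do rewrite big_nil; exact: L1_0.
by under eq_fun do rewrite big_cons; exact: L1D.
Qed.

Lemma L1_real f : rint f -> L1 (fun x => (f x)%:C).
Proof. by move=> h; split => //=; exact: rint0. Qed.

Lemma L1_bounded (c : R) F G : L1 F -> cmeas G -> (forall x, normc (G x) <= c) ->
  L1 (fun x => G x * F x).
Proof.
move=> iF mG Gc; apply: (@L1_le (fun x => c * normc (F x))).
- by apply: cmeasM => //; exact: L1_cmeas.
- by move=> x; rewrite Normc.normcM ler_wpM2r ?normc_ge0.
- by apply: rintZ; exact: L1_normc.
Qed.

Lemma eq_cint F G : (forall x, F x = G x) -> cint F = cint G.
Proof. by move=> h; congr cint; apply/funext. Qed.

Lemma cintD F G : L1 F -> L1 G -> cint (fun x => F x + G x) = cint F + cint G.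
Proof.
move=> [h1 h2] [h3 h4]; apply: complexP; rewrite ?ReD ?ImD /= -RintD//.
  by apply: eq_Rintegral => x _; rewrite ReD.
by apply: eq_Rintegral => x _; rewrite ImD.
Qed.

Lemma cintN F : L1 F -> cint (fun x => - F x) = - cint F.
Proof.
move=> [h1 h2]; apply: complexP; rewrite ?ReN ?ImN /= -RintN//.
  by apply: eq_Rintegral => x _; rewrite ReN.
by apply: eq_Rintegral => x _; rewrite ImN.
Qed.

Lemma cintB F G : L1 F -> L1 G -> cint (fun x => F x - G x) = cint F - cint G.
Proof. by move=> h1 h2; rewrite cintD ?cintN//; exact: L1N. Qed.

Lemma cintZ (c : C) F : L1 F -> cint (fun x => c * F x) = c * cint F.
Proof.
move=> [h1 h2]; apply: complexP; rewrite ?ReM ?ImM /= -!RintZ// -?RintB -?RintD//; try exact: rintZ.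
  by apply: eq_Rintegral => x _; rewrite ReM.
by apply: eq_Rintegral => x _; rewrite ImM.
Qed.

Lemma cintJ F : L1 F -> cint (fun x => (F x)^*) = (cint F)^*.
Proof.
move=> [h1 h2]; apply: complexP; rewrite /= ?ReJ ?ImJ /= -?RintN//.
  by apply: eq_Rintegral => x _; rewrite ReJ.
by apply: eq_Rintegral => x _; rewrite ImJ.
Qed.

Lemma cint0 : cint (fun=> 0) = 0.
Proof. by apply: complexP; rewrite /= Rintegral_cst// mul0r. Qed.

Lemma cint_real f : cint (fun x => (f x)%:C) = (\int[m]_x f x)%:C.
Proof. by apply: complexP => //=; rewrite Rintegral_cst// mul0r. Qed.

Lemma cint_sum I (s : seq I) (h : I -> T -> C) : (forall i, L1 (h i)) ->
  cint (fun x => \sum_(i <- s) h i x) = \sum_(i <- s) cint (h i).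
Proof.
move=> hh; elim: s => [|i s IH].
  by rewrite big_nil; under eq_cint do rewrite big_nil; exact: cint0.
rewrite big_cons -IH -cintD//; last exact: L1_sum.
by apply: eq_cint => x; rewrite big_cons.
Qed.

Lemma normc_cint F : L1 F -> normc (cint F) <= \int[m]_x normc (F x).
Proof.
move=> iF; have [F0|F0] := eqVneq (normc (cint F)) 0.
  by rewrite F0; apply: Rint_ge0 => x; exact: normc_ge0.
(* Multiplying by the conjugate of the integral turns it into the real number [normc (cint F) ^+ 2],
   so only a real part has to be estimated. *)
set c := (cint F)^*.
have npos : 0 < normc (cint F) by rewrite lt_def F0 normc_ge0.
rewrite -(ler_pM2r npos) -expr2.
have E : (normc (cint F) ^+ 2)%:C = cint (fun x => c * F x).
  by rewrite cintZ// mulrC mulcJ.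
have -> : normc (cint F) ^+ 2 = \int[m]_x complex.Re (c * F x).
  by move/(congr1 (@complex.Re R)): E.
have icF : L1 (fun x => c * F x) by exact: L1Z.
rewrite (le_trans (ler_norm _))// (le_trans (Rint_norm_le _))//; first by case: icF.
rewrite mulrC -RintZ//; last exact: L1_normc.
apply: Rint_le.
- by apply: rint_norm; case: icF.
- by apply: rintZ; exact: L1_normc.
- by move=> x; rewrite (le_trans (Re_le_normc _))// Normc.normcM normc_conj.
Qed.

Lemma L1_ae F G : cmeas F -> L1 G -> {ae m, forall x, F x = G x} -> L1 F.
Proof.
move=> [m1 m2] [i1 i2] FG; split.
  apply: (rint_ae m1 _ (rint_norm i1)).
  by apply: filterS FG => x ->.
apply: (rint_ae m2 _ (rint_norm i2)).
by apply: filterS FG => x ->.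
Qed.

Lemma cint_ae F G : cmeas F -> cmeas G -> {ae m, forall x, F x = G x} -> cint F = cint G.
Proof.
move=> [m1 m2] [m3 m4] FG; apply: complexP; apply: Rint_ae_eq => //;
  by apply: filterS FG => x ->.
Qed.

Lemma rDCT (f_ : nat -> T -> R) f g : (forall n, measurable_fun setT (f_ n)) ->
  measurable_fun setT f -> {ae m, forall x, (fun n => f_ n x) @ \oo --> f x} ->
  rint g -> (forall n x, `|f_ n x| <= g x) ->
  rint f /\ (fun n => \int[m]_x f_ n x) @ \oo --> \int[m]_x f x.
Proof.
move=> mf_ mf cf ig fg.
have [h1 h2 h3] := @dominated_convergence _ _ _ m setT measurableT
  (fun n x => (f_ n x)%:E) (fun x => (f x)%:E) (fun x => (g x)%:E)
  (fun n => proj2 (measurable_EFinP _ _) (mf_ n)) (proj2 (measurable_EFinP _ _) mf)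
  ltac:(by apply: filterS cf => x h _; apply: cvg_EFin; [exact: nearW|exact: h])
  ig ltac:(by apply/nearW => x n _; rewrite lee_fin).
split=> //; apply: fine_cvg; rewrite fineK//; exact: integrable_fin_num.
Qed.

Lemma cDCT (F_ : nat -> T -> C) F g : (forall n, cmeas (F_ n)) -> cmeas F ->
  {ae m, forall x, ccvg (fun n => F_ n x) (F x)} ->
  rint g -> (forall n x, normc (F_ n x) <= g x) ->
  L1 F /\ ccvg (fun n => cint (F_ n)) (cint F).
Proof.
move=> mF_ [mF1 mF2] cF ig Fg.
have [i1 c1] := @rDCT (fun n x => complex.Re (F_ n x)) _ g (fun n => proj1 (mF_ n)) mF1
  ltac:(by apply: filterS cF => x /ccvg_ReIm[]) ig
  ltac:(by move=> n x; exact: le_trans (Re_le_normc _) (Fg n x)).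
have [i2 c2] := @rDCT (fun n x => complex.Im (F_ n x)) _ g (fun n => proj2 (mF_ n)) mF2
  ltac:(by apply: filterS cF => x /ccvg_ReIm[]) ig
  ltac:(by move=> n x; exact: le_trans (Im_le_normc _) (Fg n x)).
by split=> //; apply/ccvg_ReIm.
Qed.
End Gen.

Lemma cmeas_comp d1 d2 (T1 : measurableType d1) (T2 : measurableType d2)
    (R : realType) (F : T2 -> R[i]) (f : T1 -> T2) :
  cmeas F -> measurable_fun setT f -> cmeas (fun x => F (f x)).
Proof. by move=> [h1 h2] mf; split; [exact: (measurableT_comp h1 mf)|exact: (measurableT_comp h2 mf)]. Qed.

(** * Fubini's theorem and substitutions on R^3 x R^3 *)

Section Fub.
Variable R : realType.
Local Notation R3 := (R * R * R)%type.
Local Notation C := R[i].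
Local Notation mu := (mu3 R).
Implicit Types (f g : R3 -> R) (F G : R3 -> C).

Lemma cintegrableE F : cintegrable F = L1 mu F. Proof. by []. Qed.
Lemma cintegralE F : cintegral F = cint mu F. Proof. by []. Qed.

Global Instance ae3_filter : Filter (nbhs (almost_everywhere mu)).
Proof. exact: (@ae_filter_ringOfSetsType _ _ R mu). Qed.

Definition mm : {measure set _ -> \bar R} := (sfmu3 R \x sfmu3 R)%E.

Definition unc (A : Type) (f : R3 -> R3 -> A) : R3 * R3 -> A := fun z => f z.1 z.2.
Definition rint2 (f : R3 -> R3 -> R) := rint mm (unc f).
Definition L12 (F : R3 -> R3 -> C) := L1 mm (unc F).
Definition meas2 (f : R3 -> R3 -> R) := measurable_fun setT (unc f).
Definition cmeas2 (F : R3 -> R3 -> C) := cmeas (unc F).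

Lemma rint_fine (h : R3 -> \bar R) : mu.-integrable setT h -> rint mu (fun x => fine (h x)).
Proof.
move=> ih; have mh := measurable_int _ ih.
apply: le_integrable ih => //.
  by apply/measurable_EFinP; exact: measurableT_comp.
by move=> x _; case: (h x) => //= ; rewrite ?leey// normr0 leey.
Qed.

Implicit Types (k : R3 -> R3 -> R) (K : R3 -> R3 -> C).

Lemma fub_rint k : rint2 k -> rint mu (fun x => \int[mu]_y k x y).
Proof.
move=> h; have := @integrable_fubini_F _ _ _ _ _ (sfmu3 R) (sfmu3 R) _ h.
exact: rint_fine.
Qed.

Lemma fub_ae k : rint2 k -> {ae mu, forall x, rint mu (k x)}.
Proof. by move=> h; exact: (@ae_integrable1 _ _ _ _ _ (sfmu3 R) (sfmu3 R) _ h). Qed.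

(** Where [k x] is not integrable the real inner integral has a default value; by [fub_ae] this
    happens on a null set only. *)
Lemma fub_eq1 k : rint2 k -> \int[mu]_x (\int[mu]_y k x y) = \int[mm]_z k z.1 z.2.
Proof.
move=> h; have ih := @integrable_fubini_F _ _ _ _ _ (sfmu3 R) (sfmu3 R) _ h.
rewrite /Rintegral; congr fine.
have E := @integral12_prod_meas1 _ _ _ _ _ (sfmu3 R) (sfmu3 R) _ h.
transitivity (\int[mm]_z (k z.1 z.2)%:E)%E => //; rewrite -[RHS]E.
apply: ae_eq_integral => //.
- by have /measurable_int := rint_fine ih.
- exact: measurable_int ih.
- have := fub_ae h; apply: filterS => x hx _.
  by rewrite fineK//; exact: (integrable_fin_num measurableT hx).
Qed.

Lemma measurable_swap2 : measurable_fun setT (fun z : R3 * R3 => (z.2, z.1)).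
Proof. exact: measurable_swap. Qed.

Lemma rint2_meas k : rint2 k -> meas2 k.
Proof. by move=> h; exact: rint_meas h. Qed.

Lemma rint2_lty k : meas2 k ->
  (\int[mu]_x \int[mu]_y `|k x y|%:E < +oo)%E -> rint2 k.
Proof.
move=> mk h; apply/(@integrable12ltyP _ _ _ _ _ (sfmu3 R) (sfmu3 R)) => //.
exact/measurable_EFinP.
Qed.

Lemma lty_rint2 k : rint2 k -> (\int[mu]_x \int[mu]_y `|k x y|%:E < +oo)%E.
Proof.
move=> h; have mk := rint2_meas h.
by move/(@integrable12ltyP _ _ _ _ _ (sfmu3 R) (sfmu3 R)): h; apply; exact/measurable_EFinP.
Qed.

Lemma tonelli_swap k : meas2 k -> (forall x y, 0 <= k x y) ->
  (\int[mu]_x \int[mu]_y (k x y)%:E = \int[mu]_y \int[mu]_x (k x y)%:E)%E.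
Proof.
move=> mk k0; apply: (@fubini_tonelli _ _ _ _ _ (sfmu3 R) (sfmu3 R) (fun z => (k z.1 z.2)%:E)).
  exact/measurable_EFinP.
by move=> z; rewrite lee_fin.
Qed.

Lemma meas2_swap k : meas2 k -> meas2 (fun x y => k y x).
Proof. by move=> mk; exact: (measurableT_comp mk measurable_swap2). Qed.

Lemma meas2_norm k : meas2 k -> meas2 (fun x y => `|k x y|).
Proof. by move=> mk; exact: (measurableT_comp (@normr_measurable R setT) mk). Qed.

Lemma rint2_swap k : rint2 k -> rint2 (fun x y => k y x).
Proof.
move=> h; have mk := rint2_meas h.
apply: rint2_lty; first exact: meas2_swap.
rewrite (tonelli_swap (k := fun x y => `|k y x|)); first exact: lty_rint2.
  exact: (meas2_norm (meas2_swap mk)).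
by move=> x y.
Qed.

Lemma fub_swap k : rint2 k ->
  \int[mu]_x (\int[mu]_y k x y) = \int[mu]_y (\int[mu]_x k x y).
Proof.
move=> h; rewrite (fub_eq1 h).
have h2 := rint2_swap h.
have ih : mu.-integrable setT (fun y => \int[mu]_x (k x y)%:E)%E.
  exact: (@integrable_fubini_F _ _ _ _ _ (sfmu3 R) (sfmu3 R) _ h2).
rewrite /Rintegral; congr fine.
have E := @integral21_prod_meas1 _ _ _ _ _ (sfmu3 R) (sfmu3 R) _ h.
transitivity (\int[mm]_z (k z.1 z.2)%:E)%E => //; rewrite -[LHS]E.
apply: ae_eq_integral => //.
- exact: measurable_int ih.
- by have /measurable_int := rint_fine ih.
- have := fub_ae h2; apply: filterS => x hx _.
  by rewrite fineK//; exact: (integrable_fin_num measurableT hx).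
Qed.

Lemma rint2D k1 k2 : rint2 k1 -> rint2 k2 -> rint2 (fun x y => k1 x y + k2 x y).
Proof. by move=> h1 h2; exact: rintD h1 h2. Qed.

Lemma rint2Z c k : rint2 k -> rint2 (fun x y => c * k x y).
Proof. by move=> h; exact: rintZ h. Qed.

Lemma meas2_1 f : measurable_fun setT f -> meas2 (fun x y => f x).
Proof. by move=> mf; exact: (measurableT_comp mf measurable_fst). Qed.

Lemma meas2_2 f : measurable_fun setT f -> meas2 (fun x y => f y).
Proof. by move=> mf; exact: (measurableT_comp mf measurable_snd). Qed.

Lemma meas2M k1 k2 : meas2 k1 -> meas2 k2 -> meas2 (fun x y => k1 x y * k2 x y).
Proof. by move=> h1 h2; exact: measurable_funM. Qed.

Lemma meas2D k1 k2 : meas2 k1 -> meas2 k2 -> meas2 (fun x y => k1 x y + k2 x y).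
Proof. by move=> h1 h2; exact: measurable_funD. Qed.

Lemma rint2_prod f g : rint mu f -> rint mu g -> rint2 (fun x y => f x * g y).
Proof.
move=> hf hg; have mf := rint_meas hf; have mg := rint_meas hg.
apply: rint2_lty; first by apply: meas2M; [exact: meas2_1|exact: meas2_2].
under eq_integral do under eq_integral do rewrite normrM EFinM.
have E x : (\int[mu]_y (`|f x|%:E * `|g y|%:E) = `|f x|%:E * \int[mu]_y `|g y|%:E)%E.
  rewrite ge0_integralZl_EFin//; apply/measurable_EFinP.
  exact: measurableT_comp.
under eq_integral do rewrite E.
rewrite -EFin_Rint; last exact: rint_norm.
under eq_integral do rewrite -EFinM mulrC.
apply: lty_rint; last by apply: rintZ; exact: rint_norm.
by move=> x; rewrite mulr_ge0//; apply: Rint_ge0.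
Qed.

Lemma measurable_add3 : measurable_fun setT (fun z : R3 * R3 => z.1 + z.2).
Proof.
have c1 : measurable_fun setT (fun x : R3 => x.1.1).
  by apply: measurableT_comp => //; exact: measurable_fst.
have c2 : measurable_fun setT (fun x : R3 => x.1.2).
  by apply: measurableT_comp => //; exact: measurable_fst.
have c3 : measurable_fun setT (fun x : R3 => x.2) by exact: measurable_snd.
have p1 : measurable_fun setT (fst : R3 * R3 -> R3) by exact: measurable_fst.
have p2 : measurable_fun setT (snd : R3 * R3 -> R3) by exact: measurable_snd.
apply: measurable_fun_pair; first apply: measurable_fun_pair; apply: measurable_funD;
  [exact: (measurableT_comp c1 p1)|exact: (measurableT_comp c1 p2)
  |exact: (measurableT_comp c2 p1)|exact: (measurableT_comp c2 p2)
  |exact: (measurableT_comp c3 p1)|exact: (measurableT_comp c3 p2)].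
Qed.

Lemma measurable_opp3 : measurable_fun setT (fun x : R3 => - x).
Proof.
have c1 : measurable_fun setT (fun x : R3 => x.1.1).
  by apply: measurableT_comp => //; exact: measurable_fst.
have c2 : measurable_fun setT (fun x : R3 => x.1.2).
  by apply: measurableT_comp => //; exact: measurable_fst.
have c3 : measurable_fun setT (fun x : R3 => x.2) by exact: measurable_snd.
by apply: measurable_fun_pair; first apply: measurable_fun_pair; exact: measurable_funN.
Qed.

Lemma measurable_sub3 : measurable_fun setT (fun z : R3 * R3 => z.1 - z.2).
Proof.
have := measurableT_comp measurable_add3
 (measurable_fun_pair (@measurable_fst _ _ _ _) (measurableT_comp measurable_opp3 (@measurable_snd _ _ _ _))).
exact.
Qed.

Lemma measurable_reflect (h : R3) : measurable_fun setT (fun x : R3 => h - x).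
Proof.
exact: (measurableT_comp measurable_sub3 (pair1_measurable h)).
Qed.

Lemma rint_affine (a : R) (h : R3) f : 0 < a -> rint mu f ->
  rint mu (fun x => f (a *: x + h)).
Proof.
move=> a0 hf; have mf := rint_meas hf; apply/integrableP; split.
  by apply/measurable_EFinP; exact: (measurableT_comp mf (measurable_scale3 a h)).
rewrite (@integral3_affine _ a h (fun x => `|(f x)%:E|)%E)//.
  by apply: lte_mul_pinfty => //; [rewrite lee_fin invr_ge0 exprn_ge0// ltW|case/integrableP: hf].
by apply: measurableT_comp => //; exact/measurable_EFinP.
Qed.

Lemma rint_reflect (h : R3) f : rint mu f -> rint mu (fun x => f (h - x)).
Proof.
move=> hf; have mf := rint_meas hf; apply/integrableP; split.
  by apply/measurable_EFinP; exact: (measurableT_comp mf (measurable_reflect h)).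
rewrite (@integral3_reflect _ h (fun x => `|(f x)%:E|)%E)//; first by case/integrableP: hf.
by apply: measurableT_comp => //; exact/measurable_EFinP.
Qed.

(** Carries substitution formulas from nonnegative functions, where they are statements about
    measures, to integrable ones. *)
Lemma rint_posneg f : rint mu f -> exists f1 f2, [/\ rint mu f1, rint mu f2,
  forall x, 0 <= f1 x, forall x, 0 <= f2 x & f = (fun x => f1 x - f2 x)].
Proof.
move=> hf; exists (fun x => (`|f x| + f x) / 2), (fun x => (`|f x| - f x) / 2).
have h2 : rint mu (fun x => `|f x|) by exact: rint_norm.
split.
- by under eq_fun do rewrite mulrC; apply: rintZ; exact: rintD.
- by under eq_fun do rewrite mulrC; apply: rintZ; exact: rintB.
- by move=> x; rewrite divr_ge0// -lerBlDr sub0r ler_normr lexx orbT.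
- by move=> x; rewrite divr_ge0// subr_ge0 ler_norm.
- by apply/funext => x; lra.
Qed.

Lemma Rint_affine (a : R) (h : R3) f : 0 < a -> rint mu f ->
  \int[mu]_x f (a *: x + h) = a ^- 3 * \int[mu]_x f x.
Proof.
move=> a0 /rint_posneg[f1 [f2 [i1 i2 p1 p2 ->]]].
rewrite !RintB// ?mulrBr; try exact: rint_affine.
suff H g : rint mu g -> (forall x, 0 <= g x) -> \int[mu]_x g (a *: x + h) = a ^- 3 * \int[mu]_x g x.
  by rewrite !H.
move=> ig g0; apply: EFin_inj; rewrite EFinM !EFin_Rint//; last exact: rint_affine.
rewrite (@integral3_affine _ a h (fun x => (g x)%:E)%E)//.
by apply/measurable_EFinP; exact: rint_meas ig.
Qed.

Lemma Rint_reflect (h : R3) f : rint mu f -> \int[mu]_x f (h - x) = \int[mu]_x f x.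
Proof.
move=> /rint_posneg[f1 [f2 [i1 i2 p1 p2 ->]]].
rewrite !RintB//; try exact: rint_reflect.
suff H g : rint mu g -> (forall x, 0 <= g x) -> \int[mu]_x g (h - x) = \int[mu]_x g x.
  by rewrite !H.
move=> ig g0; apply: EFin_inj; rewrite !EFin_Rint//; last exact: rint_reflect.
rewrite (@integral3_reflect _ h (fun x => (g x)%:E)%E)//.
by apply/measurable_EFinP; exact: rint_meas ig.
Qed.

Lemma L1_affine (a : R) (h : R3) F : 0 < a -> L1 mu F -> L1 mu (fun x => F (a *: x + h)).
Proof.
move=> a0 [h1 h2]; split; first exact: (rint_affine h a0 h1).
exact: (rint_affine h a0 h2).
Qed.

Lemma L1_reflect (h : R3) F : L1 mu F -> L1 mu (fun x => F (h - x)).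
Proof. by move=> [h1 h2]; split; [exact: (rint_reflect h h1)|exact: (rint_reflect h h2)]. Qed.

Lemma cint_affine (a : R) (h : R3) F : 0 < a -> L1 mu F ->
  cint mu (fun x => F (a *: x + h)) = (a ^- 3)%:C * cint mu F.
Proof.
move=> a0 [h1 h2]; apply: complexP; rewrite ?ReM ?ImM /= mul0r ?subr0 ?addr0.
  exact: (Rint_affine h a0 h1).
exact: (Rint_affine h a0 h2).
Qed.

Lemma cint_reflect (h : R3) F : L1 mu F -> cint mu (fun x => F (h - x)) = cint mu F.
Proof.
move=> [h1 h2]; apply: complexP; first exact: (Rint_reflect h h1).
exact: (Rint_reflect h h2).
Qed.

Lemma ae_reflect (h : R3) (P : R3 -> Prop) :
  {ae mu, forall x, P x} -> {ae mu, forall x, P (h - x)}.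
Proof.
move=> [N [mN N0 PN]]; exists ((fun x => h - x) @^-1` N); split.
- by rewrite -[_ @^-1` _]setTI; exact: measurable_reflect.
- have mi : measurable_fun setT (fun x => (\1_N x : R)%:E).
    by apply/measurable_EFinP; exact: measurable_indic.
  have E := @integral3_reflect _ h (fun x => (\1_N x)%:E) mi
    (fun x => ltac:(by rewrite lee_fin)).
  have E1 : (\int[mu]_x (\1_N x : R)%:E = 0)%E by rewrite integral_indic// setIT.
  have mpre : measurable ((fun x => h - x) @^-1` N).
    by rewrite -[_ @^-1` _]setTI; exact: measurable_reflect.
  have E2 : (\int[mu]_x (\1_((fun x => h - x)%R @^-1` N) x : R)%:E =
    mu ((fun x => h - x)%R @^-1` N))%E by rewrite integral_indic// setIT.
  by rewrite -E2 -E1 -E; apply: eq_integral => x _; rewrite !indicE.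
- by move=> x /= nP; apply: PN.
Qed.

(** For each [x] the inner integral is invariant under reflection about a point that may depend on
    [x]. The choice [h = -id] yields the third frequency [- x - y] of a triple with sum 0, and
    [h = id] yields convolution integrands. *)
Lemma rint2_reflect (h : R3 -> R3) k : measurable_fun setT h -> rint2 k ->
  rint2 (fun x y => k x (h x - y)).
Proof.
move=> mh ik; have mk := rint2_meas ik.
have mz : measurable_fun setT (fun z : R3 * R3 => (z.1, h z.1 - z.2)).
  apply: measurable_fun_pair; first exact: measurable_fst.
  have := measurableT_comp measurable_sub3 (measurable_fun_pair
    (measurableT_comp mh (@measurable_fst _ _ _ _)) (@measurable_snd _ _ _ _)).
  exact.
apply: rint2_lty; first exact: (measurableT_comp mk mz).
have := lty_rint2 ik.
rewrite (_ : (\int[mu]_x \int[mu]_y `|k x y|%:E = \int[mu]_x \int[mu]_y `|k x (h x - y)|%:E)%E); first exact.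
apply: eq_integral => x _.
rewrite (@integral3_reflect _ (h x) (fun y => `|k x y|%:E))//.
apply/measurable_EFinP.
exact: (measurableT_comp (meas2_norm mk) (pair1_measurable x)).
Qed.


Lemma L12_le k K : cmeas2 K -> (forall x y, normc (K x y) <= k x y) -> rint2 k -> L12 K.
Proof. by move=> mK h; apply: L1_le => // -[x y]; exact: h. Qed.

Lemma cfub_L1 K : L12 K -> L1 mu (fun x => cint mu (K x)).
Proof. by move=> [h1 h2]; split; [exact: (fub_rint h1)|exact: (fub_rint h2)]. Qed.

Lemma cfub_ae K : L12 K -> {ae mu, forall x, L1 mu (K x)}.
Proof.
move=> [h1 h2]; have := fub_ae (k := fun x y => complex.Im (K x y)) h2.
have := fub_ae (k := fun x y => complex.Re (K x y)) h1.
by apply: filterS2 => x a b; split.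
Qed.

Lemma cfub_swap K : L12 K ->
  cint mu (fun x => cint mu (K x)) = cint mu (fun y => cint mu (fun x => K x y)).
Proof.
by move=> [h1 h2]; apply: complexP; [exact: (fub_swap h1)|exact: (fub_swap h2)].
Qed.

Lemma L12_swap K : L12 K -> L12 (fun x y => K y x).
Proof. by move=> [h1 h2]; split; [exact: (rint2_swap (k := fun x y => complex.Re (K x y)) h1)
  |exact: (rint2_swap (k := fun x y => complex.Im (K x y)) h2)]. Qed.

Lemma L12_reflect (h : R3 -> R3) K : measurable_fun setT h -> L12 K ->
  L12 (fun x y => K x (h x - y)).
Proof.
by move=> mh [h1 h2]; split; [exact: (rint2_reflect (k := fun x y => complex.Re (K x y)) mh h1)
  |exact: (rint2_reflect (k := fun x y => complex.Im (K x y)) mh h2)].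
Qed.

Lemma cmeas2_1 F : cmeas F -> cmeas2 (fun x y => F x).
Proof. by move=> mF; exact: (cmeas_comp mF (@measurable_fst _ _ _ _)). Qed.

Lemma cmeas2_2 F : cmeas F -> cmeas2 (fun x y => F y).
Proof. by move=> mF; exact: (cmeas_comp mF (@measurable_snd _ _ _ _)). Qed.

Lemma L12_prod F G : L1 mu F -> L1 mu G -> L12 (fun x y => F x * G y).
Proof.
move=> hF hG; apply: (L12_le (k := fun x y => normc (F x) * normc (G y))).
- by apply: cmeasM; [exact: cmeas2_1 (L1_cmeas hF)|exact: cmeas2_2 (L1_cmeas hG)].
- by move=> x y; rewrite Normc.normcM.
- by apply: rint2_prod; exact: L1_normc.
Qed.
End Fub.

(** * Smooth functions and integrable weights *)

Section Topo.
Variable R : realType.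
Local Notation R3 := (R * R * R)%type.
Local Notation C := R[i].
Local Notation mu := (mu3 R).

Definition box3 (p : rat * rat * rat) (n : nat) : set R3 :=
  (ball (ratr p.1.1 : R) n.+1%:R^-1 `*` ball (ratr p.1.2 : R) n.+1%:R^-1)
    `*` ball (ratr p.2 : R) n.+1%:R^-1.

(** Measurability on R^3 refers to the product sigma-algebra, so an open set has to be exhausted by
    countably many boxes with rational centres and radii [n.+1%:R^-1]. *)
Lemma open_measurable3 (U : set R3) : open U -> measurable U.
Proof.
move=> oU.
pose F (t : rat * rat * rat * nat) : set R3 :=
  if `[< box3 t.1 t.2 `<=` U >] then box3 t.1 t.2 else set0.
have -> : U = \bigcup_t F t.
  apply/seteqP; split => [x Ux|x [t _]]; last first.
    by rewrite /F; case: asboolP => // h hx; exact: h.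
  have /nbhs_ballP[e /= e0 eU] : nbhs x U by exact: open_nbhs_nbhs.
  have [n _ hn] := near_infty_natSinv_lt (PosNum (divr_gt0 e0 (ltr0Sn R 1))).
  have {}hn : n.+1%:R^-1 < e / 2 by exact: (hn n (leqnn n)).
  have n0 : 0 < n.+1%:R^-1 :> R by rewrite invr_gt0.
  have H (y : R) : exists q : rat, `|ratr q - y| < n.+1%:R^-1.
    have [q] := @rat_in_itvoo R y (y + n.+1%:R^-1) ltac:(by rewrite ltrDl).
    rewrite in_itv/= => /andP[h1 h2]; exists q.
    by rewrite gtr0_norm ?subr_gt0// ltrBlDr addrC.
  have [q1 h1] := H x.1.1; have [q2 h2] := H x.1.2; have [q3 h3] := H x.2.
  have K (q y z : R) : `|q - y| < n.+1%:R^-1 -> `|q - z| < n.+1%:R^-1 -> `|y - z| < e.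
    move=> a b; have -> : y - z = (q - z) - (q - y) by lra.
    rewrite (le_lt_trans (ler_normB _ _))//.
    apply: (lt_trans (ltrD b a)); move: hn; set w := _^-1; lra.
  exists (q1, q2, q3, n) => //; rewrite /F; case: asboolP => [_|]; first by split => //; split.
  case=> y [[/= a1 a2] a3]; apply: eU; split; first split; rewrite /ball/=.
  - exact: (K _ _ _ h1 a1).
  - exact: (K _ _ _ h2 a2).
  - exact: (K _ _ _ h3 a3).
apply: countable_bigcupT_measurable; first exact: countableP.
move=> t; rewrite /F.
case: asboolP => // _; apply: measurableX; first apply: measurableX; exact: measurable_ball.
Qed.

Lemma continuous_measurable3 (f : R3 -> R) : continuous f -> measurable_fun setT f.
Proof.
move=> /continuousP cf; apply: (measurability _ (RGenOpens.measurableE R)).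
move=> _ [_ [a [b ->] <-]]; rewrite setTI; apply: open_measurable3.
by apply: cf; exact: interval_open.
Qed.

(** Smoothness of finite order, by recursion on the derivative taken first. [partials] adds new
    derivatives on the outside, whereas the product and chain rules recurse on the first
    derivative. *)
Fixpoint smN (n : nat) (f : R3 -> R) : Prop :=
  continuous f /\
  if n is n'.+1 then
    forall i, (forall x, derivable f x (basis3 R i)) /\ smN n' (partial i f)
  else True.

Lemma smNW n f : smN n.+1 f -> smN n f.
Proof.
elim: n f => [|n IH] f; first by case.
move=> [cf h]; split=> // i; have [h1 h2] := h i; split=> //; exact: IH.
Qed.

Lemma partials_rcons b i (f : R3 -> R) : partials (rcons b i) f = partials b (partial i f).
Proof. by rewrite /partials foldr_rcons. Qed.

Lemma smooth_partial i f : smooth f -> smooth (@partial R i f).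
Proof. by move=> sf b; rewrite -partials_rcons; exact: sf. Qed.

Lemma smooth_smN f : smooth f <-> forall n, @smN n f.
Proof.
split=> [sf n|h b].
  elim: n f sf => [|n IH] f sf; first by split=> //; case: (sf [::]).
  split; first by case: (sf [::]).
  move=> i; split; first by move=> x; case: (sf [::]) => _; exact.
  by apply: IH; exact: smooth_partial.
have {h} : smN (size b).+1 f by exact: h.
elim/last_ind: b f => [|b i IH] f /=.
  by move=> [cf h]; split=> // i x; have [] := h i.
rewrite size_rcons => -[cf h]; rewrite partials_rcons; apply: IH.
by have [] := h i.
Qed.

Lemma smooth_continuous f : @smooth R f -> continuous f.
Proof. by move=> sf; case: (sf [::]). Qed.
Lemma smooth_derivable f i x : @smooth R f -> derivable f x (basis3 R i).
Proof. by move=> sf; case: (sf [::]) => _; exact. Qed.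
Lemma smooth_measurable f : @smooth R f -> measurable_fun setT f.
Proof. by move=> /smooth_continuous; exact: continuous_measurable3. Qed.

Lemma partialD (f g : R3 -> R) i : (forall x, derivable f x (basis3 R i)) ->
  (forall x, derivable g x (basis3 R i)) ->
  partial i (fun x : R3 => f x + g x) = (fun x => partial i f x + partial i g x).
Proof.
move=> sf sg; apply/funext => x; rewrite /partial.
by rewrite -deriveD.
Qed.

Lemma partialM (f g : R3 -> R) i : (forall x, derivable f x (basis3 R i)) ->
  (forall x, derivable g x (basis3 R i)) ->
  partial i (fun x : R3 => f x * g x) = (fun x => f x * partial i g x + partial i f x * g x).
Proof.
move=> sf sg; apply/funext => x; rewrite /partial.
have := deriveM (sf x) (sg x).
by rewrite /GRing.scale/= => ->; rewrite [in X in _ + X]mulrC.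
Qed.

(** Coinduction for classes whose derivatives have the same form again, such as coordinates and
    constants, or the transforms of test functions. *)
Lemma smooth_coind (P : (R3 -> R) -> Prop) :
  (forall f, P f -> continuous f /\ forall i, (forall x, derivable f x (basis3 R i)) /\ P (partial i f)) ->
  forall f, P f -> smooth f.
Proof.
move=> h f Pf; apply/smooth_smN => n; elim: n f Pf => [|n IH] f /h[cf k] //.
by split=> // i; have [k1 k2] := k i; split=> //; exact: IH.
Qed.

Lemma smND n f g : smN n f -> smN n g -> smN n (fun x : R3 => f x + g x).
Proof.
elim: n f g => [|n IH] f g [cf hf] [cg hg].
  by split => // x; apply: cvgD; [exact: cf|exact: cg].
split; first by move=> x; apply: cvgD; [exact: cf|exact: cg].
move=> i; have [f1 f2] := hf i; have [g1 g2] := hg i; split.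
  by move=> x; exact: (derivableD (f1 x) (g1 x)).
by rewrite partialD//; exact: IH.
Qed.

Lemma smNM n f g : smN n f -> smN n g -> smN n (fun x : R3 => f x * g x).
Proof.
elim: n f g => [|n IH] f g sf sg.
  by have [cf _] := sf; have [cg _] := sg; split => // x; apply: cvgM; [exact: cf|exact: cg].
have [cf hf] := sf; have [cg hg] := sg.
split; first by move=> x; apply: cvgM; [exact: cf|exact: cg].
move=> i; have [f1 f2] := hf i; have [g1 g2] := hg i; split.
  by move=> x; exact: (derivableM (f1 x) (g1 x)).
by rewrite partialM//; apply: smND; apply: IH => //; exact: smNW.
Qed.

Lemma smoothD f g : smooth f -> smooth g -> smooth (fun x : R3 => f x + g x).
Proof. by move=> /smooth_smN hf /smooth_smN hg; apply/smooth_smN => n; exact: smND. Qed.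

Lemma smoothM f g : smooth f -> smooth g -> smooth (fun x : R3 => f x * g x).
Proof. by move=> /smooth_smN hf /smooth_smN hg; apply/smooth_smN => n; exact: smNM. Qed.

Lemma partial_cst i (c : R) : partial i (fun _ : R3 => c) = (fun=> 0).
Proof. by apply/funext => x; rewrite /partial; exact: (@derive_cst _ _ _ c). Qed.

Lemma smooth_cst (c : R) : smooth (fun _ : R3 => c).
Proof.
apply: (@smooth_coind (fun f => exists c, f = fun=> c)); last by exists c.
move=> _ [k ->]; split; first by move=> x; exact: cvg_cst.
move=> i; split; first by move=> x; exact: derivable_cst.
by exists 0; rewrite partial_cst.
Qed.

Lemma smN_cst n (c : R) : smN n (fun _ : R3 => c).
Proof. by move: n; apply/smooth_smN; exact: smooth_cst. Qed.

Lemma smoothZ (c : R) f : smooth f -> smooth (fun x : R3 => c * f x).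
Proof. by move=> sf; exact: (smoothM (smooth_cst c) sf). Qed.

Lemma smoothN f : smooth f -> smooth (fun x : R3 => - f x).
Proof.
move=> sf; have := smoothZ (-1) sf; congr smooth.
by apply/funext => x; rewrite mulN1r.
Qed.

Lemma smoothB f g : smooth f -> smooth g -> smooth (fun x : R3 => f x - g x).
Proof. by move=> sf sg; exact: (smoothD sf (smoothN sg)). Qed.

(** Reduces a directional derivative to the derivative at 0 of the restriction to a line, so that
    the rules of one-variable calculus apply. *)
Lemma derivable_lineP (f : R3 -> R) x v l :
  is_derive (0 : R) (1 : R) (fun t : R => f (t *: v + x)) l -> derivable f x v /\ 'D_v f x = l.
Proof.
move=> [h1 h2]; split; first exact/derivable1P.
rewrite -h2 /derive; congr (lim _).
suff -> : (fun h : R => h^-1 *: ((f \o shift x) (h *: v) - f x)) =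
   (fun h : R => h^-1 *: (((fun t : R => f (t *: v + x)) \o shift 0) (h *: 1) - f (0 *: v + x))) by [].
by apply/funext => h /=; rewrite addr0 scale0r add0r [_%:A]mulr1.
Qed.

Lemma line_derivable (f : R3 -> R) x v (t : R) : derivable f (t *: v + x) v ->
  is_derive t (1 : R) (fun t : R => f (t *: v + x)) ('D_v f (t *: v + x)).
Proof.
move=> h.
have E : (fun h : R => h^-1 *: ((f \o shift (t *: v + x)) (h *: v) - f (t *: v + x))) =
   (fun h : R => h^-1 *: (((fun t : R => f (t *: v + x)) \o shift t) (h *: 1) - f (t *: v + x))).
  by apply/funext => k /=; rewrite [_%:A]mulr1 scalerDl addrA.
by apply: DeriveDef; rewrite /derivable /derive -E.
Qed.

Lemma coord3_basis i j : coord3 i (basis3 R j) = (i == j)%:R.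
Proof. by case: i => -[|[|[|]]]// ?; case: j => -[|[|[|]]]. Qed.

Lemma coord3D i (x y : R3) : coord3 i (x + y) = coord3 i x + coord3 i y.
Proof. by rewrite /coord3; case: (val i) => [|[|]]. Qed.
Lemma coord3Z i (a : R) (x : R3) : coord3 i (a *: x) = a * coord3 i x.
Proof. by rewrite /coord3; case: (val i) => [|[|]]. Qed.
Lemma coord3N i (x : R3) : coord3 i (- x) = - coord3 i x.
Proof. by rewrite /coord3; case: (val i) => [|[|]]. Qed.

Lemma dotC (x y : R3) : dot x y = dot y x.
Proof. by apply: eq_bigr => i _; rewrite mulrC. Qed.
Lemma dotDl (x y z : R3) : dot (x + y) z = dot x z + dot y z.
Proof. by rewrite -big_split; apply: eq_bigr => i _; rewrite coord3D mulrDl. Qed.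
Lemma dotZl (a : R) (x z : R3) : dot (a *: x) z = a * dot x z.
Proof. by rewrite [RHS]mulr_sumr; apply: eq_bigr => i _; rewrite coord3Z mulrA. Qed.
Lemma dotNl (x z : R3) : dot (- x) z = - dot x z.
Proof. by rewrite -scaleN1r dotZl mulN1r. Qed.
Lemma dotDr (x y z : R3) : dot x (y + z) = dot x y + dot x z.
Proof. by rewrite ![dot x _]dotC dotDl. Qed.
Lemma dotZr (a : R) (x z : R3) : dot x (a *: z) = a * dot x z.
Proof. by rewrite ![dot x _]dotC dotZl. Qed.
Lemma dotNr (x z : R3) : dot x (- z) = - dot x z.
Proof. by rewrite ![dot x _]dotC dotNl. Qed.
Lemma dot_basis j (x : R3) : dot (basis3 R j) x = coord3 j x.
Proof.
rewrite /dot (bigD1 j)//= coord3_basis eqxx mul1r big1 ?addr0// => i ij.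
by rewrite coord3_basis (negbTE ij) mul0r.
Qed.

Lemma coord3_continuous i : continuous (@coord3 R i).
Proof.
move=> x; rewrite /coord3; case: (val i) => [|[|n]].
- by apply: (cvg_comp fst fst); [exact: cvg_fst|exact: cvg_fst].
- by apply: (cvg_comp fst snd); [exact: cvg_fst|exact: cvg_snd].
- exact: cvg_snd.
Qed.

Lemma dot_continuous y : continuous (fun x : R3 => dot x y).
Proof.
rewrite /dot; under eq_fun do rewrite !big_ord_recl big_ord0.
by move=> x; do ?[apply: cvgD]; try exact: cvg_cst; apply: cvgM; try exact: cvg_cst;
  exact: coord3_continuous.
Qed.

Lemma partial_coord i j x : derivable (@coord3 R i) x (basis3 R j) /\
  partial j (@coord3 R i) x = (i == j)%:R.
Proof.
apply: derivable_lineP.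
rewrite (_ : (fun t : R => _) = (fun t => t * (i == j)%:R + coord3 i x)); last first.
  by apply/funext => t; rewrite coord3D coord3Z coord3_basis.
by apply: is_derive_eq; rewrite scaler0 add0r addr0 [_ *: _]mulr1.
Qed.

Lemma smooth_coord i : smooth (@coord3 R i).
Proof.
apply: (@smooth_coind (fun f => f = coord3 i \/ exists c, f = fun=> c)); last by left.
move=> _ [->|[k ->]]; split.
- exact: coord3_continuous.
- move=> j; split; first by move=> x; have [] := partial_coord i j x.
  right; exists (i == j)%:R; apply/funext => x; by have [_ ->] := partial_coord i j x.
- by move=> x; exact: cvg_cst.
- move=> j; split; first by move=> x; exact: derivable_cst.
  by right; exists 0; rewrite partial_cst.
Qed.

Lemma partial_cos_dot (y : R3) j x :
  derivable (fun x => cos (dot x y)) x (basis3 R j) /\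
  partial j (fun x => cos (dot x y)) x = - coord3 j y * sin (dot x y).
Proof.
apply: derivable_lineP.
rewrite (_ : (fun t : R => _) = cos \o (fun t => t * coord3 j y + dot x y)); last first.
  by apply/funext => t /=; rewrite dotDl dotZl dot_basis.
have h : is_derive (0 : R) (1 : R) (fun t => t * coord3 j y + dot x y) (coord3 j y).
  by apply: is_derive_eq; rewrite scaler0 add0r addr0 [_ *: _]mulr1.
apply: is_derive_eq; rewrite /= mul0r add0r; set a := sin _; ring.
Qed.

Lemma partial_sin_dot (y : R3) j x :
  derivable (fun x => sin (dot x y)) x (basis3 R j) /\
  partial j (fun x => sin (dot x y)) x = coord3 j y * cos (dot x y).
Proof.
apply: derivable_lineP.
rewrite (_ : (fun t : R => _) = sin \o (fun t => t * coord3 j y + dot x y)); last first.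
  by apply/funext => t /=; rewrite dotDl dotZl dot_basis.
have h : is_derive (0 : R) (1 : R) (fun t => t * coord3 j y + dot x y) (coord3 j y).
  by apply: is_derive_eq; rewrite scaler0 add0r addr0 [_ *: _]mulr1.
apply: is_derive_eq; rewrite /= mul0r add0r; set a := cos _; ring.
Qed.

Lemma cos_dot_continuous y : continuous (fun x : R3 => cos (dot x y)).
Proof. by move=> x; apply: (cvg_comp (fun x => dot x y) (@cos R)); [exact: dot_continuous|exact: continuous_cos]. Qed.
Lemma sin_dot_continuous y : continuous (fun x : R3 => sin (dot x y)).
Proof. by move=> x; apply: (cvg_comp (fun x => dot x y) (@sin R)); [exact: dot_continuous|exact: continuous_sin]. Qed.

Let cs_smN n (y : R3) : (smN n (fun x => cos (dot x y))) /\ (smN n (fun x => sin (dot x y))).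
Proof.
elim: n => [|n [IH1 IH2]].
  by split; split=> //; [exact: cos_dot_continuous|exact: sin_dot_continuous].
have cstN := smN_cst.
split; split; try exact: cos_dot_continuous; try exact: sin_dot_continuous; move=> j; split.
- by move=> x; have [] := partial_cos_dot y j x.
- rewrite (_ : partial j _ = (fun x => - coord3 j y * sin (dot x y))); first exact: smNM.
  by apply/funext => x; have [] := partial_cos_dot y j x.
- by move=> x; have [] := partial_sin_dot y j x.
- rewrite (_ : partial j _ = (fun x => coord3 j y * cos (dot x y))); first exact: smNM.
  by apply/funext => x; have [] := partial_sin_dot y j x.
Qed.

Lemma smooth_cos_dot y : smooth (fun x : R3 => cos (dot x y)).
Proof. by apply/smooth_smN => n; have [] := cs_smN n y. Qed.
Lemma smooth_sin_dot y : smooth (fun x : R3 => sin (dot x y)).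
Proof. by apply/smooth_smN => n; have [] := cs_smN n y. Qed.

Lemma affine_continuous (a : R) (h : R3) : continuous (fun x : R3 => a *: x + h).
Proof. by move=> x; apply: cvgD; [apply: cvgZ; [exact: cvg_cst|exact: cvg_id]|exact: cvg_cst]. Qed.

Lemma partial_affine f (a : R) (h : R3) j x : (forall z, derivable f z (basis3 R j)) ->
  derivable (fun x => f (a *: x + h)) x (basis3 R j) /\
  partial j (fun x => f (a *: x + h)) x = a * partial j f (a *: x + h).
Proof.
move=> df; apply: derivable_lineP.
rewrite (_ : (fun t : R => _) = (fun t : R => f (t *: basis3 R j + (a *: x + h))) \o (fun t => a * t)); last first.
  by apply/funext => t /=; congr f; rewrite scalerDr scalerA addrA.
have h0 : is_derive (0 : R) (1 : R) (fun t => a * t) a.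
  by apply: is_derive_eq; rewrite [_ *: _]mulr1.
have h1 := @line_derivable f (a *: x + h) (basis3 R j) (a * 0) (df _).
by apply: is_derive_eq; rewrite mulr0 scale0r add0r mulrC.
Qed.

Lemma smooth_affine f (a : R) (h : R3) : smooth f -> smooth (fun x : R3 => f (a *: x + h)).
Proof.
move=> /smooth_smN sf; apply/smooth_smN => n; move: (sf n) => {sf}.
have cc g : continuous g -> continuous (fun x : R3 => g (a *: x + h)).
  by move=> cg x; apply: (cvg_comp (fun x => a *: x + h) g); [exact: affine_continuous|exact: cg].
elim: n f => [|n IH] f [cf hf]; split => //; try exact: cc.
move=> i; have [f1 f2] := hf i; split; first by move=> x; have [] := @partial_affine f a h i x f1.
rewrite (_ : partial i _ = (fun x => a * partial i f (a *: x + h))).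
  by apply: smNM; [exact: smN_cst|exact: IH].
by apply/funext => x; have [] := @partial_affine f a h i x f1.
Qed.
End Topo.

(** * The Euclidean norm, the weight [om], test functions and Schwartz functions *)

Section Enorm.
Variable R : realType.
Local Notation R3 := (R * R * R)%type.
Local Notation C := R[i].
Local Notation mu := (mu3 R).

Let o0 : 'I_3 := Ordinal (isT : (0 < 3)%N).
Let o1 : 'I_3 := Ordinal (isT : (1 < 3)%N).
Let o2 : 'I_3 := Ordinal (isT : (2 < 3)%N).

Lemma dotE (x y : R3) : dot x y = x.1.1 * y.1.1 + x.1.2 * y.1.2 + x.2 * y.2.
Proof. by rewrite /dot !big_ord_recl big_ord0 /coord3/= addr0 addrA. Qed.

Lemma dot_ge0 (x : R3) : 0 <= dot x x.
Proof. by rewrite dotE -!expr2 !addr_ge0 ?sqr_ge0. Qed.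

Lemma enorm_ge0 (x : R3) : 0 <= enorm x. Proof. exact: sqrtr_ge0. Qed.

Lemma sqr_enorm (x : R3) : enorm x ^+ 2 = dot x x.
Proof. by rewrite sqr_sqrtr ?dot_ge0. Qed.

Lemma enormZ (a : R) (x : R3) : enorm (a *: x) = `|a| * enorm x.
Proof. by rewrite /enorm dotZl dotZr mulrA -expr2 sqrtrM ?sqr_ge0// sqrtr_sqr. Qed.

Lemma enormN (x : R3) : enorm (- x) = enorm x.
Proof. by rewrite -scaleN1r enormZ normrN normr1 mul1r. Qed.

Lemma dot_le_enorm (x y : R3) : `|dot x y| <= enorm x * enorm y.
Proof.
rewrite -(ler_pXn2r (_ : 0 < 2)%N)// ?nnegrE ?mulr_ge0 ?enorm_ge0//.
rewrite exprMn !sqr_enorm real_normK ?num_real// !dotE.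
case: x y => -[a b] c [[d e] f] /=.
have h1 := sqr_ge0 (a * e - b * d); have h2 := sqr_ge0 (a * f - c * d).
have h3 := sqr_ge0 (b * f - c * e); rewrite -subr_ge0.
rewrite (_ : _ - _ = (a * e - b * d) ^+ 2 + (a * f - c * d) ^+ 2 + (b * f - c * e) ^+ 2); last by ring.
by rewrite !addr_ge0.
Qed.

Lemma ler_enormD (x y : R3) : enorm (x + y) <= enorm x + enorm y.
Proof.
rewrite -(ler_pXn2r (_ : 0 < 2)%N)// ?nnegrE ?addr_ge0 ?enorm_ge0//.
rewrite sqrrD !sqr_enorm dotDl !dotDr (dotC y x).
have := le_trans (ler_norm _) (dot_le_enorm x y); lra.
Qed.

Lemma coord_le_enorm i (x : R3) : `|coord3 i x| <= enorm x.
Proof.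
rewrite -sqrtr_sqr ler_sqrt ?dot_ge0// /dot (bigD1 i)//= expr2 lerDl.
by apply: sumr_ge0 => j _; rewrite -expr2 sqr_ge0.
Qed.

Lemma enorm_le_coord (r : R) (x : R3) : 0 <= r -> (forall i, `|coord3 i x| <= r) ->
  enorm x <= 3 * r.
Proof.
move=> r0 h; rewrite -(ler_pXn2r (_ : 0 < 2)%N)// ?nnegrE ?mulr_ge0 ?enorm_ge0//.
rewrite sqr_enorm dotE.
have K (t : R) : `|t| <= r -> t * t <= r * r.
  by move=> tr; rewrite -expr2 -real_normK ?num_real// expr2 ler_pM.
have := K _ (h o0); have := K _ (h o1); have := K _ (h o2); rewrite /coord3/=.
move: (x.1.1 * _) (x.1.2 * _) (x.2 * _) => a b c; have := mulr_ge0 r0 r0; nra.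
Qed.

Lemma enorm0 : enorm (0 : R3) = 0.
Proof. by rewrite -(scale0r (0 : R3)) enormZ normr0 mul0r. Qed.

Lemma enorm_continuous : continuous (@enorm R).
Proof.
move=> x; apply: (cvg_comp (fun x : R3 => dot x x) (@Num.sqrt R)); last exact: sqrt_continuous.
have -> : (fun x : R3 => dot x x) = (fun x => coord3 o0 x * coord3 o0 x +
    coord3 o1 x * coord3 o1 x + coord3 o2 x * coord3 o2 x).
  by apply/funext => y; rewrite dotE.
rewrite dotE; apply: cvgD; last by apply: cvgM; exact: (@coord3_continuous R o2).
by apply: cvgD; apply: cvgM; [exact: (@coord3_continuous R o0)|exact: (@coord3_continuous R o0)
  |exact: (@coord3_continuous R o1)|exact: (@coord3_continuous R o1)].
Qed.

Lemma enorm_measurable : measurable_fun setT (@enorm R).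
Proof. exact: continuous_measurable3 enorm_continuous. Qed.

Lemma coord_measurable i : measurable_fun setT (@coord3 R i).
Proof. exact: continuous_measurable3 (@coord3_continuous R i). Qed.

Implicit Types f g : R3 -> R.

Lemma testM f g : test_function f -> smooth g -> test_function (fun x => g x * f x).
Proof.
move=> [sf [r hr]] sg; split; first exact: smoothM.
by exists r => x /hr ->; rewrite mulr0.
Qed.

Lemma testD f g : test_function f -> test_function g -> test_function (fun x => f x + g x).
Proof.
move=> [sf [r hr]] [sg [q hq]]; split; first exact: smoothD.
exists (Num.max r q) => x; rewrite gt_max => /andP[a b].
by rewrite hr// hq// addr0.
Qed.

Lemma testN f : test_function f -> test_function (fun x => - f x).
Proof.
move=> hf; have := testM hf (smooth_cst (-1)); congr test_function.
by apply/funext => x; rewrite mulN1r.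
Qed.

Lemma test0 : test_function (fun _ : R3 => 0 : R).
Proof. by split; [exact: smooth_cst|exists 0]. Qed.

Lemma test_partial i f : test_function f -> test_function (partial i f).
Proof.
move=> [sf [r hr]]; split; first exact: smooth_partial.
exists r => x rx; rewrite /partial.
transitivity ('D_(basis3 R i) (fun _ : R3 => 0 : R) x); last exact: derive_cst.
apply: near_eq_derive.
have := cvgr_gt (enorm x) (@enorm_continuous x) r rx.
by move=> h; near=> y; apply: hr; near: y; exact: h.
Unshelve. all: end_near.
Qed.

Lemma test_affine f (a : R) (h : R3) : a != 0 -> test_function f ->
  test_function (fun x => f (a *: x + h)).
Proof.
move=> a0 [sf [r hr]]; split; first exact: smooth_affine.
exists ((r + enorm h) / `|a|) => x; rewrite ltr_pdivrMr ?normr_gt0// => hx.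
apply: hr; have := ler_enormD (a *: x + h) (- h).
by rewrite addrK enormZ enormN mulrC; move: hx; lra.
Qed.

Lemma compact_cube (r : R) : compact (((`[- r, r]%classic : set R) `*` `[- r, r]%classic)
   `*` `[- r, r]%classic : set R3).
Proof. by apply: compact_setX; first apply: compact_setX; exact: segment_compact. Qed.

Lemma test_bounded f : test_function f -> exists2 M, 0 <= M & forall x, `|f x| <= M.
Proof.
move=> [sf [r hr]].
have cf : continuous f by exact: smooth_continuous.
have /compact_bounded : compact (f @` (((`[- r, r]%classic : set R) `*` `[- r, r]%classic)
   `*` `[- r, r]%classic : set R3)).
  apply: continuous_compact; last exact: compact_cube.
  exact: continuous_subspaceT.
move=> [M [_ hM]]; exists (`|M| + 1); first by rewrite addr_ge0.
move=> x; have [xr|rx] := leP (enorm x) r; last by rewrite hr// normr0 addr_ge0.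
apply: (hM (`|M| + 1)); first by rewrite (le_lt_trans (ler_norm M))// ltrDl.
exists x => //.
have K i := le_trans (coord_le_enorm i x) xr.
have := K o0; have := K o1; have := K o2; rewrite /coord3/= !ler_norml => h1 h2 h3.
by split; first split; rewrite /= in_itv/=.
Qed.

(* A product weight, because (1 + |x|^2)^-1 is not integrable on R^3. *)
Definition om (x : R3) : R := (1 + x.1.1 ^+ 2)^-1 * (1 + x.1.2 ^+ 2)^-1 * (1 + x.2 ^+ 2)^-1.

Let q1 (t : R) : 0 < 1 + t ^+ 2. Proof. by rewrite ltr_pwDl// sqr_ge0. Qed.

Lemma om_gt0 x : 0 < om x.
Proof. by rewrite /om !mulr_gt0 ?invr_gt0. Qed.
Lemma om_ge0 x : 0 <= om x. Proof. exact: ltW (om_gt0 x). Qed.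

Lemma om_le1 x : om x <= 1.
Proof.
have q (t : R) : (1 + t ^+ 2)^-1 <= 1 by rewrite invf_le1// lerDl sqr_ge0.
have p (t : R) : 0 <= (1 + t ^+ 2)^-1 by rewrite invr_ge0 ltW.
by rewrite /om; apply: mulr_ile1 => //; [exact: mulr_ge0|exact: mulr_ile1].
Qed.

Lemma om_measurable : measurable_fun setT om.
Proof.
have c (g : R3 -> R) : continuous g -> continuous (fun x => (1 + g x ^+ 2)^-1).
  move=> cg x; apply: cvgV; first by rewrite gt_eqF.
  apply: cvgD; first exact: cvg_cst.
  by under eq_fun do rewrite expr2; rewrite expr2; apply: cvgM; exact: cg.
have h0 := c _ (@coord3_continuous R o0); have h1 := c _ (@coord3_continuous R o1).
have h2 := c _ (@coord3_continuous R o2).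
apply: continuous_measurable3 => x; apply: cvgM; last exact: h2.
by apply: cvgM; [exact: h0|exact: h1].
Qed.

Lemma int_oneDsqr : (\int[@lebesgue_measure R]_x ((1 + x ^+ 2)^-1)%:E = pi%:E)%E.
Proof.
have := @ge0_symfun_integralT R (fun x => (1 + x ^+ 2)^-1).
move=> ->.
- rewrite -set_itvcy.
  have := @integral0y_oneDsqr R; rewrite /oneDsqr => ->.
  by rewrite -EFinM mulrCA mulfV// mulr1.
- by move=> x; rewrite invr_ge0 ltW.
- exact: (@continuous_oneDsqrV R).
- by move=> x /=; rewrite sqrrN.
Qed.

Lemma rint_om : rint mu om.
Proof.
apply: rint_lty; [exact: om_measurable|exact: om_ge0|].
have mo : measurable_fun setT (fun x : R => ((1 + x ^+ 2)^-1)%:E).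
  by apply/measurable_EFinP; exact: continuous_measurable_fun (@continuous_oneDsqrV R).
rewrite mu3_fubini; last 2 first.
- by apply/measurable_EFinP; exact: om_measurable.
- by move=> x; rewrite lee_fin om_ge0.
have H (c : R) : 0 <= c ->
    (\int[@lebesgue_measure R]_t (c * (1 + t ^+ 2)^-1)%:E = (c * pi)%:E)%E.
  move=> c0; under eq_integral do rewrite EFinM.
  rewrite ge0_integralZl_EFin//; last by move=> z _; rewrite lee_fin invr_ge0 ltW.
  by rewrite int_oneDsqr EFinM.
have p (t : R) : 0 <= (1 + t ^+ 2)^-1 by rewrite invr_ge0 ltW.
have pp : 0 <= pi :> R by exact: pi_ge0.
rewrite (_ : (\int[_]_x _)%E = (pi * pi * pi)%:E) ?ltry//.
transitivity (\int[@lebesgue_measure R]_x ((pi * pi) * (1 + x ^+ 2)^-1)%:E)%E; last first.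
  by rewrite H// mulr_ge0.
apply: eq_integral => x _.
transitivity (\int[@lebesgue_measure R]_y (((1 + x ^+ 2)^-1 * pi) * (1 + y ^+ 2)^-1)%:E)%E; last first.
  by rewrite H ?mulr_ge0//; congr (_%:E); ring.
apply: eq_integral => y _.
rewrite /om/= H; last by rewrite mulr_ge0.
by congr (_%:E); ring.
Qed.

Definition decay f := forall a, exists M, forall x, `|monomial a x * f x| <= M.

Lemma decay_coord i f : decay f -> decay (fun x => coord3 i x * f x).
Proof.
move=> h a; have [M hM] := h (i :: a); exists M => x.
by have := hM x; rewrite /monomial big_cons mulrA [coord3 _ _ * _]mulrC.
Qed.

Lemma decayD f g : decay f -> decay g -> decay (fun x => f x + g x).
Proof.
move=> hf hg a; have [M hM] := hf a; have [N hN] := hg a; exists (M + N) => x.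
by rewrite mulrDr (le_trans (ler_normD _ _))// lerD.
Qed.

Lemma decay_om f : decay f -> decay (fun x => f x / om x).
Proof.
have K i h : decay h -> decay (fun x => (1 + coord3 i x ^+ 2) * h x).
  move=> dh; have := decayD dh (decay_coord i (decay_coord i dh)).
  by congr decay; apply/funext => x; rewrite mulrDl mul1r expr2 mulrA.
move=> /(K o0) /(K o1) /(K o2); congr decay; apply/funext => x.
by rewrite /om !invfM !invrK /coord3/=; ring.
Qed.

(** Division by [om] is multiplication by the polynomial $\prod_i(1+x_i^2)$, which preserves decay;
    hence [f / om ^+ n] is bounded for every [n]. *)
Lemma decay_le f n : decay f -> exists2 M, 0 <= M & forall x, `|f x| <= M * om x ^+ n.
Proof.
move=> df; have [M hM] : exists M, forall x, `|f x| <= M * om x ^+ n.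
  elim: n f df => [|n IH] f df.
    have [M hM] := df [::]; exists M => x.
    by have := hM x; rewrite /monomial big_nil mul1r mulr1.
  have [M hM] := IH _ (decay_om df); exists M => x.
  have := hM x; rewrite normrM normfV (ger0_norm (om_ge0 x)) ler_pdivrMr ?om_gt0//.
  by rewrite exprSr mulrA.
exists `|M| => // x; rewrite (le_trans (hM x))// ler_wpM2r ?exprn_ge0 ?om_ge0//.
exact: ler_norm.
Qed.

Lemma smooth_monomial a : smooth (@monomial R a).
Proof.
elim: a => [|i a IH].
  rewrite (_ : monomial _ = fun=> 1); first exact: smooth_cst.
  by apply/funext => x; rewrite /monomial big_nil.
rewrite (_ : monomial _ = fun x => coord3 i x * monomial a x).
  by apply: smoothM => //; exact: smooth_coord.
by apply/funext => x; rewrite /monomial big_cons.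
Qed.

Lemma test_decay f : test_function f -> decay f.
Proof.
move=> tf a; have [M _ hM] := test_bounded (testM tf (smooth_monomial a)).
by exists M.
Qed.

Lemma om_expn_le x n : om x ^+ n.+1 <= om x.
Proof. by rewrite exprS ler_piMr ?om_ge0// exprn_ile1 ?om_ge0 ?om_le1. Qed.

Lemma rint_omX n : rint mu (fun x => om x ^+ n.+1).
Proof.
apply: (rint_le _ _ rint_om); first by apply: measurable_funX; exact: om_measurable.
by move=> x; rewrite ger0_norm ?exprn_ge0 ?om_ge0// om_expn_le.
Qed.

Lemma decay_rint f : measurable_fun setT f -> decay f -> rint mu f.
Proof.
move=> mf /(decay_le 1)[M _ hM]; apply: (@rint_le _ _ _ mu (fun x => M * om x) f mf).
  by move=> x; have := hM x; rewrite expr1.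
by apply: rintZ; exact: rint_om.
Qed.

Lemma test_measurable f : test_function f -> measurable_fun setT f.
Proof. by case=> sf _; exact: smooth_measurable. Qed.

Lemma test_rint f : test_function f -> rint mu f.
Proof. by move=> tf; apply: decay_rint; [exact: test_measurable|exact: test_decay]. Qed.

Definition rsch f := smooth f /\ forall b, decay (partials b f).

Lemma test_partials b f : test_function f -> test_function (partials b f).
Proof. by move=> tf; elim: b => //= i b; exact: test_partial. Qed.

Lemma test_rsch f : test_function f -> rsch f.
Proof. by move=> tf; split=> [|b]; [case: tf|apply: test_decay; exact: test_partials]. Qed.

(** There are finitely many multi-indices of length at most [n], so bounds given one by one can be
    replaced by a common one, here the sum of their absolute values along the recursion. *)
Lemma bounded_lists (P : seq 'I_3 -> R -> Prop) :
  (forall b M N, M <= N -> P b M -> P b N) -> (forall b, exists M, P b M) ->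
  forall n, exists M, forall b, (size b <= n)%N -> P b M.
Proof.
move=> Pmon Pex n; elim: n P Pmon Pex => [|n IH] P Pmon Pex.
  by have [M hM] := Pex [::]; exists M => -[].
have [M0 hM0] := Pex [::].
have h i : exists M, forall b, (size b <= n)%N -> P (i :: b) M.
  by apply: IH => [b M N|b]; [exact: Pmon|exact: Pex].
have [M hM] := choice h.
exists (`|M0| + \sum_i `|M i|) => -[|i b] hb.
  apply: Pmon hM0; rewrite (le_trans (ler_norm M0))// lerDl.
  by apply: sumr_ge0 => i _.
apply: Pmon (hM i b hb); rewrite (le_trans (ler_norm (M i)))//.
rewrite (bigD1 i)//= addrCA lerDl addr_ge0//.
by apply: sumr_ge0 => j _.
Qed.

(** A seminorm is a supremum over finitely many pairs of multi-indices, so its finiteness amounts to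
    a separate bound for each pair. In this form decay is proved and used. *)
Lemma schwartzP (F : R3 -> C) : schwartz F <->
  rsch (fun x => complex.Re (F x)) /\ rsch (fun x => complex.Im (F x)).
Proof.
split=> [[s1 s2 h]|[[s1 h1] [s2 h2]]].
  suff K b a : exists M, forall x, normc ((monomial a x)%:C * cpartials b F x) <= M.
    split; split=> // b a; have [M hM] := K b a; exists M => x;
      apply: le_trans (hM x); rewrite Normc.normcM normc_real normrM ler_wpM2l//.
      exact: le_trans (Re_le_normc (cpartials b F x)).
    exact: le_trans (Im_le_normc (cpartials b F x)).
  have hN := h (maxn (size a) (size b)).
  exists (fine (schwartz_seminorm (maxn (size a) (size b)) F)) => x.
  have hx : ((normc ((monomial a x)%:C * cpartials b F x))%:E <=
       schwartz_seminorm (maxn (size a) (size b)) F)%E.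
    by apply: ereal_sup_ubound; exists a, b, x; rewrite leq_maxl leq_maxr.
  rewrite -lee_fin fineK// fin_numElt hN andbT.
  by rewrite (lt_le_trans _ hx)// ltNyr.
split=> // N.
have K b : exists M, forall a, (size a <= N)%N -> forall x,
    normc ((monomial a x)%:C * cpartials b F x) <= M.
  apply: (@bounded_lists (fun a M => forall x, normc ((monomial a x)%:C * cpartials b F x) <= M)).
    by move=> a M M' MM' hM x; exact: le_trans (hM x) MM'.
  move=> a; have [M1 k1] := h1 b a; have [M2 k2] := h2 b a; exists (M1 + M2) => x.
  apply: le_trans (normc_le _) _; rewrite ReM ImM /= !mul0r subr0 addr0.
  by rewrite lerD.
have [M hM] := @bounded_lists (fun b M => forall a, (size a <= N)%N -> forall x,
    normc ((monomial a x)%:C * cpartials b F x) <= M)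
  (fun b M M' MM' hM a sa x => le_trans (hM a sa x) MM') K N.
apply: (@le_lt_trans _ _ M%:E); last exact: ltry.
apply: ub_ereal_sup => _ [a [b [x [sa sb ->]]]].
by rewrite lee_fin; exact: hM.
Qed.
End Enorm.

(** * The Fourier transform of test functions *)

Section Fourier.
Variable R : realType.
Local Notation R3 := (R * R * R)%type.
Local Notation C := R[i].
Local Notation mu := (mu3 R).
Implicit Types (F G : R3 -> C) (x y z : R3).

Definition cis (t : R) : C := cos t +i* sin t.

Lemma normc_cis t : normc (cis t) = 1.
Proof. by rewrite /= cos2Dsin2 sqrtr1. Qed.

Lemma cisD a b : cis (a + b) = cis a * cis b.
Proof. by apply: complexP; rewrite ?ReM ?ImM /= ?cosD ?sinD; ring. Qed.

Lemma cis0 : cis 0 = 1.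
Proof. by rewrite /cis cos0 sin0. Qed.

Lemma cisJ a : (cis a)^* = cis (- a).
Proof. by rewrite /cis cosN sinN. Qed.

Lemma lipschitz_1 (f df : R -> R) : (forall t : R, is_derive t (1 : R) f (df t)) ->
  (forall t, `|df t| <= 1) -> forall a b, `|f a - f b| <= `|a - b|.
Proof.
move=> fd f1 a b.
wlog ab : a b / b <= a.
  move=> H; have [|ba] := leP b a; first exact: H.
  by rewrite distrC [leRHS]distrC; apply: H; exact: ltW.
have [c _ ->] := @MVT_segment R f df b a ab (fun t _ => fd t)
  ltac:(apply: continuous_subspaceT => t; exact/differentiable_continuous/derivable1_diffP/(@ex_derive _ _ _ _ _ _ _ (fd t))).
by rewrite normrM ler_piMl.
Qed.

Lemma cis_lip a b : normc (cis a - cis b) <= 2 * `|a - b|.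
Proof.
rewrite (le_trans (normc_le _))// ReD ImD ReN ImN /= mulrDl mul1r lerD//.
  by apply: (lipschitz_1 (df := fun t => - sin t)) => // t; rewrite normrN ler_norml sin_geN1 sin_le1.
by apply: (lipschitz_1 (df := cos)) => // t; rewrite ler_norml cos_geN1 cos_le1.
Qed.

Definition c0 : R := (2 * pi) `^ (- (3 / 2)).

Lemma c0_gt0 : 0 < c0.
Proof. by rewrite powR_gt0// mulr_gt0// pi_gt0. Qed.

(** All Fourier analysis is done for the inverse transform; the forward one is its reflection by
    [fourier_funE]. *)
Definition FI : (R3 -> C) -> R3 -> C := @inv_fourier_fun R.

Lemma FIE F x : FI F x = c0%:C * cint mu (fun y => cis (dot x y) * F y).
Proof. by []. Qed.

Lemma dot_meas2 : meas2 (fun x y : R3 => dot x y).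
Proof.
have h i : meas2 (fun x y => coord3 i x * coord3 i y).
  by apply: meas2M; [apply: meas2_1|apply: meas2_2]; exact: coord_measurable.
rewrite /dot (_ : (fun x y => _) = (fun x y => coord3 ord0 x * coord3 ord0 y +
  (coord3 (lift ord0 ord0) x * coord3 (lift ord0 ord0) y +
  (coord3 (lift ord0 (lift ord0 ord0)) x * coord3 (lift ord0 (lift ord0 ord0)) y)))).
  by do ![apply: meas2D => //].
by apply/funext => x; apply/funext => y; rewrite !big_ord_recl big_ord0 addr0.
Qed.

Lemma cis_meas2 : cmeas2 (fun x y : R3 => cis (dot x y)).
Proof.
split; [apply: (measurableT_comp (continuous_measurable_fun (@continuous_cos R)) dot_meas2)
  |apply: (measurableT_comp (continuous_measurable_fun (@continuous_sin R)) dot_meas2)].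
Qed.

Lemma cis_meas x : cmeas (fun y => cis (dot x y)).
Proof.
exact: (cmeas_comp cis_meas2 (pair1_measurable x)).
Qed.

Lemma L1_cis x F : L1 mu F -> L1 mu (fun y => cis (dot x y) * F y).
Proof.
move=> iF; apply: (L1_bounded (c := 1) iF (cis_meas x)) => y.
by rewrite normc_cis.
Qed.

Lemma FI_bound F x : L1 mu F -> normc (FI F x) <= c0 * \int[mu]_y normc (F y).
Proof.
move=> iF; rewrite FIE Normc.normcM normc_real ger0_norm ?(ltW c0_gt0)//.
rewrite ler_wpM2l ?(ltW c0_gt0)// (le_trans (normc_cint (L1_cis x iF)))//.
apply: Rint_le; [exact: L1_normc (L1_cis x iF)|exact: L1_normc|] => y.
by rewrite Normc.normcM normc_cis mul1r.
Qed.

Lemma eq_FI F G x : (forall y, F y = G y) -> FI F x = FI G x.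
Proof. by move=> /funext ->. Qed.

Lemma ae_FI F G x : cmeas F -> cmeas G -> {ae mu, forall y, F y = G y} -> FI F x = FI G x.
Proof.
move=> mF mG FG; rewrite !FIE; congr (_ * _); apply: cint_ae.
- by apply: cmeasM => //; exact: cis_meas.
- by apply: cmeasM => //; exact: cis_meas.
- by apply: filterS FG => y ->.
Qed.

Lemma FID F G x : L1 mu F -> L1 mu G -> FI (fun y => F y + G y) x = FI F x + FI G x.
Proof.
move=> iF iG; rewrite !FIE -mulrDr -cintD; try exact: L1_cis.
by congr (_ * _); apply: eq_cint => y; rewrite mulrDr.
Qed.

Lemma FIZ (c : C) F x : L1 mu F -> FI (fun y => c * F y) x = c * FI F x.
Proof.
move=> iF; rewrite !FIE mulrCA -[c * cint _ _]cintZ; last exact: L1_cis.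
by congr (_ * _); apply: eq_cint => y; rewrite mulrCA.
Qed.

Lemma FIN F x : L1 mu F -> FI (fun y => - F y) x = - FI F x.
Proof.
by move=> iF; rewrite -mulN1r -FIZ//; apply: eq_FI => y; rewrite mulN1r.
Qed.

Lemma FIB F G x : L1 mu F -> L1 mu G -> FI (fun y => F y - G y) x = FI F x - FI G x.
Proof. by move=> iF iG; rewrite FID ?FIN//; exact: L1N. Qed.

Lemma FIJ F x : L1 mu F -> FI (fun y => (F y)^*) x = (FI F (- x))^*.
Proof.
move=> iF; rewrite !FIE conjM -cintJ; last exact: L1_cis.
congr (_ * _); first by apply: complexP; rewrite ?ReJ ?ImJ /= ?oppr0.
apply: eq_cint => y; by rewrite conjM cisJ dotNl opprK.
Qed.

Lemma FI_opp F x : L1 mu F -> FI (fun y => F (- y)) x = FI F (- x).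
Proof.
move=> iF; rewrite !FIE -(cint_reflect 0 (L1_cis (- x) iF)).
by congr (_ * _); apply: eq_cint => y; rewrite sub0r dotNl dotNr opprK.
Qed.

Lemma fourier_funE F x : fourier_fun F x = FI F (- x).
Proof.
rewrite FIE /fourier_fun; congr (_ * _); apply: eq_cint => y.
by rewrite /cis dotNl cosN sinN dotC.
Qed.

Lemma FI_mod z F x : FI (fun y => cis (dot z y) * F y) x = FI F (x + z).
Proof. by rewrite !FIE; congr (_ * _); apply: eq_cint => y; rewrite dotDl cisD mulrA. Qed.

Lemma FI_scale (a : R) F x : 0 < a -> L1 mu F ->
  FI (fun y => F (a *: y)) x = (a ^- 3)%:C * FI F (a^-1 *: x).
Proof.
move=> a0 iF; rewrite !FIE mulrCA; congr (_ * _).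
rewrite -(cint_affine 0 a0 (L1_cis (a^-1 *: x) iF)); apply: eq_cint => y.
by rewrite addr0 dotZl dotZr mulrA mulVf ?mul1r// gt_eqF.
Qed.

(** The factor [om x] makes the kernel jointly integrable, so that Fubini gives measurability in [x]
    of the inner integral; dividing by [om x] recovers [FI F]. *)
Lemma FI_cmeas F : L1 mu F -> cmeas (FI F).
Proof.
move=> iF.
pose K x y := (om x)%:C * (cis (dot x y) * F y).
have iK : L12 K.
  apply: (L12_le (k := fun x y => om x * normc (F y))).
  - apply: cmeasM; first by apply: (cmeas2_1 (F := fun x => (om x)%:C)); apply: cmeas_real; exact: om_measurable.
    by apply: cmeasM; [exact: cis_meas2|exact: cmeas2_2 (L1_cmeas iF)].
  - by move=> x y; rewrite !Normc.normcM normc_cis mul1r normc_real ger0_norm ?om_ge0.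
  - by apply: rint2_prod; [exact: rint_om|exact: L1_normc].
have := L1_cmeas (cfub_L1 iK); have -> : (fun x => cint mu (K x)) =
    (fun x => (om x)%:C * cint mu (fun y => cis (dot x y) * F y)).
  by apply/funext => x; rewrite cintZ//; exact: L1_cis.
move=> h.
have -> : FI F = (fun x => (c0 * (om x)^-1)%:C * ((om x)%:C * cint mu (fun y => cis (dot x y) * F y))).
  apply/funext => x; rewrite FIE mulrA -rmorphM /= -mulrA mulVf ?mulr1// gt_eqF//.
  exact: om_gt0.
apply: cmeasM => //; apply: cmeas_real; apply: measurable_funM => //.
have -> : (fun x => (om x)^-1) = (fun x : R3 => (1 + x.1.1 ^+ 2) * (1 + x.1.2 ^+ 2) * (1 + x.2 ^+ 2)).
  by apply/funext => x; rewrite /om !invfM !invrK.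
have q i : measurable_fun setT (fun x : R3 => 1 + coord3 i x ^+ 2).
  by apply: measurable_funD => //; apply: measurable_funX; exact: coord_measurable.
apply: measurable_funM; last exact: (q (lift ord0 (lift ord0 ord0))).
by apply: measurable_funM; [exact: (q ord0)|exact: (q (lift ord0 ord0))].
Qed.

(** Fubini, the kernel [cis (dot x y)] being bounded and symmetric. *)
Lemma FI_mult F G : L1 mu F -> L1 mu G ->
  cint mu (fun x => FI F x * G x) = cint mu (fun x => F x * FI G x).
Proof.
move=> iF iG.
pose K x y := (c0%:C * (cis (dot x y) * (F y * G x))).
have iK : L12 K.
  apply: (L12_le (k := fun x y => c0 * (normc (G x) * normc (F y)))).
  - apply: cmeasM; first exact: cmeas_cst.
    apply: cmeasM; first exact: cis_meas2.
    by apply: cmeasM; [exact: cmeas2_2 (L1_cmeas iF)|exact: cmeas2_1 (L1_cmeas iG)].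
  - move=> x y; rewrite !Normc.normcM normc_cis mul1r normc_real ger0_norm ?(ltW c0_gt0)//.
    by rewrite [_ (F y) * _]mulrC.
  - by apply: rint2Z; apply: rint2_prod; exact: L1_normc.
transitivity (cint mu (fun x => cint mu (K x))).
  apply: eq_cint => x; rewrite FIE /K cintZ; last first.
    have := L1Z (G x) (L1_cis x iF); congr L1; apply/funext => y.
    by rewrite mulrCA [G x * _]mulrC.
  rewrite -mulrA; congr (_ * _); rewrite mulrC -cintZ; last exact: L1_cis.
  by apply: eq_cint => y; rewrite mulrCA [G x * _]mulrC.
rewrite (cfub_swap iK); apply: eq_cint => y; rewrite FIE /K cintZ; last first.
  have := L1Z (F y) (L1_cis y iG); congr L1; apply/funext => x.
  by rewrite mulrCA dotC.
rewrite mulrCA; congr (_ * _); rewrite -cintZ; last exact: L1_cis.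
by apply: eq_cint => x; rewrite mulrCA dotC.
Qed.
End Fourier.
Global Opaque FI.

Section FourierD.
Variable R : realType.
Local Notation R3 := (R * R * R)%type.
Local Notation C := R[i].
Local Notation mu := (mu3 R).
Implicit Types (F G h : R3 -> C) (x y z : R3).

Definition ctest F := test_function (fun x => complex.Re (F x)) /\
  test_function (fun x => complex.Im (F x)).

Definition csmooth F := smooth (fun x => complex.Re (F x)) /\
  smooth (fun x => complex.Im (F x)).

Definition cpartial i F : R3 -> C := fun x =>
  partial i (fun y => complex.Re (F y)) x +i* partial i (fun y => complex.Im (F y)) x.

Lemma ctest_smooth F : ctest F -> csmooth F.
Proof. by case=> [[h1 _] [h2 _]]. Qed.

Lemma ctestM F G : ctest F -> csmooth G -> ctest (fun x => G x * F x).
Proof.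
move=> [f1 f2] [g1 g2]; split.
  under eq_fun do rewrite ReM; apply: testD; first exact: testM.
  by apply: testN; exact: testM.
by under eq_fun do rewrite ImM; apply: testD; exact: testM.
Qed.

Lemma ctestD F G : ctest F -> ctest G -> ctest (fun x => F x + G x).
Proof.
move=> [f1 f2] [g1 g2]; split.
  by under eq_fun do rewrite ReD; exact: testD.
by under eq_fun do rewrite ImD; exact: testD.
Qed.

Lemma csmooth_cst (c : C) : csmooth (fun=> c).
Proof. by split; exact: smooth_cst. Qed.

Lemma csmooth_real (f : R3 -> R) : smooth f -> csmooth (fun x => (f x)%:C).
Proof. by move=> sf; split; [exact: sf|exact: (smooth_cst 0)]. Qed.

Lemma csmoothM F G : csmooth F -> csmooth G -> csmooth (fun x => F x * G x).
Proof.
move=> [f1 f2] [g1 g2]; split.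
  by under eq_fun do rewrite ReM; apply: smoothB; exact: smoothM.
by under eq_fun do rewrite ImM; apply: smoothD; exact: smoothM.
Qed.

Lemma csmooth_cis y : csmooth (fun x => cis (dot x y)).
Proof. by split; [exact: smooth_cos_dot|exact: smooth_sin_dot]. Qed.

Lemma ctestZ (c : C) F : ctest F -> ctest (fun x => c * F x).
Proof. by move=> tF; apply: ctestM => //; exact: csmooth_cst. Qed.

Lemma ctest_coord i F : ctest F -> ctest (fun x => (coord3 i x)%:C * F x).
Proof. by move=> tF; apply: ctestM => //; apply: csmooth_real; exact: smooth_coord. Qed.

Lemma ctest_real f : test_function f -> ctest (fun x => (f x)%:C).
Proof. by move=> tf; split => //=; exact: test0. Qed.

Lemma ctest_partial i F : ctest F -> ctest (cpartial i F).
Proof. by move=> [h1 h2]; split; [exact: (test_partial i h1)|exact: (test_partial i h2)]. Qed.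

Lemma ctestJ F : ctest F -> ctest (fun x => (F x)^*).
Proof.
move=> [h1 h2]; split; first by under eq_fun do rewrite ReJ.
by under eq_fun do rewrite ImJ; exact: testN.
Qed.

Lemma ctest_affine (a : R) z F : a != 0 -> ctest F -> ctest (fun x => F (a *: x + z)).
Proof. by move=> a0 [h1 h2]; split; [exact: (test_affine z a0 h1)|exact: (test_affine z a0 h2)]. Qed.

Lemma ctest_opp F : ctest F -> ctest (fun x => F (- x)).
Proof.
move=> tF; have := @ctest_affine (-1) 0 F _ tF; rewrite oppr_eq0 oner_eq0 => /(_ isT).
by congr ctest; apply/funext => x; rewrite scaleN1r addr0.
Qed.

Lemma ctest_L1 F : ctest F -> L1 mu F.
Proof. by move=> [h1 h2]; split; [exact: (test_rint h1)|exact: (test_rint h2)]. Qed.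

Lemma ctest_cmeas F : ctest F -> cmeas F.
Proof. by move=> /ctest_L1 /L1_cmeas. Qed.

Lemma ctest_schwartz F : ctest F -> schwartz F.
Proof. by move=> [h1 h2]; apply/schwartzP; split; [exact: (test_rsch h1)|exact: (test_rsch h2)]. Qed.

Lemma ctest_bounded F : ctest F -> exists2 M, 0 <= M & forall x, normc (F x) <= M.
Proof.
move=> [/test_bounded[M M0 hM] /test_bounded[N N0 hN]].
by exists (M + N); [exact: addr_ge0|move=> x; rewrite (le_trans (normc_le _))// lerD].
Qed.

Lemma ctest_decay F n : ctest F -> exists2 M, 0 <= M & forall x, normc (F x) <= M * om x ^+ n.
Proof.
move=> [/test_decay/(decay_le n)[M M0 hM] /test_decay/(decay_le n)[N N0 hN]].
exists (M + N); first exact: addr_ge0.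
by move=> x; rewrite (le_trans (normc_le _))// mulrDl lerD.
Qed.

Lemma schwartz_decay F n : schwartz F -> exists2 M, 0 <= M & forall x, normc (F x) <= M * om x ^+ n.
Proof.
move=> /schwartzP[[_ /(_ [::])/(decay_le n)[M M0 hM]] [_ /(_ [::])/(decay_le n)[N N0 hN]]].
exists (M + N); first exact: addr_ge0.
by move=> x; rewrite (le_trans (normc_le _))// mulrDl lerD//; [exact: hM|exact: hN].
Qed.

Lemma schwartz_cmeas F : schwartz F -> cmeas F.
Proof. by case=> h1 h2 _; split; [exact: (smooth_measurable h1)|exact: (smooth_measurable h2)]. Qed.

Lemma schwartz_L1 F : schwartz F -> L1 mu F.
Proof.
move=> sF; have [M _ hM] := schwartz_decay 1 sF.
apply: (@L1_le _ _ _ mu (fun x => M * om x)); first exact: schwartz_cmeas.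
  by move=> x; have := hM x; rewrite expr1.
by apply: rintZ; exact: rint_om.
Qed.

(** Each factor of [om] is at least $(1+r^2)^{-1}$ on the ball. Bounded functions of bounded support
    are thereby dominated by a multiple of [om]. *)
Lemma om_lb (r : R) x : enorm x <= r -> 1 <= (1 + r ^+ 2) ^+ 3 * om x.
Proof.
move=> xr; have r0 : 0 <= r := le_trans (enorm_ge0 x) xr.
have q (i : 'I_3) : 1 <= (1 + r ^+ 2) * (1 + coord3 i x ^+ 2)^-1.
  rewrite ler_pdivlMr ?mul1r ?lerD2l; last by rewrite ltr_pwDl// sqr_ge0.
  rewrite -(real_normK (num_real (coord3 i x))) ler_pXn2r ?nnegrE//.
  exact: le_trans (coord_le_enorm i x) xr.
rewrite /om (_ : _ * _ = ((1 + r ^+ 2) * (1 + x.1.1 ^+ 2)^-1) * ((1 + r ^+ 2) * (1 + x.1.2 ^+ 2)^-1)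
   * ((1 + r ^+ 2) * (1 + x.2 ^+ 2)^-1)); last by ring.
rewrite -[1 in X in X <= _](mulr1 1) ler_pM//; last exact: (q (lift ord0 (lift ord0 ord0))).
rewrite -[1 in X in X <= _](mulr1 1) ler_pM//; [exact: (q ord0)|exact: (q (lift ord0 ord0))].
Qed.

Lemma enorm_basis j : enorm (basis3 R j) = 1.
Proof. by rewrite /enorm dot_basis coord3_basis eqxx sqrtr1. Qed.

(** The integral of $f(te_j+x)$ over $x$ does not depend on [t], and differentiating under the
    integral at [t = 0] gives the integral of the partial derivative. *)
Lemma int_partial j (f : R3 -> R) : test_function f -> \int[mu]_x partial j f x = 0.
Proof.
move=> tf; have [sf [r hr]] := tf.
have tp := test_partial j tf.
have [M M0 hM] := test_bounded tp; have [sp [q hq]] := tp.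
have Df z : derivable f z (basis3 R j) by exact: smooth_derivable.
pose k (t : R) x := f (t *: basis3 R j + x).
have d1 t x : partial1of2 k t x = partial j f (t *: basis3 R j + x).
  by rewrite partial1of2E; have [_ ->] := @line_derivable _ f x (basis3 R j) t (Df _).
have kE t : k t = (fun x => f (1 *: x + t *: basis3 R j)).
  by apply/funext => x; rewrite /k scale1r addrC.
have ik t : rint mu (k t) by rewrite kE; apply: rint_affine => //; exact: test_rint.
pose c := M * (1 + (`|q| + 1) ^+ 2) ^+ 3.
have c0' : 0 <= c by rewrite mulr_ge0// exprn_ge0// addr_ge0// sqr_ge0.
have Gub t x : (`]-1, 1[%classic : set R) t -> `|partial1of2 k t x| <= c * om x.
  rewrite /= in_itv/= => /andP[t1 t2]; rewrite d1.
  (* As $|t|<1$, the translated derivative vanishes outside the ball of radius $|q|+1$; inside it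
     [om] is bounded below, which explains [c]. *)
  have [xq|qx] := leP (enorm x) (`|q| + 1).
    by apply: (le_trans (hM _)); rewrite /c -mulrA ler_peMr//; exact: om_lb.
  rewrite hq; first by rewrite normr0; exact: (mulr_ge0 c0' (om_ge0 x)).
  have := ler_enormD (t *: basis3 R j + x) (- (t *: basis3 R j)).
  rewrite addrAC subrr add0r enormN enormZ enorm_basis mulr1 => t4.
  have t3 : `|t| <= 1 by rewrite ler_norml !ltW.
  by move: qx t3 t4 (ler_norm q); lra.
have I0 : (`]-1, 1[%classic : set R) 0 by rewrite /= in_itv/= ltrN10 ltr01.
have dd t x : derivable (k^~ x) t 1 by have [] := @line_derivable _ f x (basis3 R j) t (Df _).
have H := @differentiation_under_integral R _ _ mu k setT measurableT 0 (-1) 1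
  I0 (fun t _ => ik t) (fun t x _ _ => dd t x) (fun x => c * om x)
  (fun x => mulr_ge0 c0' (om_ge0 x)) (rintZ c (rint_om R)) (fun t x It _ => Gub t x It).
transitivity (\int[mu]_y partial1of2 k 0 y).
  by apply: eq_Rintegral => x _; rewrite d1 scale0r add0r.
rewrite -H (_ : (fun t : R => \int[mu]_y k t y) = cst (\int[mu]_y f y)).
  exact: derive1_cst.
apply/funext => t; rewrite kE (@Rint_affine _ 1)//; first by rewrite expr1n invr1 mul1r.
exact: test_rint.
Qed.

Lemma partial_re j (a b c d : R3 -> R) : smooth a -> smooth b -> smooth c -> smooth d ->
  partial j (fun x => a x * c x - b x * d x) =
  (fun x => (a x * partial j c x - b x * partial j d x) +
    (partial j a x * c x - partial j b x * d x)).
Proof.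
move=> sa sb sc sd; have D f x (sf : smooth f) : derivable f x (basis3 R j).
  exact: (smooth_derivable sf).
have nb := smoothN sb.
rewrite (_ : (fun x => _) = (fun x => a x * c x + (- b x) * d x)); last first.
  by apply/funext => x; rewrite mulNr.
rewrite (@partialD _ (fun x => a x * c x) (fun x => (- b x) * d x)) => [|x|x]; last 2 first.
- exact: (D _ x (smoothM sa sc)).
- exact: (D _ x (smoothM nb sd)).
rewrite (@partialM _ a c j (fun x => D _ x sa) (fun x => D _ x sc)).
rewrite (@partialM _ (fun x => - b x) d j (fun x => D _ x nb) (fun x => D _ x sd)).
apply/funext => x.
rewrite (_ : partial j (fun y => - b y) x = - partial j b x); first by ring.
exact: (deriveN (D _ x sb)).
Qed.

Lemma partial_im j (a b c d : R3 -> R) : smooth a -> smooth b -> smooth c -> smooth d ->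
  partial j (fun x => a x * d x + b x * c x) =
  (fun x => (a x * partial j d x + b x * partial j c x) +
    (partial j a x * d x + partial j b x * c x)).
Proof.
move=> sa sb sc sd; have D f x (sf : smooth f) : derivable f x (basis3 R j).
  exact: (smooth_derivable sf).
rewrite (@partialD _ (fun x => a x * d x) (fun x => b x * c x)) => [|x|x]; last 2 first.
- exact: (D _ x (smoothM sa sd)).
- exact: (D _ x (smoothM sb sc)).
rewrite (@partialM _ a d j (fun x => D _ x sa) (fun x => D _ x sd)).
rewrite (@partialM _ b c j (fun x => D _ x sb) (fun x => D _ x sc)).
by apply/funext => x; ring.
Qed.

Lemma cpartialM j F G : csmooth F -> csmooth G ->
  cpartial j (fun x => F x * G x) = (fun x => F x * cpartial j G x + cpartial j F x * G x).
Proof.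
move=> [f1 f2] [g1 g2]; apply/funext => x; apply: complexP.
  rewrite ReD !ReM /cpartial /=.
  rewrite (_ : (fun y => complex.Re (F y * G y)) = (fun y => complex.Re (F y) * complex.Re (G y) - complex.Im (F y) * complex.Im (G y))).
    by rewrite (partial_re j f1 f2 g1 g2).
  by apply/funext => y; rewrite ReM.
rewrite ImD !ImM /cpartial /=.
rewrite (_ : (fun y => complex.Im (F y * G y)) = (fun y => complex.Re (F y) * complex.Im (G y) + complex.Im (F y) * complex.Re (G y))).
  by rewrite (partial_im j f1 f2 g1 g2).
by apply/funext => y; rewrite ImM.
Qed.

Lemma cpartial_cis j y : cpartial j (fun x => cis (dot y x)) =
  (fun x => (ci R * (coord3 j y)%:C) * cis (dot y x)).
Proof.
apply/funext => x; apply: complexP; rewrite ?ReM ?ImM /= .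
  rewrite (_ : (fun z => cos _) = (fun z => cos (dot z y))); last by apply/funext => z; rewrite dotC.
  have [_ ->] := partial_cos_dot y j x; rewrite dotC; ring.
rewrite (_ : (fun z => sin _) = (fun z => sin (dot z y))); last by apply/funext => z; rewrite dotC.
have [_ ->] := partial_sin_dot y j x; rewrite dotC; ring.
Qed.

Lemma csmooth_cis' y : csmooth (fun x => cis (dot y x)).
Proof. by have := csmooth_cis y; congr csmooth; apply/funext => x; rewrite dotC. Qed.

(** Integration by parts: the derivative of [h] times a character has integral 0. *)
Lemma FI_partial j h x : ctest h ->
  FI (cpartial j h) x = - (ci R * (coord3 j x)%:C) * FI h x.
Proof.
move=> th.
have tg := ctestM th (csmooth_cis' x).
have [tg1 tg2] := tg.
have : cint mu (cpartial j (fun y => cis (dot x y) * h y)) = 0.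
  by apply: complexP; rewrite /= (int_partial j).
rewrite (cpartialM j (csmooth_cis' x) (ctest_smooth th)) cintD; last 2 first.
- by apply: L1_cis; apply: ctest_L1; exact: ctest_partial.
- apply: ctest_L1; rewrite cpartial_cis; apply: ctestM => //.
  by apply: csmoothM; [exact: csmooth_cst|exact: csmooth_cis'].
rewrite cpartial_cis !FIE => /eqP; rewrite addr_eq0 => /eqP ->.
rewrite mulrN mulNr; congr (- _); rewrite [RHS]mulrCA; congr (_ * _).
rewrite -cintZ; last by apply: L1_cis; exact: ctest_L1.
by apply: eq_cint => y; rewrite mulrA.
Qed.

(** The parameter integral is the real part of $\int e^{ity_j}(a+ib)\,dy$, that is of [FI] along a
    line in direction $e_j$; its derivative in [t] is dominated by $|y_ja|+|y_jb|$. *)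
Lemma deriv_par j (a b : R3 -> R) : rint mu a -> rint mu b ->
  rint mu (fun y => coord3 j y * a y) -> rint mu (fun y => coord3 j y * b y) ->
  is_derive (0 : R) (1 : R)
    (fun t : R => \int[mu]_y (cos (t * coord3 j y) * a y - sin (t * coord3 j y) * b y))
    (\int[mu]_y (- (coord3 j y * b y))).
Proof.
move=> ia ib ja jb.
pose k (t : R) y := cos (t * coord3 j y) * a y - sin (t * coord3 j y) * b y.
have ma := rint_meas ia; have mb := rint_meas ib.
have mc (t : R) : measurable_fun setT (fun y : R3 => t * coord3 j y).
  by apply: measurable_funM => //; exact: coord_measurable.
have ik t : rint mu (k t).
  apply: rintB.
    apply: (@rint_le _ _ _ mu (fun y => `|a y|)); last exact: rint_norm.
      apply: measurable_funM => //.
      exact: (measurableT_comp (continuous_measurable_fun (@continuous_cos R)) (mc t)).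
    by move=> y; rewrite normrM ler_piMl// ler_norml cos_geN1 cos_le1.
  apply: (@rint_le _ _ _ mu (fun y => `|b y|)); last exact: rint_norm.
    apply: measurable_funM => //.
    exact: (measurableT_comp (continuous_measurable_fun (@continuous_sin R)) (mc t)).
  by move=> y; rewrite normrM ler_piMl// ler_norml sin_geN1 sin_le1.
have dk (t : R) y : is_derive t (1 : R) (k ^~ y)
    (- coord3 j y * sin (t * coord3 j y) * a y - coord3 j y * cos (t * coord3 j y) * b y).
  have h : is_derive t (1 : R) (fun t => t * coord3 j y) (coord3 j y).
    by apply: is_derive_eq; rewrite scaler0 add0r [_ *: _]mulr1.
  have hc := @is_derive1_comp R cos (fun t => t * coord3 j y) t _ _ (is_derive_cos _) h.
  have hs := @is_derive1_comp R sin (fun t => t * coord3 j y) t _ _ (is_derive_sin _) h.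
  have := is_deriveB (is_deriveM hc (is_derive_cst (a y) t 1)) (is_deriveM hs (is_derive_cst (b y) t 1)).
  move=> H; apply: (is_derive_eq H).
  rewrite !scaler0 !add0r /GRing.scale /=; set A := sin _; set B := cos _; ring.
pose G y := `|coord3 j y * a y| + `|coord3 j y * b y|.
have iG : rint mu G by apply: rintD; exact: rint_norm.
have G0 y : 0 <= G y by rewrite addr_ge0.
have dE t y : partial1of2 k t y =
    (- coord3 j y * sin (t * coord3 j y) * a y - coord3 j y * cos (t * coord3 j y) * b y).
  by rewrite partial1of2E; have [_] := dk t y.
have Gub t y : `|partial1of2 k t y| <= G y.
  rewrite dE (le_trans (ler_normB _ _))// lerD//.
    rewrite -mulrA mulNr normrN mulrCA normrM ler_piMl// ler_norml sin_geN1 sin_le1//.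
  by rewrite -mulrA mulrCA normrM ler_piMl// ler_norml cos_geN1 cos_le1.
have I0 : (`]-1, 1[%classic : set R) 0 by rewrite /= in_itv/= ltrN10 ltr01.
have dd t y : derivable (k^~ y) t 1 by have [] := dk t y.
apply: DeriveDef.
  exact: (@derivable_under_integral R _ _ mu k setT measurableT 0 (-1) 1 I0
    (fun t _ => ik t) (fun t y _ _ => dd t y) G G0 iG (fun t y _ _ => Gub t y)).
rewrite -derive1E (@differentiation_under_integral R _ _ mu k setT measurableT 0 (-1) 1 I0
    (fun t _ => ik t) (fun t y _ _ => dd t y) G G0 iG (fun t y _ _ => Gub t y)).
apply: eq_Rintegral => y _; rewrite dE mul0r sin0 cos0; ring.
Qed.

Definition xL1 F := L1 mu F /\ forall j, L1 mu (fun y => (coord3 j y)%:C * F y).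

Lemma FI_deriveRe j F x : xL1 F ->
  derivable (fun x => complex.Re (FI F x)) x (basis3 R j) /\
  partial j (fun x => complex.Re (FI F x)) x =
    complex.Re (FI (fun y => ci R * ((coord3 j y)%:C * F y)) x).
Proof.
move=> [iF jF]; apply: derivable_lineP.
have [ia ib] := L1_cis x iF.
have [ja jb] : L1 mu (fun y => (coord3 j y)%:C * (cis (dot x y) * F y)).
  by have := L1_cis x (jF j); congr L1; apply/funext => y; rewrite mulrCA.
have ja' : rint mu (fun y => coord3 j y * complex.Re (cis (dot x y) * F y)).
  by move: ja; congr rint; apply/funext => y; rewrite ReZ.
have jb' : rint mu (fun y => coord3 j y * complex.Im (cis (dot x y) * F y)).
  by move: jb; congr rint; apply/funext => y; rewrite ImZ.
have := deriv_par ia ib ja' jb'.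
set l := \int[mu]_y _ => H.
rewrite (_ : (fun t : R => _) = (fun t => c0 R * \int[mu]_y (cos (t * coord3 j y) * complex.Re (cis (dot x y) * F y) -
        sin (t * coord3 j y) * complex.Im (cis (dot x y) * F y)))); last first.
  apply/funext => t; rewrite FIE ReZ; congr (_ * _).
  apply: eq_Rintegral => y _; rewrite dotDl dotZl dot_basis cisD -mulrA [LHS]ReM.
  by [].
have H2 := is_deriveM (is_derive_cst (c0 R) (0 : R) (1 : R)) H.
apply: (is_derive_eq H2); rewrite scaler0 addr0.
rewrite FIE ReZ /GRing.scale/=; congr (_ * _).
apply: eq_Rintegral => y _; rewrite /= mulrCA ReM /= mul0r mul1r sub0r; congr (- _).
by rewrite (mulrCA (cis _)) ImZ.
Qed.

Lemma ctest_xL1 h : ctest h -> xL1 h.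
Proof. by move=> th; split; [exact: ctest_L1|move=> j; apply: ctest_L1; exact: ctest_coord]. Qed.

(** The imaginary part of [FI F] is the real part of [FI] of [- ci R * F], so the case of real parts
    suffices. *)
Lemma FI_deriveIm j F x : xL1 F ->
  derivable (fun x => complex.Im (FI F x)) x (basis3 R j) /\
  partial j (fun x => complex.Im (FI F x)) x =
    complex.Im (FI (fun y => ci R * ((coord3 j y)%:C * F y)) x).
Proof.
move=> [iF jF].
have xL : xL1 (fun y => - ci R * F y).
  split; first exact: L1Z.
  move=> k; have := L1Z (- ci R) (jF k); congr L1; apply/funext => y; by rewrite mulrCA.
have E G z : L1 mu G -> complex.Im (FI G z) = complex.Re (FI (fun y => - ci R * G y) z).
  by move=> iG; rewrite FIZ// ReM /= ?oppr0; ring.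
have [h1 h2] := FI_deriveRe j x xL.
rewrite (_ : (fun x => complex.Im (FI F x)) = (fun x => complex.Re (FI (fun y => - ci R * F y) x))); last first.
  by apply/funext => z; rewrite E.
split=> //; rewrite h2 E; last by apply: L1Z; exact: jF.
congr (complex.Re _); apply: eq_FI => y; ring.
Qed.

Lemma FI_deriv j F : xL1 F -> cpartial j (FI F) = FI (fun y => ci R * ((coord3 j y)%:C * F y)).
Proof.
move=> xF; apply/funext => x; apply: complexP => /=.
  by have [_] := FI_deriveRe j x xF.
by have [_] := FI_deriveIm j x xF.
Qed.

Lemma FI_lip F : L1 mu F -> rint mu (fun y => enorm y * normc (F y)) ->
  forall x x', normc (FI F x - FI F x') <=
    (c0 R * 2 * \int[mu]_y (enorm y * normc (F y))) * enorm (x - x').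
Proof.
move=> iF eF x x'; rewrite !FIE -mulrBr -cintB; [|exact: L1_cis|exact: L1_cis].
set I := \int[mu]_y _; set e := enorm _.
rewrite (_ : _ * I * e = c0 R * (2 * e * I)); last by ring.
rewrite Normc.normcM normc_real ger0_norm ?(ltW (c0_gt0 R))// ler_wpM2l ?(ltW (c0_gt0 R))//.
apply: (le_trans (normc_cint (L1B (L1_cis x iF) (L1_cis x' iF)))).
rewrite -RintZ//; apply: Rint_le.
- exact: L1_normc (L1B (L1_cis x iF) (L1_cis x' iF)).
- exact: rintZ.
move=> y; rewrite -mulrBl Normc.normcM mulrA ler_wpM2r ?normc_ge0//.
rewrite (le_trans (cis_lip _ _))// -mulrA ler_wpM2l//.
by have := dot_le_enorm (x - x') y; rewrite dotDl dotNl.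
Qed.
End FourierD.

Section FourierS.
Variable R : realType.
Local Notation R3 := (R * R * R)%type.
Local Notation C := R[i].
Local Notation mu := (mu3 R).
Implicit Types (F G h : R3 -> C) (x y z : R3).

Lemma enorm_le_sum x : enorm x <= \sum_(i < 3) `|coord3 i x|.
Proof.
rewrite -(ler_pXn2r (_ : 0 < 2)%N)// ?nnegrE ?enorm_ge0 ?sumr_ge0//.
rewrite sqr_enorm dotE !big_ord_recl big_ord0 addr0 /coord3/=.
have q (t : R) : t * t = `|t| ^+ 2 by rewrite real_normK ?num_real.
rewrite !q; have := normr_ge0 x.1.1; have := normr_ge0 x.1.2; have := normr_ge0 x.2.
move: `|_| `|_| `|_| => a b c ha hb hc; nra.
Qed.

Lemma rint_enorm F : xL1 F -> rint mu (fun y => enorm y * normc (F y)).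
Proof.
move=> [iF jF].
have h : rint mu (fun y => \sum_(i < 3) normc ((coord3 i y)%:C * F y)).
  by apply: rint_sum => i; exact: (L1_normc (jF i)).
apply: (@rint_le _ _ _ mu _ _ _ _ h).
  by apply: measurable_funM; [exact: enorm_measurable|exact: (cmeas_normc (L1_cmeas iF))].
move=> y; rewrite ger0_norm ?mulr_ge0 ?enorm_ge0 ?normc_ge0//.
under eq_bigr do rewrite Normc.normcM normc_real.
by rewrite -mulr_suml ler_wpM2r ?normc_ge0// enorm_le_sum.
Qed.

Lemma FI_lip_ex F : xL1 F -> exists2 L, 0 <= L &
  forall x x', normc (FI F x - FI F x') <= L * enorm (x - x').
Proof.
move=> xF; have iE := rint_enorm xF.
exists (c0 R * 2 * \int[mu]_y (enorm y * normc (F y))); last first.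
  by move=> x x'; apply: FI_lip => //; case: xF.
rewrite !mulr_ge0// ?(ltW (c0_gt0 R))//; apply: Rint_ge0 => y.
by rewrite mulr_ge0 ?enorm_ge0 ?normc_ge0.
Qed.

Lemma lip_continuous (f : R3 -> R) L : (forall x x', `|f x - f x'| <= L * enorm (x - x')) ->
  continuous f.
Proof.
move=> h x; apply/cvgrPdist_le => e e0 /=.
have L1 : 0 < `|L| + 1 by rewrite ltr_wpDl.
have c : (fun y => enorm (x - y)) @ x --> (0 : R).
  rewrite -(enorm0 R) -(subrr x).
  apply: (cvg_comp (fun y => x - y) (@enorm R)); last exact: enorm_continuous.
  by apply: cvgB; [exact: cvg_cst|exact: cvg_id].
have := cvgr_lt 0 c (e / (`|L| + 1)) (divr_gt0 e0 L1).
move=> hN; near=> y.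
have : enorm (x - y) < e / (`|L| + 1) by near: y; exact: hN.
rewrite ltr_pdivlMr// => hy.
rewrite (le_trans (h x y))// (le_trans _ (ltW hy))// mulrC ler_wpM2l ?enorm_ge0//.
by rewrite (le_trans (ler_norm L))// lerDl.
Unshelve. all: end_near. Qed.

Lemma FI_smoothRe h : ctest h -> smooth (fun x => complex.Re (FI h x)).
Proof.
move=> th; apply: (@smooth_coind R (fun f => exists2 h, ctest h & f = (fun x => complex.Re (FI h x)))); last by exists h.
move=> _ [k tk ->]; split.
  have [L _ hL] := FI_lip_ex (ctest_xL1 tk).
  apply: (@lip_continuous _ L) => x x'; apply: le_trans (hL x x').
  by rewrite -ReN -ReD Re_le_normc.
move=> i; split; first by move=> x; have [] := FI_deriveRe i x (ctest_xL1 tk).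
exists (fun y => ci R * ((coord3 i y)%:C * k y)).
  by apply: ctestZ; exact: ctest_coord.
by apply/funext => x; have [_ ->] := FI_deriveRe i x (ctest_xL1 tk).
Qed.

Lemma FI_csmooth h : ctest h -> csmooth (FI h).
Proof.
move=> th; split; first exact: FI_smoothRe.
have := FI_smoothRe (ctestZ (- ci R) th); congr smooth; apply/funext => x.
by rewrite FIZ ?ReM /=; [rewrite oppr0; ring|exact: ctest_L1].
Qed.

Lemma FI_cpartials h b : ctest h -> exists2 h', ctest h' & cpartials b (FI h) = FI h'.
Proof.
move=> th; elim: b => [|i b [h' th' E]].
  by exists h => //; apply/funext => x; apply: complexP.
exists (fun y => ci R * ((coord3 i y)%:C * h' y)).
  by apply: ctestZ; exact: ctest_coord.
rewrite -(FI_deriv i (ctest_xL1 th')) -E.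
by apply/funext => x; apply: complexP.
Qed.

Lemma FI_coord i h x : ctest h -> (coord3 i x)%:C * FI h x = FI (fun y => ci R * cpartial i h y) x.
Proof.
move=> th; rewrite FIZ; last by apply: ctest_L1; exact: ctest_partial.
by rewrite FI_partial// mulNr mulrN -mulrA ci2 opprK.
Qed.

Lemma FI_monomial a h : ctest h -> exists2 h', ctest h' &
  forall x, (monomial a x)%:C * FI h x = FI h' x.
Proof.
move=> th; elim: a => [|i a [h' th' E]].
  by exists h => // x; rewrite /monomial big_nil mul1r.
exists (fun y => ci R * cpartial i h' y).
  by apply: ctestZ; exact: ctest_partial.
move=> x; rewrite -FI_coord// -E /monomial big_cons rmorphM /= mulrA.
by [].
Qed.

(** Derivatives of [FI h] come from multiplying [h] by coordinates, and coordinate factors from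
    differentiating [h]. Every expression in a seminorm is thus [FI] of a test function, which is
    bounded. *)
Lemma FI_schwartz h : ctest h -> schwartz (FI h).
Proof.
move=> th.
have K b a : exists M, forall x, normc ((monomial a x)%:C * cpartials b (FI h) x) <= M.
  have [h1 t1 E1] := FI_cpartials b th; have [h2 t2 E2] := FI_monomial a t1.
  exists (c0 R * \int[mu]_y normc (h2 y)) => x; rewrite E1 E2.
  by apply: FI_bound; exact: ctest_L1.
have [s1 s2] := FI_csmooth th.
apply/schwartzP; split; split=> // b a; have [M hM] := K b a; exists M => x;
  apply: le_trans (hM x); rewrite Normc.normcM normc_real normrM ler_wpM2l//.
  exact: (Re_le_normc (cpartials b (FI h) x)).
exact: (Im_le_normc (cpartials b (FI h) x)).
Qed.

Lemma FI_decay n h : ctest h -> exists2 M, 0 <= M & forall x, normc (FI h x) <= M * om x ^+ n.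
Proof. by move=> th; apply: schwartz_decay; exact: FI_schwartz. Qed.

Lemma FI_L1 h : ctest h -> L1 mu (FI h).
Proof. by move=> th; apply: schwartz_L1; exact: FI_schwartz. Qed.

Definition cube (r : R) : set R3 := ((`[- r, r]%classic : set R) `*` `[- r, r]%classic)
   `*` `[- r, r]%classic.

Lemma cube_measurable (r : R) : measurable (cube r).
Proof. by apply: measurableX => //; apply: measurableX. Qed.

Lemma mu3_cube (r : R) : 0 <= r -> mu (cube r) = ((2 * r) ^+ 3)%:E.
Proof.
move=> r0.
pose I : set (measurableTypeR R) := `[- r, r]%classic.
have E : @lebesgue_measure R I = (2 * r)%:E.
  rewrite lebesgue_measure_itv /= lte_fin; case: ifPn => [_|].
    by rewrite -EFinB opprK mulr2n mulrDl mul1r.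
  move=> h; have r00 : r = 0 by move: h r0; rewrite -leNgt; lra.
  by rewrite r00 mulr0.
have m1 : measurable I by exact: measurable_itv.
have e2 := @product_measure1E _ _ _ _ R (@lebesgue_measure R) (@lebesgue_measure R) _ _ m1 m1.
have m2 : measurable (I `*` I) by exact: measurableX.
have e3 := @product_measure1E _ _ _ _ R (sfmu2 R) (@lebesgue_measure R) _ _ m2 m1.
transitivity (sfmu2 R (I `*` I) * @lebesgue_measure R I)%E; first exact: e3.
rewrite E (_ : sfmu2 R _ = ((2 * r)%:E * (2 * r)%:E)%E).
  by rewrite -!EFinM; congr (_%:E); ring.
by rewrite -E; exact: e2.
Qed.

Lemma rint_indic (A : set R3) : measurable A -> (mu A < +oo)%E -> rint mu (\1_A).
Proof.
move=> mA Af; apply: rint_lty => //.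
by rewrite integral_indic// setIT.
Qed.

Lemma cube_enorm (r : R) x : cube r x -> enorm x <= 3 * r.
Proof.
move=> [[/= h1 h2] h3]; move: h1 h2 h3; rewrite !in_itv /= => h1 h2 h3.
have r0 : 0 <= r by case/andP: h1; lra.
apply: enorm_le_coord => // i; rewrite ler_norml /coord3.
by case: (val i) => [|[|]].
Qed.

Lemma enorm_cube (r : R) x : enorm x <= r -> cube r x.
Proof.
move=> h; have K i := le_trans (coord_le_enorm i x) h.
by split; first split; rewrite /= in_itv/= -ler_norml;
  [exact: (K ord0)|exact: (K (lift ord0 ord0))|exact: (K (lift ord0 (lift ord0 ord0)))].
Qed.

Lemma Rint_pos f (c r : R) : 0 < c -> 0 < r -> rint mu f -> (forall x, 0 <= f x) ->
  (forall x, enorm x <= r -> c <= f x) -> 0 < \int[mu]_x f x.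
Proof.
move=> c0 r0 jf f0 hf; have r3 : 0 <= r / 3 by rewrite divr_ge0// ltW.
have mc := cube_measurable (r / 3).
have ii : rint mu (fun x => c * \1_(cube (r / 3)) x).
  apply: rintZ; apply: rint_indic => //.
  by rewrite mu3_cube// ltry.
apply: lt_le_trans (Rint_le ii jf _); last first.
  move=> x; rewrite indicE; case: (boolP (x \in _)) => [|_]; last by rewrite mulr0.
  rewrite inE => /cube_enorm hx; rewrite mulr1; apply: hf; rewrite (le_trans hx)//.
  by rewrite mulrC divfK.
rewrite RintZ; last first.
  by apply: rint_indic => //; rewrite mu3_cube// ltry.
rewrite mulr_gt0//; rewrite /Rintegral integral_indic// setIT mu3_cube//= exprn_gt0//.
by rewrite mulr_gt0// divr_gt0.
Qed.
End FourierS.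

(** * Square-integrable functions and Fatou's lemma *)

Section L2.
Context d (T : measurableType d) (R : realType) (m : {measure set T -> \bar R}).
Local Notation C := R[i].
Implicit Types (F G : T -> C).

Definition L2 F := cmeas F /\ rint m (fun x => normc (F x) ^+ 2).
Definition nsq F : R := \int[m]_x (normc (F x) ^+ 2).

Lemma nsq_ge0 F : 0 <= nsq F. Proof. by apply: Rint_ge0 => x; exact: sqr_ge0. Qed.

Lemma L2_le g F : cmeas F -> (forall x, normc (F x) ^+ 2 <= g x) -> rint m g -> L2 F.
Proof.
move=> mF h ig; split=> //; apply: (@rint_le _ _ _ m g _ _ _ ig).
  by apply: measurable_funX; exact: cmeas_normc.
by move=> x; rewrite ger0_norm ?sqr_ge0.
Qed.

Lemma L2_le' F G : cmeas F -> (forall x, normc (F x) <= normc (G x)) -> L2 G -> L2 F.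
Proof.
move=> mF h [_ iG]; apply: (L2_le mF _ iG) => x.
by rewrite ler_pXn2r ?nnegrE ?normc_ge0.
Qed.

Lemma amgm (a b : R) : a * b <= 2^-1 * (a ^+ 2 + b ^+ 2).
Proof. have := sqr_ge0 (a - b); rewrite sqrrB; lra. Qed.

Lemma L2_mul F G : L2 F -> L2 G -> L1 m (fun x => F x * G x).
Proof.
move=> [mF iF] [mG iG].
apply: (@L1_le _ _ _ m (fun x => 2^-1 * (normc (F x) ^+ 2 + normc (G x) ^+ 2))).
- exact: cmeasM.
- by move=> x; rewrite Normc.normcM amgm.
- by apply: rintZ; exact: rintD.
Qed.

Lemma L2D F G : L2 F -> L2 G -> L2 (fun x => F x + G x).
Proof.
move=> [mF iF] [mG iG].
apply: (@L2_le (fun x => 2 * (normc (F x) ^+ 2 + normc (G x) ^+ 2))).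
- exact: cmeasD.
- move=> x; have h : normc (F x + G x) ^+ 2 <= (normc (F x) + normc (G x)) ^+ 2.
    by rewrite ler_pXn2r ?nnegrE ?addr_ge0 ?normc_ge0// le_normcD.
  by apply: le_trans h _; rewrite sqrrD; have := amgm (normc (F x)) (normc (G x)); lra.
- by apply: rintZ; exact: rintD.
Qed.

Lemma L2Z (c : C) F : L2 F -> L2 (fun x => c * F x).
Proof.
move=> [mF iF]; split; first by apply: cmeasM => //; exact: cmeas_cst.
under eq_fun do rewrite Normc.normcM exprMn; exact: rintZ.
Qed.

Lemma L2N F : L2 F -> L2 (fun x => - F x).
Proof. by move=> h; have := L2Z (-1) h; congr L2; apply/funext => x; rewrite mulN1r. Qed.

Lemma L2B F G : L2 F -> L2 G -> L2 (fun x => F x - G x).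
Proof. by move=> h1 h2; apply: L2D => //; exact: L2N. Qed.

(** With [N] the modulus of the pairing, $2N\le t\|F\|^2+t^{-1}\|G\|^2$ for all $t>0$. The choice
    $t=N/\|F\|^2$ gives the claim; if $\|F\|=0$, large [t] forces [N = 0]. *)
Lemma cauchy_schwarz F G : L2 F -> L2 G ->
  normc (cint m (fun x => F x * G x)) ^+ 2 <= nsq F * nsq G.
Proof.
move=> hF hG; have iFG := L2_mul hF hG.
set N := normc _; have N0 : 0 <= N by exact: normc_ge0.
have [mF iF] := hF; have [mG iG] := hG.
have H (t : R) : 0 < t -> 2 * N <= t * nsq F + t^-1 * nsq G.
  move=> t0.
  have h : N <= \int[m]_x (2^-1 * (t * normc (F x) ^+ 2 + t^-1 * normc (G x) ^+ 2)).
    apply: (le_trans (normc_cint iFG)); apply: Rint_le.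
    - exact: L1_normc.
    - by apply: rintZ; apply: rintD; exact: rintZ.
    - move=> x; rewrite Normc.normcM.
      have st : 0 < Num.sqrt t by rewrite sqrtr_gt0.
      have := amgm (Num.sqrt t * normc (F x)) ((Num.sqrt t)^-1 * normc (G x)).
      rewrite mulrACA mulfV ?gt_eqF// mul1r => h; apply: le_trans h _.
      by rewrite !exprMn exprVn sqr_sqrtr// ltW.
  move: h; rewrite RintZ; last by apply: rintD; exact: rintZ.
  rewrite RintD; [|exact: rintZ|exact: rintZ].
  by rewrite !RintZ// -/(nsq F) -/(nsq G); lra.
have [F0|F0] := eqVneq (nsq F) 0.
  rewrite F0 mul0r; suff -> : N = 0 by rewrite expr0n.
  apply/eqP; rewrite eq_le N0 andbT; apply/ler_addgt0Pl => e e0; rewrite addr0.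
  have G1 : 0 < nsq G + 1 by rewrite ltr_wpDl// nsq_ge0.
  have := H ((nsq G + 1) / e) (divr_gt0 G1 e0); rewrite F0 mulr0 add0r invf_div => h.
  have : e / (nsq G + 1) * nsq G <= e.
    by rewrite mulrAC ler_pdivrMr// ler_wpM2l ?(ltW e0)// lerDl.
  by move: h N0; lra.
have F1 : 0 < nsq F by rewrite lt_def F0 nsq_ge0.
have [->|Nn0] := eqVneq N 0; first by rewrite expr0n mulr_ge0 ?nsq_ge0.
have N1 : 0 < N by rewrite lt_def Nn0.
have := H (N / nsq F) (divr_gt0 N1 F1); rewrite divfK// invf_div.
move=> h; have : N <= nsq F / N * nsq G by move: h; lra.
by rewrite mulrAC ler_pdivlMr// expr2.
Qed.
End L2.

Section Fatou.
Context d (T : measurableType d) (R : realType) (m : {measure set T -> \bar R}).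

Lemma fatou_bound (f_ : nat -> T -> R) (f : T -> R) (c : R) :
  (forall n, rint m (f_ n)) -> measurable_fun setT f -> (forall n x, 0 <= f_ n x) ->
  (forall x, 0 <= f x) -> (forall x, (fun n => f_ n x) @ \oo --> f x) ->
  (forall n, \int[m]_x f_ n x <= c) -> rint m f /\ \int[m]_x f x <= c.
Proof.
move=> if_ mf f_0 f0 cf hc.
have H : (\int[m]_x (f x)%:E <= c%:E)%E.
  have := @fatou _ _ _ m setT measurableT (fun n x => (f_ n x)%:E)
    (fun n => proj2 (measurable_EFinP _ _) (rint_meas (if_ n))) (fun n x _ => f_0 n x).
  rewrite (_ : (fun x => limn_einf _) = (fun x => (f x)%:E)); last first.
    apply/funext => x; have h : (fun n => (f_ n x)%:E) @ \oo --> (f x)%:E.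
      by apply: cvg_EFin; [exact: nearW|exact: cf].
    by rewrite is_cvg_limn_einfE ?(cvg_lim _ h)//; apply/cvg_ex; exists (f x)%:E.
  move=> h; apply: (le_trans h).
  apply: (@le_trans _ _ (limn_esup (fun n => \int[m]_x (f_ n x)%:E)%E)).
    exact: limn_einf_sup.
  rewrite limn_esup_lim; apply: lime_le; first exact: is_cvg_esups.
  apply: nearW => n; apply: ub_ereal_sup => _ [k _ <-].
  by rewrite -EFin_Rint// lee_fin.
have ii : rint m f by apply: rint_lty => //; exact: le_lt_trans H (ltry c).
by split=> //; rewrite -lee_fin EFin_Rint.
Qed.

(** The indicator of the complement of the exceptional null set reduces this to convergence
    everywhere. *)
Lemma fatou_ae (f_ : nat -> T -> R) (f : T -> R) (c : R) :
  (forall n, rint m (f_ n)) -> measurable_fun setT f -> (forall n x, 0 <= f_ n x) ->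
  (forall x, 0 <= f x) -> {ae m, forall x, (fun n => f_ n x) @ \oo --> f x} ->
  (forall n, \int[m]_x f_ n x <= c) -> rint m f /\ \int[m]_x f x <= c.
Proof.
move=> if_ mf f_0 f0 [N [mN N0 hN]] hc.
have mi : measurable_fun setT (\1_(~` N) : T -> R) by apply: measurable_indic; exact: measurableC.
have i0 x : 0 <= (\1_(~` N) : T -> R) x by rewrite indicE; case: (_ \in _).
have aeN (g : T -> R) : {ae m, forall x, g x = g x * \1_(~` N) x}.
  exists N; split=> // x /= h; apply: contrapT => nN; apply: h.
  by rewrite indicE mem_set// mulr1.
have ri n : rint m (fun x => f_ n x * \1_(~` N) x).
  apply: (rint_le _ _ (if_ n)).
    by apply: measurable_funM => //; exact: (rint_meas (if_ n)).
  move=> x; rewrite ger0_norm ?mulr_ge0// indicE; case: (_ \in _); rewrite ?mulr1 ?mulr0//.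
have [|||||i1 i2] := @fatou_bound (fun n x => f_ n x * \1_(~` N) x) (fun x => f x * \1_(~` N) x) c ri.
- exact: measurable_funM.
- by move=> n x; rewrite mulr_ge0.
- by move=> x; rewrite mulr_ge0.
- move=> x; rewrite indicE; case: (boolP (x \in _)) => [xN|_]; last first.
    by under eq_fun do rewrite mulr0; rewrite mulr0; exact: cvg_cst.
  under eq_fun do rewrite mulr1; rewrite mulr1; apply: contrapT => h.
  by move: xN; rewrite inE; apply; exact: hN.
- move=> n; rewrite -(Rint_ae_eq (rint_meas (if_ n)) (rint_meas (ri n)) (aeN _)).
  exact: hc.
split; first by apply: (rint_ae mf _ i1); apply: filterS (aeN f) => x <-; rewrite ger0_norm.
by rewrite (Rint_ae_eq mf (rint_meas i1) (aeN _)).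
Qed.
End Fatou.

(** * Fourier inversion, Plancherel and Parseval up to constants *)

Section Invert.
Variable R : realType.
Local Notation R3 := (R * R * R)%type.
Local Notation C := R[i].
Local Notation mu := (mu3 R).
Implicit Types (F G h f Q : R3 -> C) (x y z : R3).
Variables (psi : R3 -> R) (Hpsi : cutoff psi).

Lemma psi_test : test_function psi.
Proof. by case: Hpsi => sp _ h _; split=> //; exists 1. Qed.

Definition psiC : R3 -> C := fun x => (psi x)%:C.
Lemma psiC_test : ctest psiC. Proof. exact: (ctest_real psi_test). Qed.

Lemma psi_0 : psi 0 = 1.
Proof. by case: Hpsi => _ _ _; apply; rewrite enorm0 divr_ge0. Qed.

Definition e_ (n : nat) : R := n.+1%:R^-1.
Lemma e_gt0 n : 0 < e_ n. Proof. by rewrite invr_gt0. Qed.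
Lemma e_cvg0 : e_ @ \oo --> (0 : R).
Proof. by apply: cvg_harmonic. Qed.

Lemma e_line_cvg z x : (fun n => e_ n *: z + x) @ \oo --> x.
Proof.
rewrite -[X in _ --> X]add0r; apply: cvgD; last exact: cvg_cst.
by rewrite -(scale0r z); apply: cvgZ; [exact: e_cvg0|exact: cvg_cst].
Qed.

(** Summability factors: compactly supported and tending to 1 pointwise because [psi 0 = 1]. They
    play the part usually given to Gaussians. *)
Definition kn n x : R := psi (e_ n *: x).

Lemma kn_cvg x : (fun n => kn n x) @ \oo --> (1 : R).
Proof.
rewrite -psi_0; have cp : continuous psi by apply: smooth_continuous; case: Hpsi.
apply: (cvg_comp (fun n => e_ n *: x) psi); last exact: cp.
by have := @e_line_cvg x 0; under eq_fun do rewrite addr0.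
Qed.

Lemma kn_test n : test_function (kn n).
Proof.
have := @test_affine R psi (e_ n) 0 _ psi_test; rewrite gt_eqF ?e_gt0// => /(_ isT).
by congr test_function; apply/funext => x; rewrite addr0.
Qed.

Lemma kn_ge0 n x : 0 <= kn n x. Proof. by case: Hpsi => _ h _ _; exact: h. Qed.

Definition KK := FI psiC.
Lemma KK_L1 : L1 mu KK. Proof. exact: FI_L1 psiC_test. Qed.

Definition nK : R := \int[mu]_x normc (KK x).
Lemma nK_ge0 : 0 <= nK. Proof. by apply: Rint_ge0 => x; exact: normc_ge0. Qed.

(** An average of [Q] about [- x] at scale [e_ n], with the transform [KK] of [psi] as weight. *)
Definition AA Q n x : C := cint mu (fun z => Q (e_ n *: z - x) * KK z).

Lemma knC_L1 n : L1 mu (fun x => (kn n x)%:C).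
Proof. by apply: ctest_L1; exact: (ctest_real (kn_test n)). Qed.

Lemma cmeas_affine F (a : R) y : cmeas F -> cmeas (fun x => F (a *: x + y)).
Proof. by move=> mF; exact: (cmeas_comp mF (measurable_scale3 a y)). Qed.

Lemma kn_bounded : exists2 M, 0 <= M & forall n x, normc ((kn n x)%:C) <= M.
Proof.
by have [M M0 hM] := test_bounded psi_test; exists M => // n x; rewrite normc_real; exact: hM.
Qed.

Lemma AA_L1 Q n x : L1 mu Q -> L1 mu (fun z => Q (e_ n *: z - x) * KK z).
Proof.
move=> iQ; have [M M0 hM] := FI_decay 0 psiC_test.
have := @L1_bounded _ _ _ mu M _ _ (L1_affine (- x) (e_gt0 n) iQ) (L1_cmeas KK_L1).
move=> /(_ (fun y => ltac:(by have := hM y; rewrite expr0 mulr1))).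
by congr L1; apply/funext => y; rewrite mulrC.
Qed.

(** The multiplication formula moves the transform from [Q] to the modulated and dilated cutoff,
    whose transform is a rescaled translate of [KK]; a substitution turns the pairing into the
    average [AA]. *)
Lemma regularized_inversion Q n x : L1 mu Q ->
  FI (fun y => (kn n y)%:C * FI Q y) x = (c0 R)%:C * AA Q n x.
Proof.
move=> iQ; rewrite FIE; congr (_ * _).
have e0 := e_gt0 n; have en0 : e_ n != 0 by rewrite gt_eqF.
transitivity (cint mu (fun y => FI Q y * (cis (dot x y) * (kn n y)%:C))).
  by apply: eq_cint => y; rewrite mulrC -mulrA [_ * cis _]mulrC mulrCA mulrA mulrC.
rewrite (FI_mult iQ (L1_cis x (knC_L1 n))).
have E y : FI (fun z => cis (dot x z) * (kn n z)%:C) y = (e_ n ^- 3)%:C * KK ((e_ n)^-1 *: (y + x)).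
  by rewrite FI_mod /kn (@FI_scale _ (e_ n) psiC _ e0 (ctest_L1 psiC_test)).
pose F y := Q y * KK ((e_ n)^-1 *: (y + x)).
have iF : L1 mu F.
  have [M M0 hM] := FI_decay 0 psiC_test.
  have := @L1_bounded _ _ _ mu M _ (fun y => KK ((e_ n)^-1 *: y + (e_ n)^-1 *: x)) iQ
    (cmeas_affine _ _ (L1_cmeas KK_L1)).
  move=> /(_ (fun y => ltac:(by have := hM ((e_ n)^-1 *: y + (e_ n)^-1 *: x); rewrite expr0 mulr1))).
  by congr L1; apply/funext => y; rewrite mulrC /F scalerDr.
transitivity ((e_ n ^- 3)%:C * cint mu F).
  by rewrite -cintZ//; apply: eq_cint => y; rewrite E /F mulrCA.
rewrite -(cint_affine (- x) e0 iF); apply: eq_cint => z.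
by rewrite /F addrNK scalerA mulVf ?scale1r.
Qed.

Lemma AA_cmeas Q n : L1 mu Q -> cmeas (AA Q n).
Proof.
move=> iQ; have [M M0 hM] := kn_bounded.
have i1 : L1 mu (fun y => (kn n y)%:C * FI Q y).
  have := @L1_bounded _ _ _ mu (c0 R * \int[mu]_y normc (Q y)) _ _ (knC_L1 n) (FI_cmeas iQ).
  move=> /(_ (fun y => FI_bound y iQ)); congr L1; apply/funext => y; by rewrite mulrC.
have := FI_cmeas i1; move=> /(cmeasM (@cmeas_cst _ _ _ ((c0 R)^-1)%:C)).
congr cmeas; apply/funext => x; rewrite (regularized_inversion n x iQ) mulrA -rmorphM /= mulVf ?mul1r//.
by rewrite gt_eqF// c0_gt0.
Qed.

(** Continuity at [- x], but only along the sequences occurring in [AA]. This weak form also holds,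
    for almost every [x], for functions with the factor $|\xi|^s$, which is not smooth at the
    origin. *)
Definition pcont Q x := forall z, ccvg (fun n => Q (e_ n *: z - x)) (Q (- x)).

Lemma AA_bound Q n x M : L1 mu Q -> (forall y, normc (Q y) <= M) ->
  normc (AA Q n x) <= M * nK.
Proof.
move=> iQ hM; apply: le_trans (normc_cint (AA_L1 n x iQ)) _.
rewrite -RintZ; last exact: (L1_normc KK_L1).
apply: Rint_le.
- exact: (L1_normc (AA_L1 n x iQ)).
- by apply: rintZ; exact: (L1_normc KK_L1).
- by move=> y; rewrite Normc.normcM ler_wpM2r ?normc_ge0.
Qed.

Lemma AA_cvg Q x M : L1 mu Q -> (forall y, normc (Q y) <= M) -> pcont Q x ->
  ccvg (fun n => AA Q n x) (Q (- x) * cint mu KK).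
Proof.
move=> iQ hM hc; rewrite -cintZ; last exact: KK_L1.
have mK := L1_cmeas KK_L1.
have [] := @cDCT _ _ _ mu (fun n z => Q (e_ n *: z - x) * KK z) (fun z => Q (- x) * KK z)
  (fun z => M * normc (KK z)).
- by move=> n; apply: cmeasM => //; exact: (cmeas_affine _ _ (L1_cmeas iQ)).
- by apply: cmeasM => //; exact: cmeas_cst.
- by apply: nearW => z; apply: ccvgM; [exact: hc|exact: ccvg_cst].
- by apply: rintZ; exact: (L1_normc KK_L1).
- by move=> n z; rewrite Normc.normcM ler_wpM2r ?normc_ge0.
- by move=> _ h; exact: h.
Qed.

(* [FI (FI h) x = kap * h (- x)]; with the normalisation [c0] this constant is 1, but
   only [kap > 0] is ever needed, which avoids computing a Gaussian integral. *)
Definition kap : C := (c0 R)%:C * cint mu KK.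

Lemma kn_ccvg x (w : C) : ccvg (fun n => (kn n x)%:C * w) w.
Proof.
have h : ccvg (fun n => (kn n x)%:C) 1.
  by apply/ccvg_ReIm; split; [exact: kn_cvg|exact: cvg_cst].
by have := ccvgM h (ccvg_cst w); rewrite mul1r.
Qed.

(** The regularised double transform has two limits: the average [AA] concentrates at [- x], while
    the factor [kn n] tends to 1 under the integral of [FI Q]. *)
Lemma FI_inv Q x M : L1 mu Q -> (forall y, normc (Q y) <= M) -> L1 mu (FI Q) ->
  pcont Q x -> FI (FI Q) x = kap * Q (- x).
Proof.
move=> iQ hM iFQ hc; have [N N0 hN] := kn_bounded.
have h1 : ccvg (fun n => FI (fun y => (kn n y)%:C * FI Q y) x) (kap * Q (- x)).
  under eq_fun do rewrite (regularized_inversion _ x iQ).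
  rewrite /kap -mulrA [cint _ _ * _]mulrC; apply: ccvgM; first exact: ccvg_cst.
  exact: AA_cvg hM hc.
have h2 : ccvg (fun n => FI (fun y => (kn n y)%:C * FI Q y) x) (FI (FI Q) x).
  rewrite FIE; under eq_fun do rewrite FIE; apply: ccvgM; first exact: ccvg_cst.
  have mFQ := L1_cmeas iFQ.
  have [] := @cDCT _ _ _ mu (fun n y => cis (dot x y) * ((kn n y)%:C * FI Q y))
    (fun y => cis (dot x y) * FI Q y) (fun y => N * normc (FI Q y)).
  - move=> n; apply: cmeasM; first exact: cis_meas.
    by apply: cmeasM => //; exact: (L1_cmeas (knC_L1 n)).
  - by apply: cmeasM => //; exact: cis_meas.
  - by apply: nearW => y; apply: ccvgM; [exact: ccvg_cst|exact: kn_ccvg].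
  - by apply: rintZ; exact: (L1_normc iFQ).
  - by move=> n y; rewrite Normc.normcM normc_cis mul1r Normc.normcM; exact: (ler_wpM2r (normc_ge0 _) (hN n y)).
  - by move=> _ h; exact: h.
exact: ccvg_unique h2 h1.
Qed.

Lemma pcont_continuous Q x : continuous (fun x => complex.Re (Q x)) ->
  continuous (fun x => complex.Im (Q x)) -> pcont Q x.
Proof.
move=> c1 c2 z; apply/ccvg_ReIm; split.
  exact: (cvg_comp (fun n => e_ n *: z - x) (fun x => complex.Re (Q x)) (@e_line_cvg z (- x)) (c1 (- x))).
exact: (cvg_comp (fun n => e_ n *: z - x) (fun x => complex.Im (Q x)) (@e_line_cvg z (- x)) (c2 (- x))).
Qed.

Lemma csmooth_pcont Q x : csmooth Q -> pcont Q x.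
Proof.
by move=> [s1 s2]; apply: pcont_continuous; [exact: (smooth_continuous s1)|exact: (smooth_continuous s2)].
Qed.

Lemma FI_inv_test h x : ctest h -> FI (FI h) x = kap * h (- x).
Proof.
move=> th; have [M M0 hM] := ctest_bounded th.
apply: (@FI_inv _ _ M); [exact: ctest_L1|exact: hM|exact: FI_L1|].
by apply: csmooth_pcont; exact: ctest_smooth.
Qed.

(** The involution of the convolution algebra: its transform is the conjugate of that of [f], so
    pairing the two produces $|\mathrm{FI}\,f|^2$. *)
Definition oJ f : R3 -> C := fun y => (f (- y))^*.

Lemma oJ_L1 f : L1 mu f -> L1 mu (oJ f).
Proof.
move=> jf; have := L1J (L1_reflect 0 jf); congr L1.
by apply/funext => y; rewrite /oJ sub0r.
Qed.

Lemma FI_oJ f x : L1 mu f -> FI (oJ f) x = (FI f x)^*.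
Proof.
move=> jf; have := FI_opp x (L1J jf); rewrite -/(oJ f) => E.
by rewrite [LHS]E (FIJ _ jf) opprK.
Qed.

(** The multiplication formula rewrites the integral as [c0] times that of [f] against an average of
    [oJ f]. Products of values of [f] are at most half the sum of their squares, and translation
    invariance then gives a bound independent of [n]. *)
Lemma nsq_kn f n : L1 mu f -> rint mu (fun x => normc (f x) ^+ 2) ->
  rint mu (fun x => kn n x * normc (FI f x) ^+ 2) /\
  \int[mu]_x (kn n x * normc (FI f x) ^+ 2) <= c0 R * nK * nsq mu f.
Proof.
move=> jf j2; have iQ := oJ_L1 jf.
have mF := FI_cmeas jf; have [N N0 hN] := kn_bounded.
have i1 : L1 mu (fun y => (kn n y)%:C * FI (oJ f) y).
  have := @L1_bounded _ _ _ mu (c0 R * \int[mu]_y normc (oJ f y)) _ _ (knC_L1 n) (FI_cmeas iQ).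
  move=> /(_ (fun y => FI_bound y iQ)); congr L1; apply/funext => y; by rewrite mulrC.
have i2 : L1 mu (fun y => FI f y * ((kn n y)%:C * FI (oJ f) y)).
  by apply: (@L1_bounded _ _ _ mu (c0 R * \int[mu]_y normc (f y))) => // y; exact: FI_bound.
have E y : FI f y * ((kn n y)%:C * FI (oJ f) y) = (kn n y * normc (FI f y) ^+ 2)%:C.
  by rewrite (FI_oJ y jf) mulrCA mulcJ -rmorphM.
have i3 : rint mu (fun x => kn n x * normc (FI f x) ^+ 2).
  by case: i2 => + _; congr rint; apply/funext => y; rewrite E.
split=> //.
have E2 : (\int[mu]_x (kn n x * normc (FI f x) ^+ 2))%:C =
    (c0 R)%:C * cint mu (fun x => f x * AA (oJ f) n x).
  transitivity (cint mu (fun y => FI f y * ((kn n y)%:C * FI (oJ f) y))).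
    by rewrite -cint_real; apply: eq_cint => y; rewrite E.
  rewrite (FI_mult jf i1).
  have [M [M0 hM]] : exists M, 0 <= M /\ forall x, normc (AA (oJ f) n x) <= M.
    have [M M0 hM] := FI_decay 0 psiC_test.
    exists (M * (e_ n ^- 3 * \int[mu]_y normc (oJ f y))); split.
      rewrite mulr_ge0// mulr_ge0 ?invr_ge0 ?exprn_ge0 ?(ltW (e_gt0 n))//.
      by apply: Rint_ge0 => x; exact: normc_ge0.
    move=> x; apply: le_trans (normc_cint (AA_L1 n x iQ)) _.
    have iA := L1_affine (- x) (e_gt0 n) iQ.
    rewrite -(Rint_affine (- x) (e_gt0 n) (L1_normc iQ)) -RintZ; last exact: (L1_normc iA).
    apply: Rint_le; [exact: (L1_normc (AA_L1 n x iQ))|by apply: rintZ; exact: (L1_normc iA)|].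
    move=> y; rewrite Normc.normcM mulrC ler_wpM2r ?normc_ge0//.
    by have := hM y; rewrite expr0 mulr1.
  rewrite -cintZ.
    by apply: eq_cint => x; rewrite (regularized_inversion n x iQ) mulrCA.
  have := @L1_bounded _ _ _ mu M _ _ jf (AA_cmeas n iQ) hM.
  by congr L1; apply/funext => x; rewrite mulrC.
have iQ2 : rint mu (fun x => normc (oJ f x) ^+ 2).
  have := rint_reflect 0 j2; congr rint; apply/funext => x.
  by rewrite /oJ normc_conj sub0r.
(* The majorant from the arithmetic-geometric mean inequality: both of its terms integrate to
   [nK * nsq mu f]. *)
pose k x z := 2^-1 * (normc (f x) ^+ 2 * normc (KK z) + normc (oJ f (e_ n *: z - x)) ^+ 2 * normc (KK z)).
have r1 : rint2 (fun x z => normc (f x) ^+ 2 * normc (KK z)).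
  by apply: rint2_prod => //; exact: (L1_normc KK_L1).
have me : measurable_fun setT (fun z : R3 => e_ n *: z).
  by have := measurable_scale3 (e_ n) (0 : R3); under eq_fun do rewrite addr0.
have r2' : rint2 (fun z x => normc (KK z) * normc (oJ f (e_ n *: z - x)) ^+ 2).
  exact: (rint2_reflect me (rint2_prod (L1_normc KK_L1) iQ2)).
have r2 : rint2 (fun x z => normc (oJ f (e_ n *: z - x)) ^+ 2 * normc (KK z)).
  have := rint2_swap r2'; congr rint2; apply/funext => x; apply/funext => z; exact: mulrC.
have rk : rint2 k by apply: rint2Z; exact: rint2D.
have rkx x : rint mu (k x).
  apply: rintZ; apply: rintD; first by apply: rintZ; exact: (L1_normc KK_L1).
  have [M M0 hM] := FI_decay 0 psiC_test.
  have iA := rint_affine (- x) (e_gt0 n) iQ2.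
  apply: (@rint_le _ _ _ mu (fun z => M * normc (oJ f (e_ n *: z - x)) ^+ 2)).
  - apply: measurable_funM; first exact: (rint_meas iA).
    exact: (rint_meas (L1_normc KK_L1)).
  - move=> z; rewrite ger0_norm ?mulr_ge0 ?sqr_ge0 ?normc_ge0// mulrC ler_wpM2r ?sqr_ge0//.
    by have := hM z; rewrite expr0 mulr1.
  - exact: rintZ.
have Ek : \int[mu]_x (\int[mu]_z k x z) = nK * nsq mu f.
  have ae1 := fub_ae rk.
  transitivity (2^-1 * \int[mu]_x (\int[mu]_z (normc (f x) ^+ 2 * normc (KK z)) +
      \int[mu]_z (normc (oJ f (e_ n *: z - x)) ^+ 2 * normc (KK z)))).
    rewrite -RintZ; last by apply: rintD; exact: fub_rint.
    apply: eq_Rintegral => x _.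
    have a1 : rint mu (fun z => normc (f x) ^+ 2 * normc (KK z)).
      by apply: rintZ; exact: (L1_normc KK_L1).
    have a2 : rint mu (fun z => normc (oJ f (e_ n *: z - x)) ^+ 2 * normc (KK z)).
      have := rintB (rintZ 2 (rkx x)) a1; congr rint; apply/funext => z; rewrite /k; lra.
    by rewrite RintZ ?RintD//; exact: rintD.
  rewrite RintD; [|exact: fub_rint|exact: fub_rint].
  have -> : \int[mu]_x (\int[mu]_z (normc (f x) ^+ 2 * normc (KK z))) = nK * nsq mu f.
    rewrite -RintZ//; apply: eq_Rintegral => x _.
    by rewrite RintZ ?(mulrC nK)//; exact: (L1_normc KK_L1).
  have -> : \int[mu]_x (\int[mu]_z (normc (oJ f (e_ n *: z - x)) ^+ 2 * normc (KK z))) = nK * nsq mu f.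
    rewrite fub_swap//.
    transitivity (\int[mu]_z (nsq mu f * normc (KK z))); last first.
      by rewrite RintZ 1?mulrC//; exact: (L1_normc KK_L1).
    apply: eq_Rintegral => z _.
    under eq_Rintegral do rewrite mulrC.
    rewrite RintZ; last exact: (rint_reflect (e_ n *: z) iQ2).
    rewrite (Rint_reflect (e_ n *: z) iQ2) mulrC; congr (_ * _).
    have := Rint_reflect 0 j2; rewrite /nsq => <-.
    by apply: eq_Rintegral => y _; rewrite /oJ normc_conj sub0r.
  lra.
have iAA : L1 mu (fun x => f x * AA (oJ f) n x).
  apply: (@L1_le _ _ _ mu (fun x => \int[mu]_z k x z)).
  - by apply: cmeasM; [exact: (L1_cmeas jf)|exact: AA_cmeas].
  - move=> x; rewrite Normc.normcM.
    apply: le_trans (ler_wpM2l (normc_ge0 (f x)) (normc_cint (AA_L1 n x iQ))) _.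
    rewrite -RintZ; last exact: (L1_normc (AA_L1 n x iQ)).
    apply: Rint_le => //; first by apply: rintZ; exact: (L1_normc (AA_L1 n x iQ)).
    move=> z; rewrite Normc.normcM mulrA /k -mulrDl mulrA ler_wpM2r ?normc_ge0//.
    exact: amgm.
  - exact: fub_rint.
have P0 : 0 <= \int[mu]_x (kn n x * normc (FI f x) ^+ 2).
  by apply: Rint_ge0 => x; rewrite mulr_ge0 ?sqr_ge0// kn_ge0.
rewrite -[leLHS]ger0_norm// -normc_real E2 Normc.normcM normc_real ger0_norm ?(ltW (c0_gt0 R))//.
rewrite -mulrA ler_wpM2l ?(ltW (c0_gt0 R))// -Ek.
apply: le_trans (normc_cint iAA) _; apply: Rint_le; [exact: L1_normc|exact: fub_rint|].
move=> x; rewrite Normc.normcM.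
apply: le_trans (ler_wpM2l (normc_ge0 (f x)) (normc_cint (AA_L1 n x iQ))) _.
rewrite -RintZ; last exact: (L1_normc (AA_L1 n x iQ)).
apply: Rint_le => //; first by apply: rintZ; exact: (L1_normc (AA_L1 n x iQ)).
move=> z; rewrite Normc.normcM mulrA /k -mulrDl mulrA ler_wpM2r ?normc_ge0//.
exact: amgm.
Qed.

Definition plancherel_const : R := c0 R * nK.
Lemma CP_ge0 : 0 <= plancherel_const. Proof. by rewrite mulr_ge0 ?nK_ge0// ltW// c0_gt0. Qed.

(** Fatou's lemma in [nsq_kn] as [kn n] tends to 1. The constant need not be sharp: only continuity
    in the square norm matters. *)
Lemma plancherel_le f : L1 mu f -> L2 mu f ->
  L2 mu (FI f) /\ nsq mu (FI f) <= plancherel_const * nsq mu f.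
Proof.
move=> jf [mf j2]; have mF := FI_cmeas jf.
have [] := @fatou_bound _ _ _ mu (fun n x => kn n x * normc (FI f x) ^+ 2)
  (fun x => normc (FI f x) ^+ 2) (plancherel_const * nsq mu f).
- by move=> n; have [] := nsq_kn n jf j2.
- by apply: measurable_funX; exact: cmeas_normc.
- by move=> n x; rewrite mulr_ge0 ?sqr_ge0// kn_ge0.
- by move=> x; exact: sqr_ge0.
- move=> x; rewrite -[X in _ --> X]mul1r; apply: cvgM; [exact: kn_cvg|exact: cvg_cst].
- by move=> n; have [] := nsq_kn n jf j2.
- by move=> h1 h2; split.
Qed.

(** The pairings with [kn n] inserted converge to both sides: by domination to the left one, and,
    rewritten with [AA Q n], to the right one, since the averages are bounded and converge wherever
    [pcont] holds. *)
Lemma parseval f Q M : L1 mu f -> L2 mu f -> L1 mu Q -> L2 mu Q ->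
  (forall y, normc (Q y) <= M) -> {ae mu, forall x, pcont Q x} ->
  cint mu (fun x => FI f x * FI Q x) = kap * cint mu (fun x => f x * Q (- x)).
Proof.
move=> jf f2 iQ Q2 hM hc; have [N N0 hN] := kn_bounded.
have [Ff _] := plancherel_le jf f2; have [FQ _] := plancherel_le iQ Q2.
have iFF := L2_mul Ff FQ.
have mFf := FI_cmeas jf; have mFQ := FI_cmeas iQ.
have h1 : ccvg (fun n => cint mu (fun x => FI f x * ((kn n x)%:C * FI Q x)))
    (cint mu (fun x => FI f x * FI Q x)).
  have [] := @cDCT _ _ _ mu (fun n x => FI f x * ((kn n x)%:C * FI Q x))
     (fun x => FI f x * FI Q x) (fun x => N * normc (FI f x * FI Q x)).
  - move=> n; apply: cmeasM => //; apply: cmeasM => //; exact: (L1_cmeas (knC_L1 n)).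
  - exact: cmeasM.
  - by apply: nearW => y; apply: ccvgM; [exact: ccvg_cst|exact: kn_ccvg].
  - by apply: rintZ; exact: (L1_normc iFF).
  - by move=> n y; rewrite mulrCA Normc.normcM; exact: (ler_wpM2r (normc_ge0 _) (hN n y)).
  - by move=> _ h; exact: h.
have h2 : ccvg (fun n => cint mu (fun x => f x * AA Q n x)) (cint mu (fun x => f x * (Q (- x) * cint mu KK))).
  have [] := @cDCT _ _ _ mu (fun n x => f x * AA Q n x)
     (fun x => f x * (Q (- x) * cint mu KK)) (fun x => (M * nK) * normc (f x)).
  - by move=> n; apply: cmeasM; [exact: (L1_cmeas jf)|exact: AA_cmeas].
  - apply: cmeasM; first exact: (L1_cmeas jf).
    apply: cmeasM; last exact: cmeas_cst.
    have := L1_cmeas (L1_reflect 0 iQ); congr cmeas; apply/funext => x; by rewrite sub0r.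
  - apply: filterS hc => x hx; apply: ccvgM; first exact: ccvg_cst.
    exact: AA_cvg hM hx.
  - by apply: rintZ; exact: (L1_normc jf).
  - by move=> n y; rewrite Normc.normcM mulrC ler_wpM2r ?normc_ge0// AA_bound.
  - by move=> _ h; exact: h.
have E n : cint mu (fun x => FI f x * ((kn n x)%:C * FI Q x)) =
    (c0 R)%:C * cint mu (fun x => f x * AA Q n x).
  have i1 : L1 mu (fun y => (kn n y)%:C * FI Q y).
    have := @L1_bounded _ _ _ mu (c0 R * \int[mu]_y normc (Q y)) _ _ (knC_L1 n) mFQ.
    move=> /(_ (fun y => FI_bound y iQ)); congr L1; apply/funext => y; by rewrite mulrC.
  rewrite (FI_mult jf i1) -cintZ.
    by apply: eq_cint => x; rewrite (regularized_inversion n x iQ) mulrCA.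
  have := @L1_bounded _ _ _ mu (M * nK) _ _ jf (AA_cmeas n iQ) (fun x => AA_bound n x iQ hM).
  by congr L1; apply/funext => x; rewrite mulrC.
have h3 : ccvg (fun n => cint mu (fun x => FI f x * ((kn n x)%:C * FI Q x)))
    ((c0 R)%:C * cint mu (fun x => f x * (Q (- x) * cint mu KK))).
  under eq_fun do rewrite E; exact: ccvgM (ccvg_cst _) h2.
rewrite (ccvg_unique h1 h3) /kap -mulrA; congr (_ * _).
rewrite -cintZ; first by apply: eq_cint => x; rewrite mulrA mulrC.
apply: (@L1_le _ _ _ mu (fun x => M * normc (f x))).
- apply: cmeasM; first exact: (L1_cmeas jf).
  have := L1_cmeas (L1_reflect 0 iQ); congr cmeas; apply/funext => x; by rewrite sub0r.
- by move=> x; rewrite Normc.normcM mulrC ler_wpM2r ?normc_ge0.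
- by apply: rintZ; exact: (L1_normc jf).
Qed.
End Invert.

(** * Densities determined by continuous functions of compact support *)

Section dens.
Context d (T : measurableType d) (R : realType) (mu : {measure set T -> \bar R}).
Variables (h : T -> R) (mh : measurable_fun setT h) (h0 : forall x, 0 <= h x).

Definition dens (A : set T) : \bar R := (\int[mu]_(x in A) (h x)%:E)%E.

Let dens0 : dens set0 = 0%E. Proof. exact: integral_set0. Qed.
Let dens_ge0 A : (0 <= dens A)%E. Proof. by apply: integral_ge0 => x _; rewrite lee_fin. Qed.
Let dens_sigma : semi_sigma_additive dens.
Proof.
move=> F mF tF mUF; rewrite /dens ge0_integral_bigcup//.
- by apply: is_cvg_ereal_nneg_natsum => n _; exact: dens_ge0.
- by apply/measurable_EFinP; exact: measurable_funTS.
- by move=> x _; rewrite lee_fin.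
Qed.

HB.instance Definition _ := isMeasure.Build _ _ _ dens dens0 dens_ge0 dens_sigma.
Definition densm : {measure set T -> \bar R} := dens.
End dens.

Lemma dens_unique d (T : measurableType d) (R : realType) (mu : {measure set T -> \bar R})
    (h h' : T -> R) (G : set (set T)) (g : (set T)^nat) :
  measurable_fun setT h -> (forall x, 0 <= h x) ->
  measurable_fun setT h' -> (forall x, 0 <= h' x) ->
  d.-measurable = <<s G >> -> setI_closed G -> (forall i, G (g i)) -> \bigcup_k g k = setT ->
  (forall A, G A -> dens mu h A = dens mu h' A) -> (forall k, (dens mu h (g k) < +oo)%E) ->
  forall A, measurable A -> dens mu h A = dens mu h' A.
Proof.
move=> mh h0 mh' h0' mG GI Gg gT hG hg A mA.
exact: (@measure_unique _ R T G g mG GI Gg gT (densm mu mh h0) (densm mu mh' h0') hG hg A mA).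
Qed.

Section Cc.
Variable R : realType.
Local Notation R3 := (R * R * R)%type.
Local Notation C := R[i].
Local Notation mu := (mu3 R).

Definition Cc (f : R3 -> R) := continuous f /\ exists r, forall x, r < enorm x -> f x = 0.

Lemma Cc_measurable f : Cc f -> measurable_fun setT f.
Proof. by move=> [cf _]; exact: continuous_measurable3 cf. Qed.

Lemma Cc_bounded f : Cc f -> exists2 M, 0 <= M & forall x, `|f x| <= M.
Proof.
move=> [cf [r hr]].
have /compact_bounded : compact (f @` cube r).
  apply: continuous_compact; last exact: compact_cube.
  exact: continuous_subspaceT.
move=> [M [_ hM]]; exists (`|M| + 1); first by rewrite addr_ge0.
move=> x; have [xr|rx] := leP (enorm x) r; last by rewrite hr// normr0 addr_ge0.
apply: (hM (`|M| + 1)); first by rewrite (le_lt_trans (ler_norm M))// ltrDl.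
by exists x => //; exact: enorm_cube.
Qed.

Lemma CcM f g : Cc f -> continuous g -> Cc (fun x => f x * g x).
Proof.
move=> [cf [r hr]] cg; split; first by move=> x; apply: cvgM; [exact: cf|exact: cg].
by exists r => x /hr ->; rewrite mul0r.
Qed.

Lemma contmax (f g : R3 -> R) : continuous f -> continuous g ->
  continuous (fun x => Num.max (f x) (g x)).
Proof. by move=> cf cg x; exact: (@continuous_max R _ f g x (cf x) (cg x)). Qed.

Lemma contmin (f g : R3 -> R) : continuous f -> continuous g ->
  continuous (fun x => Num.min (f x) (g x)).
Proof. by move=> cf cg x; exact: (@continuous_min R _ f g x (cf x) (cg x)). Qed.

Definition hat (r : R) (x : R3) : R := Num.max 0 (r - enorm x).

Lemma hat_continuous r : continuous (hat r).
Proof.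
apply: (contmax (f := fun=> 0)); first by move=> x; exact: cvg_cst.
by move=> x; apply: cvgB; [exact: cvg_cst|exact: enorm_continuous].
Qed.

Lemma hat_Cc r : Cc (hat r).
Proof.
split; first exact: hat_continuous.
by exists r => x h; rewrite /hat max_l// subr_le0 ltW.
Qed.

Lemma hat_ge0 r x : 0 <= hat r x. Proof. by rewrite /hat le_max lexx. Qed.

Definition posset (f : R3 -> R) : set R3 := [set x | 0 < f x].
(** A pi-system generating the Borel sets. The indicator of such a set is a pointwise limit of [Cc]
    functions, so integrals against [Cc] determine the measures of its members. *)
Definition GG : set (set R3) := [set A | exists f, [/\ Cc f, forall x, 0 <= f x & A = posset f]].

Lemma GG_setI : setI_closed GG.
Proof.
move=> _ _ [f [cf f0 ->]] [g [cg g0 ->]]; exists (fun x => f x * g x); split.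
- by apply: CcM => //; case: cg.
- by move=> x; rewrite mulr_ge0.
- apply/seteqP; split => x; rewrite /posset/=; first by case=> a b; exact: mulr_gt0.
  move=> h; have := f0 x; have := g0 x; rewrite !le_eqVlt.
  case/orP => [/eqP E|hg]; first by move: h; rewrite -E mulr0 ltxx.
  by case/orP => [/eqP E|hf]; [move: h; rewrite -E mul0r ltxx|split].
Qed.

Lemma GG_measurable A : GG A -> measurable A.
Proof.
move=> [f [[cf _] _ ->]]; apply: open_measurable3.
rewrite (_ : posset f = f @^-1` `]0, +oo[%classic); last first.
  by apply/seteqP; split => x; rewrite /posset /= in_itv/= andbT.
by move/continuousP: cf; apply; exact: interval_open.
Qed.

Local Notation GT := (g_sigma_algebraType GG).

(** The set where $f>b$ is the union over [n] of the positivity sets of $(f-b)^+$ times [hat n%:R];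
    the second factor provides bounded support. *)
Lemma GG_gen (f : R3 -> R) : continuous f -> measurable_fun [set: GT] (f : GT -> R).
Proof.
move=> cf; apply: (measurability _ (RGenOInfty.measurableE R)).
move=> _ [_ [b ->] <-]; rewrite setTI.
rewrite (_ : _ @^-1` _ = \bigcup_n posset (fun x => Num.max 0 (f x - b) * hat n%:R x)); last first.
  apply/seteqP; split => [x|x [n _]].
    rewrite /= in_itv/= andbT => h.
    exists (Num.bound (enorm x)) => //; rewrite /posset /= mulr_gt0//.
      by rewrite lt_max subr_gt0 h orbT.
    rewrite /hat lt_max subr_gt0; apply/orP; right.
    by have := archi_boundP (enorm_ge0 x).
  rewrite /posset /= in_itv/= andbT => h; rewrite ltNge; apply/negP => h'; by move: h; rewrite max_l ?subr_le0// mul0r ltxx.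
pose F n : set GT := posset (fun x => Num.max 0 (f x - b) * hat n%:R x).
suff mF n : measurable (F n) by exact: (@bigcup_measurable _ GT F setT (fun k _ => mF k)).
apply: sub_sigma_algebra.
exists (fun x => Num.max 0 (f x - b) * hat n%:R x); split => //.
- have := @CcM (hat n%:R) (fun x => Num.max 0 (f x - b)) (hat_Cc _).
  under [X in _ -> Cc X]eq_fun do rewrite mulrC; apply.
  apply: (contmax (f := fun=> 0)); first by move=> x; exact: cvg_cst.
  by move=> x; apply: cvgB; [exact: cf|exact: cvg_cst].
- by move=> x; rewrite mulr_ge0 ?hat_ge0// le_max lexx.
Qed.

Lemma measurable_GG : (@measurable _ (measurableTypeR R * measurableTypeR R * measurableTypeR R)%type) = <<s GG >>.
Proof.
apply/seteqP; split => A mA; last first.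
  by move: A mA; apply: smallest_sub; [exact: sigma_algebra_measurable|exact: GG_measurable].
have c1 : measurable_fun [set: GT] (fun x : GT => (x : R3).1.1 : R) := GG_gen (@coord3_continuous R ord0).
have c2 : measurable_fun [set: GT] (fun x : GT => (x : R3).1.2 : R) := GG_gen (@coord3_continuous R (lift ord0 ord0)).
have c3 : measurable_fun [set: GT] (fun x : GT => (x : R3).2 : R) := GG_gen (@coord3_continuous R (lift ord0 (lift ord0 ord0))).
have := measurable_fun_pair (measurable_fun_pair c1 c2) c3.
move=> /(_ measurableT A mA); rewrite setTI.
rewrite (_ : _ @^-1` _ = A)//.
by apply/seteqP; split => -[[x y] z].
Qed.

Lemma dens_rint (h : R3 -> R) : measurable_fun setT h -> (forall x, 0 <= h x) ->
  forall A, measurable A -> rint mu (fun x => h x * \1_A x) ->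
  dens mu h A = (\int[mu]_x (h x * \1_A x))%:E.
Proof.
move=> mh h0 A mA ih; rewrite EFin_Rint// /dens integral_mkcond.
apply: eq_integral => x _; rewrite /patch indicE; case: ifPn => _; rewrite ?mulr1 ?mulr0//.
Qed.

(** The positive and negative parts of [g] are densities of measures that agree on the pi-system
    [GG], hence everywhere; having disjoint supports, both vanish almost everywhere. *)
Lemma Cc_separates_real (g : R3 -> R) : measurable_fun setT g ->
  (forall f, Cc f -> rint mu (fun x => g x * f x) /\ \int[mu]_x (g x * f x) = 0) ->
  {ae mu, forall x, g x = 0}.
Proof.
move=> mg Hg.
pose gp x := Num.max 0 (g x); pose gn x := Num.max 0 (- g x).
have mgp : measurable_fun setT gp by apply: measurable_maxr => //; exact: measurable_cst.
have mgn : measurable_fun setT gn.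
  by apply: measurable_maxr; [exact: measurable_cst|exact: measurable_funN].
have gp0 x : 0 <= gp x by rewrite le_max lexx.
have gn0 x : 0 <= gn x by rewrite le_max lexx.
have gE x : g x = gp x - gn x.
  by rewrite /gp /gn; case: (leP 0 (g x)) => h; rewrite ?(max_r h) ?(max_l (ltW h));
    [rewrite max_l ?subr0// oppr_le0|rewrite max_r ?sub0r ?opprK// oppr_ge0 ltW].
have gpn x : `|g x| = gp x + gn x.
  rewrite /gp /gn; have [h|h] := leP 0 (g x).
    by rewrite (ger0_norm h) max_l ?addr0// oppr_le0.
  by rewrite (ltr0_norm h) max_r ?add0r// oppr_ge0 ltW.
have ig f : Cc f -> rint mu (fun x => gp x * f x) /\ rint mu (fun x => gn x * f x).
  move=> cf; have mf := Cc_measurable cf; have [i1 _] := Hg f cf.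
  split; apply: (rint_le _ _ (rint_norm i1)); try exact: measurable_funM.
    by move=> x; rewrite !normrM ler_wpM2r// ger0_norm// gpn lerDl.
  by move=> x; rewrite !normrM ler_wpM2r// ger0_norm// gpn lerDr.
have eqf f : Cc f -> \int[mu]_x (gp x * f x) = \int[mu]_x (gn x * f x).
  move=> cf; have [i1 i2] := ig f cf; have [_ h] := Hg f cf.
  apply/eqP; rewrite -subr_eq0 -RintB//; apply/eqP; rewrite -[RHS]h.
  by apply: eq_Rintegral => x _; rewrite -mulrBl -gE.
have eqA A : GG A -> [/\ rint mu (fun x => gp x * \1_A x), rint mu (fun x => gn x * \1_A x) &
     \int[mu]_x (gp x * \1_A x) = \int[mu]_x (gn x * \1_A x)].
  move=> GA; have mA := GG_measurable GA.
  have [f [cf f0 EA]] := GA; have [cof [r hr]] := cf.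
  pose th n x := Num.min 1 (n%:R * f x).
  have cth n : Cc (th n).
    split; last by exists r => x /hr E; rewrite /th E mulr0 min_r.
    apply: (contmin (f := fun=> 1)); first by move=> x; exact: cvg_cst.
    by move=> x; apply: cvgM; [exact: cvg_cst|exact: cof].
  have th0 n x : 0 <= th n x by rewrite le_min ler01 mulr_ge0.
  have th1 n x : th n x <= 1 by rewrite ge_min lexx.
  have thc x : (fun n => th n x) @ \oo --> (\1_A x : R).
    rewrite indicE; case: (boolP (x \in A)) => xA.
      have fx : 0 < f x by move: xA; rewrite inE EA.
      apply: cvg_near_cst; exists (Num.bound (f x)^-1) => // n /= hn.
      have iv : 0 < (f x)^-1 by rewrite invr_gt0.
      have h : (f x)^-1 <= n%:R.
        by rewrite (le_trans (ltW (archi_boundP (ltW iv))))// ler_nat.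
      have h1 : 1 <= n%:R * f x by rewrite -[leLHS](mulVf (lt0r_neq0 fx)) ler_pM2r.
      by rewrite /th min_l.
    have fx0 : f x = 0.
      apply/eqP; rewrite eq_le f0 andbT leNgt; apply/negP => h.
      by move/negP: xA; apply; rewrite inE EA.
    by under eq_fun do rewrite /th fx0 mulr0 min_r//; exact: cvg_cst.
  have big x : th 0%N x = th 0%N x by [].
  (* A single [Cc] function above all [th n], so that its product with the density is an integrable
     majorant. *)
  pose H := fun x => Num.min 1 (hat (`|r| + 1) x).
  have cH : Cc H.
    split; last first.
      by exists (`|r| + 1) => x h; rewrite /H /hat [in X in Num.min 1 X]max_l ?min_r// subr_le0 ltW.
    apply: (contmin (f := fun=> 1)); first by move=> x; exact: cvg_cst.
    exact: hat_continuous.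
  have H0 x : 0 <= H x by rewrite le_min ler01 hat_ge0.
  have thH n x : th n x <= H x.
    have [xr|rx] := leP (enorm x) r; last by rewrite /th hr// mulr0 min_r.
    rewrite /H min_l//; rewrite /hat le_max; apply/orP; right.
    by have := ler_norm r; lra.
  have K (q : R3 -> R) : measurable_fun setT q -> (forall x, 0 <= q x) ->
      (forall f, Cc f -> rint mu (fun x => q x * f x)) ->
      rint mu (fun x => q x * \1_A x) /\
      (fun n => \int[mu]_x (q x * th n x)) @ \oo --> \int[mu]_x (q x * \1_A x).
    move=> mq q0 iq.
    apply: (@rDCT _ _ _ mu (fun n x => q x * th n x) _ (fun x => q x * H x)).
    - by move=> n; exact: (rint_meas (iq _ (cth n))).
    - by apply: measurable_funM => //; exact: measurable_indic.
    - by apply: nearW => x; apply: cvgM; [exact: cvg_cst|exact: thc].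
    - exact: iq.
    - by move=> n x; rewrite ger0_norm ?mulr_ge0// ler_wpM2l.
  have [a1 a2] := K gp mgp gp0 (fun f cf => (ig f cf).1).
  have [b1 b2] := K gn mgn gn0 (fun f cf => (ig f cf).2).
  have E : (fun n => \int[mu]_x (gp x * th n x)) = fun n => \int[mu]_x (gn x * th n x).
    by apply/funext => n; rewrite eqf.
  move: b2; rewrite -E => b2.
  by split=> //; exact: (cvg_unique _ a2 b2).
have DE A : measurable A -> dens mu gp A = dens mu gn A.
  move=> mA.
  apply: (@dens_unique _ _ R mu gp gn GG (fun n => posset (hat n%:R)) mgp gp0 mgn gn0
    measurable_GG GG_setI _ _ _ _ A mA).
  - by move=> n; exists (hat n%:R); split=> //; [exact: hat_Cc|exact: hat_ge0].
  - apply/seteqP; split => // x _; exists (Num.bound (enorm x)) => //.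
    rewrite /posset /= /hat lt_max subr_gt0; apply/orP; right.
    exact: archi_boundP (enorm_ge0 x).
  - move=> B GB; have [i1 i2 E] := eqA B GB; have mB := GG_measurable GB.
    by rewrite !dens_rint// E.
  - move=> n; have GB : GG (posset (hat n%:R)).
      by exists (hat n%:R); split=> //; [exact: hat_Cc|exact: hat_ge0].
    have [i1 i2 E] := eqA _ GB; have mB := GG_measurable GB.
    by rewrite !dens_rint// ltry.
(* On the set where [q] is positive the common measure also has the density [q'], which vanishes
   there; so [q] has integral 0 over that set. *)
have Z (q q' : R3 -> R) (mq : measurable_fun setT q) (mq' : measurable_fun setT q')
    (q0 : forall x, 0 <= q x) (q0' : forall x, 0 <= q' x) :
    (forall A, measurable A -> dens mu q A = dens mu q' A) ->
    (forall x, 0 < q x -> q' x = 0) -> {ae mu, forall x, q x = 0}.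
  move=> hA hq.
  have mA : measurable [set x | 0 < q x].
    have := measurable_fun_ltr (@measurable_cst _ _ R3 _ setT (0 : R)) mq.
    move=> /(_ measurableT [set true]); rewrite setTI; apply.
    by [].
  have := hA _ mA; rewrite /dens.
  have -> : (\int[mu]_(x in [set x | (0 < q x)%R]) (q' x)%:E = 0)%E.
    by apply: integral0_eq => x /= /hq ->.
  have mqE : measurable_fun [set x | 0 < q x] (fun x => (q x)%:E).
    by apply/measurable_EFinP; exact: measurable_funTS.
  move=> E; have := (ae_eq_integral_abs mu mA mqE).1.
  rewrite (_ : (\int[mu]_(x in _) `|(q x)%:E|)%E = 0%E); last first.
    by rewrite -[RHS]E; apply: eq_integral => x _; rewrite abse_EFin ger0_norm.
  move=> /(_ erefl); apply: filterS => x h.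
  apply/eqP; rewrite eq_le q0 andbT leNgt; apply/negP => qx.
  by have := h qx; move=> [] => qx0; rewrite qx0 ltxx in qx.
have z1 := Z gp gn mgp mgn gp0 gn0 DE
  (fun x => ltac:(by rewrite /gp /gn lt_max ltxx /= => h; rewrite max_l// oppr_le0 ltW)).
have z2 := Z gn gp mgn mgp gn0 gp0 (fun A mA => esym (DE A mA))
  (fun x => ltac:(by rewrite /gp /gn lt_max ltxx /= oppr_gt0 => h; rewrite max_l// ltW)).
by move: z2; apply: filterS2 z1 => x a b; rewrite gE a b subr0.
Qed.
End Cc.

(** * Functions determined by their pairings *)

Section Unique.
Variable R : realType.
Local Notation R3 := (R * R * R)%type.
Local Notation C := R[i].
Local Notation mu := (mu3 R).
Implicit Types (F G K : R3 -> C).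

Lemma L1b_L2 F M : L1 mu F -> (forall x, normc (F x) <= M) -> L2 mu F.
Proof.
move=> iF hM; apply: (@L2_le _ _ _ mu (fun x => M * normc (F x)) _ (L1_cmeas iF)).
  by move=> x; rewrite expr2 ler_wpM2r ?normc_ge0.
by apply: rintZ; exact: (L1_normc iF).
Qed.

Lemma ctest_L2 F : ctest F -> L2 mu F.
Proof. by move=> tF; have [M _ hM] := ctest_bounded tF; exact: (L1b_L2 (ctest_L1 tF) hM). Qed.

Lemma cmeas_opp F : cmeas F -> cmeas (fun x : R3 => F (- x)).
Proof. by move=> mF; exact: (cmeas_comp mF (@measurable_opp3 R)). Qed.

Lemma measurable_line (e : R) : measurable_fun setT (fun p : R3 * R3 => p.1 + e *: p.2).
Proof.
have h := measurable_scale3 e (0 : R3).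
have := measurableT_comp (@measurable_add3 R)
 (measurable_fun_pair (@measurable_fst _ _ _ _) (measurableT_comp h (@measurable_snd _ _ _ _))).
by congr (measurable_fun setT _); apply/funext => p /=; rewrite addr0.
Qed.

Lemma measurable_scaled_sub (e : R) : measurable_fun setT (fun p : R3 * R3 => e *: (p.2 - p.1)).
Proof.
have h := measurable_scale3 e (0 : R3).
have := measurableT_comp h (measurableT_comp (@measurable_sub3 R)
 (measurable_fun_pair (@measurable_snd _ _ _ _) (@measurable_fst _ _ _ _))).
by congr (measurable_fun setT _); apply/funext => p /=; rewrite addr0.
Qed.

(** Peetre's inequality for the product weight; each coordinate contributes a factor 2. *)
Lemma om_peetre (e : R) (x z : R3) : 0 <= e <= 1 -> om (x + e *: z) * om z <= 8 * om x.
Proof.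
move=> /andP[e0 e1].
have h (a b : R) : (1 + (a + e * b) ^+ 2)^-1 * (1 + b ^+ 2)^-1 <= 2 * (1 + a ^+ 2)^-1.
  have p1 : 0 < 1 + (a + e * b) ^+ 2 by rewrite ltr_pwDl// sqr_ge0.
  have p2 : 0 < 1 + b ^+ 2 by rewrite ltr_pwDl// sqr_ge0.
  have p3 : 0 < 1 + a ^+ 2 by rewrite ltr_pwDl// sqr_ge0.
  rewrite -invfM ler_pdivlMr// mulrC ler_pdivrMr ?mulr_gt0//.
  have q1 : (e * b) ^+ 2 <= b ^+ 2 by rewrite exprMn ler_piMl ?sqr_ge0// expr_le1.
  have q2 : a ^+ 2 <= 2 * (a + e * b) ^+ 2 + 2 * (e * b) ^+ 2.
    by have := sqr_ge0 (a + e * b + e * b); nra.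
  by have := sqr_ge0 ((a + e * b) * b); nra.
have p (a : R) : 0 <= (1 + a ^+ 2)^-1 by rewrite invr_ge0 addr_ge0// sqr_ge0.
rewrite /om /=.
have h1 := h x.1.1 z.1.1; have h2 := h x.1.2 z.1.2; have h3 := h x.2 z.2.
have := ler_pM (mulr_ge0 (mulr_ge0 (p _) (p _)) (mulr_ge0 (p _) (p _))) (mulr_ge0 (p _) (p _))
  (ler_pM (mulr_ge0 (p _) (p _)) (mulr_ge0 (p _) (p _)) h1 h2) h3.
by move=> hh; apply: le_trans (le_trans _ hh) _; rewrite le_eqVlt; apply/orP; left; apply/eqP; ring.
Qed.

Lemma ccvg_cont F x z : continuous (fun x => complex.Re (F x)) ->
  continuous (fun x => complex.Im (F x)) ->
  ccvg (fun n => F (x + e_ R n *: z)) (F x).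
Proof.
move=> c1 c2; have hl : (fun n => x + e_ R n *: z) @ \oo --> x.
  by have := @e_line_cvg R z x; under eq_fun do rewrite addrC.
apply/ccvg_ReIm; split.
  by apply: (cvg_comp (fun n => x + e_ R n *: z) (fun x => complex.Re (F x))) hl _; exact: c1.
by apply: (cvg_comp (fun n => x + e_ R n *: z) (fun x => complex.Im (F x))) hl _; exact: c2.
Qed.

Lemma Cc_decay (f : R3 -> R) n : Cc f -> exists2 M, 0 <= M & forall x, `|f x| <= M * om x ^+ n.
Proof.
move=> cf; have [M M0 hM] := Cc_bounded cf; have [_ [r hr]] := cf.
exists (M * ((1 + `|r| ^+ 2) ^+ 3) ^+ n).
  by rewrite mulr_ge0// exprn_ge0// exprn_ge0// addr_ge0// sqr_ge0.
move=> x; have [xr|rx] := leP (enorm x) `|r|; last first.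
  rewrite hr ?normr0; last exact: le_lt_trans (ler_norm r) rx.
  by rewrite mulr_ge0 ?exprn_ge0 ?om_ge0// mulr_ge0// exprn_ge0// exprn_ge0// addr_ge0// sqr_ge0.
by rewrite (le_trans (hM x))// -mulrA -exprMn ler_peMr// exprn_ege1//; exact: om_lb.
Qed.

Lemma Cc_separates G : cmeas G -> (forall f, Cc f -> L1 mu (fun x => (f x)%:C * G x) /\
    cint mu (fun x => (f x)%:C * G x) = 0) -> {ae mu, forall x, G x = 0}.
Proof.
move=> [m1 m2] h.
have r1 : {ae mu, forall x, complex.Re (G x) = 0}.
  apply: Cc_separates_real => // f cf; have [[i _] /(congr1 (@complex.Re R)) /= e] := h f cf.
  have E : (fun x => complex.Re ((f x)%:C * G x)) = fun x => complex.Re (G x) * f x.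
    by apply/funext => x; rewrite ReZ mulrC.
  by rewrite E in i e; split.
have r2 : {ae mu, forall x, complex.Im (G x) = 0}.
  apply: Cc_separates_real => // f cf; have [[_ i] /(congr1 (@complex.Im R)) /= e] := h f cf.
  have E : (fun x => complex.Im ((f x)%:C * G x)) = fun x => complex.Im (G x) * f x.
    by apply/funext => x; rewrite ImZ mulrC.
  by rewrite E in i e; split.
by apply: filterS2 r1 r2 => x a b; exact: complexP.
Qed.

(* Mollifying a test function [f] with the kernel [K] gives [0 = cint (G * T_n)],
   where [T_n --> cint K * f] is dominated by a multiple of [om ^+ m]. *)
Lemma kernel_separates K G m : cmeas K -> cint mu K <> 0 ->
  (exists2 M, 0 <= M & forall w, normc (K w) <= M * om w ^+ m.+1) ->
  cmeas G -> L1 mu (fun x => (om x ^+ m)%:C * G x) ->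
  (forall y n, L1 mu (fun x => G x * K ((e_ R n)^-1 *: (y - x))) /\
    cint mu (fun x => G x * K ((e_ R n)^-1 *: (y - x))) = 0) ->
  {ae mu, forall x, G x = 0}.
Proof.
move=> mK K0 [M M0 hM] mG iG hG; apply: Cc_separates => // f cf.
have [Cf Cf0 hCf] := Cc_decay m cf; have [Df Df0 hDf] := Cc_decay m.+1 cf.
have mf := Cc_measurable cf; have [cof _] := cf.
pose T n x z : C := G x * ((f (x + e_ R n *: z))%:C * K z).
have e01 n : 0 <= e_ R n <= 1.
  by rewrite ltW ?e_gt0//= /e_ invf_le1 ?ltr0n// ler1n.
have ompos k (x : R3) : 0 <= om x ^+ k by rewrite exprn_ge0// om_ge0.
have bT n x z : normc (T n x z) <= (Cf * M * 8 ^+ m) * (normc ((om x ^+ m)%:C * G x) * om z).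
  rewrite /T !Normc.normcM !normc_real.
  rewrite (ger0_norm (ompos _ _)).
  have h1 := ler_pM (normr_ge0 _) (normc_ge0 _) (hCf (x + e_ R n *: z)) (hM z).
  have h2 : om (x + e_ R n *: z) ^+ m * om z ^+ m <= 8 ^+ m * om x ^+ m.
    by rewrite -!exprMn lerXn2r ?om_peetre// nnegrE mulr_ge0 ?om_ge0.
  apply: (@le_trans _ _ (normc (G x) * (Cf * om (x + e_ R n *: z) ^+ m * (M * om z ^+ m.+1)))).
    by rewrite ler_wpM2l ?normc_ge0.
  rewrite [leLHS](_ : _ = (normc (G x) * Cf * M * om z) * (om (x + e_ R n *: z) ^+ m * om z ^+ m));
    last by rewrite exprS; ring.
  rewrite [leRHS](_ : _ = (normc (G x) * Cf * M * om z) * (8 ^+ m * om x ^+ m)); last by ring.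
  apply: ler_wpM2l h2; apply: mulr_ge0 (om_ge0 _); apply: mulr_ge0 => //.
  by apply: mulr_ge0 => //; exact: normc_ge0.
have mfz n x : measurable_fun setT (fun z : R3 => f (x + e_ R n *: z)).
  have := measurableT_comp mf (measurable_scale3 (e_ R n) x).
  by congr (measurable_fun setT _); apply/funext => z /=; rewrite addrC.
have mT n : cmeas2 (T n).
  apply: cmeasM; first exact: (cmeas2_1 mG).
  apply: cmeasM; last exact: (cmeas2_2 mK).
  exact: (cmeas_real (measurableT_comp mf (measurable_line (e_ R n)))).
have iT n : L12 (T n).
  apply: (L12_le (mT n) (bT n)); apply: rint2Z; apply: rint2_prod; last exact: rint_om.
  exact: (L1_normc iG).
(* With $y=x+e_nz$ the double integral becomes one over [x] and [y]. Fubini allows integrating in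
   [x] first, where the hypothesis on the pairings at [y] gives 0. *)
have zT n : cint mu (fun x => cint mu (T n x)) = 0.
  pose S x y : C := G x * ((f y)%:C * K ((e_ R n)^-1 *: (y - x))).
  have en := e_gt0 R n; have en0 := lt0r_neq0 en.
  have E x z : T n x z = S x (e_ R n *: z + x).
    by rewrite /T /S addrC addrK scalerA mulVf// scale1r.
  have bS x y : normc (S x y) <= (Df * M * 8 ^+ m) * (normc ((om x ^+ m)%:C * G x) * om y).
    rewrite /S !Normc.normcM !normc_real (ger0_norm (ompos _ _)).
    set w := (e_ R n)^-1 *: (y - x).
    have Ey : y = x + e_ R n *: w by rewrite /w scalerA mulfV// scale1r addrC subrK.
    have h1 := ler_pM (normr_ge0 _) (normc_ge0 _) (hDf y) (hM w).
    have h2 : om y ^+ m * om w ^+ m <= 8 ^+ m * om x ^+ m.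
      have P := @om_peetre (e_ R n) x w (e01 n); rewrite -Ey in P.
      by rewrite -!exprMn lerXn2r ?P// nnegrE mulr_ge0 ?om_ge0.
    apply: (@le_trans _ _ (normc (G x) * (Df * om y ^+ m.+1 * (M * om w ^+ m.+1)))).
      by rewrite ler_wpM2l ?normc_ge0.
    rewrite [leLHS](_ : _ = (normc (G x) * Df * M * om y) * (om y ^+ m * om w ^+ m * om w));
      last by rewrite !exprS; ring.
    rewrite [leRHS](_ : _ = (normc (G x) * Df * M * om y) * (8 ^+ m * om x ^+ m)); last by ring.
    apply: ler_wpM2l.
      apply: mulr_ge0 (om_ge0 _); apply: mulr_ge0 => //.
      by apply: mulr_ge0 => //; exact: normc_ge0.
    by apply: le_trans h2; rewrite ler_piMr ?om_le1// mulr_ge0.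
  have mS : cmeas2 S.
    apply: cmeasM; first exact: (cmeas2_1 mG).
    apply: cmeasM; first exact: (cmeas2_2 (cmeas_real mf)).
    exact: (cmeas_comp mK (measurable_scaled_sub (e_ R n)^-1)).
  have iS : L12 S.
    apply: (L12_le mS bS); apply: rint2Z; apply: rint2_prod; last exact: rint_om.
    exact: (L1_normc iG).
  have sw : cint mu (fun x => cint mu (S x)) = 0.
    rewrite cfub_swap// -[RHS](@cint0 _ _ _ mu); apply: eq_cint => y.
    rewrite /S (_ : (fun x => _) = fun x => (f y)%:C * (G x * K ((e_ R n)^-1 *: (y - x)))).
      by have [i e] := hG y n; rewrite cintZ ?e ?mulr0.
    by apply/funext => x; ring.
  have : {ae mu, forall x, cint mu (T n x) = (e_ R n ^- 3)%:C * cint mu (S x)}.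
    apply: filterS (cfub_ae iS) => x iSx.
    by rewrite -(cint_affine x en iSx); apply: eq_cint => z; exact: E.
  move=> /cint_ae ->.
  - by rewrite cintZ ?sw ?mulr0//; exact: cfub_L1.
  - by have := L1_cmeas (cfub_L1 (iT n)).
  - by have := L1_cmeas (L1Z ((e_ R n ^- 3)%:C) (cfub_L1 iS)).
have iK : L1 mu K.
  apply: (@L1_le _ _ _ mu (fun w => M * om w ^+ m.+1) _ mK hM).
  by apply: rintZ; exact: rint_omX.
have inner x : ccvg (fun n => cint mu (T n x)) (cint mu (fun z => G x * (f x)%:C * K z)).
  have [] := @cDCT _ _ _ mu (fun n => T n x) (fun z => G x * (f x)%:C * K z)
     (fun z => (Cf * M * 8 ^+ m * normc ((om x ^+ m)%:C * G x)) * om z).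
  - move=> n; rewrite /T; apply: cmeasM; first exact: cmeas_cst.
    exact: (cmeasM (cmeas_real (mfz n x)) mK).
  - by apply: cmeasM mK; exact: cmeas_cst.
  - apply: nearW => z; rewrite /T.
    have c1 : ccvg (fun n => (f (x + e_ R n *: z))%:C) (f x)%:C.
      by apply: (@ccvg_cont (fun x => (f x)%:C)) => //= w; exact: cvg_cst.
    have c2 := ccvgM (ccvg_cst (G x)) (ccvgM c1 (ccvg_cst (K z))).
    by rewrite -mulrA.
  - by apply: rintZ; exact: rint_om.
  - by move=> n z; rewrite -mulrA; exact: bT.
  by move=> _ h; exact: h.
have iGf : L1 mu (fun x => (f x)%:C * G x).
  apply: (@L1_le _ _ _ mu (fun x => Cf * normc ((om x ^+ m)%:C * G x))).
  - by apply: cmeasM mG; exact: cmeas_real.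
  - move=> x; rewrite !Normc.normcM !normc_real mulrA ler_wpM2r ?normc_ge0//.
    by rewrite (ger0_norm (ompos _ _)).
  - by apply: rintZ; exact: (L1_normc iG).
split=> //.
have [] := @cDCT _ _ _ mu (fun n x => cint mu (T n x)) (fun x => cint mu K * ((f x)%:C * G x))
   (fun x => (Cf * M * 8 ^+ m * \int[mu]_z (om z)) * normc ((om x ^+ m)%:C * G x)).
- by move=> n; exact: (L1_cmeas (cfub_L1 (iT n))).
- by have := L1_cmeas (L1Z (cint mu K) iGf).
- apply: nearW => x; have := inner x; rewrite cintZ//.
  by rewrite (_ : G x * (f x)%:C * _ = cint mu K * ((f x)%:C * G x))//; ring.
- by apply: rintZ; exact: (L1_normc iG).
- move=> n x; have mTx : cmeas (T n x).
    rewrite /T; apply: cmeasM; first exact: cmeas_cst.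
    exact: (cmeasM (cmeas_real (mfz n x)) mK).
  have iTx : L1 mu (T n x).
    apply: (@L1_le _ _ _ mu (fun z => (Cf * M * 8 ^+ m * normc ((om x ^+ m)%:C * G x)) * om z)) => //.
      by move=> z; rewrite -mulrA; exact: bT.
    by apply: rintZ; exact: rint_om.
  rewrite (le_trans (normc_cint iTx))//.
  rewrite [leRHS](_ : _ = (Cf * M * 8 ^+ m * normc ((om x ^+ m)%:C * G x)) * \int[mu]_z om z);
    last by ring.
  rewrite -RintZ; last exact: rint_om.
  apply: Rint_le; first exact: (L1_normc iTx).
    by apply: rintZ; exact: rint_om.
  by move=> z; have := bT n x z; rewrite [X in _ <= X]mulrA.
move=> _ lim.
have l0 : ccvg (fun n => cint mu (fun x => cint mu (T n x))) 0.
  rewrite (_ : (fun n => _) = fun=> 0); first exact: ccvg_cst.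
  by apply/funext => n; exact: zT.
have := ccvg_unique l0 lim; rewrite cintZ// => /esym/eqP; rewrite mulf_eq0 => /orP[/eqP //|/eqP //].
Qed.

Variables (psi : R3 -> R) (Hpsi : cutoff psi).

Let pC := @psiC R psi.
Let pCt : ctest pC := psiC_test Hpsi.

Lemma intpsi_gt0 : 0 < \int[mu]_x psi x.
Proof.
case: Hpsi => _ p0 _ p1; apply: (@Rint_pos R psi 1 (1/2)) => //.
  exact: (test_rint (psi_test Hpsi)).
by move=> x /p1 ->.
Qed.

(** Multiplication by [kn n] makes [G] integrable and keeps its pairings with test functions zero;
    translates and dilates of [psi] then serve as mollifiers, and finally [n] tends to infinity. *)
Lemma ctest_separates G : cmeas G -> (forall h, ctest h -> L1 mu (fun x => G x * h x) /\
    cint mu (fun x => G x * h x) = 0) -> {ae mu, forall x, G x = 0}.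
Proof.
move=> mG hG.
have H n : {ae mu, forall x, (kn psi n x)%:C * G x = 0}.
  have tk := ctest_real (kn_test Hpsi n).
  apply: (@kernel_separates pC _ 0).
  - exact: ctest_cmeas.
  - rewrite /pC /psiC cint_real => /(congr1 (@complex.Re R)) /= E.
    by have := intpsi_gt0; rewrite E ltxx.
  - exact: ctest_decay.
  - by apply: cmeasM => //; exact: (ctest_cmeas tk).
  - have [i _] := hG _ tk; move: i; congr L1; apply/funext => x.
    by rewrite expr0 mul1r mulrC.
  - move=> y k; have ek := e_gt0 R k.
    have th : ctest (fun x => pC ((- (e_ R k)^-1) *: x + (e_ R k)^-1 *: y)).
      by apply: ctest_affine => //; rewrite oppr_eq0 invr_eq0 lt0r_neq0.
    have [] := hG _ (ctestM th (ctest_smooth tk)).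
    have E : (fun x => G x * ((kn psi n x)%:C * pC (- (e_ R k)^-1 *: x + (e_ R k)^-1 *: y))) =
      (fun x => (kn psi n x)%:C * G x * pC ((e_ R k)^-1 *: (y - x))).
      apply/funext => x; rewrite (_ : - _ *: x + _ = (e_ R k)^-1 *: (y - x)); first by ring.
      by rewrite scalerBr scaleNr addrC.
    by rewrite E.
have /ae_foralln : forall n, {ae mu, forall x, (kn psi n x)%:C * G x = 0} by [].
apply: filterS => x hx.
have c1 := @kn_ccvg R psi Hpsi x (G x).
apply: (ccvg_unique c1); rewrite (_ : (fun n => _) = fun=> 0); first exact: ccvg_cst.
by apply/funext => n; exact: hx.
Qed.

Lemma FIpsi0 : exists2 a : R, 0 < a & FI pC 0 = a%:C.
Proof.
exists (c0 R * \int[mu]_x psi x); first by rewrite mulr_gt0 ?c0_gt0 ?intpsi_gt0.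
rewrite FIE (_ : cint _ _ = cint mu pC); last first.
  apply: eq_cint => y; rewrite (_ : dot 0 y = 0) ?cis0 ?mul1r//.
  by rewrite dotE /= !mul0r !addr0.
by rewrite /pC /psiC cint_real rmorphM.
Qed.

(** The value that Parseval's identity, for [psi] against its own involution, gives to [kap]. As a
    quotient of positive integrals it is visibly positive, which the defining integral of [KK] is
    not. *)
Definition kapr : R := (\int[mu]_x (normc (FI pC x) ^+ 2)) / \int[mu]_x (psi x ^+ 2).

Lemma kapr_gt0 : 0 < kapr.
Proof.
have [a a0 Ea] := FIpsi0; have [_ p0 _ p1] := Hpsi.
rewrite /kapr divr_gt0//.
  have [L L0 hL] := FI_lip_ex (ctest_xL1 pCt).
  have [jf _] := plancherel_le Hpsi (ctest_L1 pCt) (ctest_L2 pCt).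
  apply: (@Rint_pos R _ ((a / 2) ^+ 2) (a / (2 * (L + 1)))).
  - by rewrite exprn_gt0// divr_gt0.
  - by rewrite divr_gt0// mulr_gt0// ltr_wpDl.
  - by case: jf.
  - by move=> x; rewrite exprn_ge0// normc_ge0.
  move=> x hx; rewrite lerXn2r ?nnegrE ?normc_ge0//; first by rewrite divr_ge0// ltW.
  have h1 := hL 0 x; rewrite sub0r enormN Ea in h1.
  have h2 : L * enorm x <= a / 2.
    apply: (@le_trans _ _ ((L + 1) * (a / (2 * (L + 1))))).
      by apply: ler_pM => //; [exact: enorm_ge0|rewrite lerDl].
    rewrite le_eqVlt; apply/orP; left; apply/eqP; field.
    by rewrite lt0r_neq0// ltr_wpDl.
  have h3 : a <= normc (a%:C - FI pC x) + normc (FI pC x).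
    have := le_normcD (a%:C - FI pC x) (FI pC x).
    by rewrite subrK normc_real ger0_norm// ltW.
  lra.
have jp : rint mu (fun x => psi x ^+ 2).
  have [_] := ctest_L2 pCt; congr rint; apply/funext => x.
  by rewrite /pC /psiC normc_real ger0_norm.
apply: (@Rint_pos R _ 1 (1 / 2)) => //.
- by move=> x; exact: sqr_ge0.
- by move=> x /p1 ->; rewrite expr1n.
Qed.

Lemma kapE : kap psi = kapr%:C.
Proof.
have iP := ctest_L1 pCt; have P2 := ctest_L2 pCt; have [_ p0 _ p1] := Hpsi.
have tQ : ctest (oJ pC) by apply: ctestJ; exact: ctest_opp.
have [M _ hM] := ctest_bounded tQ.
have := parseval Hpsi iP P2 (ctest_L1 tQ) (ctest_L2 tQ) hM
  (nearW _ (fun x => @csmooth_pcont R _ x (ctest_smooth tQ))).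
rewrite (_ : cint _ _ = (\int[mu]_x (normc (FI pC x) ^+ 2))%:C); last first.
  by rewrite -cint_real; apply: eq_cint => x; rewrite FI_oJ// mulcJ.
rewrite (_ : cint _ _ = (\int[mu]_x (psi x ^+ 2))%:C); last first.
  rewrite -cint_real; apply: eq_cint => x; rewrite /oJ opprK /pC /psiC mulcJ normc_real.
  by rewrite ger0_norm.
have J0 : \int[mu]_x (psi x ^+ 2) != 0.
  by apply/eqP => E; have := kapr_gt0; rewrite /kapr E invr0 mulr0 ltxx.
move=> E; apply/eqP; rewrite -(inj_eq (mulIf (_ : (\int[mu]_x (psi x ^+ 2))%:C != 0))).
  by rewrite -E /kapr -rmorphM /= divfK.
by apply/eqP => /(congr1 (@complex.Re R)) /= /eqP; apply/negP.
Qed.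

Lemma kap_neq0 : kap psi != 0.
Proof.
rewrite kapE; apply/eqP => /(congr1 (@complex.Re R)) /= E.
by have := kapr_gt0; rewrite E ltxx.
Qed.

(** Here [FI psi] is the mollifier: its translates and dilates are transforms of modulated test
    functions, its integral is nonzero because [kap] is, and its decay admits functions integrable
    only against [om ^+ m]. *)
Lemma FI_ctest_separates G m : cmeas G -> L1 mu (fun x => (om x ^+ m)%:C * G x) ->
  (forall h, ctest h -> cint mu (fun x => G x * FI h x) = 0) -> {ae mu, forall x, G x = 0}.
Proof.
move=> mG iG hG; apply: (@kernel_separates (FI pC) _ m) => //.
- exact: FI_cmeas (ctest_L1 pCt).
- by move=> E; have := kap_neq0; rewrite /kap /KK E mulr0 eqxx.
- exact: FI_decay.
move=> y k; have ek := e_gt0 R k.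
have th : ctest (fun x => (e_ R k ^+ 3)%:C * (cis (dot (- y) x) * pC ((- e_ R k) *: x + 0))).
  apply: ctestZ; apply: ctestM (csmooth_cis' _); apply: ctest_affine => //.
  by rewrite oppr_eq0 lt0r_neq0.
have E x : FI pC ((e_ R k)^-1 *: (y - x)) =
    FI (fun x => (e_ R k ^+ 3)%:C * (cis (dot (- y) x) * pC ((- e_ R k) *: x + 0))) x.
  have ia := ctest_L1 (ctest_affine (0 : R3) (lt0r_neq0 ek) pCt).
  have iP := ctest_L1 pCt.
  have j1 : L1 mu (fun z => pC (e_ R k *: z)).
    by move: ia; congr L1; apply/funext => z; rewrite addr0.
  have j2 : L1 mu (fun z => pC (e_ R k *: (- z))).
    by have := L1_reflect 0 j1; congr L1; apply/funext => z; rewrite sub0r.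
  rewrite FIZ; last first.
    by have := L1_cis (- y) j2; congr L1; apply/funext => z; rewrite addr0 scalerN scaleNr.
  rewrite FI_mod.
  have -> : FI (fun y0 => pC (- e_ R k *: y0 + 0)) (x - y) = FI (fun z => pC (e_ R k *: (- z))) (x - y).
    by apply: eq_FI => z; rewrite addr0 scalerN scaleNr.
  rewrite (@FI_opp _ (fun z => pC (e_ R k *: z)))// FI_scale// opprB mulrA -rmorphM /=.
  by rewrite mulfV ?mul1r// expf_neq0// lt0r_neq0.
have mh : cmeas (fun x : R3 => FI pC ((e_ R k)^-1 *: (y - x))).
  have := FI_cmeas (ctest_L1 th); congr cmeas; apply/funext => x; exact: esym (E x).
split; last by rewrite -[RHS](hG _ th); apply: eq_cint => x; rewrite E.
have [M M0 hM] := FI_decay m th.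
apply: (@L1_le _ _ _ mu (fun x => M * normc ((om x ^+ m)%:C * G x)) _ (cmeasM mG mh)).
  move=> x; have H := hM x; rewrite -E in H.
  have B : normc ((om x ^+ m)%:C * G x) = om x ^+ m * normc (G x).
    by rewrite Normc.normcM normc_real ger0_norm// exprn_ge0// om_ge0.
  rewrite B Normc.normcM [leRHS]mulrA [leLHS]mulrC.
  by apply: ler_wpM2r; [exact: normc_ge0|exact: H].
by apply: rintZ; exact: (L1_normc iG).
Qed.
End Unique.

Lemma ccvg_normc (R : realType) (z_ : nat -> R[i]) z : ccvg z_ z ->
  (fun n => normc (z_ n)) @ \oo --> normc z.
Proof.
move=> /cvgrPdist_le h; apply/cvgrPdist_le => e e0; have := h e e0.
apply: filterS => n; rewrite sub0r normrN ger0_norm ?normc_ge0// => hn.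
apply: le_trans hn; rewrite ler_norml; apply/andP; split.
  have := le_normcD (z_ n - z) z; rewrite subrK; lra.
have := le_normcD (z - z_ n) (z_ n); rewrite subrK normcB_sym; lra.
Qed.

(** * The Fourier transform on L^2 *)

Section RieszFischer.
Context d (T : measurableType d) (R : realType) (m : {measure set T -> \bar R}).
Local Notation C := R[i].
Implicit Types (F G : T -> C).

Lemma sum_half (n : nat) : \sum_(i < n) (2^-1 : R) ^+ i <= 2.
Proof.
suff -> : \sum_(i < n) (2^-1 : R) ^+ i = 2 - 2 * 2^-1 ^+ n.
  by rewrite lerBlDr lerDl mulr_ge0// exprn_ge0// invr_ge0.
elim: n => [|n IH]; first by rewrite big_ord0 expr0 mulr1 subrr.
by rewrite big_ord_recr/= IH exprS; field.
Qed.

(** The series of the [h_ n] has a finite integral, so its sum is finite almost everywhere and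
    bounds every term. *)
Lemma ae_bounded_of_summable (h_ : nat -> T -> R) : (forall n, rint m (h_ n)) ->
  (forall n x, 0 <= h_ n x) -> (forall n, \int[m]_x h_ n x <= 2^-1 ^+ n) ->
  {ae m, forall x, exists B, forall n, h_ n x <= B}.
Proof.
move=> ih h0 hb.
have mh n : measurable_fun setT (fun x => (h_ n x)%:E).
  by apply/measurable_EFinP; exact: (rint_meas (ih n)).
pose S x : \bar R := (\sum_(n <oo) (h_ n x)%:E)%E.
have mS : measurable_fun setT S.
  by apply: ge0_emeasurable_sum => // n x _ _; rewrite lee_fin.
have S0 x : (0 <= S x)%E by apply: nneseries_ge0 => n _ _; rewrite lee_fin.
have iS : m.-integrable setT S.
  apply/integrableP; split=> //.
  rewrite (eq_integral S); last by move=> x _; rewrite gee0_abs.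
  rewrite integral_nneseries//; last by move=> n x _; rewrite lee_fin.
  apply: (@le_lt_trans _ _ 2%:E); last exact: ltry.
  apply: lime_le.
    by apply: is_cvg_ereal_nneg_natsum => n _; apply: integral_ge0 => x _; rewrite lee_fin.
  apply: nearW => n; rewrite big_mkord.
  under eq_bigr do rewrite -(EFin_Rint (ih _)).
  rewrite sumEFin lee_fin; apply: le_trans (sum_half n).
  by apply: ler_sum => i _; exact: hb.
have := integrable_ae measurableT iS; apply: filterS => x /(_ I) fS.
exists (fine (S x)) => n; rewrite -lee_fin fineK//.
apply: le_trans (nneseries_lim_ge n.+1 _) => /=; last by move=> i _ _; rewrite lee_fin.
rewrite big_nat_recr//= leeDr// sume_ge0// => i _; rewrite lee_fin//.
Qed.

Lemma cvg_of_geometric (u : nat -> R) (K : R) :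
  (forall n, `|u n.+1 - u n| <= K * 2^-1 ^+ n) -> cvgn u.
Proof.
move=> hu.
have hc : cvgn (series (telescope u)).
  apply: normed_cvg; rewrite /normed_series_of/=.
  apply: (@series_le_cvg _ _ (geometric K 2^-1)) => //.
  - by move=> n; rewrite /geometric /=; exact: le_trans (hu n).
  - by apply: is_cvg_geometric_series; rewrite ger0_norm ?invr_ge0// invf_lt1// ltr1n.
have -> : u = (fun n => u 0%N + series (telescope u) n) by apply/funext => n; exact: eq_sum_telescope.
by apply: is_cvgD => //; exact: is_cvg_cst.
Qed.

Lemma nsq_le2D F G : L2 m F -> L2 m G ->
  nsq m (fun x => F x + G x) <= 2 * nsq m F + 2 * nsq m G.
Proof.
move=> hF hG; have [_ i1] := hF; have [_ i2] := hG; have [_ i3] := L2D hF hG.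
rewrite /nsq -!RintZ// -RintD; [|exact: rintZ|exact: rintZ].
apply: Rint_le => //; first by apply: rintD; exact: rintZ.
move=> x; have h : normc (F x + G x) ^+ 2 <= (normc (F x) + normc (G x)) ^+ 2.
  by rewrite ler_pXn2r ?nnegrE ?addr_ge0 ?normc_ge0// le_normcD.
by apply: le_trans h _; rewrite sqrrD; have := amgm (normc (F x)) (normc (G x)); lra.
Qed.

Lemma eq_nsq F G : (forall x, F x = G x) -> nsq m F = nsq m G.
Proof. by move=> h; congr nsq; apply/funext. Qed.

Lemma L2_complete (f_ : nat -> T -> C) : (forall n, L2 m (f_ n)) ->
  (forall n, nsq m (fun x => f_ n.+1 x - f_ n x) <= 8^-1 ^+ n) ->
  exists G, L2 m G /\ (fun n => nsq m (fun x => G x - f_ n x)) @ \oo --> (0 : R).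
Proof.
move=> f2 hf.
pose d_ n x := normc (f_ n.+1 x - f_ n x) ^+ 2.
have d2 n : L2 m (fun x => f_ n.+1 x - f_ n x) by apply: L2B.
(* The rate [8^-1 ^+ n] splits in two: after weighting by [4 ^+ n] the integrals are still summable,
   and a bound on [4 ^+ n * d_ n x] makes the increments of [f_ n x] geometric with ratio 1/2. *)
have aeB : {ae m, forall x, exists B, forall n, 4 ^+ n * d_ n x <= B}.
  apply: ae_bounded_of_summable => n.
  - by apply: rintZ; have [] := d2 n.
  - by move=> x; apply: mulr_ge0; [exact: exprn_ge0|exact: sqr_ge0].
  - rewrite RintZ; last by have [] := d2 n.
    have := ler_wpM2l (exprn_ge0 n (ler0n R 4)) (hf n).
    by rewrite -exprMn (_ : 4 * 8^-1 = 2^-1 :> R)//; field.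
have aec : {ae m, forall x, exists z, ccvg (fun n => f_ n x) z}.
  apply: filterS aeB => x [B hB].
  have B0 : 0 <= B by apply: le_trans (hB 0%N); apply: mulr_ge0; [exact: exprn_ge0|exact: sqr_ge0].
  have hd n : normc (f_ n.+1 x - f_ n x) <= (B + 1) * 2^-1 ^+ n.
    rewrite -(@ler_pXn2r _ 2) ?nnegrE ?normc_ge0//; last first.
      by rewrite mulr_ge0 ?addr_ge0// exprn_ge0// invr_ge0.
    rewrite exprMn -exprM mulnC exprM.
    have -> : (2^-1 : R) ^+ 2 = 4^-1 by field.
    rewrite exprVn ler_pdivlMr ?exprn_gt0// mulrC (le_trans (hB n))//.
    by rewrite sqrrD; nra.
  have c1 : cvgn (fun n => complex.Re (f_ n x)).
    apply: (@cvg_of_geometric _ (B + 1)) => n; apply: le_trans (hd n).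
    by rewrite -ReN -ReD Re_le_normc.
  have c2 : cvgn (fun n => complex.Im (f_ n x)).
    apply: (@cvg_of_geometric _ (B + 1)) => n; apply: le_trans (hd n).
    by rewrite -ImN -ImD Im_le_normc.
  exists (limn (fun n => complex.Re (f_ n x)) +i* limn (fun n => complex.Im (f_ n x))).
  by apply/ccvg_ReIm; split.
(* Upper limits of the real and imaginary parts are measurable and defined everywhere, and agree
   with the limit wherever it exists. *)
pose ls (u : nat -> T -> R) x := fine (limn_esup (fun n => (u n x)%:E)).
have mls u : (forall n, measurable_fun setT (u n)) -> measurable_fun setT (ls u).
  move=> mu; apply: measurableT_comp => //; apply: measurable_fun_limn_esup => n.
  exact/measurable_EFinP.
have lsE u x l : (fun n => u n x) @ \oo --> l -> ls u x = l.
  move=> h; rewrite /ls (_ : limn_esup _ = l%:E)//.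
  by apply: (cvg_limn_einf_sup _).2; apply: cvg_EFin; [exact: nearW|exact: h].
pose G x := ls (fun n x => complex.Re (f_ n x)) x +i* ls (fun n x => complex.Im (f_ n x)) x.
have mG : cmeas G by split; apply: mls => n; have [[]] := f2 n.
have aeG : {ae m, forall x, ccvg (fun n => f_ n x) (G x)}.
  apply: filterS aec => x [z hz]; suff -> : G x = z by [].
  have [h1 h2] := (ccvg_ReIm _ _).1 hz.
  by apply: complexP; [exact: (lsE (fun n x => complex.Re (f_ n x)))
    |exact: (lsE (fun n x => complex.Im (f_ n x)))].
(* The factor 4 closes the induction: $2\cdot4/8+2=3\le4$. *)
have bnd k n : nsq m (fun x => f_ (n + k)%N x - f_ n x) <= 4 * 8^-1 ^+ n.
  elim: k n => [|k IH] n.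
    rewrite addn0 (@eq_nsq _ (fun=> 0)); last by move=> x; rewrite subrr.
    rewrite /nsq (_ : (fun x => _) = fun=> 0); last first.
      by apply/funext => x; rewrite normc_real normr0 expr0n.
    by rewrite /Rintegral integral0 mulr_ge0// exprn_ge0// invr_ge0.
  rewrite (@eq_nsq _ (fun x => (f_ (n.+1 + k)%N x - f_ n.+1 x) + (f_ n.+1 x - f_ n x))); last first.
    by move=> x; rewrite addnS addSn addrA subrK.
  apply: (le_trans (nsq_le2D (L2B (f2 _) (f2 _)) (d2 n))).
  have h1 := IH n.+1; have h2 := hf n; rewrite exprS in h1.
  have : 0 <= (8^-1 : R) ^+ n by rewrite exprn_ge0// invr_ge0.
  lra.
have key n : L2 m (fun x => G x - f_ n x) /\ nsq m (fun x => G x - f_ n x) <= 4 * 8^-1 ^+ n.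
  have mGf : cmeas (fun x => G x - f_ n x) by apply: cmeasB => //; have [] := f2 n.
  have [] := @fatou_ae _ _ _ m (fun k x => normc (f_ (k + n)%N x - f_ n x) ^+ 2)
    (fun x => normc (G x - f_ n x) ^+ 2) (4 * 8^-1 ^+ n).
  - by move=> k; have [] := L2B (f2 (k + n)%N) (f2 n).
  - by apply: measurable_funX; exact: cmeas_normc.
  - by move=> k x; exact: sqr_ge0.
  - by move=> x; exact: sqr_ge0.
  - apply: filterS aeG => x hx.
    have hx' : ccvg (fun k => f_ (k + n)%N x - f_ n x) (G x - f_ n x).
      have := ccvgD hx (ccvg_cst (- f_ n x)); rewrite /ccvg => h.
      by have := h; rewrite -(cvg_shiftn n).
    by have := ccvg_normc hx' => h; apply: cvgM.
  - by move=> k; rewrite addnC; exact: bnd.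
  by move=> h1 h2; split.
exists G; split.
  have := L2D (key 0%N).1 (f2 0%N); congr L2; apply/funext => x; by rewrite subrK.
apply: (@squeeze_cvgr _ _ _ _ (fun=> 0) (fun n => 4 * 8^-1 ^+ n)).
- by apply: nearW => n; rewrite nsq_ge0 (key n).2.
- exact: cvg_cst.
- rewrite -[X in _ --> X](mulr0 4); apply: cvgM; first exact: cvg_cst.
  by apply: cvg_expr; rewrite ger0_norm ?invr_ge0// invf_lt1// ltr1n.
Qed.

Lemma cint_cvg (f_ : nat -> T -> C) G q : L2 m G -> (forall n, L2 m (f_ n)) -> L2 m q ->
  (fun n => nsq m (fun x => G x - f_ n x)) @ \oo --> (0 : R) ->
  ccvg (fun n => cint m (fun x => f_ n x * q x)) (cint m (fun x => G x * q x)).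
Proof.
move=> G2 f2 q2 h.
have hb n : normc (cint m (fun x => f_ n x * q x) - cint m (fun x => G x * q x)) ^+ 2 <=
    nsq m (fun x => G x - f_ n x) * nsq m q.
  rewrite normcB_sym -cintB; [|exact: L2_mul|exact: L2_mul].
  rewrite (@eq_cint _ _ _ m _ (fun x => (G x - f_ n x) * q x)); last by move=> x; rewrite mulrBl.
  by apply: cauchy_schwarz => //; exact: L2B.
have s0 : (fun n => normc (cint m (fun x => f_ n x * q x) - cint m (fun x => G x * q x)) ^+ 2)
    @ \oo --> (0 : R).
  apply: (@squeeze_cvgr _ _ _ _ (fun=> 0) (fun n => nsq m (fun x => G x - f_ n x) * nsq m q)).
  - by apply: nearW => n; rewrite sqr_ge0 hb.
  - exact: cvg_cst.
  - by rewrite -[X in _ --> X](mul0r (nsq m q)); apply: cvgM => //; exact: cvg_cst.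
rewrite /ccvg; have := @cvg_comp _ _ _ _ (@Num.sqrt R) _ _ _ s0 (@sqrt_continuous R 0).
rewrite sqrtr0 (_ : _ \o _ = fun n => normc (cint m (fun x => f_ n x * q x) - cint m (fun x => G x * q x))).
  exact.
by apply/funext => n /=; rewrite sqrtr_sqr ger0_norm// normc_ge0.
Qed.
End RieszFischer.

Section Trunc.
Variable R : realType.
Local Notation R3 := (R * R * R)%type.
Local Notation C := R[i].
Local Notation mu := (mu3 R).
Implicit Types (F G : R3 -> C).

(** Truncating position and size together makes any measurable function both integrable and
    bounded. *)
Definition truncset (n : nat) F : set R3 := [set x | enorm x <= n%:R /\ normc (F x) <= n%:R].
Definition trunc (n : nat) F (x : R3) : C := (\1_(truncset n F) x)%:C * F x.

Lemma truncset_measurable n F : cmeas F -> measurable (truncset n F).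
Proof.
move=> mF; rewrite /truncset; apply: measurableI.
  rewrite -[X in measurable X]setTI.
  have := @enorm_measurable R measurableT `]-oo, n%:R]%classic (measurable_itv _).
  by congr measurable; apply/seteqP; split=> x /=; rewrite in_itv/= => -[].
have := cmeas_normc mF measurableT (measurable_itv (Interval -oo%O (BRight (n%:R : R)))).
by rewrite setTI; congr measurable; apply/seteqP; split=> x /=; rewrite in_itv/=.
Qed.

Lemma trunc_cmeas n F : cmeas F -> cmeas (trunc n F).
Proof.
move=> mF; apply: (cmeasM _ mF); apply: cmeas_real; apply: measurable_indic.
exact: truncset_measurable.
Qed.

Lemma trunc_le n F x : normc (trunc n F x) <= normc (F x).
Proof.
rewrite /trunc indicE; case: (_ \in _); rewrite ?mul1r ?mul0r//.
by rewrite normc_real normr0 normc_ge0.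
Qed.

Lemma trunc_bound n F x : normc (trunc n F x) <= n%:R.
Proof.
rewrite /trunc indicE; case: (boolP (x \in _)) => [|_]; last by rewrite mul0r normc_real normr0.
by rewrite inE => -[_ h]; rewrite mul1r.
Qed.

Lemma trunc_om n F x : normc (trunc n F x) <= n%:R * ((1 + n%:R ^+ 2) ^+ 3 * om x).
Proof.
have [h|h] := boolP (x \in truncset n F); last first.
  rewrite /trunc indicE (negbTE h) mul0r normc_real normr0.
  by rewrite mulr_ge0// mulr_ge0 ?om_ge0// exprn_ge0// addr_ge0// sqr_ge0.
apply: (le_trans (trunc_bound _ _ _)); rewrite ler_peMr//; apply: om_lb.
by move: h; rewrite inE => -[].
Qed.

Lemma trunc_L1 n F : cmeas F -> L1 mu (trunc n F).
Proof.
move=> mF; apply: (@L1_le _ _ _ mu _ _ (trunc_cmeas n mF) (trunc_om n F)).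
by apply: rintZ; apply: rintZ; exact: rint_om.
Qed.

Lemma trunc_L2 n F : cmeas F -> L2 mu (trunc n F).
Proof. by move=> mF; exact: (L1b_L2 (trunc_L1 n mF) (trunc_bound n F)). Qed.

Lemma trunc_eventually F x : exists N, forall n, (N <= n)%N -> trunc n F x = F x.
Proof.
exists (Num.bound (enorm x) + Num.bound (normc (F x)))%N => n hn.
rewrite /trunc indicE mem_set ?mul1r//; split.
  apply: (le_trans (ltW (archi_boundP (enorm_ge0 x)))); rewrite ler_nat.
  by apply: leq_trans hn; exact: leq_addr.
apply: (le_trans (ltW (archi_boundP (normc_ge0 (F x))))); rewrite ler_nat.
by apply: leq_trans hn; exact: leq_addl.
Qed.

Lemma trunc_cvg F x : ccvg (fun n => trunc n F x) (F x).
Proof.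
have [N hN] := trunc_eventually F x; rewrite /ccvg; apply: cvg_near_cst.
by exists N => // n /= hn; rewrite hN// subrr normc_real normr0.
Qed.

Lemma trunc_nsq F : L2 mu F ->
  (fun n => nsq mu (fun x => F x - trunc n F x)) @ \oo --> (0 : R).
Proof.
move=> [mF iF].
have [] := @rDCT _ _ _ mu (fun n x => normc (F x - trunc n F x) ^+ 2) (fun=> 0)
  (fun x => normc (F x) ^+ 2).
- move=> n; apply: measurable_funX; apply: cmeas_normc; apply: cmeasB => //; exact: trunc_cmeas.
- exact: measurable_cst.
- apply: nearW => x; have [N hN] := trunc_eventually F x; apply: cvg_near_cst.
  by exists N => // n /= hn; rewrite hN// subrr normc_real normr0 expr0n.
- exact: iF.
- move=> n x; rewrite ger0_norm ?sqr_ge0// ler_pXn2r ?nnegrE ?normc_ge0//.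
  rewrite /trunc indicE; case: (_ \in _); last by rewrite mul0r subr0.
  by rewrite mul1r subrr normc_real normr0 normc_ge0.
by move=> _; rewrite /Rintegral integral0.
Qed.

Variables (psi : R3 -> R) (Hpsi : cutoff psi).

(** [G] is the limit in square norm of the transforms of truncations of [F]. It is used only through
    its pairings, which pass to the limit by Cauchy-Schwarz. *)
Lemma L2_fourier F : L2 mu F -> exists G, [/\ L2 mu G,
  forall q, L1 mu q -> L2 mu q -> cint mu (fun x => G x * q x) = cint mu (fun x => F x * FI q x) &
  forall Q M, L1 mu Q -> L2 mu Q -> (forall y, normc (Q y) <= M) ->
    {ae mu, forall x, pcont Q x} ->
    cint mu (fun x => G x * FI Q x) = kap psi * cint mu (fun x => F x * Q (- x))].
Proof.
move=> F2; have [mF _] := F2.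
have cp0 := CP_ge0 psi.
(* Sized so that the transforms of consecutive truncations differ by at most [8^-1 ^+ n] in squared
   norm, the rate required by [L2_complete]. *)
pose ep n : R := 8^-1 ^+ n / (4 * (plancherel_const psi + 1)).
have ep0 n : 0 < ep n by rewrite divr_gt0 ?exprn_gt0 ?invr_gt0// mulr_gt0// ltr_wpDl.
have /choice [k hk] : forall n, exists k, nsq mu (fun x => F x - trunc k F x) <= ep n.
  move=> n; have /cvgrPdist_le/(_ _ (ep0 n)) [N _ hN] := trunc_nsq F2.
  by exists N; have := hN N (leqnn N); rewrite sub0r normrN ger0_norm// nsq_ge0.
pose F_ n := trunc (k n) F.
have i1 n : L1 mu (F_ n) by exact: trunc_L1.
have i2 n : L2 mu (F_ n) by exact: trunc_L2.
have hF n : nsq mu (fun x => F_ n.+1 x - F_ n x) <= 2 * ep n.+1 + 2 * ep n.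
  have := nsq_le2D (L2N (L2B F2 (i2 n.+1))) (L2B F2 (i2 n)).
  rewrite (@eq_nsq _ _ _ mu (fun x => - (F x - F_ n.+1 x) + (F x - F_ n x))
    (fun x => F_ n.+1 x - F_ n x)); last by move=> x; ring.
  have -> : nsq mu (fun x => - (F x - F_ n.+1 x)) = nsq mu (fun x => F x - F_ n.+1 x).
    by congr Rintegral; apply/funext => x; rewrite normcN.
  by move=> h; apply: (le_trans h); apply: lerD; rewrite ler_wpM2l//; exact: hk.
have P n := plancherel_le Hpsi (i1 n) (i2 n).
have [|G [G2 hG]] := @L2_complete _ _ _ mu (fun n => FI (F_ n)) (fun n => (P n).1).
  move=> n; have [_ h] := plancherel_le Hpsi (L1B (i1 n.+1) (i1 n)) (L2B (i2 n.+1) (i2 n)).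
  rewrite (@eq_nsq _ _ _ mu _ (FI (fun x => F_ n.+1 x - F_ n x))); last first.
    by move=> x; rewrite FIB.
  apply: (le_trans h); apply: (@le_trans _ _ ((plancherel_const psi + 1) * (2 * ep n.+1 + 2 * ep n))).
    by apply: ler_pM => //; [exact: nsq_ge0|rewrite lerDl].
  rewrite /ep exprS -subr_ge0.
  rewrite (_ : _ - _ = 8^-1 ^+ n * (7 / 16)); last by field; rewrite lt0r_neq0// ltr_wpDl.
  by rewrite mulr_ge0 ?exprn_ge0 ?invr_ge0// divr_ge0.
have cF : (fun n => nsq mu (fun x => F x - F_ n x)) @ \oo --> (0 : R).
  apply: (@squeeze_cvgr _ _ _ _ (fun=> 0) ep).
  - by apply: nearW => n; rewrite nsq_ge0 hk.
  - exact: cvg_cst.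
  - rewrite -[X in _ --> X](mul0r (4 * (plancherel_const psi + 1))^-1); apply: cvgM; last exact: cvg_cst.
    by apply: cvg_expr; rewrite ger0_norm ?invr_ge0// invf_lt1// ltr1n.
exists G; split=> //.
  move=> q q1 q2; have [Fq2 _] := plancherel_le Hpsi q1 q2.
  have c1 := cint_cvg G2 (fun n => (P n).1) q2 hG.
  have c2 := cint_cvg F2 i2 Fq2 cF.
  apply: (ccvg_unique c1); move: c2; congr ccvg; apply/funext => n; exact: esym (FI_mult (i1 n) q1).
move=> Q M Q1 Q2 hM hQ; have [FQ2 _] := plancherel_le Hpsi Q1 Q2.
have c1 := cint_cvg G2 (fun n => (P n).1) FQ2 hG.
have Q2' : L2 mu (fun x => Q (- x)).
  have mQ : cmeas (fun x : R3 => Q (- x)) by apply: cmeas_opp; exact: (L1_cmeas Q1).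
  have Q1' : L1 mu (fun x : R3 => Q (- x)).
    by have := L1_reflect 0 Q1; congr L1; apply/funext => x; rewrite sub0r.
  by apply: (L1b_L2 Q1' (M := M)) => x.
have c2 := ccvgM (ccvg_cst (kap psi)) (cint_cvg F2 i2 Q2' cF).
apply: (ccvg_unique c1); move: c2; congr ccvg; apply/funext => n.
exact: esym (parseval Hpsi (i1 n) (i2 n) Q1 Q2 hM hQ).
Qed.

Lemma L1_opp F : L1 mu F -> L1 mu (fun x : R3 => F (- x)).
Proof. by move=> h; have := L1_reflect 0 h; congr L1; apply/funext => x; rewrite sub0r. Qed.

Lemma cint_opp F : L1 mu F -> cint mu (fun x : R3 => F (- x)) = cint mu F.
Proof. by move=> h; rewrite -(cint_reflect 0 h); apply: eq_cint => x; rewrite sub0r. Qed.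

(** Extends [parseval] to [q] neither bounded nor continuous: the transform of [FI f] in the sense
    of [L2_fourier] equals [kap psi * f (- x)] almost everywhere, since test functions, to which
    [parseval] applies, separate the two. *)
Lemma parseval_L2 f q : L1 mu f -> L2 mu f -> L1 mu q -> L2 mu q ->
  cint mu (fun x => FI f x * FI q x) = kap psi * cint mu (fun x => f x * q (- x)).
Proof.
move=> f1 f2 q1 q2; have [Ff2 _] := plancherel_le Hpsi f1 f2.
have [G [G2 hG _]] := L2_fourier Ff2; have [mG _] := G2.
rewrite -hG//.
have mf := L1_cmeas f1; have mfo := cmeas_opp mf; have f1o := L1_opp f1.
have L2h h (th : ctest h) := ctest_L2 th.
have : {ae mu, forall x, G x - kap psi * f (- x) = 0}.
  apply: (ctest_separates Hpsi); first by apply: cmeasB => //; apply: cmeasM => //; exact: cmeas_cst.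
  move=> h th; have h1 := ctest_L1 th; have h2 := ctest_L2 th.
  have [M M0 hM] := ctest_bounded th.
  have j1 : L1 mu (fun x => G x * h x) by exact: L2_mul.
  have j2 : L1 mu (fun x => f (- x) * h x).
    by have := L1_bounded f1o (ctest_cmeas th) hM; congr L1; apply/funext => x; rewrite mulrC.
  have E : (fun x => (G x - kap psi * f (- x)) * h x) =
           (fun x => G x * h x - kap psi * (f (- x) * h x)) by apply/funext => x; ring.
  rewrite E; split; first by apply: L1B => //; exact: L1Z.
  rewrite cintB//; last exact: L1Z.
  rewrite cintZ// hG//.
  rewrite (parseval Hpsi f1 f2 h1 h2 hM (nearW _ (fun x => @csmooth_pcont R _ x (ctest_smooth th)))).
  rewrite -(cint_opp j2) (@eq_cint _ _ _ mu (fun x => f (- - x) * _) (fun x => f x * h (- x))).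
    by rewrite subrr.
  by move=> x; rewrite opprK.
move=> ae1.
have -> : cint mu (fun x => G x * q x) = cint mu (fun x => kap psi * (f (- x) * q x)).
  apply: cint_ae.
  - by apply: cmeasM => //; exact: (L1_cmeas q1).
  - apply: cmeasM; first exact: cmeas_cst.
    by apply: cmeasM => //; exact: (L1_cmeas q1).
  - by apply: filterS ae1 => x /eqP; rewrite subr_eq0 => /eqP ->; rewrite mulrA.
have f2o : L2 mu (fun x : R3 => f (- x)).
  split=> //; have [_ i] := f2; have := rint_reflect 0 i.
  by congr rint; apply/funext => x; rewrite sub0r.
have j := L2_mul f2o q2.
rewrite cintZ//; congr (_ * _); rewrite -(cint_opp j); apply: eq_cint => x.
by rewrite opprK.
Qed.
End Trunc.

Section AeLe.
Context d (T : measurableType d) (R : realType) (m : {measure set T -> \bar R}).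

Lemma Rint_le_ae (f g : T -> R) : rint m f -> rint m g -> {ae m, forall x, f x <= g x} ->
  \int[m]_x f x <= \int[m]_x g x.
Proof.
move=> jf jg h; rewrite -subr_ge0 -RintB//; have jfg := rintB jg jf.
rewrite (Rint_ae_eq (rint_meas jfg) (rint_meas (rint_norm jfg))); first exact: Rint_ge0.
by apply: filterS h => x hx; rewrite ger0_norm// subr_ge0.
Qed.
End AeLe.

(** * Trilinear estimates *)

Section Mult.
Variable R : realType.
Local Notation R3 := (R * R * R)%type.
Local Notation C := R[i].
Local Notation mu := (mu3 R).
Local Notation mm := (mm R).
Implicit Types (A B K : R3 -> C).

Lemma cfub_eq1 (k : R3 -> R3 -> C) : L12 k ->
  cint mu (fun x => cint mu (k x)) = cint mm (unc k).
Proof. by move=> [k1 k2]; rewrite /cint /= (fub_eq1 k1) (fub_eq1 k2). Qed.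

Lemma rint2_conv1 (f g : R3 -> R) : rint mu f -> rint mu g -> rint2 (fun x y => f x * g (- x - y)).
Proof. by move=> jf jg; apply: (rint2_reflect (@measurable_opp3 R) (rint2_prod jf jg)). Qed.

Lemma rint2_conv2 (f g : R3 -> R) : rint mu f -> rint mu g -> rint2 (fun x y => f y * g (- x - y)).
Proof.
move=> jf jg; have := rint2_swap (rint2_conv1 jf jg); congr rint2.
by apply/funext => x; apply/funext => y; rewrite -opprD addrC opprD.
Qed.

Lemma cmeas2_third A : cmeas A -> cmeas2 (fun x y : R3 => A (- x - y)).
Proof.
move=> mA; have := cmeas_comp mA (measurableT_comp (@measurable_opp3 R) (@measurable_add3 R)).
by congr cmeas; apply/funext => -[x y] /=; rewrite /unc /= opprD.
Qed.

(** $|ABK|\le\frac12(|A|^2|K|+|B|^2|K|)$, and both terms are convolution integrands of integrable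
    functions. *)
Lemma L12_tri A B K : L2 mu A -> L2 mu B -> L1 mu K ->
  L12 (fun x y => A x * (B y * K (- x - y))).
Proof.
move=> [mA jA] [mB jB] jK; have mK := L1_cmeas jK; have nK := L1_normc jK.
apply: (@L12_le _ (fun x y => 2^-1 * (normc (A x) ^+ 2 * normc (K (- x - y)) +
   normc (B y) ^+ 2 * normc (K (- x - y))))).
- apply: cmeasM; first exact: (cmeas2_1 mA).
  by apply: cmeasM; [exact: (cmeas2_2 mB)|exact: (cmeas2_third mK)].
- move=> x y; rewrite !Normc.normcM mulrA -mulrDl mulrA ler_wpM2r ?normc_ge0//; exact: amgm.
- apply: rint2Z; apply: rint2D; first exact: (rint2_conv1 jA nK).
  exact: (rint2_conv2 jB nK).
Qed.

Variables (psi : R3 -> R) (Hpsi : cutoff psi).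

Definition multiplier_const : R := plancherel_const psi / (c0 R * kapr psi).

(** The form is the pairing of [A] with the convolution of [B] and [K]. Parseval and the convolution
    theorem make it an integral of [FI A * FI B * FI K], so the supremum of [FI K] controls it, not
    the norm of [K]; this is how the sup norm of the low-frequency field enters. *)
Lemma mult_bounded A B K M Mb : L1 mu A -> L2 mu A -> L1 mu B -> L2 mu B ->
  (forall x, normc (B x) <= Mb) -> L1 mu K -> 0 <= M -> {ae mu, forall x, normc (FI K x) <= M} ->
  normc (cint mu (fun x => cint mu (fun y => A x * (B y * K (- x - y))))) <=
    multiplier_const * M * Num.sqrt (nsq mu A * nsq mu B).
Proof.
move=> A1 A2 B1 B2 hB jK M0 hM.
have mK := L1_cmeas jK; have mB := L1_cmeas B1.
pose Q x : C := cint mu (fun y => B y * K (x - y)).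
have L : L12 (fun y x => B y * K (x - y)).
  have := L12_reflect (@measurable_id _ _ setT) (L12_prod B1 (L1_opp jK)).
  by congr L12; apply/funext => x; apply/funext => y; rewrite opprB.
have Q1 : L1 mu Q by exact: (cfub_L1 (L12_swap L)).
have jBK x : L1 mu (fun y => B y * K (x - y)) by exact: (L1_bounded (L1_reflect x jK) mB hB).
have hQ x : normc (Q x) <= Mb * \int[mu]_y normc (K y).
  rewrite (le_trans (normc_cint (jBK x)))// -(Rint_reflect x (L1_normc jK)) -RintZ; last first.
    by have := rint_reflect x (L1_normc jK).
  apply: Rint_le; first exact: (L1_normc (jBK x)).
    by apply: rintZ; have := rint_reflect x (L1_normc jK).
  by move=> y; rewrite Normc.normcM ler_wpM2r ?normc_ge0.
have Q2 := L1b_L2 Q1 hQ.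
have c0n : (c0 R)%:C != 0.
  apply/eqP => /(congr1 (@complex.Re R)) /= E; by have := c0_gt0 R; rewrite E ltxx.
(* The convolution theorem, with the normalisation [c0]. *)
have FQ x : (c0 R)%:C * FI Q x = FI B x * FI K x.
  have jx : L12 (fun y z => cis (dot x z) * (B y * K (z - y))).
    have ncis := @L1_bounded _ _ _ (mm) 1 _ (fun p : R3 * R3 => cis (dot x p.2)) L.
    apply: ncis; first exact: (cmeas2_2 (cis_meas x)).
    by move=> p; rewrite normc_cis.
  rewrite [FI Q x]FIE.
  rewrite (@eq_cint _ _ _ mu _ (fun z => cint mu (fun y => cis (dot x z) * (B y * K (z - y))))); last first.
    by move=> z; rewrite cintZ.
  rewrite -(cfub_swap jx).
  rewrite (@eq_cint _ _ _ mu _ (fun y => (cis (dot x y) * B y) * cint mu (fun z => cis (dot x z) * K z))); last first.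
    move=> y; have jxK := L1_cis x jK.
    rewrite -(@cintZ _ _ _ mu _ _ jxK).
    have := cint_affine (a := 1) (- y) ltr01 (L1Z (cis (dot x y) * B y) jxK).
    rewrite expr1n invr1 mul1r => <-; apply: eq_cint => z.
    rewrite scale1r (_ : dot x z = dot x y + dot x (z - y)) ?cisD; first by ring.
    by rewrite -dotDr addrC subrK.
  rewrite (@eq_cint _ _ _ mu _ (fun y => cint mu (fun z => cis (dot x z) * K z) * (cis (dot x y) * B y))); last first.
    by move=> y; rewrite mulrC.
  rewrite cintZ; last exact: L1_cis.
  by rewrite !FIE; ring.
have P := parseval_L2 Hpsi A1 A2 Q1 Q2.
have [FA2 hFA] := plancherel_le Hpsi A1 A2; have [FB2 hFB] := plancherel_le Hpsi B1 B2.
have E : cint mu (fun x => cint mu (fun y => A x * (B y * K (- x - y)))) =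
    cint mu (fun x => A x * Q (- x)).
  by apply: eq_cint => x; rewrite /Q -cintZ.
rewrite E; set I := cint mu _; set rt := Num.sqrt _.
have [mFK hFK] : cmeas (FI K) /\ forall x, normc (FI K x) <= c0 R * \int[mu]_y normc (K y).
  by split; [exact: FI_cmeas|move=> x; exact: FI_bound].
have BK2 : L2 mu (fun x => FI B x * FI K x).
  apply: (@L2_le _ _ _ mu (fun x => (c0 R * \int[mu]_y normc (K y)) ^+ 2 * normc (FI B x) ^+ 2)).
  - by apply: cmeasM => //; exact: (FI_cmeas B1).
  - move=> x; rewrite Normc.normcM exprMn mulrC ler_wpM2r ?sqr_ge0//.
    by rewrite lerXn2r ?nnegrE ?normc_ge0 ?(le_trans (normc_ge0 _) (hFK x)).
  - by apply: rintZ; have [] := FB2.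
have nBK : nsq mu (fun x => FI B x * FI K x) <= M ^+ 2 * nsq mu (FI B).
  have [_ i] := FB2; have [_ i'] := BK2.
  rewrite /nsq -RintZ//; apply: Rint_le_ae => //; first exact: rintZ.
  apply: filterS hM => x hx; rewrite Normc.normcM exprMn mulrC ler_wpM2r ?sqr_ge0//.
  by rewrite lerXn2r ?nnegrE ?normc_ge0.
have kp := kapr_gt0 Hpsi; have cp := c0_gt0 R.
have EI : normc I = (c0 R * kapr psi)^-1 * normc (cint mu (fun x => FI A x * (FI B x * FI K x))).
  rewrite (@eq_cint _ _ _ mu (fun x => FI A x * (FI B x * FI K x)) (fun x => (c0 R)%:C * (FI A x * FI Q x))); last first.
    by move=> x; rewrite -FQ mulrCA.
  have [FQ2 _] := plancherel_le Hpsi Q1 Q2.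
  rewrite cintZ; last exact: L2_mul.
  rewrite P kapE// !Normc.normcM !normc_real !gtr0_norm//.
  by rewrite [c0 R * (kapr psi * _)]mulrA mulKf// mulf_neq0// lt0r_neq0.
have CS := cauchy_schwarz FA2 BK2.
have CS' : normc (cint mu (fun x => FI A x * (FI B x * FI K x))) <= plancherel_const psi * M * rt.
  rewrite -(@ler_pXn2r _ 2) ?nnegrE ?normc_ge0//; last first.
    by apply: mulr_ge0 (sqrtr_ge0 _); apply: mulr_ge0 => //; exact: CP_ge0.
  apply: (le_trans CS); rewrite exprMn /rt sqr_sqrtr ?mulr_ge0 ?nsq_ge0//.
  apply: (@le_trans _ _ ((plancherel_const psi * nsq mu A) * (M ^+ 2 * (plancherel_const psi * nsq mu B)))).
    apply: ler_pM => //; try exact: nsq_ge0.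
    by apply: (le_trans nBK); rewrite ler_wpM2l// sqr_ge0.
  by rewrite le_eqVlt; apply/orP; left; apply/eqP; ring.
rewrite EI /multiplier_const [leRHS](_ : _ = (c0 R * kapr psi)^-1 * (plancherel_const psi * M * rt)); last by ring.
by rewrite ler_wpM2l// invr_ge0 mulr_ge0// ltW.
Qed.

Lemma trunc_nsq_le n F : L2 mu F -> nsq mu (trunc n F) <= nsq mu F.
Proof.
move=> [mF iF]; apply: Rint_le => //; first by have [] := trunc_L2 n mF.
by move=> x; rewrite lerXn2r ?nnegrE ?normc_ge0// trunc_le.
Qed.

(** Truncations of [A] and [B] satisfy [mult_bounded] with a constant independent of [n]; [L12_tri]
    supplies the majorant for the limit. *)
Lemma mult_bound A B K M : L2 mu A -> L2 mu B -> L1 mu K -> 0 <= M ->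
  {ae mu, forall x, normc (FI K x) <= M} ->
  normc (cint mu (fun x => cint mu (fun y => A x * (B y * K (- x - y))))) <=
    multiplier_const * M * Num.sqrt (nsq mu A * nsq mu B).
Proof.
move=> A2 B2 jK M0 hM; have L := L12_tri A2 B2 jK; have [mA _] := A2; have [mB _] := B2.
have L' n := L12_tri (trunc_L2 n mA) (trunc_L2 n mB) jK.
rewrite (cfub_eq1 L).
have [] := @cDCT _ _ _ mm (fun n => unc (fun x y => trunc n A x * (trunc n B y * K (- x - y))))
  (unc (fun x y => A x * (B y * K (- x - y)))) (fun p => normc (unc (fun x y => A x * (B y * K (- x - y))) p)).
- by move=> n; exact: (L1_cmeas (L' n)).
- exact: (L1_cmeas L).
- by apply: nearW => -[x y]; apply: ccvgM (trunc_cvg A x) (ccvgM (trunc_cvg B y) (ccvg_cst _)).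
- exact: (L1_normc L).
- move=> n [x y]; rewrite /unc /= (Normc.normcM (trunc n A x)) (Normc.normcM (trunc n B y)).
  rewrite (Normc.normcM (A x)) (Normc.normcM (B y)).
  apply: ler_pM; [exact: normc_ge0|by rewrite mulr_ge0 ?normc_ge0|exact: trunc_le|].
  by apply: ler_wpM2r; [exact: normc_ge0|exact: trunc_le].
move=> _ /ccvg_le; apply => n.
rewrite -(cfub_eq1 (L' n)).
apply: le_trans (mult_bounded (trunc_L1 n mA) (trunc_L2 n mA) (trunc_L1 n mB) (trunc_L2 n mB)
  (trunc_bound n B) jK M0 hM) _.
apply: ler_wpM2l.
  by rewrite mulr_ge0// /multiplier_const divr_ge0 ?CP_ge0// mulr_ge0// ltW ?c0_gt0 ?kapr_gt0.
by rewrite ler_wsqrtr// ler_pM ?nsq_ge0 ?trunc_nsq_le.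
Qed.
End Mult.

Section TrilinearReal.
Variable R : realType.
Variables (s dl : R).
Hypotheses (s56 : 5 / 6 <= s) (s1 : s < 1) (dl0 : 0 < dl).

Let s0 : 0 <= s. Proof. by apply: le_trans s56; rewrite divr_ge0. Qed.

Lemma powR_mono (a b r : R) : 0 <= r -> 0 <= a -> a <= b -> a `^ r <= b `^ r.
Proof. by move=> r0 a0 ab; apply: ge0_ler_powR; rewrite ?nnegrE// (le_trans a0). Qed.

(** For $a\le b$: $m\le a=a^sa^{1-s}\le a^sg^{1-s}=a^sg^sg^{1-2s}$, and $g\le2b$ gives
    $g^s\le2b^s$. *)
Lemma min_weight (a b g m : R) : 0 <= m -> m <= a -> m <= b -> a <= g -> b <= g -> g <= a + b ->
  m <= 2 * (a `^ s * b `^ s) * g `^ (1 - 2 * s).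
Proof.
wlog ab : a b / a <= b.
  move=> H m0 ma mb ag bg gab; have [ab|/ltW ba] := leP a b; first exact: H.
  by rewrite [a `^ s * _]mulrC; apply: H => //; rewrite addrC.
move=> m0 ma mb ag bg gab.
have rhs0 : 0 <= 2 * (a `^ s * b `^ s) * g `^ (1 - 2 * s).
  by rewrite !mulr_ge0 ?powR_ge0.
have [am|a0] := leP a 0; first by rewrite (le_trans (le_trans ma am)).
have g0 : 0 < g by apply: lt_le_trans ag.
have b0 : 0 < b by apply: lt_le_trans ab.
apply: (le_trans ma).
rewrite [leLHS](_ : _ = a `^ s * a `^ (1 - s)); last first.
  rewrite -powRD; last by rewrite (lt0r_neq0 a0) implybT.
  by rewrite addrC subrK powRr1// ltW.
rewrite [leRHS](_ : _ = (a `^ s) * (2 * b `^ s * g `^ (1 - 2 * s))); last by ring.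
rewrite ler_wpM2l ?powR_ge0//.
apply: (@le_trans _ _ (g `^ (1 - s))).
  by apply: powR_mono => //; [rewrite subr_ge0 ltW|exact: ltW].
have -> : 1 - s = s + (1 - 2 * s) by ring.
rewrite powRD; last by rewrite (lt0r_neq0 g0) implybT.
rewrite ler_wpM2r ?powR_ge0//.
apply: (@le_trans _ _ ((2 * b) `^ s)); first by apply: powR_mono; [exact: s0|exact: ltW|lra].
rewrite powRM ?(ltW b0)// ler_wpM2r ?powR_ge0// -[leRHS]powRr1//.
by apply: ler_powR; rewrite ?ler1n// ltW.
Qed.

(** After [min_weight] and the arithmetic-geometric mean inequality there remains
    $g^{2-4s}=g^{5-6s}g^{2s-3}$. Its first factor is bounded for $g\ge\delta$, with $\delta$ = [dl],
    exactly because $5-6s\le0$. *)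
Lemma tri_real (a b g p q r m : R) : dl <= g -> 0 <= p -> 0 <= q -> 0 <= r ->
  0 <= m -> m <= a -> m <= b -> a <= g -> b <= g -> g <= a + b ->
  m * p * q * r <= 2^-1 * ((a `^ s * p) ^+ 2 * (b `^ s * q) ^+ 2) +
    2 * dl `^ (5 - 6 * s) * (g ^- 3 * (g `^ s * r) ^+ 2).
Proof.
move=> dg p0 q0 r0 m0 ma mb ag bg gab.
have g0 : 0 < g by apply: lt_le_trans dg.
have h := min_weight m0 ma mb ag bg gab.
set P := a `^ s * p; set Q := b `^ s * q.
have P0 : 0 <= P by rewrite mulr_ge0// powR_ge0.
have Q0 : 0 <= Q by rewrite mulr_ge0// powR_ge0.
apply: (@le_trans _ _ ((P * Q) * (2 * g `^ (1 - 2 * s) * r))).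
  rewrite [leRHS](_ : _ = 2 * (a `^ s * b `^ s) * g `^ (1 - 2 * s) * (p * q * r)); last first.
    by rewrite /P /Q; ring.
  by rewrite [leLHS](_ : _ = m * (p * q * r)) ?ler_wpM2r ?mulr_ge0//; ring.
apply: (le_trans (amgm _ _)).
rewrite mulrDr exprMn lerD2l !exprMn.
rewrite [leLHS](_ : _ = 2 * (g `^ (1 - 2 * s) ^+ 2 * r ^+ 2)); last by field.
rewrite [leRHS](_ : _ = 2 * ((dl `^ (5 - 6 * s) * (g ^- 3 * g `^ s ^+ 2)) * r ^+ 2)); last by ring.
rewrite ler_wpM2l// ler_wpM2r ?sqr_ge0//.
rewrite -[g `^ (1 - 2 * s) ^+ 2]powR_mulrn ?powR_ge0// -powRrM.
rewrite -[g `^ s ^+ 2]powR_mulrn ?powR_ge0// -powRrM.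
rewrite -[g ^+ 3](powR_mulrn 3 (ltW g0)) -powRN.
have gn : g != 0 by rewrite lt0r_neq0.
rewrite [leRHS](_ : _ = dl `^ (5 - 6 * s) * g `^ (- 3%:R + s * 2%:R)); last first.
  by rewrite (@powRD _ g) ?gn ?implybT.
have -> : (1 - 2 * s) * 2%:R = (5 - 6 * s) + (- 3%:R + s * 2%:R) by ring.
rewrite (@powRD _ g) ?gn ?implybT// ler_wpM2r ?powR_ge0//.
have -> : 5 - 6 * s = - (6 * s - 5) by ring.
rewrite !powRN lef_pV2 ?posrE ?powR_gt0//.
by apply: powR_mono => //; [have := s56; lra|exact: ltW].
Qed.
End TrilinearReal.

Section TrilinearDom.
Variable R : realType.
Local Notation R3 := (R * R * R)%type.
Local Notation C := R[i].
Local Notation mu := (mu3 R).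
Variables (s dl : R).
Hypotheses (s56 : 5 / 6 <= s) (s1 : s < 1) (dl0 : 0 < dl).
Variable N : R3 -> R.
Hypotheses (mN : measurable_fun setT N) (N0 : forall x, 0 <= N x).

Definition D2 x : R := (enorm x `^ s * N x) ^+ 2.
Hypothesis iD : rint mu D2.

Let D20 x : 0 <= D2 x. Proof. exact: sqr_ge0. Qed.

Definition regset : set (R3 * R3) := [set p | enorm p.2 <= enorm p.1 /\ dl <= enorm p.1].
Definition GG_ (g t : R3) : R := D2 g * (enorm g ^- 3 * \1_regset (g, t)).

Lemma regset_measurable : measurable regset.
Proof.
have e1 : measurable_fun setT (fun p : R3 * R3 => enorm p.1).
  exact: (measurableT_comp (@enorm_measurable R) (@measurable_fst _ _ _ _)).
have e2 : measurable_fun setT (fun p : R3 * R3 => enorm p.2).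
  exact: (measurableT_comp (@enorm_measurable R) (@measurable_snd _ _ _ _)).
apply: measurableI.
  have := measurable_fun_ler e2 e1 measurableT (Y := [set true]) I.
  by rewrite setTI.
have := measurable_fun_ler (@measurable_cst _ _ (R3 * R3)%type _ setT dl) e1 measurableT (Y := [set true]) I.
by rewrite setTI.
Qed.

Lemma GG_ge0 g t : 0 <= GG_ g t.
Proof.
rewrite /GG_ mulr_ge0// mulr_ge0 ?invr_ge0 ?exprn_ge0 ?enorm_ge0//.
Qed.

(** For fixed [g] the variable [t] stays in a ball of radius $|g|$, hence in a cube of volume
    $8|g|^3$, which cancels $|g|^{-3}$. *)
Lemma GG_rint2 : rint2 GG_.
Proof.
have mD := rint_meas iD.
have mGG : meas2 GG_.
  apply: meas2M; first exact: (meas2_1 mD).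
  apply: meas2M.
    have := measurableT_comp (@measurable_powR R (- 3%:R)) (@enorm_measurable R).
    move=> /meas2_1; congr meas2; apply/funext => x; apply/funext => y /=.
    by rewrite powRN powR_mulrn ?enorm_ge0.
  have := measurable_indic regset_measurable (D := setT) (R := R).
  by congr (measurable_fun setT _); apply/funext => -[].
apply: rint2_lty => //.
apply: (@le_lt_trans _ _ (\int[mu]_x (8 * D2 x)%:E)%E); last first.
  by apply: lty_rint; [move=> x; rewrite mulr_ge0|exact: rintZ].
apply: ge0_le_integral => //.
- by move=> x _; apply: integral_ge0 => y _; rewrite lee_fin.
- have m1 : measurable_fun setT (fun p : R3 * R3 => (`|unc GG_ p|)%:E).
    by apply/measurable_EFinP; exact: measurableT_comp.
  have p1 (p : R3 * R3) : (0 <= (`|unc GG_ p|)%:E)%E by rewrite lee_fin.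
  exact: (@measurable_fun_fubini_tonelli_F _ _ _ _ _ (sfmu3 R) _ m1 p1).
- by apply/measurable_EFinP; apply: measurable_funM.
move=> x _; have [dx|xd] := leP dl (enorm x); last first.
  rewrite integral0_eq => [|y _]; first by rewrite lee_fin (mulr_ge0 (ler0n _ 8) (D20 x)).
  rewrite /GG_ indicE memNset ?mulr0 ?normr0// => -[_] /=; by rewrite leNgt xd.
have ex : 0 < enorm x by apply: lt_le_trans dx.
have mc := cube_measurable (enorm x).
have ic : rint mu (\1_(cube (enorm x))).
  by apply: rint_indic => //; rewrite mu3_cube ?ltW// ltry.
apply: (@le_trans _ _ (\int[mu]_y (D2 x * enorm x ^- 3 * \1_(cube (enorm x)) y)%:E)%E).
  apply: ge0_le_integral => //.
  - apply/measurable_EFinP; apply: measurableT_comp => //.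
    have := measurableT_comp mGG (measurable_pair1 x); exact.
  - by apply/measurable_EFinP; apply: measurable_funM => //; exact: measurable_indic.
  move=> y _; rewrite lee_fin ger0_norm ?GG_ge0// /GG_ mulrA ler_wpM2l//.
    by rewrite mulr_ge0// invr_ge0 exprn_ge0// enorm_ge0.
  rewrite !indicE; case: (boolP (_ \in regset)); rewrite ?inE// => -[h _].
  by rewrite mem_set//; exact: enorm_cube.
rewrite -EFin_Rint; last exact: rintZ.
rewrite lee_fin RintZ// /Rintegral integral_indic// setIT mu3_cube ?enorm_ge0//=.
rewrite le_eqVlt; apply/orP; left; apply/eqP; field.
by rewrite lt0r_neq0.
Qed.

(* Dominates [m |U x| |U y| |U z|] for [x + y + z = 0], [m] the least of the three moduli and
   [|z| >= dl]; [regset] selects the variable of largest modulus, and integrating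
   [|g|^-3] over the ball of radius [|g|] costs a constant. *)
Definition Phi (x y : R3) : R :=
  2^-1 * (D2 x * D2 y) + 2^-1 * (D2 x * D2 (- x - y)) + 2^-1 * (D2 y * D2 (- x - y)) +
  2 * dl `^ (5 - 6 * s) * GG_ x y + 2 * dl `^ (5 - 6 * s) * GG_ y x +
  2 * dl `^ (5 - 6 * s) * GG_ (- x - y) x.

Lemma Phi_rint2 : rint2 Phi.
Proof.
apply: rint2D; last first.
  apply: rint2Z; exact: (rint2_reflect (@measurable_opp3 R) (rint2_swap GG_rint2)).
apply: rint2D; last by apply: rint2Z; exact: (rint2_swap GG_rint2).
apply: rint2D; last by apply: rint2Z; exact: GG_rint2.
apply: rint2D; last by apply: rint2Z; exact: (rint2_conv2 iD iD).
apply: rint2D; last by apply: rint2Z; exact: (rint2_conv1 iD iD).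
by apply: rint2Z; exact: rint2_prod.
Qed.

Lemma Phi_ge0 x y : 0 <= Phi x y.
Proof.
have k0 : 0 <= 2 * dl `^ (5 - 6 * s) by rewrite mulr_ge0// powR_ge0.
have a (p q : R3) : 0 <= 2^-1 * (D2 p * D2 q) by rewrite mulr_ge0 ?invr_ge0// mulr_ge0.
have b p q : 0 <= 2 * dl `^ (5 - 6 * s) * GG_ p q by rewrite mulr_ge0// GG_ge0.
by rewrite /Phi !addr_ge0.
Qed.

(** Whichever of the three moduli is largest plays the role of [g] in [tri_real]: it is at most the
    sum of the other two, since the frequencies add up to 0, and at least [dl], since the third one
    is. *)
Lemma Phi_bound x y m : dl <= enorm (- x - y) ->
  0 <= m -> m <= enorm x -> m <= enorm y -> m <= enorm (- x - y) ->
  m * N x * N y * N (- x - y) <= Phi x y.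
Proof.
move=> dz m0 mx my mz; set z := - x - y in dz mz *.
have t1 : enorm x <= enorm y + enorm z.
  by rewrite -(enormN y) -(enormN z) (le_trans _ (ler_enormD _ _))// /z opprB opprK addKr.
have t2 : enorm y <= enorm x + enorm z.
  rewrite -(enormN x) -(enormN z) (le_trans _ (ler_enormD _ _))// /z.
  by rewrite opprB opprK [_ + x]addrC addKr.
have t3 : enorm z <= enorm x + enorm y.
  by rewrite -(enormN x) -(enormN y) ler_enormD.
have q1 := GG_ge0 x y; have q2 := GG_ge0 y x; have q3 := GG_ge0 z x.
have k0 : 0 <= 2 * dl `^ (5 - 6 * s) by rewrite mulr_ge0// powR_ge0.
have e1 : 0 <= 2^-1 * (D2 x * D2 y) by rewrite mulr_ge0 ?invr_ge0// mulr_ge0.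
have e2 : 0 <= 2^-1 * (D2 x * D2 z) by rewrite mulr_ge0 ?invr_ge0// mulr_ge0.
have e3 : 0 <= 2^-1 * (D2 y * D2 z) by rewrite mulr_ge0 ?invr_ge0// mulr_ge0.
have f1 := mulr_ge0 k0 q1; have f2 := mulr_ge0 k0 q2; have f3 := mulr_ge0 k0 q3.
rewrite /Phi -/z.
have GGE g t : enorm t <= enorm g -> dl <= enorm g -> GG_ g t = enorm g ^- 3 * D2 g.
  by move=> h1 h2; rewrite /GG_ indicE mem_set ?mulr1 1?mulrC.
have [xz|zx] := leP (enorm x) (enorm z).
  have [yz|zy] := leP (enorm y) (enorm z).
    have := tri_real s56 s1 dl0 dz (N0 x) (N0 y) (N0 z) m0 mx my xz yz t3.
    by rewrite -/(D2 x) -/(D2 y) -/(D2 z) -(GGE z x)//; lra.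
  have dy := le_trans dz (ltW zy).
  have := tri_real s56 s1 dl0 dy (N0 x) (N0 z) (N0 y) m0 mx mz (le_trans xz (ltW zy)) (ltW zy) t2.
  rewrite -/(D2 x) -/(D2 y) -/(D2 z) -(GGE y x)//; last exact: (le_trans xz (ltW zy)).
  by have -> : m * N x * N z * N y = m * N x * N y * N z; [ring|lra].
have [yx|xy] := leP (enorm y) (enorm x).
  have dx := le_trans dz (ltW zx).
  have := tri_real s56 s1 dl0 dx (N0 y) (N0 z) (N0 x) m0 my mz yx (ltW zx) t1.
  rewrite -/(D2 x) -/(D2 y) -/(D2 z) -(GGE x y)//.
  by have -> : m * N y * N z * N x = m * N x * N y * N z; [ring|lra].
have dy := le_trans dz (ltW (lt_trans zx xy)).
have := tri_real s56 s1 dl0 dy (N0 x) (N0 z) (N0 y) m0 mx mz (ltW xy) (ltW (lt_trans zx xy)) t2.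
rewrite -/(D2 x) -/(D2 y) -/(D2 z) -(GGE y x)//; last exact: ltW.
by have -> : m * N x * N z * N y = m * N x * N y * N z; [ring|lra].
Qed.
End TrilinearDom.

Section Vnorm.
Variable R : realType.
Local Notation R3 := (R * R * R)%type.
Local Notation C := R[i].
Variable U : 'I_3 -> R3 -> C.

Lemma vnorm_ge0 x : 0 <= vnorm U x. Proof. exact: sqrtr_ge0. Qed.

Lemma sqr_vnorm x : vnorm U x ^+ 2 = \sum_(j < 3) normc (U j x) ^+ 2.
Proof. by rewrite sqr_sqrtr// sumr_ge0// => j _; exact: sqr_ge0. Qed.

Lemma normc_vnorm j x : normc (U j x) <= vnorm U x.
Proof.
rewrite -(@ler_pXn2r _ 2) ?nnegrE ?normc_ge0 ?vnorm_ge0// sqr_vnorm (bigD1 j)//= lerDl.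
by rewrite sumr_ge0// => i _; exact: sqr_ge0.
Qed.

Lemma vnorm_measurable : (forall j, cmeas (U j)) -> measurable_fun setT (vnorm U).
Proof.
move=> U_cmeas; apply: (measurableT_comp (f := @Num.sqrt R)) => //.
  by apply: continuous_measurable_fun; exact: sqrt_continuous.
by apply: measurable_sum => j; apply: measurable_funX; exact: cmeas_normc.
Qed.

Lemma normc_dot3 (a : 'I_3 -> R) (b : 'I_3 -> C) (A B : R) : 0 <= A ->
  (forall j, `|a j| <= A) -> (forall j, normc (b j) <= B) ->
  normc (\sum_(j < 3) (a j)%:C * b j) <= 3 * (A * B).
Proof.
move=> A0 hA hB; apply: (le_trans (normc_sum _ _ _)).
apply: (@le_trans _ _ (\sum_(j < 3) A * B)).
  by apply: ler_sum => j _; rewrite Normc.normcM normc_real ler_pM// normc_ge0.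
by rewrite !big_ord_recl big_ord0 /=; lra.
Qed.
End Vnorm.

(** * The energy identity *)

Section Split.
Variable R : realType.
Local Notation R3 := (R * R * R)%type.
Local Notation C := R[i].
Local Notation mu := (mu3 R).
Local Notation mm := (mm R).
Variables (psi : R3 -> R) (Hpsi : cutoff psi) (s : R).
Hypotheses (s56 : 5 / 6 <= s) (s1 : s < 1).
Variable U : 'I_3 -> R3 -> C.
Hypothesis U_cmeas : forall j, cmeas (U j).
Hypothesis HL : forall j h, ctest h -> L1 mu (fun x => U j x * h x).
Hypothesis Hdiv : forall x, \sum_(j < 3) (coord3 j x)%:C * U j x = 0.
Local Notation N := (vnorm U).
Local Notation D := (D2 s N).
Hypothesis iD : rint mu D.
Variables (Mp : R) (hMp : forall x, `|psi x| <= Mp).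

Let s0 : 0 < s. Proof. by apply: lt_le_trans s56; rewrite divr_gt0. Qed.
Let Mp0 : 0 <= Mp. Proof. exact: le_trans (normr_ge0 _) (hMp 0). Qed.

Definition EE : R := \int[mu]_x D x.
Lemma EE_ge0 : 0 <= EE. Proof. by apply: Rint_ge0 => x; exact: sqr_ge0. Qed.

Variables (lam : R) (lam0 : 0 < lam).
(** [rho] is 1 on the ball of this radius, so [VV] vanishes inside it. *)
Definition dl : R := (2 * lam)^-1.
Let dl0 : 0 < dl. Proof. by rewrite invr_gt0 mulr_gt0. Qed.
Local Notation La := (lam `^ s).
Let La0 : 0 < La. Proof. exact: powR_gt0. Qed.

Definition rho (x : R3) : R := psi (lam *: x).
(* The dilation parameter [lam] is [2^-k]: [WW] and [VV] are the parts of [U] in the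
   frequencies at most, respectively at least, of order [lam^-1 = 2^k]. *)
Definition WW j (x : R3) : C := (rho x)%:C * U j x.
Definition VV j (x : R3) : C := (1 - rho x)%:C * U j x.
(** Up to a factor [ci], the frequency side of the derivative in direction [j] of the low-frequency
    part of component [p]. *)
Definition yW j p (x : R3) : C := (coord3 j x)%:C * WW p x.

Lemma rho_test : test_function rho.
Proof.
have := test_affine (0 : R3) (lt0r_neq0 lam0) (psi_test Hpsi).
by congr test_function; apply/funext => x; rewrite addr0.
Qed.

Lemma rho_measurable : measurable_fun setT rho.
Proof. exact: test_measurable rho_test. Qed.

Lemma WV j x : U j x = WW j x + VV j x.
Proof. by rewrite /WW /VV -mulrDl -rmorphD /= addrC subrK mul1r. Qed.

Lemma WW_L1 j : L1 mu (WW j).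
Proof.
by have := HL j (ctest_real rho_test); congr L1; apply/funext => x; rewrite mulrC.
Qed.

Lemma yW_L1 j p : L1 mu (yW j p).
Proof.
have := HL p (ctest_coord j (ctest_real rho_test)); congr L1; apply/funext => x.
by rewrite /yW /WW; ring.
Qed.

Lemma VV_cmeas j : cmeas (VV j).
Proof.
apply: cmeasM (U_cmeas j); apply: cmeas_real; apply: measurable_funB rho_measurable.
exact: measurable_cst.
Qed.

Lemma rho_far x : lam^-1 < enorm x -> rho x = 0.
Proof.
move=> h; case: Hpsi => _ _ far _; rewrite /rho; apply: far.
by rewrite enormZ gtr0_norm// -(mulfV (lt0r_neq0 lam0)) ltr_pM2l.
Qed.

Lemma rho_near x : enorm x < dl -> rho x = 1.
Proof.
move=> h; case: Hpsi => _ _ _ near; rewrite /rho; apply: near.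
rewrite enormZ gtr0_norm// div1r -(@ler_pM2l _ lam^-1) ?invr_gt0//.
by rewrite mulKf ?lt0r_neq0// -invfM mulrC ltW.
Qed.

Lemma VV_near j x : enorm x < dl -> VV j x = 0.
Proof. by move=> /rho_near h; rewrite /VV h subrr mul0r. Qed.

Lemma VV_le j x : normc (VV j x) <= (1 + Mp) * N x.
Proof.
rewrite /VV Normc.normcM normc_real ler_pM ?normc_ge0 ?normc_vnorm//.
by rewrite (le_trans (ler_normB _ _))// normr1 lerD2l hMp.
Qed.

Definition farset : set R3 := [set x | dl <= enorm x].
(** Dominates the squared norm of [VV] divided by $\lambda^{2s}$; this is the quantity that becomes
    small as [lam] grows. *)
Definition bb : R := \int[mu]_x (La ^- 2 * (\1_farset x * N x ^+ 2)).

Lemma farset_measurable : measurable farset.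
Proof.
have := measurable_fun_ler (@measurable_cst _ _ R3 _ setT dl) (@enorm_measurable R) measurableT (Y := [set true]) I.
by rewrite setTI.
Qed.

(** On [farset], $(2\lambda|x|)^s\ge1$, so $\lambda^{-s}\le2|x|^s$. The resulting majorant does not
    depend on [lam]. *)
Lemma far_le x : La ^- 2 * (\1_farset x * N x ^+ 2) <= 4 * D x.
Proof.
rewrite indicE; case: (boolP (x \in _)) => [|_]; last first.
  by rewrite mul0r mulr0 mulr_ge0//; exact: sqr_ge0.
rewrite inE => h; rewrite mul1r /D2 [(_ * N x) ^+ 2]exprMn [leRHS]mulrA ler_wpM2r ?sqr_ge0//.
rewrite -exprVn (_ : 4 = 2 ^+ 2); last by rewrite expr2; ring.
rewrite -exprMn lerXn2r ?nnegrE ?invr_ge0 ?powR_ge0//; first by rewrite mulr_ge0 ?powR_ge0.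
rewrite -(ler_pM2l La0) mulfV ?lt0r_neq0//.
have h1 : 1 <= (2 * lam * enorm x) `^ s.
  rewrite [leLHS](_ : 1 = 1 `^ s); last by rewrite powR1.
  apply: powR_mono => //; first exact: ltW.
  by rewrite -(ler_pM2l dl0) mulr1 mulKf// lt0r_neq0// mulr_gt0.
apply: (le_trans h1); rewrite powRM ?enorm_ge0//; last by rewrite mulr_ge0// ltW.
rewrite powRM ?(ltW lam0)// mulrCA mulrA ler_wpM2r ?powR_ge0//.
rewrite ler_wpM2r ?powR_ge0// -[leRHS]powRr1//.
by apply: ler_powR; rewrite ?ler1n// ltW.
Qed.

Lemma far_meas : measurable_fun setT (fun x => La ^- 2 * (\1_farset x * N x ^+ 2)).
Proof.
apply: measurable_funM => //; apply: measurable_funM.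
  exact: measurable_indic farset_measurable.
by apply: measurable_funX; exact: vnorm_measurable.
Qed.

Lemma bb_rint : rint mu (fun x => La ^- 2 * (\1_farset x * N x ^+ 2)).
Proof.
apply: (@rint_le _ _ _ mu (fun x => 4 * D x) _ far_meas); last exact: rintZ.
move=> x; rewrite ger0_norm; first exact: far_le.
by rewrite mulr_ge0 ?invr_ge0 ?sqr_ge0// mulr_ge0// sqr_ge0.
Qed.

Lemma bb_ge0 : 0 <= bb.
Proof.
by apply: Rint_ge0 => x; rewrite mulr_ge0 ?invr_ge0 ?sqr_ge0// mulr_ge0// sqr_ge0.
Qed.

Lemma VV_L2 j : L2 mu (VV j) /\ nsq mu (VV j) <= ((1 + Mp) * La) ^+ 2 * bb.
Proof.
have h x : normc (VV j x) ^+ 2 <= ((1 + Mp) * La) ^+ 2 * (La ^- 2 * (\1_farset x * N x ^+ 2)).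
  rewrite indicE; case: (boolP (x \in _)) => [_|hx]; last first.
    rewrite VV_near ?normc_real ?normr0 ?expr0n ?mul0r ?mulr0//.
    by rewrite ltNge; apply/negP => h; move/negP: hx; apply; rewrite inE.
  rewrite mul1r exprMn -mulrA mulVKf ?expf_neq0 ?lt0r_neq0// -exprMn.
  rewrite lerXn2r ?nnegrE ?normc_ge0 ?VV_le//.
  by rewrite mulr_ge0 ?vnorm_ge0// addr_ge0.
have i := rintZ (((1 + Mp) * La) ^+ 2) bb_rint.
have V2 : L2 mu (VV j) by exact: (@L2_le _ _ _ mu _ _ (VV_cmeas j) h i).
split=> //; rewrite /bb -RintZ; last exact: bb_rint.
by apply: Rint_le => //; case: V2.
Qed.

(** On the support of [rho], $\lambda|x|\le1$, and $s<1$ gives $\lambda|x|\le(\lambda|x|)^s$: the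
    coordinate factor is absorbed by the weight of the energy at the cost of $\lambda^{s-1}$. *)
Lemma yW_L2 j p : L2 mu (yW j p) /\ nsq mu (yW j p) <= (Mp * La / lam) ^+ 2 * EE.
Proof.
have h x : normc (yW j p x) ^+ 2 <= (Mp * La / lam) ^+ 2 * D x.
  have [far|near] := ltP lam^-1 (enorm x).
    rewrite /yW /WW rho_far// mul0r mulr0 normc_real normr0 expr0n.
    by rewrite mulr_ge0 ?sqr_ge0//; exact: sqr_ge0.
  rewrite /D2 -exprMn lerXn2r ?nnegrE ?normc_ge0//.
    by rewrite !mulr_ge0 ?powR_ge0 ?invr_ge0 ?vnorm_ge0// ltW.
  rewrite /yW /WW Normc.normcM Normc.normcM !normc_real.
  apply: (@le_trans _ _ (enorm x * (Mp * N x))).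
    apply: ler_pM => //; rewrite ?mulr_ge0 ?normc_ge0 ?coord_le_enorm//.
    by apply: ler_pM; rewrite ?normc_ge0 ?hMp ?normc_vnorm.
  rewrite [leLHS](_ : _ = (Mp * N x) * enorm x); last by ring.
  rewrite [leRHS](_ : _ = (Mp * N x) * (La / lam * enorm x `^ s)); last by ring.
  rewrite ler_wpM2l//; first by rewrite mulr_ge0 ?vnorm_ge0.
  rewrite mulrAC ler_pdivlMr// -powRM ?enorm_ge0 ?(ltW lam0)// mulrC.
  have le1 : lam * enorm x <= 1 by rewrite -(ler_pM2l lam0) mulfV ?lt0r_neq0// in near.
  have [->|e0] := eqVneq (lam * enorm x) 0; first by rewrite powR0 ?lt0r_neq0.
  have e1 : 0 < lam * enorm x by rewrite lt_def e0 mulr_ge0 ?enorm_ge0// ltW.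
  have E : lam * enorm x = (lam * enorm x) `^ (1 - s) * (lam * enorm x) `^ s.
    by rewrite -powRD ?(lt0r_neq0 e1) ?implybT// subrK powRr1// ltW.
  rewrite [leLHS]E ler_piMl ?powR_ge0//.
  rewrite [leRHS](_ : 1 = 1 `^ (1 - s)); last by rewrite powR1.
  by apply: powR_mono => //; [rewrite subr_ge0 ltW|exact: ltW].
have m1 := L1_cmeas (yW_L1 j p).
have i := rintZ ((Mp * La / lam) ^+ 2) iD.
have Y2 : L2 mu (yW j p) by exact: (@L2_le _ _ _ mu _ _ m1 h i).
by split=> //; rewrite /EE -RintZ//; apply: Rint_le => //; case: Y2.
Qed.

Definition dotU x (v : R3) : C := \sum_(j < 3) (coord3 j v)%:C * U j x.
(** With $y=-z-x$, [PP] is $(U(x)\cdot y)(W(y)\cdot V(z))$, and $U(x)=V(x)+W(x)$ produces the two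
    pieces. In [P1] the function [yW] is the integrable kernel between two high-frequency factors;
    in [P2] the kernel is [WW], and [yW] counts as a square-integrable factor. *)
Definition P1 j p z x : C := VV p z * (VV j x * yW j p (- z - x)).
Definition P2 j p z x : C := VV p z * (yW j p (- z - x) * WW j x).
Definition PP z x : C := \sum_(j < 3) \sum_(p < 3) (P1 j p z x + P2 j p z x).

Lemma PPE z x : PP z x = dotU x (- z - x) * \sum_(p < 3) WW p (- z - x) * VV p z.
Proof.
rewrite /PP /dotU mulr_suml; apply: eq_bigr => j _; rewrite mulr_sumr; apply: eq_bigr => p _.
by rewrite /P1 /P2 (WV j x) /yW; ring.
Qed.

Lemma L12_sum (h : 'I_3 -> R3 -> R3 -> C) : (forall i, L12 (h i)) ->
  L12 (fun x y => \sum_(i < 3) h i x y).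
Proof. by move=> H; exact: (L1_sum _ H). Qed.

Lemma L12D (h k : R3 -> R3 -> C) : L12 h -> L12 k -> L12 (fun x y => h x y + k x y).
Proof. by move=> H1 H2; exact: (L1D H1 H2). Qed.

Lemma P1_L12 j p : L12 (P1 j p).
Proof. exact: (L12_tri (VV_L2 p).1 (VV_L2 j).1 (yW_L1 j p)). Qed.

Lemma L12_tri' A B K : L2 mu A -> L2 mu B -> L1 mu K ->
  L12 (fun z x => A z * (B (- z - x) * K x)).
Proof.
move=> A2 B2 jK; have := L12_reflect (@measurable_opp3 R) (L12_tri A2 B2 jK).
by congr L12; apply/funext => z; apply/funext => x; rewrite subKr.
Qed.

Lemma P2_L12 j p : L12 (P2 j p).
Proof. exact: (L12_tri' (VV_L2 p).1 (yW_L2 j p).1 (WW_L1 j)). Qed.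

Lemma PP_L12 : L12 PP.
Proof.
by apply: L12_sum => j; apply: L12_sum => p; apply: L12D; [exact: P1_L12|exact: P2_L12].
Qed.

(* Cuts off high frequencies; being Lipschitz with constant [e_ m] it makes
   the antisymmetrised integrand [SA] below absolutely integrable. *)
Definition chi (m : nat) (z : R3) : R := (1 + e_ R m * enorm z)^-1.

Lemma chi_den m z : 1 <= 1 + e_ R m * enorm z.
Proof. by rewrite lerDl mulr_ge0 ?enorm_ge0 ?ltW ?e_gt0. Qed.

Lemma chi_ge0 m z : 0 <= chi m z.
Proof. by rewrite invr_ge0 (le_trans _ (chi_den m z)). Qed.

Lemma chi_le1 m z : chi m z <= 1.
Proof. by rewrite invf_le1 ?chi_den// (lt_le_trans _ (chi_den m z)). Qed.

Lemma chi_enorm m z : e_ R m * enorm z * chi m z <= 1.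
Proof.
have h := chi_den m z; rewrite ler_pdivrMr ?mul1r; first by rewrite lerDr.
exact: lt_le_trans h.
Qed.

Lemma chi_measurable m : measurable_fun setT (chi m).
Proof.
apply: continuous_measurable3 => z; apply: cvgV.
  by rewrite gt_eqF// (lt_le_trans _ (chi_den m z)).
apply: cvgD; first exact: cvg_cst.
by apply: cvgM; [exact: cvg_cst|exact: enorm_continuous].
Qed.

Lemma chi_cvg z : (fun m => chi m z) @ \oo --> (1 : R).
Proof.
rewrite -[X in _ --> X]invr1; apply: cvgV; first exact: oner_neq0.
rewrite -[X in _ --> X]addr0 -(mul0r (enorm z)).
by apply: cvgD; [exact: cvg_cst|apply: cvgM; [exact: e_cvg0|exact: cvg_cst]].
Qed.

(** The difference equals $\epsilon(|y|-|z|)\chi(z)\chi(y)$ with $\epsilon$ = [e_ R m], and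
    $\epsilon|z|\chi(z)\le1$. The factor $|z|$ is thereby traded for $|x|$, uniformly in [m]. *)
Lemma chi_sub m z y x : `|enorm y - enorm z| <= enorm x ->
  `|chi m z - chi m y| <= 1 /\ `|chi m z - chi m y| * enorm z <= enorm x.
Proof.
move=> h; have z0 := chi_ge0 m z; have y0 := chi_ge0 m y.
have z1 := chi_le1 m z; have y1 := chi_le1 m y.
split; first by rewrite ler_norml; lra.
have dz : 1 + e_ R m * enorm z != 0 by rewrite gt_eqF// (lt_le_trans _ (chi_den m z)).
have dy : 1 + e_ R m * enorm y != 0 by rewrite gt_eqF// (lt_le_trans _ (chi_den m y)).
have -> : chi m z - chi m y = e_ R m * (enorm y - enorm z) * chi m z * chi m y.
  by rewrite /chi; field; rewrite dz dy.
rewrite !normrM (ger0_norm z0) (ger0_norm y0) (gtr0_norm (e_gt0 R m)).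
set q := `|enorm y - enorm z| in h *.
rewrite (_ : _ * _ = (e_ R m * enorm z * chi m z) * (q * chi m y)); last by ring.
have q0 : 0 <= q by exact: normr_ge0.
rewrite -[leRHS]mul1r; apply: ler_pM; rewrite ?chi_enorm//.
- by apply: mulr_ge0 (chi_ge0 m z); rewrite mulr_ge0 ?enorm_ge0// ltW ?e_gt0.
- by rewrite mulr_ge0.
- by rewrite -[leRHS]mulr1; apply: ler_pM.
Qed.

Lemma dotU_opp x z : dotU x (- z - x) = - dotU x z.
Proof.
rewrite /dotU (eq_bigr (fun j => - ((coord3 j z)%:C * U j x) - (coord3 j x)%:C * U j x)); last first.
  by move=> j _; rewrite coord3D !coord3N rmorphD !rmorphN /=; ring.
by rewrite big_split /= !sumrN Hdiv subr0.
Qed.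

Definition SW m z x : C := - (chi m z)%:C * PP z x.
Definition SV m z x : C := (chi m z)%:C * (dotU x z * \sum_(p < 3) VV p (- z - x) * VV p z).
(** For fixed [z], the integrand of the energy identity, the second frequency being [- z - x]. *)
Definition Tz z x : C := dotU x z * \sum_(p < 3) U p (- z - x) * U p z.

Lemma SWV m z x : SW m z x + SV m z x = (chi m z * (1 - rho z))%:C * Tz z x.
Proof.
rewrite /SW PPE dotU_opp /SV /Tz.
have -> : \sum_(p < 3) U p (- z - x) * U p z =
   \sum_(p < 3) WW p (- z - x) * U p z + \sum_(p < 3) VV p (- z - x) * U p z.
  by rewrite -big_split /=; apply: eq_bigr => p _; rewrite -mulrDl -WV.
have E (A : 'I_3 -> R3 -> C) : \sum_(p < 3) A p (- z - x) * VV p z =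
    (1 - rho z)%:C * \sum_(p < 3) A p (- z - x) * U p z.
  by rewrite mulr_sumr; apply: eq_bigr => p _; rewrite /VV; ring.
by rewrite !E rmorphM; ring.
Qed.

Let V3 := 1 + Mp.
Let V30 : 0 <= V3. Proof. by rewrite addr_ge0. Qed.
Let mN : measurable_fun setT N. Proof. exact: vnorm_measurable. Qed.
Let N0 x : 0 <= N x. Proof. exact: vnorm_ge0. Qed.
Let PhiN := Phi s dl N.
Let iPhi : rint2 PhiN. Proof. exact: Phi_rint2. Qed.
Let Phi0 z x : 0 <= PhiN z x. Proof. exact: Phi_ge0. Qed.
Let mV2 p : cmeas2 (fun z x : R3 => VV p (- z - x)). Proof. exact: (cmeas2_third (VV_cmeas p)). Qed.

(** All three frequencies have modulus at least [dl], so [Phi_bound] applies with [m = dl]. *)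
Lemma VVV_L12 j p : L12 (fun z x => VV p z * (VV p (- z - x) * VV j x)).
Proof.
apply: (@L12_le _ (fun z x => V3 ^+ 3 * dl^-1 * PhiN z x)).
- apply: cmeasM; first exact: (cmeas2_1 (VV_cmeas p)).
  by apply: cmeasM; [exact: mV2|exact: (cmeas2_2 (VV_cmeas j))].
- move=> z x; have k0 : 0 <= V3 ^+ 3 * dl^-1 by rewrite mulr_ge0 ?exprn_ge0// invr_ge0 ltW.
  have [h1|h1] := ltP (enorm z) dl.
    by rewrite VV_near// mul0r normc_real normr0 mulr_ge0.
  have [h2|h2] := ltP (enorm (- z - x)) dl.
    by rewrite (VV_near _ h2) mul0r mulr0 normc_real normr0 mulr_ge0.
  have [h3|h3] := ltP (enorm x) dl.
    by rewrite (VV_near _ h3) !mulr0 normc_real normr0 mulr_ge0.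
  apply: (@le_trans _ _ (V3 ^+ 3 * dl^-1 * (dl * N z * N x * N (- z - x)))); last first.
    by rewrite ler_wpM2l//; apply: Phi_bound => //; exact: ltW.
  rewrite [leRHS](_ : _ = (V3 * N z) * ((V3 * N (- z - x)) * (V3 * N x))); last first.
    by field; rewrite lt0r_neq0.
  rewrite (Normc.normcM (VV p z)) (Normc.normcM (VV p (- z - x))).
  apply: ler_pM; rewrite ?mulr_ge0 ?normc_ge0 ?VV_le//.
  by apply: ler_pM; rewrite ?normc_ge0 ?VV_le.
- exact: rint2Z.
Qed.

(** The cutoff bounds [chi m z * coord3 j z] by [(e_ R m)^-1], a constant for each [m]. Of the
    remaining products, the one with [WW j x] is covered by [L12_tri'] and the one with [VV j x] by
    [VVV_L12]. *)
Lemma SV_L12 m : L12 (SV m).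
Proof.
have E : SV m = (fun z x => \sum_(j < 3) \sum_(p < 3)
    (chi m z * coord3 j z)%:C * (VV p z * (VV p (- z - x) * WW j x) + VV p z * (VV p (- z - x) * VV j x))).
  apply/funext => z; apply/funext => x; rewrite /SV /dotU mulr_suml mulr_sumr.
  apply: eq_bigr => j _; rewrite mulr_sumr mulr_sumr; apply: eq_bigr => p _.
  by rewrite (WV j x) rmorphM; ring.
rewrite E; apply: L12_sum => j; apply: L12_sum => p.
have i := L12D (L12_tri' (VV_L2 p).1 (VV_L2 p).1 (WW_L1 j)) (VVV_L12 j p).
have mc : measurable_fun setT (fun z : R3 => chi m z * coord3 j z).
  by apply: measurable_funM; [exact: chi_measurable|exact: coord_measurable].
apply: (L1_bounded (c := (e_ R m)^-1) i (cmeas2_1 (cmeas_real mc))) => -[z x].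
change (normc ((chi m z * coord3 j z)%:C) <= (e_ R m)^-1).
rewrite normc_real normrM (ger0_norm (chi_ge0 m z)).
rewrite -(ler_pM2l (e_gt0 R m)) mulfV ?lt0r_neq0 ?e_gt0//.
apply: le_trans (chi_enorm m z).
rewrite [leLHS](_ : _ = e_ R m * `|coord3 j z| * chi m z); last by ring.
rewrite ler_wpM2r ?chi_ge0// ler_wpM2l ?coord_le_enorm//.
exact: ltW (e_gt0 R m).
Qed.

Lemma cint_mm_reflect1 k : L12 k -> L12 (fun z x => k (- z - x) x) /\
  cint mm (unc k) = cint mm (unc (fun z x => k (- z - x) x)).
Proof.
move=> jk; have jk' := L12_swap jk.
have i2 : L12 (fun z x => k (- z - x) x).
  have := L12_swap (L12_reflect (@measurable_opp3 R) jk').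
  by congr L12; apply/funext => z; apply/funext => x; rewrite [- x - z]addrC.
split=> //; rewrite -(cfub_eq1 jk) -(cfub_eq1 i2) (cfub_swap jk) (cfub_swap i2).
apply: cint_ae.
- exact: (L1_cmeas (cfub_L1 jk')).
- exact: (L1_cmeas (cfub_L1 (L12_swap i2))).
apply: filterS (cfub_ae jk') => x ix; rewrite -(cint_reflect (- x) ix).
by apply: eq_cint => z; rewrite [- x - z]addrC.
Qed.

(* Exchanging [z] and [- z - x] turns [SV] into [SA]: the product of the two [VV] is
   symmetric and [dotU x z] changes sign because [dotU x x = 0]. *)
Definition SA m z x : C := (chi m z - chi m (- z - x))%:C *
  (dotU x z * \sum_(p < 3) VV p (- z - x) * VV p z).

Lemma SV_SA m : L12 (SA m) /\ cint mm (unc (SV m)) = (2^-1)%:C * cint mm (unc (SA m)).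
Proof.
have [i1 e1] := cint_mm_reflect1 (SV_L12 m).
have E : SA m = (fun z x => SV m z x + SV m (- z - x) x).
  apply/funext => z; apply/funext => x.
  have zz : - (- z - x) - x = z by rewrite opprB opprK addrAC subrr add0r.
  rewrite /SV zz dotU_opp /SA rmorphB /=.
  rewrite (eq_bigr (fun p => VV p z * VV p (- z - x))); last by move=> p _; rewrite mulrC.
  by rewrite -/(VV _); ring.
have i2 : L12 (SA m) by rewrite E; exact: (L12D (SV_L12 m) i1).
split; first exact: i2.
have -> : unc (SA m) = fun w => unc (SV m) w + unc (fun z x => SV m (- z - x) x) w.
  by rewrite E.
rewrite (cintD (SV_L12 m) i1) -e1; set X := cint mm _.
by apply: complexP; rewrite ?ReZ ?ImZ ?ReD ?ImD; lra.
Qed.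

(** $U(x)\cdot z=-U(x)\cdot y$ gives the factor $\min(|y|,|z|)$, and by [chi_sub] its product with
    the difference of the cutoffs is also at most $|x|$. The least of the three moduli thus appears,
    with a bound independent of [m]. *)
Lemma SA_bound m z x : normc (SA m z x) <= 9 * V3 ^+ 2 * PhiN z x.
Proof.
set y := - z - x; have [h2|h2] := ltP (enorm y) dl.
  rewrite /SA -/y big1 ?mulr0 ?normc_real ?normr0; last by move=> p _; rewrite (VV_near _ h2) mul0r.
  by rewrite mulr_ge0// mulr_ge0// sqr_ge0.
have tr : `|enorm y - enorm z| <= enorm x.
  rewrite ler_norml; apply/andP; split.
    have := ler_enormD (- y) (- x); rewrite !enormN /y opprB opprK addrAC subrr add0r; lra.
  have := ler_enormD (- z) (- x); rewrite !enormN -/y; lra.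
have [c1 cz] := chi_sub m tr.
set ch := `|chi m z - chi m y| in c1 cz.
have ch0 : 0 <= ch by exact: normr_ge0.
set mi := Num.min (enorm z) (enorm y).
have mi0 : 0 <= mi by rewrite /mi le_min !enorm_ge0.
have dU : normc (dotU x z) <= 3 * (mi * N x).
  have [zy|yz] := leP (enorm z) (enorm y).
    by rewrite /mi min_l//; apply: normc_dot3 => [|j|j]; [exact: enorm_ge0|exact: coord_le_enorm|exact: normc_vnorm].
  rewrite /mi (min_r (ltW yz)) -normcN -dotU_opp -/y.
  by apply: normc_dot3 => [|j|j]; [exact: enorm_ge0|exact: coord_le_enorm|exact: normc_vnorm].
have dV : normc (\sum_(p < 3) VV p y * VV p z) <= 3 * ((V3 * N y) * (V3 * N z)).
  apply: (le_trans (normc_sum _ _ _)).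
  apply: (@le_trans _ _ (\sum_(p < 3) (V3 * N y) * (V3 * N z))).
    apply: ler_sum => p _; rewrite (Normc.normcM (VV p y)).
    by apply: ler_pM; rewrite ?normc_ge0 ?VV_le.
  by rewrite !big_ord_recl big_ord0 /=; lra.
have PB : (ch * mi) * N z * N x * N y <= PhiN z x.
  apply: Phi_bound => //; first by rewrite mulr_ge0.
  - by rewrite -[leRHS]mul1r; apply: ler_pM => //; rewrite /mi ge_min lexx.
  - by apply: le_trans cz; rewrite ler_wpM2l// /mi ge_min lexx.
  - by rewrite -[leRHS]mul1r; apply: ler_pM => //; rewrite /mi ge_min lexx orbT.
rewrite /SA -/y (Normc.normcM _ (dotU x z * _)) normc_real -/ch (Normc.normcM (dotU x z)).
apply: (@le_trans _ _ (ch * ((3 * (mi * N x)) * (3 * ((V3 * N y) * (V3 * N z)))))).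
  by rewrite ler_wpM2l//; apply: ler_pM; rewrite ?normc_ge0.
rewrite [leLHS](_ : _ = 9 * V3 ^+ 2 * ((ch * mi) * N z * N x * N y)); last by ring.
by rewrite ler_wpM2l// mulr_ge0// sqr_ge0.
Qed.

Variable k1 : C.
Hypothesis Hid : {ae mu, forall z, L1 mu (Tz z) /\ k1 * (D z)%:C = cint mu (Tz z)}.

Lemma energy_chi m : k1 * (\int[mu]_z (chi m z * (1 - rho z) * D z))%:C =
  cint mm (unc (SW m)) + (2^-1)%:C * cint mm (unc (SA m)).
Proof.
have jW : L12 (SW m).
  have mc := cmeas_real (chi_measurable m).
  apply: (L1_bounded (c := 1) PP_L12 (cmeasN (cmeas2_1 mc))) => -[z x].
  change (normc (- (chi m z)%:C) <= 1).
  by rewrite normcN normc_real ger0_norm ?chi_ge0 ?chi_le1.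
have [_ <-] := SV_SA m; rewrite -(cintD jW (SV_L12 m)).
have jS := L12D jW (SV_L12 m).
have -> : (fun w => unc (SW m) w + unc (SV m) w) = unc (fun z x => SW m z x + SV m z x) by [].
have mD := rint_meas iD.
have mr : measurable_fun setT (fun z => chi m z * (1 - rho z)).
  apply: measurable_funM; first exact: chi_measurable.
  by apply: measurable_funB; [exact: measurable_cst|exact: rho_measurable].
have iR : rint mu (fun z => chi m z * (1 - rho z) * D z).
  apply: (@rint_le _ _ _ mu (fun z => V3 * D z)); last exact: rintZ.
    exact: measurable_funM.
  move=> z; rewrite normrM (ger0_norm (sqr_ge0 _ : 0 <= D z)) ler_wpM2r//; first exact: sqr_ge0.
  rewrite normrM (ger0_norm (chi_ge0 m z)) -[leRHS]mul1r ler_pM ?chi_ge0 ?chi_le1//.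
  by rewrite (le_trans (ler_normB _ _))// normr1 lerD2l hMp.
rewrite -(cfub_eq1 jS) -cint_real -cintZ; last exact: L1_real.
apply: cint_ae.
- exact: (cmeasM (cmeas_cst _ _) (cmeas_real (rint_meas iR))).
- exact: (L1_cmeas (cfub_L1 jS)).
apply: filterS Hid => z [iz ez].
under [RHS]eq_cint do rewrite SWV.
by rewrite cintZ// -ez rmorphM; ring.
Qed.

(** As [m] grows, [SW m] tends to [- PP] under the majorant [normc PP], and [SA m] tends to 0 under
    the majorant of [SA_bound]. *)
Lemma energy : k1 * (\int[mu]_z ((1 - rho z) * D z))%:C = - cint mm (unc PP).
Proof.
have mD := rint_meas iD.
have mr : measurable_fun setT (fun z => (1 - rho z)).
  by apply: measurable_funB; [exact: measurable_cst|exact: rho_measurable].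
have bD z : `|(1 - rho z) * D z| <= V3 * D z.
  rewrite normrM (ger0_norm (sqr_ge0 _ : 0 <= D z)) ler_wpM2r//; first exact: sqr_ge0.
  by rewrite (le_trans (ler_normB _ _))// normr1 lerD2l hMp.
have cL : ccvg (fun m => k1 * (\int[mu]_z (chi m z * (1 - rho z) * D z))%:C)
    (k1 * (\int[mu]_z ((1 - rho z) * D z))%:C).
  apply: ccvgM (ccvg_cst k1) _; apply/ccvg_ReIm; split=> /=; last exact: cvg_cst.
  have [] := @rDCT _ _ _ mu (fun m z => chi m z * (1 - rho z) * D z)
    (fun z => (1 - rho z) * D z) (fun z => V3 * D z).
  - move=> m; apply: measurable_funM => //; apply: measurable_funM => //; exact: chi_measurable.
  - exact: measurable_funM.
  - apply: nearW => z; rewrite -[X in _ --> X]mul1r; under eq_fun do rewrite -mulrA.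
    by apply: cvgM; [exact: chi_cvg|exact: cvg_cst].
  - exact: rintZ.
  - move=> m z; rewrite -mulrA normrM (ger0_norm (chi_ge0 m z)) -[leRHS]mul1r.
    by apply: ler_pM; rewrite ?chi_ge0 ?chi_le1.
  by move=> _ h; exact: h.
have cW : ccvg (fun m => cint mm (unc (SW m))) (cint mm (fun w => - unc PP w)).
  have [] := @cDCT _ _ _ mm (fun m => unc (SW m)) (fun w => - unc PP w) (fun w => normc (unc PP w)).
  - move=> m; apply: cmeasM (L1_cmeas PP_L12).
    exact: (cmeasN (cmeas2_1 (cmeas_real (chi_measurable m)))).
  - exact: (cmeasN (L1_cmeas PP_L12)).
  - apply: nearW => -[z x]; rewrite /unc /SW /= -[- PP z x]mulN1r; apply: ccvgM (ccvg_cst _).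
    apply/ccvg_ReIm; split=> /=; last exact: cvg_cst.
    by apply: cvgN; exact: chi_cvg.
  - exact: (L1_normc PP_L12).
  - move=> m [z x]; rewrite /unc /SW /= Normc.normcM normcN normc_real ger0_norm ?chi_ge0//.
    by rewrite ler_piMl ?normc_ge0 ?chi_le1.
  by move=> _ h; exact: h.
have cA : ccvg (fun m => cint mm (unc (SA m))) (cint mm (fun=> 0)).
  have [] := @cDCT _ _ _ mm (fun m => unc (SA m)) (fun=> 0) (fun w => 9 * V3 ^+ 2 * unc PhiN w).
  - by move=> m; exact: (L1_cmeas (SV_SA m).1).
  - exact: cmeas_cst.
  - apply: nearW => -[z x]; rewrite /unc /SA /= -[X in ccvg _ X](mul0r (dotU x z * \sum_(p < 3) VV p (- z - x) * VV p z)).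
    apply: ccvgM (ccvg_cst _); apply/ccvg_ReIm; split=> /=; last exact: cvg_cst.
    by rewrite -[X in _ --> X](subrr (1 : R)); apply: cvgB; exact: chi_cvg.
  - exact: (rint2Z (9 * V3 ^+ 2) iPhi).
  - by move=> m [z x]; exact: SA_bound.
  by move=> _ h; exact: h.
have cR := ccvgD cW (ccvgM (ccvg_cst (2^-1)%:C) cA).
rewrite cint0 mulr0 addr0 cintN in cR; last exact: PP_L12.
apply: (ccvg_unique cL); move: cR; congr ccvg; apply/funext => m; exact: esym (energy_chi m).
Qed.

Lemma cint_mm_reflect2 k : L12 k -> cint mm (unc k) = cint mm (unc (fun z x => k z (- z - x))).
Proof.
move=> jk; have i2 := L12_reflect (@measurable_opp3 R) jk.
rewrite -(cfub_eq1 jk) -(cfub_eq1 i2); apply: cint_ae.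
- exact: (L1_cmeas (cfub_L1 jk)).
- exact: (L1_cmeas (cfub_L1 i2)).
by apply: filterS (cfub_ae jk) => z iz; rewrite -(cint_reflect (- z) iz).
Qed.

Lemma PP_bound M1 M2 : 0 <= M1 -> 0 <= M2 ->
  (forall j, {ae mu, forall x, normc (FI (WW j) x) <= M2}) ->
  (forall j p, {ae mu, forall x, normc (FI (yW j p) x) <= M1}) ->
  normc (cint mm (unc PP)) <= 9 * (multiplier_const psi * M1 * ((V3 * La) ^+ 2 * bb) +
    multiplier_const psi * M2 * (V3 * Mp * La ^+ 2 / lam * Num.sqrt (bb * EE))).
Proof.
move=> M10 M20 h2 h1; have b0 := bb_ge0; have E0 := EE_ge0.
have CM0 : 0 <= multiplier_const psi.
  by rewrite /multiplier_const divr_ge0 ?CP_ge0// mulr_ge0// ltW ?c0_gt0 ?kapr_gt0.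
set K1 := multiplier_const psi * M1 * _; set K2 := multiplier_const psi * M2 * _.
have e1 j p : normc (cint mm (unc (P1 j p))) <= K1.
  have [Vp np] := VV_L2 p; have [Vj nj] := VV_L2 j.
  rewrite -(cfub_eq1 (P1_L12 j p)).
  apply: (le_trans (mult_bound Hpsi Vp Vj (yW_L1 j p) M10 (h1 j p))).
  apply: ler_wpM2l; first by rewrite mulr_ge0.
  have X0 : 0 <= (V3 * La) ^+ 2 * bb by rewrite mulr_ge0// sqr_ge0.
  rewrite -[leRHS](ger0_norm X0) -sqrtr_sqr; apply: ler_wsqrtr.
  by rewrite expr2; apply: ler_pM => //; exact: nsq_ge0.
have e2 j p : normc (cint mm (unc (P2 j p))) <= K2.
  have [Vp np] := VV_L2 p; have [Yj nj] := yW_L2 j p.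
  have iT := L12_tri Vp Yj (WW_L1 j).
  (* The reflection $x\mapsto-z-x$ puts the integrable factor [WW] in the position of the kernel in
     [mult_bound]. *)
  have -> : cint mm (unc (P2 j p)) = cint mm (unc (fun z x => VV p z * (yW j p x * WW j (- z - x)))).
    rewrite (cint_mm_reflect2 iT); congr (cint mm (unc _)).
    by apply/funext => z; apply/funext => x; rewrite subKr.
  rewrite -(cfub_eq1 iT).
  apply: (le_trans (mult_bound Hpsi Vp Yj (WW_L1 j) M20 (h2 j))).
  apply: ler_wpM2l; first by rewrite mulr_ge0.
  have X0 : 0 <= V3 * Mp * La ^+ 2 / lam.
    apply: mulr_ge0; last by rewrite invr_ge0 ltW.
    by apply: mulr_ge0 (sqr_ge0 _); apply: mulr_ge0; [exact: V30|exact: Mp0].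
  apply: (@le_trans _ _ (Num.sqrt ((V3 * Mp * La ^+ 2 / lam) ^+ 2 * (bb * EE)))).
    apply: ler_wsqrtr; rewrite [leRHS](_ : _ = ((V3 * La) ^+ 2 * bb) * ((Mp * La / lam) ^+ 2 * EE)).
      by apply: ler_pM => //; exact: nsq_ge0.
    by field; rewrite lt0r_neq0.
  by rewrite sqrtrM ?sqr_ge0// sqrtr_sqr ger0_norm.
have E : unc PP = fun w => \sum_(j < 3) \sum_(p < 3) (unc (P1 j p) w + unc (P2 j p) w) by [].
have i12 j p := L1D (P1_L12 j p) (P2_L12 j p).
rewrite E cint_sum; last by move=> j; apply: L1_sum => p; exact: i12.
apply: (le_trans (normc_sum _ _ _)).
apply: (@le_trans _ _ (\sum_(j < 3) \sum_(p < 3) (K1 + K2))).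
  apply: ler_sum => j _; rewrite cint_sum; last by move=> p; exact: i12.
  apply: (le_trans (normc_sum _ _ _)); apply: ler_sum => p _.
  rewrite (cintD (P1_L12 j p) (P2_L12 j p)); apply: (le_trans (le_normcD _ _)).
  exact: lerD (e1 j p) (e2 j p).
by rewrite !big_ord_recl !big_ord0 /=; lra.
Qed.
End Split.

(** * Bernstein's inequality *)

Section Bernstein.
Variable R : realType.
Local Notation R3 := (R * R * R)%type.
Local Notation C := R[i].
Local Notation mu := (mu3 R).
Variables (psi : R3 -> R) (Hpsi : cutoff psi).

(** By inversion [g] is a superposition of characters, so [FI] of the product is a constant times
    the convolution of [FI g] with [FI F], bounded by the integral of [normc (FI g t)] times [M]. *)
Lemma FI_mul_bound (g F : R3 -> C) (M : R) : ctest g -> L1 mu F -> 0 <= M ->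
  {ae mu, forall x, normc (FI F x) <= M} -> forall x,
  normc (FI (fun y => g y * F y) x) <= c0 R / kapr psi * (\int[mu]_t normc (FI g t)) * M.
Proof.
move=> tg jF M0 hM x; have jG := FI_L1 tg; have kp := kapr_gt0 Hpsi.
have [Mg Mg0 hMg] := ctest_bounded tg.
have gE y : (kapr psi)%:C * g y = (c0 R)%:C * cint mu (fun t => cis (- dot y t) * FI g t).
  rewrite -(kapE Hpsi) -[y in LHS]opprK -(FI_inv_test Hpsi (- y) tg) FIE; congr (_ * _).
  by apply: eq_cint => t; rewrite dotNl.
have L : L12 (fun y t => cis (dot (x - t) y) * (F y * FI g t)).
  have mc : cmeas2 (fun y t : R3 => cis (dot (x - t) y)).
    have m1 : cmeas2 (fun y t : R3 => cis (dot x y)) by exact: (cmeas2_1 (cis_meas x)).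
    have m2 := cmeasM m1 (cmeasJ (@cis_meas2 R)).
    have m3 : cmeas2 (fun y t : R3 => cis (dot x y) * (cis (dot t y))^*).
      have := cmeasM m1 (cmeasJ (cmeas_comp (@cis_meas2 R) (@measurable_swap2 R))).
      exact.
    move: m3; congr cmeas; apply/funext => -[y t]; rewrite /unc /=.
    by rewrite cisJ -cisD dotDl dotNl.
  apply: (L1_bounded (c := 1) (L12_prod jF jG) mc) => w.
  by rewrite normc_cis.
have E : (kapr psi)%:C * FI (fun y => g y * F y) x =
   (c0 R)%:C * cint mu (fun t => FI g t * FI F (x - t)).
  have jgF := L1_bounded jF (ctest_cmeas tg) hMg.
  rewrite FIE mulrCA -(cintZ (kapr psi)%:C (L1_cis x jgF)).
  rewrite (@eq_cint _ _ _ mu _ (fun y => (c0 R)%:C * cint mu (fun t => cis (dot (x - t) y) * (F y * FI g t)))); last first.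
    move=> y; rewrite (_ : _ * (cis _ * _) = cis (dot x y) * F y * ((kapr psi)%:C * g y)); last by ring.
    have jc : L1 mu (fun t => cis (- dot y t) * FI g t).
      by have := L1_cis (- y) jG; congr L1; apply/funext => t; rewrite dotNl.
    rewrite gE mulrCA -(cintZ _ jc).
    congr (_ * _); apply: eq_cint => t.
    by rewrite dotDl dotNl cisD (dotC y t); ring.
  rewrite cintZ; last exact: (cfub_L1 L).
  rewrite cfub_swap//; congr (_ * _).
  rewrite -cintZ; last exact: (cfub_L1 (L12_swap L)).
  apply: eq_cint => t; rewrite [FI F _]FIE.
  rewrite (@eq_cint _ _ _ mu _ (fun y => FI g t * (cis (dot (x - t) y) * F y))); last by move=> y; ring.
  by rewrite (cintZ (FI g t) (L1_cis (x - t) jF)) mulrCA.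
have mFr : cmeas (fun t : R3 => FI F (x - t)).
  exact: (cmeas_comp (FI_cmeas jF) (@measurable_reflect R x)).
have jP : L1 mu (fun t => FI g t * FI F (x - t)).
  have := L1_bounded jG mFr (fun t => FI_bound (x - t) jF).
  by congr L1; apply/funext => t; rewrite mulrC.
have E2 : kapr psi * normc (FI (fun y => g y * F y) x) =
    c0 R * normc (cint mu (fun t => FI g t * FI F (x - t))).
  have := congr1 (@Normc.normc R) E.
  rewrite (Normc.normcM (kapr psi)%:C (FI _ x)).
  rewrite (Normc.normcM (c0 R)%:C (cint mu (fun t => FI g t * FI F (x - t)))).
  by rewrite (normc_real (kapr psi)) (normc_real (c0 R)) (gtr0_norm kp) (gtr0_norm (c0_gt0 R)).
rewrite -(ler_pM2l kp) E2.
rewrite [leRHS](_ : _ = c0 R * (M * \int[mu]_t normc (FI g t))); last by field; rewrite lt0r_neq0.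
rewrite ler_wpM2l ?(ltW (c0_gt0 R))// (le_trans (normc_cint jP))//.
rewrite -RintZ; last exact: (L1_normc jG).
apply: Rint_le_ae; first exact: (L1_normc jP).
  by apply: rintZ; exact: (L1_normc jG).
apply: filterS (ae_reflect x hM) => t ht.
by rewrite (Normc.normcM (FI g t) (FI F _)) mulrC ler_wpM2r ?normc_ge0.
Qed.
End Bernstein.

(** * Vanishing of the energy along a sequence of low frequencies *)

Section FourierSide.
Variable R : realType.
Local Notation R3 := (R * R * R)%type.
Local Notation C := R[i].
Local Notation mu := (mu3 R).
Variables (psi : R3 -> R) (Hpsi : cutoff psi).

Lemma bump_coord_test j : ctest (fun x : R3 => (coord3 j x)%:C * psiC psi (2^-1 *: x + 0)).
Proof.
apply: ctest_coord; apply: ctest_affine; last exact: (psiC_test Hpsi).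
by rewrite invr_eq0.
Qed.

(** A test function equal to $x_j$ on the whole unit ball; the dilation by 2 is there because [psi]
    is known to be 1 only on the ball of radius 1/2. *)
Definition bumpj j (x : R3) : C := (coord3 j x)%:C * psiC psi (2^-1 *: x + 0).
Definition bernstein_const : R := \sum_(j < 3) \int[mu]_t normc (FI (bumpj j) t).

Lemma Gb_ge j : \int[mu]_t normc (FI (bumpj j) t) <= bernstein_const.
Proof.
rewrite /bernstein_const (bigD1 j)//= lerDl sumr_ge0// => i _.
by apply: Rint_ge0 => x; exact: normc_ge0.
Qed.

(** On the support of [rho] the factor $x_j$ equals $\lambda^{-1}b_j(\lambda x)$, with $b_j$ =
    [bumpj j]. The integral of the modulus of the transform is invariant under dilation of $b_j$, so
    the derivative costs only [lam^-1]. *)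
Lemma yW_FI (U : 'I_3 -> R3 -> C) (lam M : R) : 0 < lam -> 0 <= M ->
  (forall j, L1 mu (WW psi U lam j)) ->
  (forall j, {ae mu, forall x, normc (FI (WW psi U lam j) x) <= M}) ->
  forall j p, {ae mu, forall x, normc (FI (yW psi U lam j p) x) <= c0 R / kapr psi * bernstein_const / lam * M}.
Proof.
move=> lam0 M0 WL hM j p; apply: nearW => x.
have ln := lt0r_neq0 lam0; have tb := bump_coord_test j; have ib := ctest_L1 tb.
pose g (y : R3) : C := (lam^-1)%:C * bumpj j (lam *: y).
have tg : ctest g.
  apply: ctestZ; have := ctest_affine (0 : R3) ln tb.
  by congr ctest; apply/funext => y; rewrite addr0.
have -> : FI (yW psi U lam j p) x = FI (fun y => g y * WW psi U lam p y) x.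
  apply: eq_FI => y; rewrite /yW /WW /g /bumpj coord3Z addr0 scalerA.
  rewrite /psiC /rho; have [far|near] := ltP 1 (enorm (lam *: y)).
    case: Hpsi => _ _ hf _; rewrite (hf _ far) !mul0r; ring.
  have -> : psi ((2^-1 * lam) *: y) = 1.
    case: Hpsi => _ _ _; apply; rewrite -scalerA enormZ gtr0_norm ?invr_gt0//.
    by rewrite div1r ler_piMr// invr_ge0.
  congr (_ * _); rewrite (_ : (1 : R)%:C = 1)// mulr1 -rmorphM /= mulKf//.
apply: (le_trans (FI_mul_bound Hpsi tg (WL p) M0 (hM p) x)).
rewrite ler_wpM2r//.
have ck : 0 <= c0 R / kapr psi by rewrite divr_ge0 ?ltW ?c0_gt0 ?kapr_gt0.
rewrite [leRHS](_ : _ = c0 R / kapr psi * (bernstein_const / lam)); last by rewrite [RHS]mulrA.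
apply: ler_wpM2l => //.
have jF := FI_L1 tb; have ln1 : 0 < lam^-1 by rewrite invr_gt0.
have -> : \int[mu]_t normc (FI g t) = lam^-1 * \int[mu]_t normc (FI (bumpj j) t).
  have iba : L1 mu (fun y : R3 => bumpj j (lam *: y)).
    by have := L1_affine 0 lam0 ib; congr L1; apply/funext => y; rewrite addr0.
  have E t : normc (FI g t) = lam^-1 * lam ^- 3 * normc (FI (bumpj j) (lam^-1 *: t + 0)).
    have l3 : 0 < lam ^- 3 by rewrite invr_gt0 exprn_gt0.
    rewrite /g (FIZ _ _ iba) (FI_scale _ lam0 ib) addr0.
    rewrite (Normc.normcM (lam^-1)%:C) (Normc.normcM (lam ^- 3)%:C (FI _ _)).
    by rewrite (normc_real lam^-1) (normc_real (lam ^- 3)) (gtr0_norm ln1) (gtr0_norm l3) mulrA.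
  have ia := rint_affine 0 ln1 (L1_normc jF).
  rewrite (_ : (fun t => normc (FI g t)) = fun t => lam^-1 * lam ^- 3 * normc (FI (bumpj j) (lam^-1 *: t + 0))).
    by rewrite (RintZ _ ia) (Rint_affine 0 ln1 (L1_normc jF)); field.
  by apply/funext => t; exact: E.
by rewrite mulrC; apply: ler_wpM2r; [exact: ltW|exact: Gb_ge].
Qed.

Variable s : R.
Hypotheses (s56 : 5 / 6 <= s) (s1 : s < 1).
Variable U : 'I_3 -> R3 -> C.
Hypothesis U_cmeas : forall j, cmeas (U j).
Hypothesis HL : forall j h, ctest h -> L1 mu (fun x => U j x * h x).
Hypothesis Hdiv : forall x, \sum_(j < 3) (coord3 j x)%:C * U j x = 0.
Local Notation N := (vnorm U).
Local Notation D := (D2 s N).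
Hypothesis iD : rint mu D.
Variable k1 : C.
Hypothesis k10 : k1 != 0.
Hypothesis Hid : {ae mu, forall z, L1 mu (Tz U z) /\ k1 * (D z)%:C = cint mu (Tz U z)}.

Let s0 : 0 < s. Proof. by apply: lt_le_trans s56; rewrite divr_gt0. Qed.

Definition la (n : nat) : R := 2 ^+ n.
Definition La n : R := la n `^ s.

Lemma la_gt0 n : 0 < la n. Proof. by rewrite exprn_gt0. Qed.
Lemma La_gt0 n : 0 < La n. Proof. by rewrite powR_gt0// la_gt0. Qed.

Lemma La_expr n : La n = (2 `^ s) ^+ n.
Proof.
by rewrite /La /la -powR_mulrn// -powRrM mulrC powRrM powR_mulrn// powR_ge0.
Qed.

Lemma La_inv_cvg : (fun n => La n ^- 2) @ \oo --> (0 : R).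
Proof.
rewrite (_ : (fun n => _) = (fun n => ((2 `^ s) ^- 2) ^+ n)).
  apply: cvg_expr; rewrite ger0_norm; last by rewrite invr_ge0 sqr_ge0.
  rewrite invf_lt1 ?exprn_gt0 ?powR_gt0// expr_gt1 ?powR_ge0//.
  by rewrite /powR pnatr_eq0 /= expR_gt1 mulr_gt0// ln_gt0// ltr1n.
by apply/funext => n; rewrite La_expr -!exprVn exprAC.
Qed.

Lemma la_unbounded (c : R) : exists n0, forall n, (n0 <= n)%N -> c < la n.
Proof.
exists (Num.bound c) => n hn; apply: (@lt_le_trans _ _ (Num.bound c)%:R).
  have [c0|c0] := leP 0 c; first exact: archi_boundP.
  by apply: lt_le_trans c0 _; rewrite ler0n.
by rewrite /la -natrX ler_nat (leq_trans hn)// ltnW// ltn_expl.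
Qed.

(** Pointwise the integrand is at most $2^{-2ns}|U(x)|^2$, which tends to 0, and [far_le] provides a
    majorant independent of [n]. *)
Lemma bb_cvg : (fun n => bb s U (la n)) @ \oo --> (0 : R).
Proof.
have [] := @rDCT _ _ _ mu (fun n x => La n ^- 2 * (\1_(farset (la n)) x * N x ^+ 2)) (fun=> 0)
  (fun x => 4 * D x).
- by move=> n; exact: (rint_meas (bb_rint s56 s1 U_cmeas iD (la_gt0 n))).
- exact: measurable_cst.
- apply: nearW => x.
  apply: (@squeeze_cvgr _ _ _ _ (fun=> 0) (fun n => La n ^- 2 * N x ^+ 2)).
  + apply: nearW => n; apply/andP; split.
      by rewrite mulr_ge0 ?invr_ge0 ?sqr_ge0// mulr_ge0// sqr_ge0.
    have i1 : (\1_(farset (la n)) x : R) <= 1 by rewrite indicE; case: (_ \in _).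
    apply: ler_wpM2l; first by rewrite invr_ge0 sqr_ge0.
    by rewrite -[leRHS]mul1r; apply: ler_wpM2r => //; exact: sqr_ge0.
  + exact: cvg_cst.
  + by rewrite -[X in _ --> X](mul0r (N x ^+ 2)); apply: cvgM; [exact: La_inv_cvg|exact: cvg_cst].
- exact: rintZ.
- move=> n x; rewrite ger0_norm; first exact: (far_le s56 s1 U (la_gt0 n)).
  by rewrite mulr_ge0 ?invr_ge0 ?sqr_ge0// mulr_ge0// sqr_ge0.
by move=> _; rewrite /Rintegral integral0.
Qed.

(** The low-pass cutoff eventually vanishes at every point except the origin, where the energy
    density itself is 0. *)
Lemma far_energy_cvg Mp : (forall x, `|psi x| <= Mp) ->
  (fun n => \int[mu]_z ((1 - rho psi (la n) z) * D z)) @ \oo --> EE s U.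
Proof.
move=> hMp; have mD := rint_meas iD.
have [] := @rDCT _ _ _ mu (fun n z => (1 - rho psi (la n) z) * D z) D (fun z => (1 + Mp) * D z).
- move=> n; apply: measurable_funM mD; apply: measurable_funB; first exact: measurable_cst.
  exact: (rho_measurable Hpsi (la_gt0 n)).
- exact: mD.
- apply: nearW => z; have [z0|z0] := eqVneq (enorm z) 0.
    have -> : D z = 0 by rewrite /D2 z0 powR0 ?lt0r_neq0// mul0r expr0n.
    by under eq_fun do rewrite mulr0; exact: cvg_cst.
  have z1 : 0 < enorm z by rewrite lt_def z0 enorm_ge0.
  apply: cvg_near_cst; have [n0 h0] := la_unbounded (enorm z)^-1.
  exists n0 => // n /= hn; rewrite (rho_far Hpsi (la_gt0 n)) ?subr0 ?mul1r//.
  rewrite -(@ltr_pM2l _ (la n)) ?la_gt0// mulfV ?lt0r_neq0 ?la_gt0//.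
  by rewrite -(ltr_pM2r (_ : 0 < (enorm z)^-1)) ?invr_gt0// mul1r mulfK ?h0// lt0r_neq0.
- exact: rintZ.
- move=> n z; rewrite normrM (ger0_norm (sqr_ge0 _ : 0 <= D z)) ler_wpM2r//; first exact: sqr_ge0.
  by rewrite (le_trans (ler_normB _ _))// normr1 lerD2l hMp.
by move=> _ h; exact: h.
Qed.

(** The common form of the three low-frequency conditions: [la n / La n ^+ 2] is $2^{n(1-2s)}$, and
    a bound for infinitely many [n] is what a finite lower limit provides. *)
Hypothesis Hcore : exists M : R, forall n0 : nat, exists n, (n0 <= n)%N /\
  forall j, {ae mu, forall x, normc (FI (WW psi U (la n) j) x) <= M * (la n / La n ^+ 2)}.

Lemma EE_eq0 : EE s U = 0.
Proof.
have [M0' hcore] := Hcore; pose M := `|M0'|.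
have [Mp Mp0 hMp] := test_bounded (psi_test Hpsi).
have M0 : 0 <= M by exact: normr_ge0.
have b0 n : 0 <= bb s U (la n) by exact: bb_ge0.
have E0 : 0 <= EE s U by exact: EE_ge0.
set V3 := 1 + Mp.
pose cA := c0 R / kapr psi * bernstein_const.
(* Once the size of the low-frequency part is inserted in [PP_bound], the powers of [la n] and
   [La n] cancel, and [bb] alone decides the limit. *)
pose r n := 9 * multiplier_const psi * M * (cA * V3 ^+ 2 * bb s U (la n) + V3 * Mp * Num.sqrt (bb s U (la n) * EE s U)).
have r0 : r @ \oo --> (0 : R).
  rewrite (_ : 0 = 9 * multiplier_const psi * M * (cA * V3 ^+ 2 * 0 + V3 * Mp * 0)); last by ring.
  apply: cvgM; first exact: cvg_cst.
  apply: cvgD; apply: cvgM; try exact: cvg_cst; first exact: bb_cvg.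
  have c1 : (fun n => bb s U (la n) * EE s U) @ \oo --> (0 : R).
    by rewrite -[X in _ --> X](mul0r (EE s U)); apply: cvgM; [exact: bb_cvg|exact: cvg_cst].
  have := cvg_comp _ _ c1 (@sqrt_continuous R 0); rewrite sqrtr0; exact.
have hb n : (forall j, {ae mu, forall x, normc (FI (WW psi U (la n) j) x) <= M0' * (la n / La n ^+ 2)}) ->
    normc k1 * `|\int[mu]_z ((1 - rho psi (la n) z) * D z)| <= r n.
  move=> h; have l0 := la_gt0 n; have L0 := La_gt0 n.
  set M2 := M * (la n / La n ^+ 2).
  have M20 : 0 <= M2 by rewrite mulr_ge0// divr_ge0 ?sqr_ge0// ltW.
  have h2 j : {ae mu, forall x, normc (FI (WW psi U (la n) j) x) <= M2}.
    apply: filterS (h j) => x hx; apply: (le_trans hx); rewrite ler_wpM2r ?ler_norm//.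
    by rewrite divr_ge0 ?sqr_ge0// ltW.
  have h1 := yW_FI l0 M20 (WW_L1 Hpsi HL l0) h2.
  have M10 : 0 <= c0 R / kapr psi * bernstein_const / la n * M2.
    rewrite mulr_ge0// divr_ge0 ?(ltW l0)// mulr_ge0//.
      by rewrite divr_ge0 ?ltW ?c0_gt0 ?kapr_gt0.
    by apply: sumr_ge0 => j _; apply: Rint_ge0 => x; exact: normc_ge0.
  have PB := PP_bound Hpsi s56 s1 U_cmeas HL iD hMp l0 M10 M20 h2 h1.
  have := energy Hpsi s56 s1 U_cmeas HL Hdiv iD hMp l0 Hid.
  move=> /(congr1 (@Normc.normc R)); rewrite Normc.normcM normc_real normcN => ->.
  apply: (le_trans PB); rewrite -/(La n) /r /M2 /cA -/V3 le_eqVlt; apply/orP; left; apply/eqP.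
  field.
  by rewrite !lt0r_neq0 ?kapr_gt0.
apply/eqP; rewrite eq_le E0 andbT leNgt; apply/negP => Epos.
have kp : 0 < normc k1.
  rewrite lt_def normc_ge0 andbT; apply/eqP => /Normc.eq0_normc kk; by move: k10; rewrite kk eqxx.
(* A third, since the energy term and its bound are each within [e] of their limits, leaving $2e$
   against $3e$. *)
pose e := normc k1 * EE s U / 3.
have e0 : 0 < e by rewrite divr_gt0// mulr_gt0.
have cE : (fun n => normc k1 * `|\int[mu]_z ((1 - rho psi (la n) z) * D z)|) @ \oo --> normc k1 * EE s U.
  apply: cvgM; first exact: cvg_cst.
  by rewrite -[X in _ --> X](ger0_norm E0); apply: cvg_norm; exact: (far_energy_cvg hMp).
move/cvgrPdist_le/(_ _ e0) : cE => [n1 _ h1].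
move/cvgrPdist_le/(_ _ e0) : r0 => [n2 _ h2].
have [n [hn hc]] := hcore (maxn n1 n2).
have a1 := h1 n (leq_trans (leq_maxl _ _) hn).
have a2 := h2 n (leq_trans (leq_maxr _ _) hn).
have a3 := hb n hc; move: a1 a2 => /=; rewrite sub0r normrN => a1 a2.
have a4 := le_trans (ler_norm _) a1; have a5 := le_trans (ler_norm _) a2.
have : normc k1 * EE s U <= e + e by lra.
rewrite /e; have := mulr_gt0 kp Epos; lra.
Qed.

Lemma enorm_neq0_ae : {ae mu, forall x, enorm x != 0}.
Proof.
exists (cube (0 : R)); split; first exact: cube_measurable.
  by rewrite mu3_cube// mulr0 expr0n.
by move=> x /= /negP; rewrite negbK => /eqP e0; apply: enorm_cube; rewrite e0.
Qed.

Lemma energy_argument : {ae mu, forall x, forall j, U j x = 0}.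
Proof.
have mD := rint_meas iD; have D0 x : 0 <= D x by exact: sqr_ge0.
have := (ae_eq_integral_abs mu measurableT (proj2 (measurable_EFinP _ _) mD)).1.
rewrite (_ : (\int[mu]_(x in setT) `|(D x)%:E|)%E = 0%E); last first.
  under eq_integral do rewrite abse_EFin (ger0_norm (D0 _)).
  by rewrite -EFin_Rint// -/(EE s U) EE_eq0.
move=> /(_ erefl); apply: filterS2 enorm_neq0_ae => x x0 /(_ I) [] /eqP.
rewrite /D2 sqrf_eq0 mulf_eq0 => /orP[|].
  by rewrite gt_eqF// powR_gt0// lt_def x0 enorm_ge0.
move=> /eqP N0 j; have := normc_vnorm U j x; rewrite N0 => h.
by apply: Normc.eq0_normc; apply/eqP; rewrite eq_le h normc_ge0.
Qed.
End FourierSide.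

(** * Weak solutions on the Fourier side *)

Section Represent.
Variable R : realType.
Local Notation R3 := (R * R * R)%type.
Local Notation C := R[i].
Local Notation mu := (mu3 R).
Variables (psi : R3 -> R) (Hpsi : cutoff psi).

Lemma schwartz_bounded (f : R3 -> C) : schwartz f -> exists2 M, 0 <= M & forall x, normc (f x) <= M.
Proof.
move=> /(schwartz_decay 0) [M M0 hM]; exists M => // x.
by have := hM x; rewrite expr0 mulr1.
Qed.

Lemma schwartz_L2 (f : R3 -> C) : schwartz f -> L2 mu f.
Proof. by move=> sf; have [M _ hM] := schwartz_bounded sf; exact: (L1b_L2 (schwartz_L1 sf) hM). Qed.

Lemma regular_L1 (g f : R3 -> C) : regular g -> schwartz f -> L1 mu (fun x => g x * f x).
Proof. by move=> [_ h] /h; rewrite cintegrableE. Qed.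

Lemma regularP (g : R3 -> C) : cmeas g ->
  (forall f, schwartz f -> L1 mu (fun x => g x * f x)) -> regular g.
Proof. by move=> mg h; split=> // f sf; rewrite cintegrableE; exact: h. Qed.

Lemma dist_ofE (g f : R3 -> C) : dist_of g f = cint mu (fun x => g x * f x).
Proof. by rewrite /dist_of cintegralE. Qed.

(** Makes the choice inside [density] immaterial up to a null set. *)
Lemma represents_unique T (g h : R3 -> C) : represents T g -> represents T h ->
  {ae mu, forall x, g x = h x}.
Proof.
move=> [rg hg] [rh hh].
have : {ae mu, forall x, g x - h x = 0}.
  apply: (ctest_separates Hpsi); first by apply: cmeasB; [case: rg|case: rh].
  move=> k tk; have sk := ctest_schwartz tk.
  have i1 := regular_L1 rg sk; have i2 := regular_L1 rh sk.
  have E : (fun x => (g x - h x) * k x) = fun x => g x * k x - h x * k x.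
    by apply/funext => x; rewrite mulrBl.
  rewrite E; split; first exact: (L1B i1 i2).
  by rewrite (cintB i1 i2) -!dist_ofE -hg// -hh// subrr.
by apply: filterS => x /eqP; rewrite subr_eq0 => /eqP.
Qed.

Lemma density_represents T (g : R3 -> C) : represents T g -> represents T (density T).
Proof. by move=> h; rewrite /density; case: xgetP => [y _ //|/(_ g)]. Qed.

Lemma density_ae T (g : R3 -> C) : represents T g -> {ae mu, forall x, density T x = g x}.
Proof. by move=> h; apply: (@represents_unique T _ _ (density_represents h) h). Qed.

Lemma om_enorm (x : R3) : (1 + enorm x ^+ 2) * om x <= 1.
Proof.
rewrite sqr_enorm dotE /om.
set a := x.1.1; set b := x.1.2; set c := x.2.
have p (t : R) : 0 < 1 + t ^+ 2 by rewrite ltr_pwDl// sqr_ge0.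
have pa := p a; have pb := p b; have pc := p c.
rewrite -!invfM ler_pdivrMr ?mulr_gt0// mul1r -!expr2.
have ha := sqr_ge0 a; have hb := sqr_ge0 b; have hc := sqr_ge0 c.
have h1 := mulr_ge0 ha hb; have h2 := mulr_ge0 (addr_ge0 ha hb) hc.
have h3 := mulr_ge0 h1 hc; nra.
Qed.

Lemma om_poly (x : R3) (t : R) : 0 <= t -> t <= 1 + enorm x ^+ 2 -> t * om x <= 1.
Proof. by move=> t0 h; apply: le_trans (om_enorm x); rewrite ler_wpM2r ?om_ge0. Qed.

Lemma powR_le_sq (t r : R) : 0 <= t -> 0 <= r -> r <= 2 -> t `^ r <= 1 + t ^+ 2.
Proof.
move=> t0 r0 r2; have [t1|t1] := leP t 1.
  have := powR_mono r0 t0 t1; rewrite powR1 => h; apply: (le_trans h).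
  by rewrite lerDl sqr_ge0.
apply: (@le_trans _ _ (t `^ 2)); first by apply: ler_powR => //; exact: ltW.
by rewrite powR_mulrn// lerDr.
Qed.

Lemma om_opp (x : R3) : om (- x) = om x.
Proof. by rewrite /om /= !sqrrN. Qed.

Lemma coord_om i (x : R3) : `|coord3 i x| * om x <= 1.
Proof.
apply: om_poly => //; apply: (le_trans (coord_le_enorm i x)).
by have := sqr_ge0 (enorm x - 1); rewrite sqrrB; have := enorm_ge0 x; nra.
Qed.

Lemma powR_ccont (r t : R) (t_ : nat -> R) : 0 < t -> t_ @ \oo --> t ->
  (fun n => t_ n `^ r) @ \oo --> t `^ r.
Proof.
move=> t0 ct; apply: (cvg_comp t_ (fun t => t `^ r)) ct _.
have [d _] := @is_derive1_powR R r t t0.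
exact: (differentiable_continuous ((derivable1_diffP _ _).1 d)).
Qed.

Variables (s : R) (s0 : 0 < s) (s1 : s < 1).

(* Riesz--Fischer makes the density of (-Delta)^(s/2) T exist. *)
Lemma frac_laplacian_L2 T (A : R3 -> C) : represents (fourier T) A ->
  L2 mu (fun x => (enorm x `^ s)%:C * A x) ->
  exists G, [/\ L2 mu G, {ae mu, forall x, density (frac_laplacian (s / 2) T) x = G x} &
   forall Q M, L1 mu Q -> L2 mu Q -> (forall y, normc (Q y) <= M) ->
    {ae mu, forall x, pcont Q x} ->
    cint mu (fun x => G x * FI Q x) =
      kap psi * cint mu (fun x => (enorm x `^ s)%:C * A x * Q (- x))].
Proof.
move=> rA A2; have [G [G2 hG hQ]] := L2_fourier Hpsi A2.
exists G; split=> //; apply: density_ae; split.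
  apply: regularP; first by case: G2.
  by move=> f sf; exact: (L2_mul G2 (schwartz_L2 sf)).
move=> f sf; rewrite dist_ofE (hG _ (schwartz_L1 sf) (schwartz_L2 sf)).
rewrite /frac_laplacian /inv_fourier dist_ofE.
have dA := density_ae rA; have [[md _] _] := density_represents rA.
have mp : cmeas (fun x : R3 => (enorm x `^ s)%:C).
  apply: cmeas_real; exact: (measurableT_comp (@measurable_powR R s) (@enorm_measurable R)).
have mF := FI_cmeas (schwartz_L1 sf); have [[mA _] _] := rA.
apply: cint_ae.
- apply: cmeasM mF; apply: cmeasM md; move: mp; congr cmeas; apply/funext => x.
  by rewrite mulrC divfK.
- exact: (cmeasM (cmeasM mp mA) mF).
- by apply: filterS dA => x ->; rewrite [2 * _]mulrC divfK.
Qed.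

Lemma fourier_represents (f : R3 -> C) : L1 mu f -> represents (fourier (dist_of f)) (fun x => FI f (- x)).
Proof.
move=> jf; have mo := cmeas_opp (FI_cmeas jf); split.
  apply: regularP => // h sh; apply: (L1_bounded (schwartz_L1 sh) mo) => x.
  exact: (FI_bound _ jf).
move=> h sh; have jh := schwartz_L1 sh.
have jF : L1 mu (fun x => FI f x * h (- x)).
  by apply: (L1_bounded (L1_opp jh) (FI_cmeas jf)) => x; exact: (FI_bound _ jf).
have jF' : L1 mu (fun x => f x * FI h (- x)).
  have := L1_bounded jf (cmeas_opp (FI_cmeas jh)) (fun x => FI_bound (- x) jh).
  by congr L1; apply/funext => x; rewrite mulrC.
rewrite /fourier !dist_ofE.
transitivity (cint mu (fun x => FI f x * h (- x))); last first.
  by rewrite -(cint_opp jF); apply: eq_cint => x; rewrite opprK.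
rewrite (FI_mult jf (L1_opp jh)); apply: eq_cint => x.
by rewrite fourier_funE (FI_opp _ jh).
Qed.

(** [Q] is $|x|^s$ times the reflected transform of [phi]. The factor $|x|^s$ may be singular at the
    origin, so [pcont] is claimed only almost everywhere, which is all that Parseval requires. *)
Lemma frac_laplacian_test (phi : R3 -> R) : test_function phi -> exists Q M,
  [/\ L1 mu Q, L2 mu Q /\ (forall y, normc (Q y) <= M), {ae mu, forall x, pcont Q x},
   {ae mu, forall x, density (frac_laplacian (s / 2) (dist_of (cfun phi))) x = FI Q x} &
   forall x, Q (- x) = (enorm x `^ s)%:C * FI (cfun phi) x].
Proof.
move=> tphi; have tc : ctest (cfun phi) by exact: ctest_real.
have jc := ctest_L1 tc; have jFc := FI_L1 tc.
pose Q (x : R3) : C := (enorm x `^ s)%:C * FI (cfun phi) (- x).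
(* One power of [om] absorbs the growth of $|x|^s$, the other makes [Q] integrable. *)
have [M M0 hM] := FI_decay 2 tc.
have mp : cmeas (fun x : R3 => (enorm x `^ s)%:C).
  apply: cmeas_real; exact: (measurableT_comp (@measurable_powR R s) (@enorm_measurable R)).
have mQ : cmeas Q by exact: (cmeasM mp (cmeas_opp (L1_cmeas jFc))).
have hQ x : normc (Q x) <= M * om x.
  rewrite /Q (Normc.normcM _%:C (FI _ _)) normc_real ger0_norm ?powR_ge0//.
  apply: (@le_trans _ _ (enorm x `^ s * (M * om x ^+ 2))).
    by rewrite ler_wpM2l ?powR_ge0//; have := hM (- x); rewrite om_opp.
  rewrite [leLHS](_ : _ = (M * om x) * (enorm x `^ s * om x)); last by ring.
  rewrite -[leRHS]mulr1; apply: ler_wpM2l; first by apply: mulr_ge0 => //; exact: om_ge0.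
  apply: om_poly; first exact: powR_ge0.
  by apply: powR_le_sq; [exact: enorm_ge0|exact: ltW|rewrite (le_trans (ltW s1))// ler1n].
have jQ : L1 mu Q by apply: (@L1_le _ _ _ mu _ _ mQ hQ); apply: rintZ; exact: rint_om.
have bQ x : normc (Q x) <= M.
  by apply: (le_trans (hQ x)); rewrite ler_piMr ?om_le1.
have Q2 := L1b_L2 jQ bQ.
exists Q, M; split=> //.
- apply: filterS (@enorm_neq0_ae R) => x x0 z.
  have xpos : 0 < enorm (- x) by rewrite enormN lt_def x0 enorm_ge0.
  have cl : (fun n => e_ R n *: z - x) @ \oo --> - x := @e_line_cvg R z (- x).
  apply: ccvgM.
    apply/ccvg_ReIm; split=> /=; last exact: cvg_cst.
    apply: powR_ccont => //; apply: (cvg_comp (fun n => e_ R n *: z - x) (@enorm R)) cl _.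
    exact: enorm_continuous.
  have [c1 c2] := FI_csmooth tc.
  have := ccvg_cont x (- z) (smooth_continuous c1) (smooth_continuous c2).
  by rewrite opprK; congr ccvg; apply/funext => n; rewrite scalerN opprB.
- apply: density_ae; split.
    apply: regularP; first exact: (FI_cmeas jQ).
    move=> f sf; exact: (L1_bounded (schwartz_L1 sf) (FI_cmeas jQ) (fun x => FI_bound x jQ)).
  move=> f sf; have jf := schwartz_L1 sf.
  rewrite dist_ofE (FI_mult jQ jf) /frac_laplacian /inv_fourier dist_ofE.
  have rF := fourier_represents jc; have dA := density_ae rF.
  have [[md _] _] := density_represents rF.
  apply: cint_ae.
  + apply: cmeasM (FI_cmeas jf); apply: cmeasM md; move: mp; congr cmeas; apply/funext => x.
    by rewrite mulrC divfK.
  + exact: (cmeasM mQ (FI_cmeas jf)).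
  + by apply: filterS dA => x ->; rewrite [2 * _]mulrC divfK.
- by move=> x; rewrite /Q opprK enormN.
Qed.
End Represent.

Lemma conj_real (R : realType) (x : R) : (x%:C)^* = x%:C.
Proof. by apply: complexP; rewrite ?ReJ ?ImJ //= oppr0. Qed.

(** * The equation in frequency space *)

Section WeakFacts.
Opaque partial.
Variable R : realType.
Local Notation R3 := (R * R * R)%type.
Local Notation C := R[i].
Local Notation mu := (mu3 R).
Variables (psi : R3 -> R) (Hpsi : cutoff psi).
Variables (s : R) (s0 : 0 < s) (s1 : s < 1).
Variables (u : 'I_3 -> R3 -> R) (U : 'I_3 -> R3 -> C).
Hypothesis ru : forall j, regular (cfun (u j)).
Hypothesis rU : forall j, represents (fourier (dist_field u j)) (U j).
Hypothesis iD : rint mu (D2 s (vnorm U)).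

Local Notation uc j := (cfun (u j)).

Lemma U_cmeas j : cmeas (U j). Proof. by have [[]] := rU j. Qed.
Lemma u_cmeas j : cmeas (uc j). Proof. by have [] := ru j. Qed.

Lemma U_schwartz j f : schwartz f -> L1 mu (fun x => U j x * f x).
Proof. by move=> sf; apply: regular_L1 => //; have [] := rU j. Qed.

Lemma U_test j h : ctest h -> L1 mu (fun x => U j x * h x).
Proof. by move=> /ctest_schwartz; exact: U_schwartz. Qed.

Lemma U_FI j h : ctest h -> L1 mu (fun x => U j x * FI h x).
Proof. by move=> /FI_schwartz; exact: U_schwartz. Qed.

Lemma u_test j h : ctest h -> L1 mu (fun x => uc j x * h x).
Proof. by move=> th; apply: regular_L1; [exact: ru|exact: ctest_schwartz]. Qed.

(** By definition the transform of [u j] acts on [FI h] through [u j] paired with the forward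
    transform of [FI h], and inversion returns [h] times [kapr psi]. *)
Lemma dual_uU j h : ctest h ->
  cint mu (fun x => U j x * FI h x) = (kapr psi)%:C * cint mu (fun x => uc j x * h x).
Proof.
move=> th; have [_ H] := rU j; have := H _ (FI_schwartz th); rewrite dist_ofE => <-.
rewrite /fourier /dist_field dist_ofE -(cintZ _ (u_test j th)); apply: eq_cint => x.
by rewrite fourier_funE (FI_inv_test Hpsi _ th) opprK (kapE Hpsi); ring.
Qed.

Definition low (x : R3) : R := \1_[set x | enorm x <= 1] x.

Lemma low_measurable : measurable_fun setT low.
Proof.
apply: measurable_indic; have := measurable_fun_ler (@enorm_measurable R) (@measurable_cst _ _ R3 _ setT (1 : R)) measurableT (Y := [set true]) I.
by rewrite setTI.
Qed.

Lemma lowE x : low x = if enorm x <= 1 then 1 else 0.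
Proof. by rewrite /low indicE; case: ifP => h; [rewrite mem_set|rewrite memNset//= h]. Qed.

(** [U] need be neither integrable nor square integrable. Its part in the unit ball is integrable,
    as [U] is locally integrable; the rest is square integrable, as $|x|^s\ge1$ there. *)
Definition Ul j x : C := (low x)%:C * U j x.
Definition Uh j x : C := (1 - low x)%:C * U j x.

Lemma UlE j x : U j x = Ul j x + Uh j x.
Proof. by rewrite /Ul /Uh -mulrDl -rmorphD /= addrC subrK mul1r. Qed.

Lemma Ul_L1 j : L1 mu (Ul j).
Proof.
have tk : ctest (fun x : R3 => psiC psi (2^-1 *: x + 0)).
  by apply: ctest_affine (psiC_test Hpsi); rewrite invr_eq0.
apply: (@L1_le _ _ _ mu (fun x => normc (U j x * psiC psi (2^-1 *: x + 0)))).
- exact: (cmeasM (cmeas_real low_measurable) (U_cmeas j)).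
- move=> x; rewrite /Ul (Normc.normcM _ (U j x)) (Normc.normcM (U j x)) mulrC.
  rewrite ler_wpM2l ?normc_ge0// lowE; case: ifP => [h|_]; last by rewrite normc_real normr0 normc_ge0.
  rewrite /psiC addr0 [psi _](_ : _ = 1)//; case: Hpsi => _ _ _; apply.
  by rewrite enormZ gtr0_norm ?invr_gt0// div1r ler_piMr// invr_ge0.
- exact: (L1_normc (U_test j tk)).
Qed.

Lemma Uh_L2 j : L2 mu (Uh j).
Proof.
apply: (@L2_le _ _ _ mu (D2 s (vnorm U))) iD.
  by apply: cmeasM (U_cmeas j); apply: cmeas_real; apply: measurable_funB low_measurable; exact: measurable_cst.
move=> x; rewrite /D2 /Uh (Normc.normcM _ (U j x)) normc_real.
rewrite lerXn2r ?nnegrE ?mulr_ge0 ?normc_ge0 ?powR_ge0 ?vnorm_ge0//.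
apply: ler_pM; rewrite ?normc_ge0 ?normc_vnorm// lowE; case: ifP => h.
  by rewrite subrr normr0 powR_ge0.
rewrite subr0 normr1 [leLHS](_ : 1 = 1 `^ s); last by rewrite powR1.
by apply: powR_mono; [exact: ltW|exact: ler01|rewrite ltW// ltNge h].
Qed.

Lemma U_om j : L1 mu (fun x => (om x)%:C * U j x).
Proof.
have mo := cmeas_real (@om_measurable R).
have o2 : L2 mu (fun x : R3 => (om x)%:C).
  apply: (@L2_le _ _ _ mu (@om R) _ mo _ (@rint_om R)) => x.
  by rewrite normc_real ger0_norm ?om_ge0// expr2 ler_piMl ?om_ge0 ?om_le1.
have i1 : L1 mu (fun x => (om x)%:C * Ul j x).
  apply: (L1_bounded (Ul_L1 j) mo (c := 1)) => x.
  by rewrite normc_real ger0_norm ?om_ge0 ?om_le1.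
have := L1D i1 (L2_mul o2 (Uh_L2 j)); congr L1; apply/funext => x.
by rewrite (UlE j x); ring.
Qed.

Lemma U_om_poly j (g : R3 -> R) n : measurable_fun setT g -> (forall x, `|g x| * om x ^+ n <= 1) ->
  L1 mu (fun x => (om x ^+ n.+1)%:C * ((g x)%:C * U j x)).
Proof.
move=> mg hg; have mo : cmeas (fun x : R3 => (om x ^+ n * g x)%:C).
  by apply: cmeas_real; apply: measurable_funM mg; apply: measurable_funX; exact: om_measurable.
have := L1_bounded (U_om j) mo (c := 1); have H (x : R3) : normc ((om x ^+ n * g x)%:C) <= 1.
  by rewrite normc_real normrM mulrC (ger0_norm (exprn_ge0 n (om_ge0 x))) hg.
move=> /(_ H); congr L1; apply/funext => x.
by rewrite exprS !rmorphM /=; ring.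
Qed.

Lemma ci_neq0 : ci R != 0.
Proof. by apply/eqP => /(congr1 (@complex.Im R)) /eqP; rewrite /= oner_eq0. Qed.

Lemma om_L1_FI G m h : cmeas G -> L1 mu (fun x => (om x ^+ m)%:C * G x) -> ctest h ->
  L1 mu (fun x => G x * FI h x).
Proof.
move=> mG iG th; have [M M0 hM] := FI_decay m th.
apply: (@L1_le _ _ _ mu (fun x => M * normc ((om x ^+ m)%:C * G x))).
- exact: (cmeasM mG (FI_cmeas (ctest_L1 th))).
- move=> x; rewrite (Normc.normcM _%:C (G x)) (Normc.normcM (G x) (FI _ _)) normc_real.
  rewrite ger0_norm ?exprn_ge0 ?om_ge0// mulrA mulrC ler_wpM2r ?normc_ge0//; exact: hM.
- by apply: rintZ; exact: (L1_normc iG).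
Qed.

(** The weak formulation concerns real test functions; a complex one is split into its real and
    imaginary parts. *)
Lemma UL2_real G m : cmeas G -> L1 mu (fun x => (om x ^+ m)%:C * G x) ->
  (forall h, test_function h -> cint mu (fun x => G x * FI (cfun h) x) = 0) ->
  {ae mu, forall x, G x = 0}.
Proof.
move=> mG iG hG; apply: (FI_ctest_separates Hpsi mG iG) => h [t1 t2].
have c1 := ctest_real t1; have c2 := ctest_real t2.
have i1 := om_L1_FI mG iG c1; have i2 := om_L1_FI mG iG c2.
rewrite (@eq_cint _ _ _ mu _ (fun x => G x * FI (cfun (fun x => complex.Re (h x))) x +
   ci R * (G x * FI (cfun (fun x => complex.Im (h x))) x))).
  by rewrite (cintD i1 (L1Z (ci R) i2)) (cintZ (ci R) i2) (hG _ t1) (hG _ t2) mulr0 addr0.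
move=> x; rewrite [ci R * _]mulrCA -mulrDr; congr (_ * _).
rewrite -(FIZ (ci R) x (ctest_L1 c2)) -(FID x (ctest_L1 c1) (L1Z (ci R) (ctest_L1 c2))).
apply: eq_FI => y; rewrite /cfun /ci; case: (h y) => a b /=.
by apply: complexP; rewrite ?ReD ?ImD ?ReM ?ImM /=; ring.
Qed.

Lemma cpartial_real j (h : R3 -> R) x : cpartial j (cfun h) x = (partial j h x)%:C.
Proof. by rewrite /cpartial /cfun /= partial_cst. Qed.

(** The divergence tested with [h] is, by [dual_uU] and [FI_partial], a nonzero multiple of the
    pairing of $x\cdot U(x)$ with [FI h]. *)
Lemma dotU_ae : weakly_div_free u -> {ae mu, forall x, \sum_(j < 3) (coord3 j x)%:C * U j x = 0}.
Proof.
move=> Hdf.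
have iom j : L1 mu (fun x => (om x ^+ 2)%:C * ((coord3 j x)%:C * U j x)).
  by apply: U_om_poly => [|x]; [exact: coord_measurable|rewrite expr1; exact: coord_om].
have mG : cmeas (fun x => \sum_(j < 3) (coord3 j x)%:C * U j x).
  by apply: cmeas_sum => j; apply: cmeasM (U_cmeas j); apply: cmeas_real; exact: coord_measurable.
have iG : L1 mu (fun x => (om x ^+ 2)%:C * (\sum_(j < 3) (coord3 j x)%:C * U j x)).
  have := L1_sum (index_enum _) iom; congr L1; apply/funext => x.
  by rewrite mulr_sumr.
apply: (UL2_real mG iG) => h th; have tc : ctest (cfun h) by exact: ctest_real.
have tp j := ctest_partial j tc.
have := congr1 (@real_complex R) (Hdf h th); rewrite -cint_real => E0.
have E1 : cint mu (fun x => \sum_(j < 3) uc j x * cpartial j (cfun h) x) = 0.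
  rewrite -[RHS]E0; apply: eq_cint => x; rewrite rmorph_sum; apply: eq_bigr => j _.
  by rewrite cpartial_real /cfun -rmorphM.
rewrite cint_sum in E1; last by move=> j; exact: u_test.
have E2 : \sum_(j < 3) cint mu (fun x => U j x * FI (cpartial j (cfun h)) x) = 0.
  rewrite (eq_bigr (fun j => (kapr psi)%:C * cint mu (fun x => uc j x * cpartial j (cfun h) x))).
    by rewrite -mulr_sumr E1 mulr0.
  by move=> j _; exact: dual_uU.
rewrite -cint_sum in E2; last by move=> j; exact: U_FI.
have jG := om_L1_FI mG iG tc.
rewrite (@eq_cint _ _ _ mu _ (fun x => - ci R * ((\sum_(j < 3) (coord3 j x)%:C * U j x) * FI (cfun h) x))) in E2; last first.
  move=> x; rewrite mulr_suml mulr_sumr; apply: eq_bigr => j _.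
  by rewrite (FI_partial j x tc); ring.
move: E2; rewrite (cintZ _ jG) => /eqP; rewrite mulf_eq0 oppr_eq0 (negbTE ci_neq0) /=.
by move/eqP.
Qed.

(** Hermitian symmetry, because [u] is real: comparing the pairings with [h] and with its conjugate
    shows that [U j] and its conjugate reflection have the same pairings with all [FI h]. *)
Lemma U_conj_ae j : {ae mu, forall x, U j (- x) = (U j x)^*}.
Proof.
have io := U_om j; have mo := cmeas_opp (U_cmeas j).
have mG : cmeas (fun x : R3 => (U j (- x))^* - U j x) by exact: (cmeasB (cmeasJ mo) (U_cmeas j)).
have iG : L1 mu (fun x : R3 => (om x ^+ 1)%:C * ((U j (- x))^* - U j x)).
  have := L1B (L1J (L1_opp io)) io; congr L1; apply/funext => x.
  by rewrite (conjM (om (- x))%:C) om_opp expr1 conj_real; ring.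
have : {ae mu, forall x, (U j (- x))^* - U j x = 0}.
  apply: (FI_ctest_separates Hpsi mG iG) => h th; have tJ := ctestJ th.
  have i1 := U_FI j th; have i2 := U_FI j tJ.
  have E1 := dual_uU j th; have E2 := dual_uU j tJ.
  have E3 : cint mu (fun x => uc j x * (h x)^*) = (cint mu (fun x => uc j x * h x))^*.
    rewrite -(cintJ (u_test j th)); apply: eq_cint => x; rewrite conjM /cfun conj_real.
    by [].
  have E4 : cint mu (fun x => (U j (- x))^* * FI h x) = cint mu (fun x => U j x * FI h x).
    rewrite E1 -[RHS]conjK conjM -E3 conj_real -E2 -(cintJ i2) -(cint_opp (L1J i2)).
    apply: eq_cint => x; rewrite conjM; congr (_ * _).
    by rewrite (FIJ (- x) (ctest_L1 th)) opprK conjK.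
  rewrite (@eq_cint _ _ _ mu _ (fun x => (U j (- x))^* * FI h x - U j x * FI h x)); last first.
    by move=> x; rewrite mulrBl.
  rewrite (cintB _ i1) ?E4 ?subrr//.
  have := L1_opp (L1J i2); congr L1; apply/funext => x; rewrite conjM; congr (_ * _).
  by rewrite (FIJ (- x) (ctest_L1 th)) opprK conjK.
apply: filterS => x /eqP; rewrite subr_eq0 => /eqP <-; by rewrite conjK.
Qed.

(* [w j] is the (unnormalised) inverse Fourier transform of [U j], low frequencies
   by absolute convergence and high ones by Riesz--Fischer. *)
Lemma inverse_transform j : exists w : R3 -> C, [/\ cmeas w,
  {ae mu, forall x, (kapr psi)%:C * uc j x = w x},
  forall q, L1 mu q -> L2 mu q -> [/\ L1 mu (fun x => w x * q x), L1 mu (fun x => U j x * FI q x) &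
    cint mu (fun x => w x * q x) = cint mu (fun x => U j x * FI q x)] &
  forall h, ctest h -> L2 mu (fun x => w x * h x)].
Proof.
have [G [G2 hG _]] := L2_fourier Hpsi (Uh_L2 j); have il := Ul_L1 j; have [mG _] := G2.
have mw : cmeas (fun x => FI (Ul j) x + G x) by exact: (cmeasD (FI_cmeas il) mG).
have hq q : L1 mu q -> L2 mu q -> [/\ L1 mu (fun x => (FI (Ul j) x + G x) * q x),
    L1 mu (fun x => U j x * FI q x) &
    cint mu (fun x => (FI (Ul j) x + G x) * q x) = cint mu (fun x => U j x * FI q x)].
  move=> q1 q2; have [Fq2 _] := plancherel_le Hpsi q1 q2.
  have a1 : L1 mu (fun x => FI (Ul j) x * q x).
    exact: (L1_bounded q1 (FI_cmeas il) (fun x => FI_bound x il)).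
  have a2 := L2_mul G2 q2; have b2 := L2_mul (Uh_L2 j) Fq2.
  have b1 : L1 mu (fun x => Ul j x * FI q x).
    have := L1_bounded il (FI_cmeas q1) (fun x => FI_bound x q1).
    by congr L1; apply/funext => x; rewrite mulrC.
  have E1 : (fun x => (FI (Ul j) x + G x) * q x) = fun x => FI (Ul j) x * q x + G x * q x.
    by apply/funext => x; rewrite mulrDl.
  have E2 : (fun x => U j x * FI q x) = fun x => Ul j x * FI q x + Uh j x * FI q x.
    by apply/funext => x; rewrite (UlE j x) mulrDl.
  rewrite E1 E2; split; [exact: L1D a1 a2|exact: L1D b1 b2|].
  by rewrite (cintD a1 a2) (cintD b1 b2) (FI_mult il q1) (hG q q1 q2).
exists (fun x => FI (Ul j) x + G x); split=> //.
  have : {ae mu, forall x, (kapr psi)%:C * uc j x - (FI (Ul j) x + G x) = 0}.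
    apply: (ctest_separates Hpsi); first exact: (cmeasB (cmeasM (cmeas_cst _ _) (u_cmeas j)) mw).
    move=> h th; have [i1 i2 E] := hq h (ctest_L1 th) (ctest_L2 th).
    have iu := u_test j th; have iku := L1Z (kapr psi)%:C iu.
    have Ef : (fun x => ((kapr psi)%:C * uc j x - (FI (Ul j) x + G x)) * h x) =
        fun x => (kapr psi)%:C * (uc j x * h x) - (FI (Ul j) x + G x) * h x.
      by apply/funext => x; ring.
    rewrite Ef; split; first exact: (L1B iku i1).
    by rewrite (cintB iku i1) (cintZ _ iu) E (dual_uU j th) subrr.
  by apply: filterS => x /eqP; rewrite subr_eq0 => /eqP.
move=> h th; have [M M0 hM] := ctest_bounded th; have h2 := ctest_L2 th.
have a : L2 mu (fun x => FI (Ul j) x * h x).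
  apply: (@L2_le' _ _ _ mu _ (fun x => (c0 R * \int[mu]_y normc (Ul j y))%:C * h x)).
  - exact: (cmeasM (FI_cmeas il) (ctest_cmeas th)).
  - move=> x; rewrite (Normc.normcM (FI _ x)) (Normc.normcM (c0 R * \int[mu]_y normc (Ul j y))%:C (h x)) normc_real.
    apply: ler_wpM2r; first exact: normc_ge0.
    by apply: le_trans (FI_bound x il) _; exact: ler_norm.
  - exact: L2Z.
have b : L2 mu (fun x => G x * h x).
  apply: (@L2_le' _ _ _ mu _ (fun x => M%:C * G x)).
  - exact: (cmeasM mG (ctest_cmeas th)).
  - move=> x; rewrite (Normc.normcM (G x)) (Normc.normcM M%:C (G x)) normc_real mulrC.
    apply: ler_wpM2r; first exact: normc_ge0.
    by apply: le_trans (hM x) _; exact: ler_norm.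
  - exact: L2Z.
by have := L2D a b; congr L2; apply/funext => x; rewrite mulrDl.
Qed.

(** Four products arise from the splitting into low and high parts. Low times low is integrable by
    itself; for each of the others the weight, with [om ^+ 2 <= om], allows the arithmetic-geometric
    mean inequality to leave products of two integrable functions of independent variables. *)
Lemma conv_L12 i j : L12 (fun x y : R3 => (om (- x - y))%:C * (U i x * U j y)).
Proof.
pose p i (x : R3) := normc (Ul i x); pose q i (x : R3) := normc (Uh i x).
pose o (x y : R3) := om (- x - y).
have jp k : rint mu (p k) by exact: (L1_normc (Ul_L1 k)).
have jq k : rint mu (fun x => q k x ^+ 2) by have [] := Uh_L2 k.
have p0 k x : 0 <= p k x by exact: normc_ge0.
have q0 k x : 0 <= q k x by exact: normc_ge0.
apply: (@L12_le _ (fun x y => p i x * p j y + 2^-1 * (p i x * q j y ^+ 2 + p i x * o x y) +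
   2^-1 * (q i x ^+ 2 * p j y + p j y * o x y) + 2^-1 * (q i x ^+ 2 * o x y + q j y ^+ 2 * o x y))).
- apply: cmeasM; first exact: (cmeas2_third (cmeas_real (@om_measurable R))).
  by apply: cmeasM; [exact: (cmeas2_1 (U_cmeas i))|exact: (cmeas2_2 (U_cmeas j))].
- move=> x y; have o0 : 0 <= o x y by exact: om_ge0.
  have o1 : o x y <= 1 by exact: om_le1.
  rewrite (Normc.normcM (om (- x - y))%:C) normc_real (Normc.normcM (U i x)) (ger0_norm (om_ge0 _)).
  have hi : normc (U i x) <= p i x + q i x by rewrite (UlE i x) le_normcD.
  have hj : normc (U j y) <= p j y + q j y by rewrite (UlE j y) le_normcD.
  apply: (@le_trans _ _ (o x y * ((p i x + q i x) * (p j y + q j y)))).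
    apply: ler_wpM2l => //; apply: ler_pM hi hj; exact: normc_ge0.
  move: (p0 i x) (p0 j y) (q0 i x) (q0 j y) o0 o1.
  move: (p i x) (p j y) (q i x) (q j y) (o x y) => a b c d t a0 b0 c0 d0 t0 t1.
  have t2 : t ^+ 2 <= t by rewrite expr2 ler_piMl.
  have e1 : t * (a * b) <= a * b by rewrite ler_piMl// mulr_ge0.
  have e2 : a * (d * t) <= a * (2^-1 * (d ^+ 2 + t)).
    by rewrite ler_wpM2l//; have := amgm d t; lra.
  have e3 : b * (c * t) <= b * (2^-1 * (c ^+ 2 + t)).
    by rewrite ler_wpM2l//; have := amgm c t; lra.
  have e4 : t * (c * d) <= t * (2^-1 * (c ^+ 2 + d ^+ 2)) by rewrite ler_wpM2l// amgm.
  nra.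
- apply: rint2D; last first.
    by apply: rint2Z; apply: rint2D; [exact: rint2_conv1 (jq i) (@rint_om R)|exact: rint2_conv2 (jq j) (@rint_om R)].
  apply: rint2D; last first.
    by apply: rint2Z; apply: rint2D; [exact: rint2_prod (jq i) (jp j)|exact: rint2_conv2 (jp j) (@rint_om R)].
  apply: rint2D; first exact: rint2_prod (jp i) (jp j).
  by apply: rint2Z; apply: rint2D; [exact: rint2_prod (jp i) (jq j)|exact: rint2_conv1 (jp i) (@rint_om R)].
Qed.

(** The shear is two reflections of the inner variable in succession, one about 0 and one depending
    on the outer variable. *)
Lemma L12_shear (k : R3 -> R3 -> C) : L12 k -> L12 (fun x y => k y (x - y)) /\
  cint mu (fun y => cint mu (k y)) = cint mu (fun x => cint mu (fun y => k y (x - y))).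
Proof.
move=> jk.
have i1 : L12 (fun y x => k y (x - y)).
  have := L12_reflect (@measurable_id _ _ setT) (L12_reflect (@measurable_cst _ _ R3 R3 setT 0) jk).
  by congr L12; apply/funext => y; apply/funext => x; rewrite sub0r opprB.
have i2 := L12_swap i1; split; first exact: i2.
rewrite -(cfub_swap i1); apply: cint_ae.
- exact: (L1_cmeas (cfub_L1 jk)).
- exact: (L1_cmeas (cfub_L1 i1)).
apply: filterS (cfub_ae jk) => y iy; have := cint_affine (- y) ltr01 iy.
rewrite expr1n invr1 mul1r => <-; apply: eq_cint => x; by rewrite scale1r.
Qed.

Lemma shear_L12 i j : L12 (fun x y : R3 => (om x)%:C * (U i y * U j (x - y))).
Proof.
have [h _] := L12_shear (conv_L12 i j); move: h; congr L12.
by apply/funext => x; apply/funext => y; rewrite opprB addKr om_opp.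
Qed.

(** The convolution of [U i] and [U j], up to a constant the transform of $u_iu_j$. The weight is
    inserted and removed again so that Fubini for [shear_L12] yields measurability and weighted
    integrability. *)
Definition NN i j (x : R3) : C :=
  ((om x)^-1)%:C * cint mu (fun y => (om x)%:C * (U i y * U j (x - y))).

Lemma NN_om i j x : (om x)%:C * NN i j x = cint mu (fun y => (om x)%:C * (U i y * U j (x - y))).
Proof. by rewrite /NN mulrA -rmorphM /= mulfV ?mul1r// lt0r_neq0 ?om_gt0. Qed.

Lemma NN_L1 i j : L1 mu (fun x => (om x)%:C * NN i j x).
Proof.
by have := cfub_L1 (shear_L12 i j); congr L1; apply/funext => x; rewrite NN_om.
Qed.

Lemma NN_cmeas i j : cmeas (NN i j).
Proof.
apply: cmeasM (L1_cmeas (cfub_L1 (shear_L12 i j))); apply: cmeas_real.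
have := measurableT_comp (@measurable_powR R (- 1%:R)) (@om_measurable R).
by congr (measurable_fun setT _); apply/funext => x /=; rewrite powR_inv1// om_ge0.
Qed.

Lemma NN_ae i j : {ae mu, forall x, L1 mu (fun y => U i y * U j (x - y)) /\
  NN i j x = cint mu (fun y => U i y * U j (x - y))}.
Proof.
apply: filterS (cfub_ae (shear_L12 i j)) => x ix.
have i1 : L1 mu (fun y => U i y * U j (x - y)).
  have := L1Z ((om x)^-1)%:C ix; congr L1; apply/funext => y.
  by rewrite mulrA -rmorphM /= mulVf ?mul1r// lt0r_neq0 ?om_gt0.
split=> //; rewrite /NN (cintZ _ i1) mulrA -rmorphM /= mulVf ?mul1r// lt0r_neq0 ?om_gt0//.
Qed.

Lemma NN_om_poly i j (g : R3 -> R) n : measurable_fun setT g -> (forall x, `|g x| * om x ^+ n <= 1) ->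
  L1 mu (fun x => (om x ^+ n.+1)%:C * ((g x)%:C * NN i j x)).
Proof.
move=> mg hg; have mo : cmeas (fun x : R3 => (om x ^+ n * g x)%:C).
  by apply: cmeas_real; apply: measurable_funM mg; apply: measurable_funX; exact: om_measurable.
have := L1_bounded (NN_L1 i j) mo (c := 1); have H (x : R3) : normc ((om x ^+ n * g x)%:C) <= 1.
  by rewrite normc_real normrM mulrC (ger0_norm (exprn_ge0 n (om_ge0 x))) hg.
move=> /(_ H); congr L1; apply/funext => x.
by rewrite exprS !rmorphM /=; ring.
Qed.

Lemma NN_FI i j h : ctest h -> L1 mu (fun x => NN i j x * FI h x).
Proof.
move=> th; apply: (om_L1_FI (m := 1) (NN_cmeas i j) _ th).
by have := NN_L1 i j; congr L1.
Qed.

(** [inverse_transform] is used twice: [u j * h] is integrable and square integrable, so it may be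
    paired with [u i]; and its own transform at [x] is a pairing of [u j] with a modulated test
    function. This leaves the double integral of $U_i(x)U_j(y)\,\mathrm{FI}\,h(x+y)$, which the
    shear turns into [NN]. *)
Lemma quadratic_term i j h : ctest h -> L1 mu (fun x => uc i x * (uc j x * h x)) /\
  (kapr psi ^+ 2)%:C * cint mu (fun x => uc i x * (uc j x * h x)) =
  (c0 R)%:C * cint mu (fun x => NN i j x * FI h x).
Proof.
move=> th; have [wi [mwi ei Di _]] := inverse_transform i; have [wj [mwj ej Dj Lj]] := inverse_transform j.
have h1 := ctest_L1 th; have h2 := ctest_L2 th.
have [q1 _ _] := Dj h h1 h2; have q2 := Lj h th.
have [a1 a2 a3] := Di _ q1 q2.
have muj := u_cmeas j; have mui := u_cmeas i; have mh := ctest_cmeas th.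
have mL : cmeas (fun x => (kapr psi ^+ 2)%:C * (uc i x * (uc j x * h x))).
  exact: (cmeasM (cmeas_cst _ _) (cmeasM mui (cmeasM muj mh))).
have ae1 : {ae mu, forall x, (kapr psi ^+ 2)%:C * (uc i x * (uc j x * h x)) = wi x * (wj x * h x)}.
  apply: filterS2 ei ej => x e1 e2; rewrite -e1 -e2 expr2 rmorphM; ring.
have j1 := @L1_ae _ _ _ mu _ _ mL a1 ae1.
have kn : (kapr psi ^+ 2)%:C != 0.
  apply/eqP => /(congr1 (@complex.Re R)) /= /eqP; rewrite expf_eq0 /=.
  by apply/negP; rewrite lt0r_neq0// kapr_gt0.
have iu : L1 mu (fun x => uc i x * (uc j x * h x)).
  by have := L1Z ((kapr psi ^+ 2)%:C)^-1 j1; congr L1; apply/funext => x; rewrite mulKf.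
split=> //; rewrite -(cintZ _ iu) (@cint_ae _ _ _ mu _ _ mL (L1_cmeas a1) ae1) a3.
pose k (x y : R3) : C := U i x * U j y * FI h (x + y).
have [M M0 hM] := FI_decay 1 th.
have jk : L12 k.
  have mF : cmeas2 (fun x y : R3 => FI h (x + y)).
    exact: (cmeas_comp (FI_cmeas h1) (@measurable_add3 R)).
  apply: (@L12_le _ (fun x y => M * normc ((om (- x - y))%:C * (U i x * U j y)))).
  - exact: (cmeasM (cmeasM (cmeas2_1 (U_cmeas i)) (cmeas2_2 (U_cmeas j))) mF).
  - move=> x y; rewrite /k (Normc.normcM (U i x * U j y)) (Normc.normcM (om _)%:C (U i x * U j y)).
    rewrite normc_real (ger0_norm (om_ge0 _)) mulrA mulrC; apply: ler_wpM2r; first exact: normc_ge0.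
    by have := hM (x + y); rewrite expr1 -opprD om_opp.
  - by apply: rint2Z; exact: (L1_normc (conv_L12 i j)).
rewrite (@eq_cint _ _ _ mu _ (fun x => (c0 R)%:C * cint mu (k x))); last first.
  move=> x; have tq : ctest (fun y => cis (dot x y) * h y) by exact: (ctestM th (csmooth_cis' x)).
  have [_ b2 b3] := Dj _ (ctest_L1 tq) (ctest_L2 tq).
  rewrite FIE (@eq_cint _ _ _ mu _ (fun y => wj y * (cis (dot x y) * h y))); last by move=> y; ring.
  rewrite b3 mulrCA; congr (_ * _); rewrite -(cintZ _ b2); apply: eq_cint => y.
  by rewrite FI_mod /k [x + y]addrC mulrA.
rewrite (cintZ _ (cfub_L1 jk)); congr (_ * _).
have [i1 ->] := L12_shear jk; apply: cint_ae.
- exact: (L1_cmeas (cfub_L1 i1)).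
- exact: (L1_cmeas (NN_FI i j th)).
apply: filterS (NN_ae i j) => x [ix ->]; rewrite mulrC -(cintZ _ ix); apply: eq_cint => y.
by rewrite /k addrCA subrr addr0 mulrC.
Qed.

Lemma AU_L2 j : L2 mu (fun x => (enorm x `^ s)%:C * U j x).
Proof.
have mp := cmeas_real (measurableT_comp (@measurable_powR R s) (@enorm_measurable R)).
apply: (@L2_le _ _ _ mu (D2 s (vnorm U)) _ (cmeasM mp (U_cmeas j)) _ iD) => x.
rewrite /D2 (Normc.normcM _ (U j x)) normc_real ger0_norm ?powR_ge0//.
rewrite lerXn2r ?nnegrE ?mulr_ge0 ?normc_ge0 ?powR_ge0 ?vnorm_ge0//.
by rewrite ler_wpM2l ?powR_ge0 ?normc_vnorm.
Qed.

(** Parseval's identity, each of the two operators of order [s] contributing a factor $|x|^s$. *)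
Lemma weak_lhs (phi : 'I_3 -> R3 -> R) : (forall j, test_function (phi j)) ->
  cint mu (fun x => \sum_(j < 3) frac_laplacian_field (s / 2) u j x *
                                  frac_laplacian_field (s / 2) phi j x) =
  (kapr psi)%:C * \sum_(j < 3) cint mu (fun x => U j x * (((enorm x `^ s) ^+ 2)%:C * FI (cfun (phi j)) x)).
Proof.
move=> tphi.
have term j : L1 mu (fun x => frac_laplacian_field (s / 2) u j x * frac_laplacian_field (s / 2) phi j x) /\
   cint mu (fun x => frac_laplacian_field (s / 2) u j x * frac_laplacian_field (s / 2) phi j x) =
   (kapr psi)%:C * cint mu (fun x => U j x * (((enorm x `^ s) ^+ 2)%:C * FI (cfun (phi j)) x)).
  have [G [G2 aeG hG]] := frac_laplacian_L2 Hpsi (rU j) (AU_L2 j).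
  have [Q [M [Q1 [Q2 hM] hQ aeQ EQ]]] := frac_laplacian_test Hpsi s0 s1 (tphi j).
  have [FQ2 _] := plancherel_le Hpsi Q1 Q2.
  have i1 := L2_mul G2 FQ2.
  have ae1 : {ae mu, forall x, frac_laplacian_field (s / 2) u j x * frac_laplacian_field (s / 2) phi j x =
     G x * FI Q x}.
    by apply: filterS2 aeG aeQ => x e1 e2; rewrite -e1 -e2.
  have m1 : cmeas (fun x => frac_laplacian_field (s / 2) u j x * frac_laplacian_field (s / 2) phi j x).
    have md T : cmeas (density T).
      rewrite /density; case: xgetP => [y _ [[]] //|_].
      exact: cmeas_cst.
    by apply: cmeasM; exact: md.
  split; first exact: (@L1_ae _ _ _ mu _ _ m1 i1 ae1).
  rewrite (@cint_ae _ _ _ mu _ _ m1 (L1_cmeas i1) ae1) (hG Q M Q1 Q2 hM hQ) (kapE Hpsi).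
  congr (_ * _); apply: eq_cint => x; rewrite EQ expr2 rmorphM /=; ring.
rewrite cint_sum; last by move=> j; have [] := term j.
by rewrite mulr_sumr; apply: eq_bigr => j _; have [] := term j.
Qed.

(* Fields [d_q h e_p - d_p h e_q]: divergence free, so the pressure does not contribute. *)
Definition curl (p q : 'I_3) (h : R3 -> R) (k : 'I_3) (x : R3) : R :=
  (k == p)%:R * partial q h x + - ((k == q)%:R * partial p h x).

Lemma curl_test p q h k : test_function h -> test_function (curl p q h k).
Proof.
move=> th; apply: testD.
  exact: (testM (test_partial q th) (smooth_cst ((k == p)%:R : R))).
by apply: testN; exact: (testM (test_partial p th) (smooth_cst ((k == q)%:R : R))).
Qed.

Lemma curl_FI p q h k x : test_function h ->
  FI (cfun (curl p q h k)) x =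
  ci R * (((k == q)%:R * coord3 p x - (k == p)%:R * coord3 q x)%:C * FI (cfun h) x).
Proof.
move=> th; have tc : ctest (cfun h) by exact: ctest_real.
have i1 := ctest_L1 (ctest_partial q tc); have i2 := ctest_L1 (ctest_partial p tc).
have -> : FI (cfun (curl p q h k)) x = FI (fun y => ((k == p)%:R : R)%:C * cpartial q (cfun h) y +
    - ((k == q)%:R : R)%:C * cpartial p (cfun h) y) x.
  by apply: eq_FI => y; rewrite /cfun /curl !cpartial_real; apply: complexP; rewrite /=; ring.
rewrite (FID x (L1Z _ i1) (L1Z _ i2)) (FIZ _ x i1) (FIZ _ x i2).
rewrite (FI_partial q x tc) (FI_partial p x tc) rmorphB !rmorphM /=; ring.
Qed.

Lemma FI_eq0 (h : R3 -> C) : ctest h -> (forall x, FI h x = 0) -> forall x, h x = 0.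
Proof.
move=> th h0 x; have := FI_inv_test Hpsi (- x) th; rewrite opprK.
rewrite (_ : FI (FI h) (- x) = 0); last first.
  rewrite FIE (@eq_cint _ _ _ mu _ (fun=> 0)) ?cint0 ?mulr0// => y.
  by rewrite h0 mulr0.
by move=> /esym/eqP; rewrite mulf_eq0 (negbTE (kap_neq0 Hpsi)) => /eqP.
Qed.

(** Both second derivatives have the transform $-x_px_q\,\mathrm{FI}\,h$, and [FI] is injective on
    test functions. *)
Lemma partial_sym p q (h : R3 -> R) x : test_function h ->
  partial p (partial q h) x = partial q (partial p h) x.
Proof.
move=> th; have tc : ctest (cfun h) by exact: ctest_real.
have tr k : ctest (cfun (partial k h)) by apply: ctest_real; exact: test_partial.
have t2 k l : ctest (cpartial k (cfun (partial l h))) by exact: ctest_partial.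
have F1 k y : FI (cfun (partial k h)) y = FI (cpartial k (cfun h)) y.
  by apply: eq_FI => z; rewrite cpartial_real.
have F2 k l y : FI (cpartial k (cfun (partial l h))) y = - (ci R * (coord3 k y)%:C) * (- (ci R * (coord3 l y)%:C) * FI (cfun h) y).
  by rewrite (FI_partial k y (tr l)) F1 (FI_partial l y tc).
pose d y := partial p (partial q h) y + - partial q (partial p h) y.
have td : test_function d.
  by apply: testD; [|apply: testN]; apply: test_partial; exact: test_partial.
have Z y : FI (cfun d) y = 0.
  have i1 := ctest_L1 (t2 p q); have i2 := ctest_L1 (t2 q p).
  have -> : FI (cfun d) y = FI (fun y => cpartial p (cfun (partial q h)) y -
      cpartial q (cfun (partial p h)) y) y.
    by apply: eq_FI => z; rewrite !cpartial_real -rmorphB.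
  rewrite (FIB y i1 i2).
  apply: etrans (congr2 (fun a b : C => a - b) (F2 p q y) (F2 q p y)) _.
  move: (FI (cfun h) y) => X; ring.
have E : (d x)%:C = 0 := FI_eq0 (ctest_real td) Z x.
have {}E : d x = 0 by have := congr1 (@complex.Re R) E.
by apply/eqP; rewrite -subr_eq0 -/(d x) E.
Qed.

Lemma sum_delta_real (p q : 'I_3) (A B : 'I_3 -> R) :
  \sum_(k < 3) ((k == p)%:R * A k - (k == q)%:R * B k) = A p - B q.
Proof.
have E k : (k == p)%:R * A k - (k == q)%:R * B k = (if k == p then A k else 0) - (if k == q then B k else 0).
  by case: (k == p); case: (k == q); rewrite ?mul1r ?mul0r.
by rewrite (eq_bigr _ (fun k _ => E k)) sumrB -!big_mkcond /= !big_pred1_eq.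
Qed.

Lemma curl_div p q h x : test_function h -> divergence (curl p q h) x = 0.
Proof.
move=> th; have s1' := smooth_partial q (proj1 th); have s2' := smooth_partial p (proj1 th).
have pE k : partial k (curl p q h k) x =
    (k == p)%:R * partial k (partial q h) x - (k == q)%:R * partial k (partial p h) x.
  have c1 := smooth_cst ((k == p)%:R : R); have c2 := smooth_cst (- (k == q)%:R : R).
  rewrite (_ : curl p q h k = (fun x => (k == p)%:R * partial q h x + - (k == q)%:R * partial p h x)); last first.
    by apply/funext => y; rewrite /curl mulNr.
  rewrite (partialD (fun y => @smooth_derivable R _ k y (smoothM c1 s1'))
    (fun y => @smooth_derivable R _ k y (smoothM c2 s2'))).
  rewrite (partialM (fun y => @smooth_derivable R _ k y c1) (fun y => @smooth_derivable R _ k y s1')).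
  rewrite (partialM (fun y => @smooth_derivable R _ k y c2) (fun y => @smooth_derivable R _ k y s2')).
  rewrite (partial_cst k ((k == p)%:R : R)) (partial_cst k (- (k == q)%:R : R)).
  cbv beta; set a := partial k (partial q h) x; set b := partial k (partial p h) x.
  set c := partial q h x; set d := partial p h x.
  move: a b c d ((k == p)%:R : R) ((k == q)%:R : R) => a b c d t t'; ring.
rewrite /divergence (eq_bigr _ (fun k _ => pE k)).
apply: etrans (sum_delta_real p q (fun k => partial k (partial q h) x)
  (fun k => partial k (partial p h) x)) _.
by apply/eqP; rewrite subr_eq0; apply/eqP; exact: partial_sym.
Qed.

Lemma tempered0 P : tempered P -> P (fun _ : R3 => 0 : C) = 0.
Proof.
move=> [lin _]; have t0 : schwartz (fun _ : R3 => 0 : C).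
  by apply: ctest_schwartz; exact: (ctest_real (@test0 R)).
have := lin 1 _ _ t0 t0.
rewrite (_ : (fun x : R3 => 1 * 0 + 0) = fun _ : R3 => 0 : C); last by apply/funext => x; rewrite mulr0 addr0.
by rewrite mul1r => /eqP; rewrite -subr_eq0 opprD addrA subrr sub0r oppr_eq0 => /eqP.
Qed.

Hypothesis (s2 : 2 * s <= 2).
Variable P : tdistribution R.
Hypothesis tP : tempered P.
Hypothesis weak : forall phi : 'I_3 -> R3 -> R, (forall j, test_function (phi j)) ->
  cint mu (fun x => \sum_(j < 3) frac_laplacian_field (s / 2) u j x *
                                  frac_laplacian_field (s / 2) phi j x) =
  (\int[mu]_x (\sum_(i < 3) \sum_(j < 3) u i x * u j x * partial j (phi i) x))%:C
  + P (cfun (divergence phi)).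

(** On a curl field the pressure acts on the zero function. The other two terms bring one factor
    [kapr psi] from [weak_lhs] and two from [quadratic_term], whence the cube. *)
Lemma weak_fourier p q (h : R3 -> R) : test_function h ->
  (kapr psi ^+ 3)%:C * \sum_(k < 3) cint mu (fun x => U k x * (((enorm x `^ s) ^+ 2)%:C *
     FI (cfun (curl p q h k)) x)) =
  (c0 R)%:C * \sum_(i < 3) \sum_(j < 3) cint mu (fun x => NN i j x *
     FI (cpartial j (cfun (curl p q h i))) x).
Proof.
move=> th; have tc k := curl_test p q k th.
have tcc k : ctest (cfun (curl p q h k)) by exact: (ctest_real (tc k)).
have tcp k j := ctest_partial j (tcc k).
have := weak tc; rewrite (weak_lhs tc).
rewrite (_ : cfun (divergence (curl p q h)) = fun _ : R3 => 0 : C); last first.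
  by apply/funext => x; rewrite /cfun (curl_div p q x th).
rewrite (tempered0 tP) addr0 -cint_real.
rewrite (@eq_cint _ _ _ mu _ (fun x => \sum_(i < 3) \sum_(j < 3)
   uc i x * (uc j x * cpartial j (cfun (curl p q h i)) x))); last first.
  move=> x; rewrite rmorph_sum; apply: eq_bigr => i _; rewrite rmorph_sum; apply: eq_bigr => j _.
  by rewrite cpartial_real !rmorphM /cfun /= mulrA.
have iq i j := (quadratic_term i j (tcp i j)).1.
have -> : cint mu (fun x => \sum_(i < 3) \sum_(j < 3)
   uc i x * (uc j x * cpartial j (cfun (curl p q h i)) x)) = \sum_(i < 3) \sum_(j < 3)
   cint mu (fun x => uc i x * (uc j x * cpartial j (cfun (curl p q h i)) x)).
  rewrite cint_sum; last by move=> i; apply: L1_sum => j; exact: iq.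
  apply: eq_bigr => i _.
  exact: (@cint_sum _ _ _ mu _ _ (fun j x => uc i x * (uc j x * cpartial j (cfun (curl p q h i)) x)) (iq i)).
move=> /(congr1 (fun z => (kapr psi ^+ 2)%:C * z)).
rewrite mulrA -rmorphM /= -exprSr => ->; rewrite mulr_sumr mulr_sumr; apply: eq_bigr => i _.
rewrite mulr_sumr mulr_sumr; apply: eq_bigr => j _; exact: (quadratic_term i j (tcp i j)).2.
Qed.

(** Entries of $x\wedge|x|^{2s}U$ and, in [rhs_g], of $x\wedge(Nx)$ with $N$ the matrix [NN]: up to
    constants, the curl of the two sides of the equation at frequency [x]. *)
Definition lhs_g p q (x : R3) : C := ((enorm x `^ s) ^+ 2 * coord3 p x)%:C * U q x -
  ((enorm x `^ s) ^+ 2 * coord3 q x)%:C * U p x.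
Definition rhs_g p q (x : R3) : C := \sum_(j < 3) ((coord3 j x * coord3 p x)%:C * NN q j x -
  (coord3 j x * coord3 q x)%:C * NN p j x).

Lemma enorm_s_measurable : measurable_fun setT (fun x : R3 => (enorm x `^ s) ^+ 2).
Proof. apply: measurable_funX; exact: (measurableT_comp (@measurable_powR R s) (@enorm_measurable R)). Qed.

Lemma enorm_s_om (x : R3) : (enorm x `^ s) ^+ 2 * om x <= 1.
Proof.
apply: om_poly; first exact: sqr_ge0.
rewrite -powR_mulrn ?powR_ge0// -powRrM; apply: powR_le_sq; rewrite ?enorm_ge0//.
  by rewrite mulr_ge0// ltW.
by rewrite mulrC.
Qed.

(** One power of [om] for $|x|^{2s}$, one for the coordinate and one for [U] itself. *)
Lemma U_piece p q : L1 mu (fun x => (om x ^+ 3)%:C * (((enorm x `^ s) ^+ 2 * coord3 p x)%:C * U q x)).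
Proof.
apply: U_om_poly; first by apply: measurable_funM; [exact: enorm_s_measurable|exact: coord_measurable].
move=> x; rewrite normrM (ger0_norm (sqr_ge0 (enorm x `^ s))).
rewrite [leLHS](_ : _ = ((enorm x `^ s) ^+ 2 * om x) * (`|coord3 p x| * om x)); last by ring.
rewrite -[leRHS]mulr1; apply: ler_pM (enorm_s_om x) (coord_om p x).
  by apply: mulr_ge0 (sqr_ge0 _) (om_ge0 x).
by apply: mulr_ge0 (normr_ge0 _) (om_ge0 x).
Qed.

Lemma NN_piece i j p q : L1 mu (fun x => (om x ^+ 3)%:C * ((coord3 i x * coord3 j x)%:C * NN p q x)).
Proof.
apply: NN_om_poly; first by apply: measurable_funM; exact: coord_measurable.
move=> x; rewrite normrM.
rewrite [leLHS](_ : _ = (`|coord3 i x| * om x) * (`|coord3 j x| * om x)); last by ring.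
rewrite -[leRHS]mulr1; apply: ler_pM (coord_om i x) (coord_om j x).
  by apply: mulr_ge0 (normr_ge0 _) (om_ge0 x).
by apply: mulr_ge0 (normr_ge0 _) (om_ge0 x).
Qed.

Lemma lhs_L1 p q : L1 mu (fun x => (om x ^+ 3)%:C * lhs_g p q x).
Proof.
by have := L1B (U_piece p q) (U_piece q p); congr L1; apply/funext => x; rewrite /lhs_g mulrBr.
Qed.

Lemma rhs_L1 p q : L1 mu (fun x => (om x ^+ 3)%:C * rhs_g p q x).
Proof.
have i j := L1B (NN_piece j p q j) (NN_piece j q p j).
have := L1_sum (index_enum _) i; congr L1; apply/funext => x.
by rewrite /rhs_g mulr_sumr; apply: eq_bigr => j _; rewrite mulrBr.
Qed.

Lemma lhs_cmeas p q : cmeas (lhs_g p q).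
Proof.
have m k : measurable_fun setT (fun x : R3 => (enorm x `^ s) ^+ 2 * coord3 k x).
  by apply: measurable_funM; [exact: enorm_s_measurable|exact: coord_measurable].
exact: (cmeasB (cmeasM (cmeas_real (m p)) (U_cmeas q)) (cmeasM (cmeas_real (m q)) (U_cmeas p))).
Qed.

Lemma rhs_cmeas p q : cmeas (rhs_g p q).
Proof.
have m k l : measurable_fun setT (fun x : R3 => coord3 k x * coord3 l x).
  by apply: measurable_funM; exact: coord_measurable.
apply: cmeas_sum => j.
exact: (cmeasB (cmeasM (cmeas_real (m j p)) (NN_cmeas q j)) (cmeasM (cmeas_real (m j q)) (NN_cmeas p j))).
Qed.

Lemma sum_delta (p q : 'I_3) (F : 'I_3 -> C) (a b : R) :
  \sum_(k < 3) ((k == q)%:R * a - (k == p)%:R * b)%:C * F k = a%:C * F q - b%:C * F p.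
Proof.
have E k : ((k == q)%:R * a - (k == p)%:R * b)%:C * F k =
    (if k == q then a%:C * F k else 0) - (if k == p then b%:C * F k else 0).
  rewrite rmorphB mulrBl !rmorphM /=.
  by case: (k == q); case: (k == p); rewrite ?rmorph1 ?rmorph0 ?mul1r ?mul0r.
rewrite (eq_bigr _ (fun k _ => E k)) sumrB -!big_mkcond /=.
by rewrite !big_pred1_eq.
Qed.

Lemma curl_identity p q : {ae mu, forall x,
  (kapr psi ^+ 3)%:C * (ci R * lhs_g p q x) = (c0 R)%:C * rhs_g p q x}.
Proof.
pose G x : C := (kapr psi ^+ 3)%:C * (ci R * lhs_g p q x) - (c0 R)%:C * rhs_g p q x.
have mG : cmeas G.
  exact: (cmeasB (cmeasM (cmeas_cst _ _) (cmeasM (cmeas_cst _ _) (lhs_cmeas p q)))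
    (cmeasM (cmeas_cst _ _) (rhs_cmeas p q))).
have iG : L1 mu (fun x => (om x ^+ 3)%:C * G x).
  have := L1B (L1Z ((kapr psi ^+ 3)%:C * ci R) (lhs_L1 p q)) (L1Z (c0 R)%:C (rhs_L1 p q)).
  by congr L1; apply/funext => x; rewrite /G; ring.
suff : {ae mu, forall x, G x = 0}.
  by apply: filterS => x /eqP; rewrite /G subr_eq0 => /eqP.
apply: (UL2_real mG iG) => h th; have tc : ctest (cfun h) by exact: ctest_real.
have iL := om_L1_FI (lhs_cmeas p q) (lhs_L1 p q) tc.
have iR := om_L1_FI (rhs_cmeas p q) (rhs_L1 p q) tc.
have E : (fun x => G x * FI (cfun h) x) = fun x =>
   ((kapr psi ^+ 3)%:C * ci R) * (lhs_g p q x * FI (cfun h) x) - (c0 R)%:C * (rhs_g p q x * FI (cfun h) x).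
  by apply/funext => x; rewrite /G; move: (FI (cfun h) x) => X; ring.
rewrite E (cintB (L1Z _ iL) (L1Z _ iR)) (cintZ _ iL) (cintZ _ iR).
have W := weak_fourier p q th.
have mp k : cmeas (fun x : R3 => ((enorm x `^ s) ^+ 2 * coord3 k x)%:C).
  by apply: cmeas_real; apply: measurable_funM; [exact: enorm_s_measurable|exact: coord_measurable].
have iUk k l : L1 mu (fun x => ((enorm x `^ s) ^+ 2 * coord3 k x)%:C * U l x * FI (cfun h) x).
  exact: (om_L1_FI (cmeasM (mp k) (U_cmeas l)) (U_piece k l) tc).
have EL : \sum_(k < 3) cint mu (fun x => U k x * (((enorm x `^ s) ^+ 2)%:C *
     FI (cfun (curl p q h k)) x)) = ci R * cint mu (fun x => lhs_g p q x * FI (cfun h) x).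
  pose T k x : C := ci R * (((k == q)%:R * coord3 p x - (k == p)%:R * coord3 q x)%:C *
     (((enorm x `^ s) ^+ 2)%:C * U k x * FI (cfun h) x)).
  have iT k : L1 mu (T k).
    have := L1Z (ci R) (L1B (L1Z ((k == q)%:R : R)%:C (iUk p k)) (L1Z ((k == p)%:R : R)%:C (iUk q k))).
    congr L1; apply/funext => x; rewrite /T !rmorphB !rmorphM /=.
    by move: (FI (cfun h) x) => X; ring.
  rewrite (eq_bigr (fun k => cint mu (T k))); last first.
    move=> k _; apply: eq_cint => x; rewrite (curl_FI p q k x th) /T.
    by move: (FI (cfun h) x) => X; ring.
  rewrite -(cint_sum _ iT) -(cintZ _ iL); apply: eq_cint => x.
  rewrite /T -mulr_sumr (sum_delta p q (fun k => ((enorm x `^ s) ^+ 2)%:C * U k x * FI (cfun h) x)).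
  by rewrite /lhs_g !rmorphM /=; move: (FI (cfun h) x) => X; ring.
have iNk i j k l : L1 mu (fun x => (coord3 i x * coord3 j x)%:C * NN k l x * FI (cfun h) x).
  have mm k' l' : cmeas (fun x : R3 => (coord3 k' x * coord3 l' x)%:C).
    by apply: cmeas_real; apply: measurable_funM; exact: coord_measurable.
  exact: (om_L1_FI (cmeasM (mm i j) (NN_cmeas k l)) (NN_piece i j k l) tc).
have ER : \sum_(i < 3) \sum_(j < 3) cint mu (fun x => NN i j x *
     FI (cpartial j (cfun (curl p q h i))) x) = cint mu (fun x => rhs_g p q x * FI (cfun h) x).
  pose T i j x : C := ((i == q)%:R * coord3 p x - (i == p)%:R * coord3 q x)%:C *
     ((coord3 j x)%:C * NN i j x * FI (cfun h) x).
  have iT i j : L1 mu (T i j).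
    have := L1B (L1Z ((i == q)%:R : R)%:C (iNk j p i j)) (L1Z ((i == p)%:R : R)%:C (iNk j q i j)).
    congr L1; apply/funext => x; rewrite /T !rmorphB !rmorphM /=.
    by move: (FI (cfun h) x) => X; ring.
  rewrite (eq_bigr (fun i => \sum_(j < 3) cint mu (T i j))); last first.
    move=> i _; apply: eq_bigr => j _; apply: eq_cint => x.
    rewrite (FI_partial j x (ctest_real (curl_test p q i th))) (curl_FI p q i x th) /T.
    rewrite -[RHS]opprK -[RHS]ci2; move: (FI (cfun h) x) => X; ring.
  rewrite exchange_big /= (eq_bigr (fun j => cint mu (fun x => \sum_(i < 3) T i j x))); last first.
    by move=> j _; rewrite (cint_sum _ (fun i => iT i j)).
  rewrite -cint_sum; last by move=> j; apply: L1_sum => i; exact: iT.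
  apply: eq_cint => x; rewrite /rhs_g mulr_suml; apply: eq_bigr => j _.
  rewrite /T (sum_delta p q (fun i => (coord3 j x)%:C * NN i j x * FI (cfun h) x)).
  by rewrite !rmorphM /=; move: (FI (cfun h) x) => X; ring.
by rewrite -mulrA -EL W ER subrr.
Qed.

Lemma ae_ord3 (Q : 'I_3 -> R3 -> Prop) : (forall i, {ae mu, forall x, Q i x}) ->
  {ae mu, forall x, forall i, Q i x}.
Proof.
move=> h; apply: filterS3 (h ord0) (h (lift ord0 ord0)) (h (lift ord0 (lift ord0 ord0))).
move=> x q0 q1 q2 [[|[|[|//]]] hi].
- by rewrite (_ : Ordinal hi = ord0) //; exact: val_inj.
- by rewrite (_ : Ordinal hi = lift ord0 ord0) //; exact: val_inj.
- by rewrite (_ : Ordinal hi = lift ord0 (lift ord0 ord0)) //; exact: val_inj.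
Qed.

(** The antisymmetric tensor $x_qA_p-x_pA_q$ contracted with $B_px_q$ gives $|x|^2A\cdot B-(x\cdot
    A)(x\cdot B)$, whose last term vanishes; likewise on the right. This replaces the Leray
    projection. *)
Lemma curl_algebra (K c : C) (x A B : 'I_3 -> C) (M : 'I_3 -> 'I_3 -> C) :
  (forall p q, K * (x p * A q - x q * A p) =
     c * \sum_(j < 3) (x j * x p * M q j - x j * x q * M p j)) ->
  \sum_(j < 3) x j * A j = 0 -> \sum_(j < 3) x j * B j = 0 ->
  (\sum_(j < 3) x j ^+ 2) * (K * \sum_(p < 3) B p * A p) =
  (\sum_(j < 3) x j ^+ 2) * (c * \sum_(j < 3) \sum_(p < 3) x j * M p j * B p).
Proof.
move=> e hA hB.
transitivity (\sum_(p < 3) \sum_(q < 3) B p * x q * (K * (x q * A p - x p * A q))).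
  have z : K * (\sum_(j < 3) x j * B j) * (\sum_(j < 3) x j * A j) = 0 by rewrite hA mulr0.
  rewrite -[LHS]subr0 -[X in _ - X = _]z.
  by rewrite !big_ord_recl !big_ord0; ring.
rewrite (eq_bigr (fun p => \sum_(q < 3) B p * x q * (c * \sum_(j < 3) (x j * x q * M p j - x j * x p * M q j)))); last first.
  by move=> p _; apply: eq_bigr => q _; rewrite e.
have z : c * (\sum_(q < 3) \sum_(j < 3) x q * x j * M q j) * (\sum_(j < 3) x j * B j) = 0.
  by rewrite hB mulr0.
rewrite -[RHS]subr0 -[X in _ = _ - X]z.
by rewrite !big_ord_recl !big_ord0; ring.
Qed.

(** The constant of the energy identity; its sign comes from passing from [x] to the frequency
    [z = - x]. *)
Definition kk : C := - ((kapr psi ^+ 3)%:C * ci R) / (c0 R)%:C.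

Lemma c0_C_neq0 : (c0 R)%:C != 0.
Proof.
apply/eqP => /(congr1 (@complex.Re R)) /= E; by have := c0_gt0 R; rewrite E ltxx.
Qed.

Lemma kk_neq0 : kk != 0.
Proof.
rewrite /kk mulf_neq0 ?invr_eq0 ?c0_C_neq0// oppr_eq0 mulf_neq0 ?ci_neq0//.
apply/eqP => /(congr1 (@complex.Re R)) /= /eqP; rewrite expf_eq0 /=.
by apply/negP; rewrite lt0r_neq0// kapr_gt0.
Qed.

(** The curl identity at $x=-z$ is contracted with the conjugate of $U(x)$, which is $U(z)$ by
    Hermitian symmetry; $|x|^2\ne0$ is then cancelled, and the convolution [NN] becomes the integral
    of [Tz U z]. *)
Lemma energy_density_ae : weakly_div_free u -> {ae mu, forall z, L1 mu (Tz U z) /\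
  kk * (D2 s (vnorm U) z)%:C = cint mu (Tz U z)}.
Proof.
move=> Hdf.
have a1 : {ae mu, forall x, forall p q, (kapr psi ^+ 3)%:C * (ci R * lhs_g p q x) = (c0 R)%:C * rhs_g p q x}.
  by apply: ae_ord3 => p; apply: ae_ord3 => q; exact: curl_identity.
have a2 : {ae mu, forall x, forall j, U j (- x) = (U j x)^*}.
  by apply: ae_ord3 => j; exact: U_conj_ae.
have a3 : {ae mu, forall x, forall i j, L1 mu (fun y => U i y * U j (x - y)) /\
    NN i j x = cint mu (fun y => U i y * U j (x - y))}.
  by apply: ae_ord3 => i; apply: ae_ord3 => j; exact: NN_ae.
have a4 : {ae mu, forall x, ((forall p q, (kapr psi ^+ 3)%:C * (ci R * lhs_g p q x) = (c0 R)%:C * rhs_g p q x) /\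
    (forall j, U j (- x) = (U j x)^*) /\
    (forall i j, L1 mu (fun y => U i y * U j (x - y)) /\ NN i j x = cint mu (fun y => U i y * U j (x - y)))) /\
    \sum_(j < 3) (coord3 j x)%:C * U j x = 0 /\ enorm x != 0}.
  by apply: filterS3 (filterI a1 a2) a3 (filterI (dotU_ae Hdf) (@enorm_neq0_ae R)) => x [? ?] ? [? ?].
apply: filterS (ae_reflect 0 a4) => z; rewrite sub0r => -[[h1 [h2 h3]] [h4 h5]].
set x := - z in h1 h2 h3 h4 h5.
have zx : z = - x by rewrite opprK.
have Up p : U p z = (U p x)^* by rewrite -h2 zx.
have iT j p : L1 mu (fun y => (coord3 j z)%:C * U p z * (U j y * U p (- z - y))).
  apply: L1Z; have [i _] := h3 p j; have := L1_reflect x i; congr L1.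
  by apply/funext => y; rewrite subKr mulrC.
have TE : Tz U z = fun y => \sum_(j < 3) \sum_(p < 3) (coord3 j z)%:C * U p z * (U j y * U p (- z - y)).
  apply/funext => y; rewrite /Tz /dotU mulr_suml; apply: eq_bigr => j _.
  by rewrite mulr_sumr; apply: eq_bigr => p _; ring.
have jT : L1 mu (Tz U z) by rewrite TE; apply: L1_sum => j; apply: L1_sum => p; exact: iT.
split=> //.
have cE : cint mu (Tz U z) = - \sum_(j < 3) \sum_(p < 3) (coord3 j x)%:C * NN p j x * (U p x)^*.
  rewrite TE cint_sum; last by move=> j; apply: L1_sum => p; exact: iT.
  rewrite -sumrN; apply: eq_bigr => j _; rewrite cint_sum; last by move=> p; exact: iT.
  rewrite -sumrN; apply: eq_bigr => p _; have [i ->] := h3 p j.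
  have ir : L1 mu (fun y => U j y * U p (- z - y)).
    by have := L1_reflect x i; congr L1; apply/funext => y; rewrite subKr mulrC.
  rewrite (cintZ _ ir) Up -(cint_reflect x i) (@eq_cint _ _ _ mu _ (fun y => U p (x - y) * U j (x - (x - y)))).
    rewrite zx coord3N rmorphN /=; ring.
  by move=> y; rewrite subKr mulrC.
have key := @curl_algebra ((kapr psi ^+ 3)%:C * ci R * ((enorm x `^ s) ^+ 2)%:C) (c0 R)%:C
  (fun j => (coord3 j x)%:C) (fun j => U j x) (fun j => (U j x)^*) (fun p j => NN p j x).
have {}key := key (fun p q => ltac:(by have := h1 p q; rewrite /lhs_g /rhs_g => h;
  apply: etrans (etrans h _); [rewrite !rmorphM /=; ring|congr (_ * _); apply: eq_bigr => j _; rewrite !rmorphM /=; ring])) h4.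
have hB : \sum_(j < 3) (coord3 j x)%:C * (U j x)^* = 0.
  apply: etrans (_ : (\sum_(j < 3) (coord3 j x)%:C * U j x)^* = 0); last first.
    by rewrite h4; apply: complexP; rewrite ?ReJ ?ImJ /= ?oppr0.
  rewrite !big_ord_recl !big_ord0 !conjD !conjM !conj_real.
  by congr (_ + (_ + (_ + _))); apply: complexP; rewrite ?ReJ ?ImJ /= ?oppr0.
have {}key := key hB.
have r2 : \sum_(j < 3) (coord3 j x)%:C ^+ 2 = (enorm x ^+ 2)%:C.
  rewrite sqr_enorm /dot rmorph_sum; apply: eq_bigr => j _; by rewrite expr2 rmorphM.
rewrite r2 in key.
have r2n : (enorm x ^+ 2)%:C != 0.
  by apply/eqP => /(congr1 (@complex.Re R)) /= /eqP; rewrite sqrf_eq0; apply/negP.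
move/(mulfI r2n): key => key.
have DE : (D2 s (vnorm U) z)%:C = ((enorm x `^ s) ^+ 2)%:C * \sum_(p < 3) (U p x)^* * U p x.
  rewrite /D2 exprMn rmorphM /= sqr_vnorm zx enormN; congr (_ * _).
  rewrite rmorph_sum; apply: eq_bigr => p _; rewrite [_ * U p x]mulrC mulcJ.
  by rewrite -zx Up normc_conj.
rewrite cE DE /kk; move: key; set S := \sum_(j < 3) _; set Q := \sum_(p < 3) _ => key.
have cn := c0_C_neq0.
rewrite (_ : _ * _ = - ((c0 R)%:C^-1 * ((kapr psi ^+ 3)%:C * ci R * ((enorm x `^ s) ^+ 2)%:C * Q))); last by ring.
by rewrite key mulKf.
Qed.

Lemma weak_solution_eq0 : 5 / 6 <= s -> weakly_div_free u ->
  (exists M : R, forall n0 : nat, exists n, (n0 <= n)%N /\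
    forall j, {ae mu, forall x, normc (FI (WW psi U (la R n) j) x) <= M * (la R n / La s n ^+ 2)}) ->
  {ae mu, forall x, forall j, u j x = 0}.
Proof.
move=> s56 Hdf [M Hcore].
pose dv (x : R3) : C := \sum_(j < 3) (coord3 j x)%:C * U j x.
have mdv : cmeas dv.
  by apply: cmeas_sum => j; apply: cmeasM (U_cmeas j); apply: cmeas_real; exact: coord_measurable.
(* The energy argument wants $x\cdot U(x)=0$ at every point. Setting [U] to zero off the set where
   this holds changes it on a null set only. *)
pose S : set R3 := [set x | normc (dv x) <= 0].
have mS : measurable S.
  have := measurable_fun_ler (cmeas_normc mdv) (@measurable_cst _ _ R3 _ setT (0 : R)) measurableT (Y := [set true]) I.
  by rewrite setTI.
pose U' j x : C := (\1_S x : R)%:C * U j x.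
have mi : cmeas (fun x : R3 => (\1_S x : R)%:C) by apply: cmeas_real; exact: measurable_indic.
have mU' j : cmeas (U' j) by exact: (cmeasM mi (U_cmeas j)).
have US x : dv x = 0 -> forall j, U' j x = U j x.
  move=> h j; rewrite /U' indicE mem_set ?mul1r// /S /=; by rewrite h normc_real normr0.
have UU : {ae mu, forall x, forall j, U' j x = U j x}.
  by apply: filterS (dotU_ae Hdf) => x h; exact: US.
have UUj j : {ae mu, forall x, U' j x = U j x} by apply: (filterS _ UU) => x; exact.
have HL j h : ctest h -> L1 mu (fun x => U' j x * h x).
  move=> th; apply: (@L1_ae _ _ _ mu _ _ (cmeasM (mU' j) (ctest_cmeas th)) (U_test j th)).
  by apply: (filterS _ (UUj j)) => x ->.
have Hdiv x : \sum_(j < 3) (coord3 j x)%:C * U' j x = 0.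
  rewrite (eq_bigr (fun j => (\1_S x : R)%:C * ((coord3 j x)%:C * U j x))); last first.
    by move=> j _; rewrite /U' mulrCA.
  rewrite -mulr_sumr indicE; case: (boolP (x \in S)) => [|_]; last by rewrite mul0r.
  rewrite inE /S /= => h; rewrite mul1r; apply: Normc.eq0_normc.
  by apply/eqP; rewrite eq_le h normc_ge0.
have vE x : (forall j, U' j x = U j x) -> vnorm U' x = vnorm U x.
  by move=> h; rewrite /vnorm; congr Num.sqrt; apply: eq_bigr => j _; rewrite h.
have vle x : vnorm U' x <= vnorm U x.
  rewrite -(@ler_pXn2r _ 2) ?nnegrE ?vnorm_ge0// !sqr_vnorm; apply: ler_sum => j _.
  rewrite lerXn2r ?nnegrE ?normc_ge0// /U' (Normc.normcM _ (U j x)) normc_real.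
  by rewrite ler_piMl ?normc_ge0// ger0_norm// indicE; case: (_ \in _).
have mD' : measurable_fun setT (D2 s (vnorm U')).
  apply: measurable_funX; apply: measurable_funM; last exact: vnorm_measurable.
  exact: (measurableT_comp (@measurable_powR R s) (@enorm_measurable R)).
have iD' : rint mu (D2 s (vnorm U')).
  apply: (@rint_le _ _ _ mu _ _ mD' _ iD) => x; rewrite ger0_norm ?sqr_ge0// /D2.
  rewrite lerXn2r ?nnegrE ?mulr_ge0 ?powR_ge0 ?vnorm_ge0//.
  by rewrite ler_wpM2l ?powR_ge0.
have Hid' : {ae mu, forall z, L1 mu (Tz U' z) /\ kk * (D2 s (vnorm U') z)%:C = cint mu (Tz U' z)}.
  have UU2 := UU; apply: filterS2 (energy_density_ae Hdf) UU2 => z [iT eT] hz.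
  have mT : cmeas (Tz U' z).
    apply: cmeasM; apply: cmeas_sum => j.
      exact: (cmeasM (cmeas_cst _ _) (mU' j)).
    apply: cmeasM (cmeas_cst _ _).
    exact: (cmeas_comp (mU' j) (@measurable_reflect R (- z))).
  have aeT : {ae mu, forall y, Tz U' z y = Tz U z y}.
    have UU2 := UU; apply: filterS2 UU2 (ae_reflect (- z) UU) => y h1 h2; rewrite /Tz /dotU.
    by congr (_ * _); apply: eq_bigr => j _; rewrite ?h1 ?h2 ?hz.
  split; first exact: (@L1_ae _ _ _ mu _ _ mT iT aeT).
  by rewrite (@cint_ae _ _ _ mu _ _ mT (L1_cmeas iT) aeT) -eT /D2 (vE _ hz).
have core' : exists M : R, forall n0 : nat, exists n, (n0 <= n)%N /\
    forall j, {ae mu, forall x, normc (FI (WW psi U' (la R n) j) x) <= M * (la R n / La s n ^+ 2)}.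
  exists M => n0; have [n [hn hj]] := Hcore n0; exists n; split=> // j.
  have mr := cmeas_real (rho_measurable Hpsi (la_gt0 R n)).
  apply: (filterS _ (hj j)) => x; rewrite (@ae_FI _ _ (WW psi U (la R n) j) _ (cmeasM mr (mU' j)) (cmeasM mr (U_cmeas j)))//.
  by apply: (filterS _ (UUj j)) => y e; rewrite /WW e.
have U0 := energy_argument Hpsi s56 s1 mU' HL Hdiv iD' kk_neq0 Hid' core'.
have Uz j : {ae mu, forall x, U j x = 0}.
  by have UU2 := UU; apply: filterS2 U0 UU2 => x h1 h2; rewrite -h2 h1.
suff uz : forall j, {ae mu, forall x, uc j x = 0}.
  have : {ae mu, forall x, forall j, uc j x = 0} by exact: ae_ord3.
  by apply: filterS => x h j; have := congr1 (@complex.Re R) (h j).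
move=> j; apply: (ctest_separates Hpsi (u_cmeas j)) => h th; have iu := u_test j th; split=> //.
have E := dual_uU j th.
have Z : cint mu (fun x => U j x * FI h x) = 0.
  rewrite -[RHS](@cint0 _ _ _ mu); apply: cint_ae.
  - exact: (cmeasM (U_cmeas j) (FI_cmeas (ctest_L1 th))).
  - exact: cmeas_cst.
  - by apply: (filterS _ (Uz j)) => x ->; rewrite mul0r.
move: E; rewrite Z => /esym/eqP; rewrite mulf_eq0 => /orP[|/eqP //].
by rewrite -(kapE Hpsi) (negbTE (kap_neq0 Hpsi)).
Qed.
End WeakFacts.

(** * The low-frequency conditions *)

Section Claims.
Variable R : realType.
Local Notation R3 := (R * R * R)%type.
Local Notation C := R[i].
Local Notation mu := (mu3 R).

(** A finite lower limit gives a bound valid for infinitely many indices, the form needed by the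
    energy argument. *)
Lemma liminf_minfty_lt (a : int -> \bar R) : (liminf_minfty a < +oo)%E ->
  exists2 M : R, 0 < M & forall n0, exists2 n, (n0 <= n)%N & (a (- n%:Z)%R < M%:E)%E.
Proof.
rewrite /liminf_minfty limn_einf_lim; set v := (fun n : nat => _).
rewrite (cvg_lim (@ereal_hausdorff R) (@cvg_einfs_sup R v)).
set L := ereal_sup _ => L0.
have [M M0 hM] : exists2 M : R, 0 < M & (L < M%:E)%E.
  case: L L0 => [r _| |_] //; last by exists 1; rewrite ?ltNyr.
  exists (`|r| + 1); first by rewrite ltr_wpDl.
  by rewrite lte_fin ltr_pwDr// ler_norm.
exists M => // n0; have : (einfs v n0 < M%:E)%E.
  by apply: le_lt_trans hM; apply: ereal_sup_ubound; exists n0.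
by rewrite /einfs/= => /ereal_inf_lt [_ [n /= hn <-] h]; exists n.
Qed.

Lemma dist_Lnorm_lt p A T (M : \bar R) : (dist_Lnorm p A T < M)%E ->
  exists g, (forall j, represents (T j) (g j)) /\
    (Lnorm mu p ((fun x => (vnorm g x)%:E) \_ A) < M)%E.
Proof. by move=> /ereal_inf_lt [_ [g /= hg <-] h]; exists g. Qed.

(** The norm of exponent [+oo] is the essential supremum on spaces of positive measure. *)
Lemma mu3_gt0 : (0 < mu setT)%E.
Proof.
apply: (@lt_le_trans _ _ (mu (cube 1))).
  by rewrite mu3_cube// lte_fin exprn_gt0// mulr_gt0.
by apply: le_measure; rewrite ?inE//; exact: cube_measurable.
Qed.

Lemma Lnorm_oo_lt (g : 'I_3 -> R3 -> C) A (M : R) :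
  (Lnorm mu +oo ((fun x => (vnorm g x)%:E) \_ A) < M%:E)%E ->
  {ae mu, forall x, A x -> vnorm g x <= M}.
Proof.
rewrite unlock mu3_gt0 => /ltW h.
apply: filterS (@ess_sup_ge _ _ R mu (abse \o (fun x => (vnorm g x)%:E) \_ A)) => x hx Ax.
have := le_trans hx h; rewrite /= patchE mem_set// /= lee_fin; apply: le_trans.
exact: ler_norm.
Qed.

Lemma psi_bounded (psi : R3 -> R) : cutoff psi -> exists2 Mp, 0 <= Mp & forall x, `|psi x| <= Mp.
Proof. by move=> h; have [M M0 hM] := test_bounded (psi_test h); exists M. Qed.

Variables (psi : R3 -> R) (Hpsi : cutoff psi).
Variables (s : R) (s56 : 5 / 6 <= s) (s1 : s < 1).
Variables (u : 'I_3 -> R3 -> R) (U : 'I_3 -> R3 -> C).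
Hypothesis rU : forall j, represents (fourier (dist_field u j)) (U j).

Let HL j h : ctest h -> L1 mu (fun x => U j x * h x).
Proof. exact: U_test. Qed.

Lemma fourier_U j F : ctest F -> fourier (dist_field u j) F = cint mu (fun x => U j x * F x).
Proof. by move=> tF; have [_ H] := rU j; rewrite (H _ (ctest_schwartz tF)) dist_ofE. Qed.

Lemma multU_L1 j m : ctest (cfun m) -> L1 mu (fun x => (m x)%:C * U j x).
Proof. by move=> tm; have := HL j tm; congr L1; apply/funext => x; rewrite mulrC. Qed.

Lemma ctest_mult (m : R3 -> R) (h : R3 -> C) : ctest (cfun m) -> ctest h -> ctest (fun x => (m x)%:C * FI h x).
Proof.
move=> tm th; have := ctestM tm (FI_csmooth th).
by congr ctest; apply/funext => x; rewrite mulrC.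
Qed.

Lemma represents_FI T (g F : R3 -> C) : represents T g -> L1 mu F ->
  (forall h, ctest h -> T h = cint mu (fun x => F x * FI h x)) ->
  {ae mu, forall x, g x = FI F x}.
Proof.
move=> [rg hg] jF hT.
have mg : cmeas g by case: rg.
have : {ae mu, forall x, g x - FI F x = 0}.
  apply: (ctest_separates Hpsi); first exact: (cmeasB mg (FI_cmeas jF)).
  move=> h th; have sh := ctest_schwartz th; have jh := ctest_L1 th.
  have i1 := regular_L1 rg sh.
  have i2 : L1 mu (fun x => FI F x * h x).
    have := L1_bounded jh (FI_cmeas jF) (fun x => FI_bound x jF).
    by congr L1; apply/funext => x; rewrite mulrC.
  have E : (fun x => (g x - FI F x) * h x) = fun x => g x * h x - FI F x * h x.
    by apply/funext => x; rewrite mulrBl.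
  rewrite E; split; first exact: (L1B i1 i2).
  by rewrite (cintB i1 i2) -dist_ofE -(hg _ sh) (hT _ th) (FI_mult jF jh) subrr.
by apply: filterS => x /eqP; rewrite subr_eq0 => /eqP.
Qed.

Lemma multiplier_density j m g : ctest (cfun m) ->
  represents (inv_fourier (dist_mul m (fourier (dist_field u j)))) g ->
  {ae mu, forall x, g x = FI (fun x => (m x)%:C * U j x) x}.
Proof.
move=> tm rg; apply: (represents_FI rg (multU_L1 j tm)) => h th.
have := fourier_U j (ctest_mult tm th); rewrite /inv_fourier /dist_mul => ->.
by apply: eq_cint => x; rewrite mulrCA mulrA.
Qed.

(** Between the two multipliers an inverse transform meets a transform; on test functions their
    composition is multiplication by [kapr psi], which stays in the formula. *)
Lemma iterated_multiplier_density j m1 m2 g : ctest (cfun m1) -> ctest (cfun m2) ->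
  represents (inv_fourier (dist_mul m1 (fourier
    (inv_fourier (dist_mul m2 (fourier (dist_field u j))))))) g ->
  {ae mu, forall x, g x = (kapr psi)%:C * FI (fun x => (m1 x * m2 x)%:C * U j x) x}.
Proof.
move=> t1 t2 rg.
have t12 : ctest (cfun (fun x => m1 x * m2 x)).
  have := ctestM t1 (ctest_smooth t2).
  by congr ctest; apply/funext => x; rewrite /cfun rmorphM mulrC.
have jF := multU_L1 j t12.
have h1 := represents_FI rg (L1Z (kapr psi)%:C jF).
suff H : forall h, ctest h -> inv_fourier (dist_mul m1 (fourier
    (inv_fourier (dist_mul m2 (fourier (dist_field u j)))))) h =
    cint mu (fun x => (kapr psi)%:C * ((m1 x * m2 x)%:C * U j x) * FI h x).
  apply: filterS (h1 H) => x ->; exact: (FIZ _ _ jF).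
move=> h th; have tk := ctest_mult t1 th.
have E : inv_fourier_fun (fourier_fun (fun x => (m1 x)%:C * FI h x)) =
    fun x => (kapr psi)%:C * ((m1 x)%:C * FI h x).
  apply/funext => x; rewrite -[LHS]/(FI _ x).
  rewrite (eq_FI (G := fun y => FI (fun x => (m1 x)%:C * FI h x) (- y))); last first.
    by move=> y; rewrite fourier_funE.
  by rewrite (FI_opp _ (FI_L1 tk)) (FI_inv_test Hpsi _ tk) opprK (kapE Hpsi).
have t3 : ctest (fun x => (m2 x)%:C * ((kapr psi)%:C * ((m1 x)%:C * FI h x))).
  have := ctestM (ctestZ (kapr psi)%:C tk) (ctest_smooth t2); exact.
transitivity (fourier (dist_field u j) (fun x => (m2 x)%:C *
    inv_fourier_fun (fourier_fun (fun x => (m1 x)%:C * FI h x)) x)); first by [].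
rewrite E (fourier_U j t3).
apply: eq_cint => x; rewrite rmorphM; move: (FI h x) => X; ring.
Qed.

(** All low-frequency bounds are multiples of the geometric sequence $2^{n(1-2s)}$; this is its
    ratio. *)
Definition qq : R := 2 `^ (1 - 2 * s).

Lemma qq_gt0 : 0 < qq. Proof. exact: powR_gt0. Qed.

Lemma qq_lt1 : qq < 1.
Proof.
have h : 0 < 2 * s - 1 by have s5 := s56; lra.
rewrite /qq -opprB powRN invf_lt1 ?powR_gt0// [ltLHS](_ : 1 = 1 `^ (2 * s - 1)); last by rewrite powR1.
by apply: gt0_ltr_powR; rewrite ?nnegrE// ltr1n.
Qed.

Lemma qq_expr n : qq ^+ n = 2 `^ (n%:R * (1 - 2 * s)).
Proof. by rewrite /qq -powR_mulrn ?powR_ge0// -powRrM mulrC. Qed.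

Lemma la_qq n : la R n / La s n ^+ 2 = qq ^+ n.
Proof.
have L0 := La_gt0 s n; apply: (@mulIf _ (La s n ^+ 2)); first by rewrite expf_neq0// gt_eqF.
rewrite divfK ?expf_neq0 ?gt_eqF// La_expr -exprM [(n * 2)%N]mulnC exprM -exprMn.
rewrite /la; congr (_ ^+ n); rewrite /qq expr2 -!powRD; try by apply/implyP.
by rewrite [X in 2 `^ X](_ : _ = 1) ?powRr1//; ring.
Qed.

Lemma two_powN (n : nat) : 2 `^ ((- n%:Z)%:~R * (1 - 2 * s)) = (qq ^+ n)^-1.
Proof. by rewrite qq_expr rmorphN mulNr powRN. Qed.

Lemma dilation_la (n : nat) : (2 : R) ^ (- - n%:Z) = la R n.
Proof. by rewrite opprK. Qed.

Lemma rhoC_test n : ctest (cfun (rho psi (la R n))).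
Proof. exact: (ctest_real (rho_test Hpsi (la_gt0 R n))). Qed.

Lemma lowpass_sup_bound n (M : R) :
  ((2 `^ ((- n%:Z)%:~R * (1 - 2 * s))%R)%:E *
     dist_Lnorm +oo setT (fun j => dotS psi (- n%:Z)%R (dist_field u j)) < M%:E)%E ->
  forall j, {ae mu, forall x, normc (FI (WW psi U (la R n) j) x) <= M * (la R n / La s n ^+ 2)}.
Proof.
have q0 : 0 < qq ^+ n by rewrite exprn_gt0 ?qq_gt0.
rewrite two_powN lte_pdivrMl// -EFinM => /dist_Lnorm_lt [g [rg /Lnorm_oo_lt hg]] j.
have rj : represents (inv_fourier (dist_mul (rho psi (la R n)) (fourier (dist_field u j)))) (g j).
  have := rg j; rewrite /dotS /dyadic_multiplier.
  by rewrite (_ : (fun xi => _) = rho psi (la R n)) //; apply/funext => x; rewrite dilation_la.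
apply: filterS2 hg (multiplier_density (rhoC_test n) rj) => x h e.
rewrite la_qq mulrC; apply: le_trans (h I).
by apply: (le_trans _ (normc_vnorm g j x)); rewrite e.
Qed.
End Claims.

(** * The Besov and L^r conditions *)

Section LowFrequency.
Variable R : realType.
Local Notation R3 := (R * R * R)%type.
Local Notation C := R[i].
Local Notation mu := (mu3 R).
Variables (psi : R3 -> R) (Hpsi : cutoff psi).
Variables (s : R) (s56 : 5 / 6 <= s) (s1 : s < 1).
Variables (u : 'I_3 -> R3 -> R) (U : 'I_3 -> R3 -> C).
Hypothesis rU : forall j, represents (fourier (dist_field u j)) (U j).
Local Notation q := (qq s).
Local Notation W n := (WW psi U (la R n)).
Local Notation rh n := (rho psi (la R n)).

Let HL j h : ctest h -> L1 mu (fun x => U j x * h x).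
Proof. exact: U_test. Qed.

Lemma W_L1 n j : L1 mu (W n j).
Proof. exact: (WW_L1 Hpsi HL (la_gt0 R n)). Qed.

Lemma ler_la n m : (n <= m)%N -> la R n <= la R m.
Proof. by move=> h; rewrite /la ler_eXn2l ?ltr1n. Qed.

(** The support of [rh m] lies in the ball of radius $2^{-m}\le\frac12 2^{-n}$, where [rh n] is
    1. *)
Lemma rho_rho n m x : (n < m)%N -> rh n x * rh m x = rh m x.
Proof.
move=> nm; have [h|h] := ltP (la R m)^-1 (enorm x).
  by rewrite (rho_far Hpsi (la_gt0 R m) h) mulr0.
case: Hpsi => _ _ _ near; rewrite {1}/rho near ?mul1r//.
rewrite enormZ gtr0_norm ?la_gt0//.
apply: (@le_trans _ _ (la R n * (la R m)^-1)); first by rewrite ler_pM2l ?la_gt0.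
rewrite ler_pdivrMr ?la_gt0// ler_pdivlMl//.
by have := ler_la nm; rewrite {1}/la exprS.
Qed.

(** The multiplier of the dyadic block of index $-(m+1)$, as
    $\varphi(2^{m+1}x)=\psi(2^mx)-\psi(2^{m+1}x)$; hence the shift by one in the bounds below. *)
Definition ann m (x : R3) : R := rh m x - rh m.+1 x.

Lemma annulus_la (m : nat) x : annulus_cutoff psi ((2 ^ (- - m.+1%:Z)) *: x) = ann m x.
Proof.
rewrite dilation_la /annulus_cutoff /ann /rho scalerA; congr (psi (_ *: x) - _).
by rewrite /la exprS mulrA mulVf ?mul1r.
Qed.

Lemma ann_test m : ctest (cfun (ann m)).
Proof.
have := ctestD (rhoC_test Hpsi m) (ctestZ (-1) (rhoC_test Hpsi m.+1)).
by congr ctest; apply/funext => x; rewrite /cfun /ann rmorphB mulN1r.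
Qed.

Lemma ann_W n m j x : (n < m)%N -> (ann m x * rh n x)%:C * U j x = W m j x - W m.+1 j x.
Proof.
move=> nm; rewrite /WW -mulrBl; congr (_ * _); rewrite -rmorphB; congr (_%:C).
by rewrite /ann mulrBl ![_ * rh n x]mulrC !rho_rho// ltnS ltnW.
Qed.

(** For [m] beyond [n] the factor [rh n] is 1 on the supports of [rh m] and [rh m.+1], so a dyadic
    block of the low-pass field is a difference of two consecutive low-pass fields. *)
Lemma annulus_besov_bound n (M : R) :
  (besov_norm psi (1 - 2 * s)%R (fun j => dotS psi (- n%:Z)%R (dist_field u j)) < M%:E)%E ->
  forall j m, (n < m)%N ->
  {ae mu, forall x, normc ((kapr psi)%:C * (FI (W m j) x - FI (W m.+1 j) x)) <= M * q ^+ m.+1}.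
Proof.
rewrite /besov_norm; case: ifP => // _ hB j m nm.
have q0 : 0 < q ^+ m.+1 by rewrite exprn_gt0 ?qq_gt0.
have : ((2 `^ ((- m.+1%:Z)%:~R * (1 - 2 * s))%R)%:E * dist_Lnorm +oo setT
    (fun i => dotDelta psi (- m.+1%:Z)%R (dotS psi (- n%:Z)%R (dist_field u i))) < M%:E)%E.
  by apply: le_lt_trans hB; apply: ereal_sup_ubound; exists (- m.+1%:Z).
rewrite two_powN lte_pdivrMl// -EFinM => /dist_Lnorm_lt [g [rg /Lnorm_oo_lt hg]].
have rj : represents (inv_fourier (dist_mul (ann m) (fourier
    (inv_fourier (dist_mul (rh n) (fourier (dist_field u j))))))) (g j).
  have := rg j; rewrite /dotDelta /dotS /dyadic_multiplier.
  rewrite (_ : (fun xi => annulus_cutoff _ _) = ann m); last first.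
    by apply/funext => x; rewrite annulus_la.
  by rewrite (_ : (fun xi => psi _) = rh n) //; apply/funext => x; rewrite dilation_la.
apply: filterS2 hg (iterated_multiplier_density Hpsi rU (ann_test m) (rhoC_test Hpsi n) rj) => x h e.
rewrite [leRHS]mulrC; apply: le_trans (h I); apply: (le_trans _ (normc_vnorm g j x)).
rewrite e -(FIB _ (W_L1 m j) (W_L1 m.+1 j)).
by rewrite (eq_FI (G := fun y => W m j y - W m.+1 j y))// => y; exact: ann_W.
Qed.

(** The supports shrink to the origin. This makes the remainder of the telescoping sum over the
    dyadic blocks vanish. *)
Lemma W_int_cvg n j : (fun k => \int[mu]_x normc (W (n.+1 + k) j x)) @ \oo --> (0 : R).
Proof.
have [Mp Mp0 hMp] := psi_bounded Hpsi.
have [] := @rDCT _ _ _ mu (fun k x => normc (W (n.+1 + k) j x)) (fun=> 0)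
  (fun x => Mp * normc (W n j x)).
- by move=> k; exact: (cmeas_normc (L1_cmeas (W_L1 _ j))).
- exact: measurable_cst.
- apply: filterS (@enorm_neq0_ae R) => x x0.
  have xpos : 0 < enorm x by rewrite lt_def x0 enorm_ge0.
  have [n0 hn] := la_unbounded (enorm x)^-1.
  apply: cvg_near_cst; exists n0 => // k /= hk.
  have h : (la R (n.+1 + k))^-1 < enorm x.
    rewrite -[ltRHS]invrK ltf_pV2 ?posrE ?invr_gt0 ?la_gt0//.
    by apply: hn; rewrite (leq_trans hk)// leq_addl.
  by rewrite /WW (rho_far Hpsi (la_gt0 R _) h) mul0r normc_real normr0.
- exact: (rintZ Mp (L1_normc (W_L1 n j))).
- move=> k x; rewrite ger0_norm ?normc_ge0//.
  have -> : W (n.+1 + k) j x = (rh (n.+1 + k) x)%:C * W n j x.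
    by rewrite /WW mulrA -rmorphM [_ * rh n x]mulrC (rho_rho x (leq_addr k n.+1)).
  rewrite (Normc.normcM _ (W n j x)) normc_real.
  by apply: ler_wpM2r; [exact: normc_ge0|exact: hMp].
by move=> _; rewrite /Rintegral integral0.
Qed.

(** As $MQ/(1-p)-MpQ/(1-p)=MQ\ge MpQ$, the quantity $K|a|-MQ/(1-p)$ does not decrease from one scale
    to the next. Iterating it sums the geometric series without partial sums. *)
Lemma geometric_step (K M Q p : R) : 0 <= K -> 0 <= M -> 0 <= Q -> 0 < p -> p < 1 ->
  forall a b : C, normc (K%:C * (a - b)) <= M * (p * Q) ->
  K * normc a - M * Q / (1 - p) <= K * normc b - M * (p * Q) / (1 - p).
Proof.
move=> K0 M0 Q0 p0 p1 a b; rewrite Normc.normcM normc_real ger0_norm// => h.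
have t : normc a <= normc (a - b) + normc b by have := le_normcD (a - b) b; rewrite subrK.
have {}t : K * normc a <= M * (p * Q) + K * normc b.
  by apply: (le_trans (ler_wpM2l K0 t)); rewrite mulrDr lerD2r.
have E : M * Q / (1 - p) - M * (p * Q) / (1 - p) = M * Q by field; rewrite subr_eq0 gt_eqF.
have : M * (p * Q) <= M * Q by rewrite ler_wpM2l// ler_piMl// ltW.
lra.
Qed.

(** The nondecreasing sequence [F] is bounded above by one tending to 0, so its first term is at
    most 0. The index is [n.+1] because the blocks are controlled only for [m] beyond [n]. *)
Lemma lowpass_besov_bound n (M : R) : 0 < M ->
  (besov_norm psi (1 - 2 * s)%R (fun j => dotS psi (- n%:Z)%R (dist_field u j)) < M%:E)%E ->
  forall j, {ae mu, forall x, normc (FI (W n.+1 j) x) <=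
     (M / (1 - q) / kapr psi) * (la R n.+1 / La s n.+1 ^+ 2)}.
Proof.
move=> M0 hB j; have k0 := kapr_gt0 Hpsi; have q0 := qq_gt0 s; have q1 := qq_lt1 s56.
have hall : {ae mu, forall x, forall k,
    normc ((kapr psi)%:C * (FI (W (n.+1 + k) j) x - FI (W (n.+1 + k).+1 j) x)) <= M * q ^+ (n.+1 + k).+1}.
  by apply/ae_foralln => k; exact: (annulus_besov_bound hB j (leq_addr k n.+1)).
apply: filterS hall => x hx; rewrite la_qq.
rewrite mulrAC ler_pdivlMr// mulrAC.
pose F k := kapr psi * normc (FI (W (n.+1 + k) j) x) - M * q ^+ (n.+1 + k) / (1 - q).
have Fs k : F k <= F k.+1.
  have := geometric_step (ltW k0) (ltW M0) (exprn_ge0 (n.+1 + k) (ltW q0)) q0 q1.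
  by rewrite -exprS => /(_ _ _ (hx k)); rewrite -addnS.
have F0k k : F 0%N <= F k by elim: k => // k IH; apply: (le_trans IH).
have c : (fun k => kapr psi * (c0 R * \int[mu]_x normc (W (n.+1 + k) j x))) @ \oo --> (0 : R).
  rewrite -[X in _ --> X](_ : kapr psi * (c0 R * 0) = 0); last by rewrite !mulr0.
  by apply: cvgM; [exact: cvg_cst|apply: cvgM; [exact: cvg_cst|exact: W_int_cvg]].
have : F 0%N <= 0.
  apply: (ler_cvg_to (cvg_cst (F 0%N)) c); apply: nearW => k; apply: (le_trans (F0k k)).
  apply: (@le_trans _ _ (kapr psi * normc (FI (W (n.+1 + k) j) x))).
    by rewrite lerBlDr lerDl divr_ge0 ?mulr_ge0 ?exprn_ge0 ?subr_ge0 ?ltW.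
  by rewrite ler_wpM2l ?(ltW k0)//; exact: (FI_bound x (W_L1 _ j)).
by rewrite /F addn0 subr_le0 => h; rewrite [leLHS]mulrC.
Qed.

Lemma ball_la n : dyadic_ball (- n%:Z) = [set x | enorm x <= (la R n)^-1].
Proof. by rewrite /dyadic_ball exprnN. Qed.

(** On the ball [U] is bounded by an integrable part [f] plus a constant [l], the latter integrated
    over a cube of volume $8\cdot2^{-3n}$. Both are used for a finite exponent, and only the
    constant for the exponent [+oo]. *)
Lemma W_int_le n j (f : R3 -> R) (l Mp : R) : 0 <= l -> rint mu f -> (forall x, 0 <= f x) ->
  0 <= Mp -> (forall x, `|psi x| <= Mp) ->
  {ae mu, forall x, dyadic_ball (- n%:Z) x -> vnorm U x <= f x + l} ->
  \int[mu]_x normc (W n j x) <= Mp * (\int[mu]_x f x + l * (8 * (la R n)^-1 ^+ 3)).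
Proof.
move=> l0 jf f0 Mp0 hMp hU; set r := (la R n)^-1.
have r0 : 0 <= r by rewrite invr_ge0 ltW ?la_gt0.
have ic : rint mu (\1_(cube r)).
  by apply: rint_indic; [exact: cube_measurable|rewrite mu3_cube// ltry].
have jl := rintZ l ic; have jfl := rintD jf jl.
have -> : 8 * r ^+ 3 = \int[mu]_x \1_(cube r) x.
  apply: EFin_inj; rewrite (EFin_Rint ic) integral_indic//; last exact: cube_measurable.
  by rewrite setIT mu3_cube//; congr EFin; ring.
rewrite -(RintZ l ic) -(RintD jf jl) -(RintZ Mp jfl).
apply: (Rint_le_ae (L1_normc (W_L1 n j)) (rintZ Mp jfl)).
apply: filterS hU => x; rewrite ball_la /= -/r => hx.
rewrite /WW (Normc.normcM _ (U j x)) normc_real.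
have [far|near] := ltP r (enorm x).
  rewrite (rho_far Hpsi (la_gt0 R n) far) normr0 mul0r.
  by rewrite mulr_ge0// addr_ge0// mulr_ge0// indicE.
apply: ler_pM => //; first exact: normc_ge0.
  exact: hMp.
apply: (le_trans (normc_vnorm U j x)); apply: (le_trans (hx near)).
by rewrite lerD2l indicE mem_set ?mulr1//; exact: enorm_cube.
Qed.

Lemma la_inv3_le n : (la R n)^-1 ^+ 3 <= q ^+ n.
Proof.
rewrite /la -exprVn -exprM mulnC exprM; apply: lerXn2r; rewrite ?nnegrE ?exprn_ge0 ?(ltW (qq_gt0 s))//.
rewrite [leLHS](_ : _ = 2 `^ (- 3)); last by rewrite powRN powR_mulrn// exprVn.
by have s5 := s1; rewrite /qq ler_powR ?ler1n//; lra.
Qed.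

(** Takes the place of Hölder's inequality on the ball: for $t>l$ one has $t=t^{1-r}t^r\le
    l^{1-r}t^r$, and the level [l] remains free. *)
Lemma truncated_power (t l r : R) : 0 <= t -> 0 < l -> 1 <= r -> t <= l `^ (1 - r) * t `^ r + l.
Proof.
move=> t0 l0 r1; have [tl|lt_] := leP t l.
  by rewrite (le_trans tl)// lerDr mulr_ge0// powR_ge0.
have t1 : 0 < t by exact: lt_trans lt_.
have -> : t `^ r = t * t `^ (r - 1).
  by rewrite -{2}(powRr1 t0) -powRD ?(gt_eqF t1) ?implybT//; congr (_ `^ _); ring.
rewrite mulrCA -[leLHS]addr0; apply: lerD; last exact: ltW.
rewrite ler_peMr//.
rewrite -opprB powRN mulrC ler_pdivlMr ?powR_gt0// mul1r.
by apply: powR_mono; [rewrite subr_ge0|exact: ltW|exact: ltW].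
Qed.

Lemma Lnorm_le_power (h : R3 -> R) (r M : R) : 1 <= r -> 0 < M -> measurable_fun setT h ->
  (forall x, 0 <= h x) -> (Lnorm mu r%:E (fun x => (h x)%:E) <= M%:E)%E ->
  rint mu (fun x => h x `^ r) /\ \int[mu]_x (h x `^ r) <= M `^ r.
Proof.
move=> r1 M0 mh h0 hM; have r0 : 0 < r by exact: lt_le_trans r1.
have E : (\int[mu]_x (h x `^ r)%:E <= (M `^ r)%:E)%E.
  rewrite (_ : (\int[mu]_x _)%E = (Lnorm mu r%:E (fun x => (h x)%:E) `^ r)%E).
    rewrite -poweR_EFin; apply: gt0_ler_poweR => //; first exact: ltW.
      by rewrite in_itv/= Lnorm_ge0 leey.
    by rewrite in_itv/= lee_fin ltW// leey.
  rewrite (poweR_Lnorm mu _ (lt0r_neq0 r0)); apply: eq_integral => x _.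
  by rewrite /= ger0_norm// poweR_EFin.
have mr : measurable_fun setT (fun x => h x `^ r).
  exact: (measurableT_comp (@measurable_powR R r) mh).
have i : rint mu (fun x => h x `^ r).
  apply: rint_lty => //; first by move=> x; exact: powR_ge0.
  by apply: le_lt_trans E _; rewrite ltry.
by split=> //; rewrite -lee_fin (EFin_Rint i).
Qed.

Lemma lowpass_Lr_bound (r : \bar R) (M : R) : ((3 / (4 - 2 * s))%:E <= r)%E -> 0 < M ->
  exists K : R, forall n,
  (dist_Lnorm r (dyadic_ball (- n%:Z)) (fun j => fourier (dist_field u j)) < M%:E)%E ->
  forall j, {ae mu, forall x, normc (FI (W n j) x) <= K * (la R n / La s n ^+ 2)}.
Proof.
move=> hr M0; have [Mp Mp0 hMp] := psi_bounded Hpsi; have sl := s1; have s5 := s56.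
suff [K hK] : exists K : R, forall n,
    (dist_Lnorm r (dyadic_ball (- n%:Z)) (fun j => fourier (dist_field u j)) < M%:E)%E ->
    forall j, \int[mu]_x normc (W n j x) <= K * q ^+ n.
  exists (c0 R * K) => n hn j; apply: aeW => x; rewrite la_qq -mulrA.
  apply: (le_trans (FI_bound x (W_L1 n j))); rewrite ler_wpM2l ?(ltW (c0_gt0 R))//.
  exact: hK.
have qn n : 0 <= q ^+ n by rewrite exprn_ge0 ?ltW ?qq_gt0.
case: r hr => [r||] // hr; last first.
  exists (Mp * (M * 8)) => n /dist_Lnorm_lt [g [rg /Lnorm_oo_lt hg]] j.
  have gU : {ae mu, forall x, forall j, g j x = U j x}.
    by apply: ae_ord3 => i; exact: (represents_unique Hpsi (rg i) (rU i)).
  have := @W_int_le n j (fun=> 0) M Mp (ltW M0) (rint0 mu) (fun=> lexx _) Mp0 hMp.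
  move=> h; apply: (le_trans (h _)).
    apply: filterS2 hg gU => x hx e Bx; rewrite add0r; apply: le_trans (hx Bx).
    by rewrite /vnorm (eq_bigr (fun j => normc (g j x) ^+ 2))// => i _; rewrite e.
  rewrite /Rintegral integral0 add0r -!mulrA !ler_wpM2l ?(ltW M0)//.
  exact: la_inv3_le.
move: hr; rewrite lee_fin => hr.
(* The admissible exponents are at least 1 because $4-2s\le3$. *)
have r1 : 1 <= r by apply: le_trans hr; rewrite ler_pdivlMr; lra.
exists (Mp * (M `^ r + 8)) => n /dist_Lnorm_lt [g [rg hg]] j.
have gU : {ae mu, forall x, forall j, g j x = U j x}.
  by apply: ae_ord3 => i; exact: (represents_unique Hpsi (rg i) (rU i)).
set B := dyadic_ball _ in hg.
have mB : measurable B.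
  rewrite /B ball_la; have := measurable_fun_ler (@enorm_measurable R) (@measurable_cst _ _ R3 _ setT (la R n)^-1) measurableT (Y := [set true]) I.
  by rewrite setTI.
pose h x := \1_B x * vnorm g x.
have mh : measurable_fun setT h.
  apply: measurable_funM; first exact: measurable_indic.
  by apply: vnorm_measurable => i; have [[]] := rg i.
have h0 x : 0 <= h x by rewrite mulr_ge0 ?vnorm_ge0// indicE.
have hL : (Lnorm mu r%:E (fun x => (h x)%:E) <= M%:E)%E.
  rewrite (_ : (fun x => (h x)%:E) = (fun x => (vnorm g x)%:E) \_ B); first exact: ltW.
  by apply/funext => x; rewrite /h patchE indicE; case: ifP => _; rewrite ?mul1r ?mul0r.
have [ir hi] := Lnorm_le_power r1 M0 mh h0 hL.
(* This level makes $l\cdot2^{-3n}$ equal to $2^{n(1-2s)}$. The other term carries $l^{1-r}$, at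
   most $2^{n(1-2s)}$ exactly when $(4-2s)r\ge3$, which is the condition on the exponent. *)
pose l : R := 2 `^ (n%:R * (4 - 2 * s)); have l0 : 0 < l by exact: powR_gt0.
have := @W_int_le n j (fun x => l `^ (1 - r) * h x `^ r) l Mp (ltW l0) (rintZ _ ir).
move=> H; apply: (le_trans (H _ Mp0 hMp _)).
- by move=> x; rewrite mulr_ge0 ?powR_ge0.
- apply: filterS gU => x e Bx.
  have -> : vnorm U x = h x.
    rewrite /h indicE mem_set// mul1r /vnorm; congr Num.sqrt.
    by apply: eq_bigr => i _; rewrite e.
  exact: truncated_power.
rewrite (RintZ _ ir) -[leRHS]mulrA; apply: ler_wpM2l => //; rewrite [leRHS]mulrDl; apply: lerD.
  rewrite mulrC; apply: ler_pM => //; first exact: Rint_ge0 (fun x => powR_ge0 _ _).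
    exact: powR_ge0.
  rewrite qq_expr /l -powRrM; apply: ler_powR; first by rewrite ler1n.
  rewrite -mulrA ler_wpM2l//; move: hr; rewrite ler_pdivrMr; last by lra.
  by move=> hr; nra.
rewrite mulrCA ler_wpM2l// qq_expr /l /la exprVn -powR_mulrn// -[X in _ / X]powR_mulrn ?powR_ge0//.
rewrite -powRrM -powRN -powRD; last by apply/implyP.
by apply: ler_powR; [rewrite ler1n|lra].
Qed.
End LowFrequency.

Theorem corollary1p2 (R : realType) (psi : R * R * R -> R) (s : R)
    (u : 'I_3 -> R * R * R -> R) :
  cutoff psi ->
  5 / 6 <= s -> s < 1 ->
  weak_solution s u ->
  (\int[@mu3 R]_x ((vnorm (frac_laplacian_field (s / 2) u) x ^+ 2)%:E) < +oo)%E ->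
  [/\ (liminf_minfty (fun k : int => (2 `^ (k%:~R * (1 - 2 * s)))%:E *
          dist_Lnorm +oo [set: R * R * R]
            (fun j => dotS psi k (dist_field u j))) < +oo)%E ->
      {ae @mu3 R, forall x, forall j, u j x = 0},
      (liminf_minfty (fun k : int => besov_norm psi (1 - 2 * s)
          (fun j => dotS psi k (dist_field u j))) < +oo)%E ->
      {ae @mu3 R, forall x, forall j, u j x = 0} &
      (exists2 r : \bar R, ((3 / (4 - 2 * s))%:E <= r)%E &
        (liminf_minfty (fun k : int => dist_Lnorm r (dyadic_ball k)
          (fun j => fourier (dist_field u j))) < +oo)%E) ->
      {ae @mu3 R, forall x, forall j, u j x = 0}].
Proof.
move=> Hpsi s56 s1 [ru [U [rU iU]] Hdf [P tP weak]] _.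
have s0 : 0 < s by lra.
have s2 : 2 * s <= 2 by lra.
have U_cmeas j : cmeas (U j) by have [[]] := rU j.
have iD : rint (mu3 R) (D2 s (vnorm U)).
  apply: rint_lty.
  - apply: measurable_funX; apply: measurable_funM; last exact: vnorm_measurable.
    exact: (measurableT_comp (@measurable_powR R s) (@enorm_measurable R)).
  - by move=> x; exact: sqr_ge0.
  - move: iU; congr (_ < _)%E; apply: eq_integral => x _.
    by rewrite /D2 exprMn [2 * s]mulrC powRrM powR_mulrn ?powR_ge0.
have main := weak_solution_eq0 Hpsi s0 s1 ru rU iD s2 tP weak s56 Hdf.
split=> [/liminf_minfty_lt [M M0 hM]|/liminf_minfty_lt [M M0 hM]|[r hr /liminf_minfty_lt [M M0 hM]]].
- apply: main; exists M => n0; have [n hn hk] := hM n0; exists n; split=> //.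
  exact: (lowpass_sup_bound Hpsi rU hk).
- apply: main; exists (M / (1 - qq s) / kapr psi) => n0; have [n hn hk] := hM n0.
  exists n.+1; split; first exact: leqW.
  exact: (lowpass_besov_bound Hpsi s56 rU M0 hk).
- have [K hK] := lowpass_Lr_bound Hpsi s56 s1 rU hr M0.
  apply: main; exists K => n0; have [n hn hk] := hM n0; exists n; split=> //.
  exact: (hK n hk).
Qed.
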